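(* Let $S$ be a (not necessarily unital) $C^*$-algebra or a unital complete operator system. (a) Then $S$ is dualizable, $\|f\|^{\mathrm d}\le\|f\|_{M_\infty(S^* )}\le 4\|f\|^{\mathrm d}$ for all $f\in M_\infty(S^* )$, and $$\|g\|_{M_\infty(S^* )}=\|g\|^{\mathrm d}\qquad (g\in M_\infty(S^* )^+).$$ (b) The canonical bijection $\tau_S:S^{**}\to(S^{\mathrm d})^{\mathrm d}$ is a complete isometry.
   Context: Matrices. For a complex vector space $X$ identify $M_n(X)\subseteq M_{n+1}(X)$ (upper left corner) and put $M_\infty(X)=\bigcup_n M_n(X)$. For linear $\varphi:X\to Y$, $\varphi^{(\infty)}([x_{i,j}])=[\varphi(x_{i,j})]$ on $M_\infty(X)$ and $\varphi^{(n)}=\varphi^{(\infty)}|_{M_n(X)}$. An operator space is a complex vector space $X$ with a norm on $M_\infty(X)$ (a matrix norm) such that $\|\sum_k a_k^*x_kb_k\|\le\|\sum_k a_k^*a_k\|^{1/2}\|\sum_k b_k^*b_k\|^{1/2}\max_k\|x_k\|$ for all finite families $a_k,b_k\in M_\infty(\mathbb{C})$, $x_k\in M_\infty(X)$. A linear map $\varphi$ between operator spaces is a complete contraction / a complete isometry / a complete embedding if $\varphi^{(\infty)}$ is contractive / isometric / bounded and bounded below ($\inf_{\|x\|=1}\|\varphi^{(\infty)}(x)\|>0$). SMOS and MOS. A semi-matrix ordered operator space (SMOS) is an operator space $X$ with an involution $*$ such that $[x_{i,j}]\mapsto[x_{j,i}^*]$ is isometric on $M_\infty(X)$, and a norm-closed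 subset (matrix cone) $M_\infty(X)^+\subseteq M_\infty(X)^{\mathrm{sa}}:=\{x:x^*=x\}$ with $\sum_k a_k^*x_ka_k\in M_\infty(X)^+$ for all finite families $a_k\in M_\infty(\mathbb{C})$, $x_k\in M_\infty(X)^+$. It is a MOS if $M_\infty(X)^+\cap -M_\infty(X)^+=\{0\}$. For SMOSs, a $*$-preserving linear map $\varphi:X\to Y$ is completely positive if $\varphi^{(\infty)}(M_\infty(X)^+)\subseteq M_\infty(Y)^+$; completely order monomorphic if it is injective and, for $x\in M_\infty(X)^{\mathrm{sa}}$, $x\in M_\infty(X)^+\Leftrightarrow\varphi^{(\infty)}(x)\in M_\infty(Y)^+$; a MOS isomorphism if it is a bijective completely order monomorphic complete embedding. $\mathrm{CC}^+(X,Y)$ denotes the set of completely positive complete contractions. An operator system is a self-adjoint subspace of some $\mathcal{L}(\mathfrak{H})$ (bounded operators on a Hilbert space) with the induced matrix norm, involution and matrix cone; it is unital if it contains the identity, complete if it is norm-complete. A quasi-operator system is a MOS admitting a MOS isomorphism onto an operator system. A $C^*$-algebra is an operator system via any faithful representation. Duals. For $f=[f_{i,j}]\in M_\infty(X^* )$ let $\theta_f(x)=[f_{i,j}(x)]$ ($x\in X$). The dual space $X^*$ of a SMOS $X$ is always the SMOS with involution $f^*(x)=\overline{f(x^* )}$, i.e. $[f_{i,j}]^*=[(f_{j,i})^*]$, dual matrix norm $\|f\|_{M_\infty(X^* )}=\sup\{\|\theta_f^{(\infty)}(x)\|:x\in M_\infty(X),\|x\|\le1\}$ and dual matrix cone $M_\infty(X^*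 )^+=\{f\in M_\infty(X^* )^{\mathrm{sa}}:\theta_f\text{ is completely positive}\}$. Dual objects. A SMOS (resp. MOS) $D$ is a dual SMOS (resp. dual MOS) if there is a $*$-invariant norm-closed subspace $D_\#\subseteq D^*$ (a predual) such that the canonical map $D\to(D_\#)^*$ is a surjective complete isometry, and $M_\infty(D)^+$ is closed under the weak-$*$ topology $\sigma(M_\infty(D),M_\infty(D_\#))$ (entrywise $\sigma(D,D_\#)$-convergence). For complete $X$, $X^*$ is a dual SMOS with predual $X$. A dual MOS $D$ is a dual quasi-operator system (resp. dual operator system) if there is a weak-$*$-homeomorphic (resp. weak-$*$-homeomorphic completely isometric) MOS isomorphism from $D$ onto a weak-$*$-closed (self-adjoint) subspace of some $\mathcal{L}(\mathfrak{H})$. The map $\mu_D$. For a dual MOS $D$ with predual $D_\#$, let $\mathcal{WQ}^D_n$ be the set of $\sigma(D,D_\#)$-continuous maps in $\mathrm{CC}^+(D,M_n(\mathbb{C}))$, let $N(D)=\bigoplus^{\ell_\infty}_{n\in\mathbb{N}}\ell_\infty(\mathcal{WQ}^D_n;M_n(\mathbb{C}))$ (a von Neumann algebra), and let $\mu_D:D\to N(D)$ be $\mu_D(x)=(\mu_D(x)_n)_n$ with $\mu_D(x)_n(\varphi)=\varphi(x)$. Dualizability. A quasi-operator system $T$ is dualizable if the dual SMOS $T^*$ (with predual $T$; so $T$ is complete) is a dual quasi-operator system. In that case $T^{\mathrm d}:=\mu_{T^*}(T^* )\subseteq N(T^* )$, which is weak-$*$-closed and is equipped with the dual operator system structure induced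 from $N(T^* )$, and for $f\in M_\infty(T^* )$ $$\|f\|^{\mathrm d}:=\|\mu_{T^*}^{(\infty)}(f)\|=\sup\{\|\theta_f^{(n)}(x)\|:x\in M_n(T)^+,\ \|x\|\le1,\ n\in\mathbb{N}\}.$$ Moreover $\mu_{T^*}:T^*\to T^{\mathrm d}$ is a weak-$*$-homeomorphic MOS isomorphism, and $T^{\mathrm d}$ is again dualizable. The canonical bijection is $\tau_T:=\mu_{(T^{\mathrm d})^*}\circ(\mu_{T^*}^* )^{-1}:T^{**}\to(T^{\mathrm d})^{\mathrm d}$, where $\mu_{T^*}^*:(T^{\mathrm d})^*\to T^{**}$ is the dual map of $\mu_{T^*}:T^*\to T^{\mathrm d}$. *)

(* Defs.v *)
From HB Require Import structures.
From mathcomp Require Import all_boot all_order all_algebra.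
From mathcomp Require Import all_classical all_reals topology normedtype sequences.
From mathcomp Require Import complex lra.

Set Implicit Arguments.
Unset Strict Implicit.
Unset Printing Implicit Defensive.

Import Order.TTheory GRing.Theory Num.Theory Num.Def numFieldNormedType.Exports.

Local Open Scope classical_set_scope.
Local Open Scope ring_scope.
Local Open Scope complex_scope.
Local Open Scope sesquilinear_scope.

Definition cabs (R : realType) (z : R[i]) : R := complex.Re `|z|.

Section Subspace.
Variables (R : realType) (X : lmodType R[i]) (W : submodClosed X).

Definition lsubspace := {x : X | x \in W}.
HB.instance Definition _ := SubType.on lsubspace.
HB.instance Definition _ := Choice.on lsubspace.
HB.instance Definition _ := [SubChoice_isSubLmodule of lsubspace by <:].

(* x as an element of W; meant for x in W only, junk value 0 otherwise. *)
Definition tosub (x : X) : lsubspace := insubd (0 : lsubspace) x.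
End Subspace.

Section LinearRange.
Variables (R : realType) (X Y : lmodType R[i]) (f : {linear X -> Y}).

Definition lrange : {pred Y} := fun y => `[< exists x, f x = y >].

Lemma lrange_submod : submod_closed lrange.
Proof.
split=> [|a _ _ /asboolP[x <-] /asboolP[y <-]].
  by apply/asboolP; exists 0; rewrite linear0.
by apply/asboolP; exists (a *: x + y); rewrite linearP.
Qed.

HB.instance Definition _ := GRing.isSubmodClosed.Build R[i] Y lrange lrange_submod.

Lemma mem_lrange x : f x \in lrange.
Proof. by apply/asboolP; exists x. Qed.
End LinearRange.

Definition dfun (R : realType) (I : Type) (V : I -> lmodType R[i]) := forall i, V i.

Section DependentFunctions.
Variables (R : realType) (I : Type) (V : I -> lmodType R[i]).
Implicit Types f g h : dfun V.

HB.instance Definition _ := gen_eqMixin (dfun V).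
HB.instance Definition _ := gen_choiceMixin (dfun V).

Let dadd f g : dfun V := fun i => f i + g i.
Let dopp f : dfun V := fun i => - f i.
Let dscale (a : R[i]) f : dfun V := fun i => a *: f i.
Let daddA : associative dadd.
Proof. by move=> f g h; apply: functional_extensionality_dep => i; exact: addrA. Qed.
Let daddC : commutative dadd.
Proof. by move=> f g; apply: functional_extensionality_dep => i; exact: addrC. Qed.
Let dadd0 : left_id ((fun i => 0) : dfun V) dadd.
Proof. by move=> f; apply: functional_extensionality_dep => i; exact: add0r. Qed.
Let daddN : left_inverse ((fun i => 0) : dfun V) dopp dadd.
Proof. by move=> f; apply: functional_extensionality_dep => i; exact: addNr. Qed.
HB.instance Definition _ := GRing.isZmodule.Build (dfun V) daddA daddC dadd0 daddN.

Let dscaleA a b f : dscale a (dscale b f) = dscale (a * b) f.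
Proof. by apply: functional_extensionality_dep => i; exact: scalerA. Qed.
Let dscale1 : left_id 1 dscale.
Proof. by move=> f; apply: functional_extensionality_dep => i; exact: scale1r. Qed.
Let dscaleDr : right_distributive dscale +%R.
Proof. by move=> a f g; apply: functional_extensionality_dep => i; exact: scalerDr. Qed.
Let dscaleDl f : {morph dscale^~ f : a b / a + b}.
Proof. by move=> a b; apply: functional_extensionality_dep => i; exact: scalerDl. Qed.
HB.instance Definition _ :=
  GRing.Zmodule_isLmodule.Build R[i] (dfun V) dscaleA dscale1 dscaleDr dscaleDl.
End DependentFunctions.

Section MatricesOfOperators.
Variables (R : realType) (V : lmodType R[i]) (ip : V -> V -> R[i]) (n : nat).

Definition l2norm (xi : 'I_n -> V) : R := Num.sqrt (complex.Re (\sum_i ip (xi i) (xi i))).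

Definition opapp (x : 'I_n -> 'I_n -> V -> V) (xi : 'I_n -> V) : 'I_n -> V :=
  fun i => \sum_j x i j (xi j).

(* Norm and positivity of [x i j] as an operator on V^n. *)
Definition opnorm (x : 'I_n -> 'I_n -> V -> V) : R :=
  sup [set l2norm (opapp x xi) | xi in [set xi | l2norm xi <= 1]].

Definition oppos (x : 'I_n -> 'I_n -> V -> V) : Prop :=
  forall xi, 0 <= \sum_i ip (opapp x xi i) (xi i).
End MatricesOfOperators.

Definition cvdot (R : realType) (n : nat) (u v : 'cV[R[i]]_n) : R[i] :=
  \sum_k u k 0 * (v k 0)^*%C.

Definition cmxnorm (R : realType) (n : nat) (a : 'M[R[i]]_n) : R :=
  opnorm (@cvdot R n) (fun _ _ : 'I_1 => mulmx a).

(* M_oo(X) is presented by its levels M_n(X) = 'M[X]_n. The upper left corner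
   embeddings of M_n(X) into M_(n+1)(X) are the maps x |-> a^* x a with
   a = [1 0] rectangular; since the axioms below are stated for rectangular a,
   they make these embeddings compatible with norms and cones. *)
Record smosData (R : realType) := SmosData {
  smos_car :> lmodType R[i];
  mnorm : forall n, 'M[smos_car]_n -> R;
  mstar : smos_car -> smos_car;
  mpos : forall n, set 'M[smos_car]_n }.
Arguments mnorm {R s n}.
Arguments mstar {R s}.
Arguments mpos {R s n}.

Section Smos.
Variables (R : realType) (X : smosData R).

Definition nrm (x : X) : R := mnorm (const_mx x : 'M[X]_1).

Definition mxstar n (x : 'M[X]_n) : 'M[X]_n := (map_mx mstar x)^T.

(* a^* x b *)
Definition mxcompr m n (a b : 'M[R[i]]_(m, n)) (x : 'M[X]_m) : 'M[X]_n :=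
  \matrix_(i, j) \sum_p \sum_q ((a p i)^*%C * b q j) *: x p q.

Definition is_operator_space : Prop :=
  [/\ forall n (x : 'M[X]_n), mnorm x = 0 -> x = 0,
      forall n (c : R[i]) (x : 'M[X]_n),
        mnorm (map_mx (fun v => c *: v) x) = cabs c * mnorm x,
      forall n (x y : 'M[X]_n), mnorm (x + y) <= mnorm x + mnorm y
    & forall m n r (a b : 'I_r -> 'M[R[i]]_(m, n)) (x : 'I_r -> 'M[X]_m),
        mnorm (\sum_k mxcompr (a k) (b k) (x k)) <=
        Num.sqrt (cmxnorm (\sum_k (a k)^t* *m a k)) *
        Num.sqrt (cmxnorm (\sum_k (b k)^t* *m b k)) *
        \big[Num.max/0]_k mnorm (x k)].

Definition is_smos : Prop :=
  [/\ is_operator_space,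
      involutive (@mstar R X)
      /\ (forall (c : R[i]) (x y : X),
            mstar (c *: x + y) = c^*%C *: mstar x + mstar y),
      forall n (x : 'M[X]_n), mnorm (mxstar x) = mnorm x,
      forall n (x : 'M[X]_n), mpos x -> mxstar x = x
    & (forall n (x : 'M[X]_n),
         (forall e : R, 0 < e -> exists2 y, mpos y & mnorm (x - y) < e) -> mpos x)
      /\ (forall m n r (a : 'I_r -> 'M[R[i]]_(m, n)) (x : 'I_r -> 'M[X]_m),
         (forall k, mpos (x k)) -> mpos (\sum_k mxcompr (a k) (a k) (x k)))].

Definition is_mos : Prop :=
  is_smos /\ (forall n (x : 'M[X]_n), mpos x -> mpos (- x) -> x = 0).

Definition norm_complete : Prop :=
  forall u : nat -> X,
    (forall e : R, 0 < e ->
       exists N, forall p q, (N <= p)%N -> (N <= q)%N -> nrm (u p - u q) < e) ->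
    exists x, forall e : R, 0 < e ->
       exists N, forall p, (N <= p)%N -> nrm (u p - x) < e.

Definition norm_closed (A : set X) : Prop :=
  forall x, (forall e : R, 0 < e -> exists2 y, A y & nrm (x - y) < e) -> A x.
End Smos.

Section Maps.
Variables (R : realType) (X Y : smosData R) (phi : X -> Y).

Definition star_preserving : Prop := forall x, phi (mstar x) = mstar (phi x).

Definition complete_contraction : Prop :=
  forall n (x : 'M[X]_n), mnorm (map_mx phi x) <= mnorm x.

Definition complete_isometry : Prop :=
  forall n (x : 'M[X]_n), mnorm (map_mx phi x) = mnorm x.

Definition complete_embedding : Prop :=
  (exists K : R, forall n (x : 'M[X]_n), mnorm (map_mx phi x) <= K * mnorm x)
  /\ (exists2 c : R, 0 < c
      & forall n (x : 'M[X]_n), c * mnorm x <= mnorm (map_mx phi x)).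

Definition completely_positive : Prop :=
  star_preserving /\ (forall n (x : 'M[X]_n), mpos x -> mpos (map_mx phi x)).

Definition completely_order_monomorphic : Prop :=
  [/\ star_preserving, injective phi
    & forall n (x : 'M[X]_n), mxstar x = x -> (mpos x <-> mpos (map_mx phi x))].

Definition mos_isomorphism : Prop :=
  [/\ bijective phi, completely_order_monomorphic & complete_embedding].
End Maps.

Definition matC (R : realType) (k : nat) : smosData R :=
  @SmosData R 'M[R[i]]_k
    (fun n x => opnorm (@cvdot R k) (fun i j : 'I_n => mulmx (x i j)))
    (fun x => x^t*)
    (fun n => [set x | oppos (@cvdot R k) (fun i j : 'I_n => mulmx (x i j))]).

Definition subsmos (R : realType) (X : smosData R) (W : submodClosed X) : smosData R :=
  @SmosData R (lsubspace W)
    (fun n x => mnorm (map_mx val x : 'M[X]_n))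
    (fun x => tosub W (mstar (val x)))
    (fun n => [set x | mpos (map_mx val x : 'M[X]_n)]).

Record hilbert (R : realType) := Hilbert {
  hilbert_car :> completeNormedModType R[i];
  hip : {dot hilbert_car for conjC};
  hilbert_normE : forall x : hilbert_car, `|x| ^+ 2 = hip x x }.
Arguments hip {R h}.

Section BoundedOperators.
Variables (R : realType) (H : hilbert R).

Definition bounded_op : {pred (H -> H)} := fun T =>
  `[< linear T /\ exists K : R, forall x, `|T x| <= K%:C * `|x| >].

Lemma bounded_op_submod : submod_closed bounded_op.
Proof.
split=> [|a S T /asboolP[lS [K bK]] /asboolP[lT [L bL]]]; apply/asboolP; split.
- by move=> b x y; change (0 = b *: (0 : H) + 0); rewrite scaler0 addr0.
- by exists 0 => x; change (`|0 : H| <= 0%:C * `|x|); rewrite normr0 mul0r.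
- move=> b x y; rewrite !fctE lS lT !scalerDr !scalerA (mulrC a b).
  by rewrite addrACA.
- exists (cabs a * K + L) => x; rewrite !fctE rmorphD rmorphM mulrDl.
  apply: le_trans (ler_normD _ _) _; apply: lerD (bL x).
  rewrite normrZ -mulrA; apply: le_trans (ler_wpM2l (normr_ge0 a) (bK x)) _.
  by rewrite /cabs normc_def.
Qed.

HB.instance Definition _ :=
  GRing.isSubmodClosed.Build R[i] (H -> H) bounded_op bounded_op_submod.

(* The adjoint exists and is unique by the Riesz representation theorem, so the
   default value 0 is never taken. *)
Definition adjoint (T : lsubspace bounded_op) : lsubspace bounded_op :=
  xget 0 [set S : lsubspace bounded_op | forall x y, hip (val T x) y = hip x (val S y)].

Definition LH : smosData R :=
  @SmosData R (lsubspace bounded_op)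
    (fun n x => opnorm (@hip R H) (fun i j : 'I_n => val (x i j)))
    adjoint
    (fun n => [set x | oppos (@hip R H) (fun i j : 'I_n => val (x i j))]).

Definition selfadjoint_subspace (W : submodClosed LH) : Prop :=
  forall T : LH, T \in W -> mstar T \in W.

Definition unital_subspace (W : submodClosed LH) : Prop :=
  exists2 T : LH, T \in W & val T = id.
End BoundedOperators.

Definition quasi_operator_system (R : realType) (T : smosData R) : Prop :=
  is_mos T /\
  exists (H : hilbert R) (W : submodClosed (LH H)), selfadjoint_subspace W /\
  exists phi : {linear T -> subsmos W}, mos_isomorphism phi.

Record cstarAlgebra (R : realType) := CstarAlgebra {
  cstar_car :> completeNormedModType R[i];
  cmul : {bilinear cstar_car -> cstar_car -> cstar_car};
  cstar : cstar_car -> cstar_car;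
  cmulA : forall x y z, cmul x (cmul y z) = cmul (cmul x y) z;
  cnormM : forall x y, `|cmul x y| <= `|x| * `|y|;
  cstarK : involutive cstar;
  cstarP : forall (a : R[i]) x y, cstar (a *: x + y) = a^*%C *: cstar x + cstar y;
  cstarM : forall x y, cstar (cmul x y) = cmul (cstar y) (cstar x);
  cstar_identity : forall x, `|cmul (cstar x) x| = `|x| ^+ 2 }.
Arguments cmul {R c}.
Arguments cstar {R c}.

Record faithful_rep (R : realType) (A : cstarAlgebra R) (H : hilbert R) := FaithfulRep {
  rep :> {linear A -> LH H};
  repM : forall x y, val (rep (cmul x y)) = val (rep x) \o val (rep y);
  rep_star : forall x, rep (cstar x) = mstar (rep x);
  rep_inj : injective rep }.

Definition cstar_smos (R : realType) (A : cstarAlgebra R) (H : hilbert R)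
    (pi : faithful_rep A H) : smosData R :=
  @SmosData R A
    (fun n x => mnorm (map_mx pi x))
    (@cstar R A)
    (fun n => [set x | mpos (map_mx pi x)]).

Inductive cstar_or_unital_complete_opsys (R : realType) : smosData R -> Prop :=
| CstarCase (A : cstarAlgebra R) (H : hilbert R) (pi : faithful_rep A H) :
    cstar_or_unital_complete_opsys (cstar_smos pi)
| UnitalCompleteOpsysCase (H : hilbert R) (W : submodClosed (LH H)) :
    selfadjoint_subspace W -> unital_subspace W -> norm_complete (subsmos W) ->
    cstar_or_unital_complete_opsys (subsmos W).

Section Dual.
Variables (R : realType) (X : smosData R).

Definition bounded_functional : {pred (X -> R[i])} := fun f =>
  `[< linear f /\ exists K : R, forall x, cabs (f x) <= K * nrm x >].

Lemma bounded_functional_submod : submod_closed bounded_functional.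
Proof.
split=> [|a f g /asboolP[lf [K bK]] /asboolP[lg [L bL]]]; apply/asboolP; split.
- by move=> b x y; change (0 = b *: (0 : R[i]) + 0); rewrite scaler0 addr0.
- by exists 0 => x; change (cabs (0 : R[i]) <= 0 * nrm x); rewrite /cabs normr0 mul0r.
- move=> b x y; rewrite !fctE lf lg !scalerDr !scalerA (mulrC a b).
  by rewrite addrACA.
- exists (cabs a * K + L) => x; rewrite !fctE mulrDl.
  have cabsD (z w : R[i]) : cabs (z + w) <= cabs z + cabs w.
    by rewrite -raddfD; have := ler_normD z w; rewrite lecE => /andP[].
  apply: le_trans (cabsD _ _) _; apply: lerD (bL x).
  have -> : cabs (a *: f x) = cabs a * cabs (f x).
    by change (cabs (a * f x) = cabs a * cabs (f x)); rewrite /cabs normrM !normc_def /= mulr0 subr0.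
  by rewrite -mulrA ler_wpM2l //; rewrite /cabs normc_def sqrtr_ge0.
Qed.

HB.instance Definition _ :=
  GRing.isSubmodClosed.Build R[i] (X -> R[i]) bounded_functional
    bounded_functional_submod.

Definition theta n (f : 'M[lsubspace bounded_functional]_n) (x : X) : matC R n :=
  \matrix_(i, j) val (f i j) x.

(* When X is a SMOS its involution is isometric and x |-> conj (f (x^* )) is again
   bounded, so tosub does not take its default value. *)
Definition dual_star (f : lsubspace bounded_functional) : lsubspace bounded_functional :=
  tosub bounded_functional (fun x => (val f (mstar x))^*%C).

Definition dual : smosData R :=
  @SmosData R (lsubspace bounded_functional)
    (fun n f => sup [set r | exists m (x : 'M[X]_m),
                       mnorm x <= 1 /\ r = mnorm (map_mx (theta f) x)])
    dual_star
    (fun n => [set f | (map_mx dual_star f)^T = f /\ completely_positive (theta f)]).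
End Dual.

(* The topology sigma(X, P) on X generated by a set P of complex functions. *)
Definition weaktop (R : realType) (X : choiceType) (P : set (X -> R[i])) :=
  initial_topology
    ((fun x p => set_val p x) : X -> prod_topology (fun _ : set_type P => R[i]^o)).
HB.instance Definition _ (R : realType) (X : choiceType) (P : set (X -> R[i])) :=
  Topological.on (weaktop P).

Section DualSmos.
Variables (R : realType) (D : smosData R) (P : submodClosed (dual D)).

Definition functionals : set (D -> R[i]) :=
  [set f | exists2 p : dual D, p \in P & f = val p].

Definition entry_functionals n : set ('M[D]_n -> R[i]) :=
  [set g | exists f i j, functionals f /\ g = fun x : 'M[D]_n => f (x i j)].

(* The canonical map D -> (D_#)^*. On a SMOS evaluation at x is a bounded functional
   on D^*, so tosub does not take its default value. *)
Definition to_predual_dual (x : D) : dual (subsmos P) :=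
  tosub (@bounded_functional R (subsmos P)) (fun p : subsmos P => val (val p) x).

Definition is_dual_smos : Prop :=
  [/\ is_smos D,
      forall p : dual D, p \in P -> mstar p \in P,
      norm_closed [set p : dual D | p \in P],
      complete_isometry to_predual_dual /\ (forall F, exists x, to_predual_dual x = F)
    & forall n, closed ([set x | mpos x] : set (weaktop (@entry_functionals n)))].

Definition is_dual_mos : Prop := is_mos D /\ is_dual_smos.
End DualSmos.

Section LHWeakStar.
Variables (R : realType) (H : hilbert R).

(* The weak-* continuous functionals on L(H): T |-> sum_k <T xi_k, eta_k> with xi, eta
   square summable, i.e. the trace-class operators. *)
Definition normal_functionals : set (LH H -> R[i]) :=
  [set w | exists xi eta : nat -> H,
     [/\ cvgn (series (fun k => `|xi k| ^+ 2 : R[i]^o)),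
         cvgn (series (fun k => `|eta k| ^+ 2 : R[i]^o))
       & forall T : LH H,
           series (fun k => hip (val T (xi k)) (eta k) : R[i]^o) @ \oo --> (w T : R[i]^o)]].

Definition weakstar_closed (W : submodClosed (LH H)) : Prop :=
  closed ([set T | T \in W] : set (weaktop normal_functionals)).

Definition normal_functionals_on (W : submodClosed (LH H)) : set (subsmos W -> R[i]) :=
  [set g | exists2 w, normal_functionals w & g = w \o val].
End LHWeakStar.

Definition weak_homeomorphism (R : realType) (X Y : choiceType)
    (P : set (X -> R[i])) (Q : set (Y -> R[i])) (phi : X -> Y) : Prop :=
  exists psi : Y -> X,
    [/\ cancel phi psi, cancel psi phi,
        continuous (phi : weaktop P -> weaktop Q)
      & continuous (psi : weaktop Q -> weaktop P)].

Definition is_dual_quasi_operator_system (R : realType) (D : smosData R)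
    (P : submodClosed (dual D)) : Prop :=
  is_dual_mos P /\
  exists (H : hilbert R) (W : submodClosed (LH H)),
    [/\ selfadjoint_subspace W, weakstar_closed W
      & exists phi : {linear D -> subsmos W},
          mos_isomorphism phi /\
          weak_homeomorphism (functionals P) (@normal_functionals_on R H W) phi].

(* The canonical image of T in T^**, i.e. the predual T of T^*. *)
Section CanonicalPredual.
Variables (R : realType) (T : smosData R).

Definition bidual_image : {pred dual (dual T)} := fun F =>
  `[< exists x : T, forall f : dual T, val F f = val f x >].

Lemma bidual_image_submod : submod_closed bidual_image.
Proof.
split=> [|a F G /asboolP[x Fx] /asboolP[y Gy]]; apply/asboolP.
  exists 0 => f; change (0 = val f 0).
  by have := valP f => /asboolP[lf _]; have := lf (-1) 0 0; rewrite scaler0 addr0 scaleN1r addNr.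
exists (a *: x + y) => f; have := valP f => /asboolP[lf _].
by rewrite lf -Fx -Gy.
Qed.

HB.instance Definition _ :=
  GRing.isSubmodClosed.Build R[i] (dual (dual T)) bidual_image bidual_image_submod.
End CanonicalPredual.

Definition dualizable (R : realType) (T : smosData R) : Prop :=
  quasi_operator_system T /\ is_dual_quasi_operator_system (@bidual_image R T).

Section ComplexMatrixNorm.
Variables (R : realType) (n : nat).
Implicit Types (a b : 'M[R[i]]_n) (u v : 'cV[R[i]]_n).

Let nsq v : R := \sum_k cabs (v k 0) ^+ 2.

Let cabs_ge0 (z : R[i]) : 0 <= cabs z.
Proof. by rewrite /cabs normc_def sqrtr_ge0. Qed.

Let cabsD (z w : R[i]) : cabs (z + w) <= cabs z + cabs w.
Proof. by rewrite -raddfD; have := ler_normD z w; rewrite lecE => /andP[]. Qed.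

Let cabsM (z w : R[i]) : cabs (z * w) = cabs z * cabs w.
Proof. by rewrite /cabs normrM !normc_def /= mulr0 subr0. Qed.

Let nsq_ge0 v : 0 <= nsq v.
Proof. by apply: sumr_ge0 => k _; exact: sqr_ge0. Qed.

Let Re_cvdot v : complex.Re (cvdot v v) = nsq v.
Proof.
rewrite /cvdot raddf_sum; apply: eq_bigr => k _ /=.
by rewrite -sqr_normc /cabs normc_def -rmorphXn.
Qed.

Let l2norm_ord1 (xi : 'I_1 -> 'cV[R[i]]_n) :
  l2norm (@cvdot R n) xi = Num.sqrt (nsq (xi 0)).
Proof. by rewrite /l2norm big_ord1 Re_cvdot. Qed.

Let opapp_ord1 a (xi : 'I_1 -> 'cV[R[i]]_n) :
  opapp (fun _ _ : 'I_1 => mulmx a) xi 0 = a *m xi 0.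
Proof. by rewrite /opapp big_ord1. Qed.

Let sqrt_nsq_le1 v : (Num.sqrt (nsq v) <= 1) = (nsq v <= 1).
Proof. by rewrite -{1}sqrtr1 ler_sqrt. Qed.

Let cmxnorm_le a (K : R) :
  (forall v, nsq v <= 1 -> Num.sqrt (nsq (a *m v)) <= K) -> cmxnorm a <= K.
Proof.
move=> aK; apply: ge_sup.
  exists (l2norm (@cvdot R n) (opapp (fun _ _ : 'I_1 => mulmx a) (fun=> 0))).
  exists (fun=> 0) => //=; rewrite l2norm_ord1 /nsq big1 ?sqrtr0 // => k _.
  by rewrite mxE /cabs normr0 expr0n.
move=> _ [xi /= + <-]; rewrite !l2norm_ord1 opapp_ord1 sqrt_nsq_le1.
exact: aK.
Qed.

Let cmxnorm_ge a v : nsq v <= 1 -> Num.sqrt (nsq (a *m v)) <= cmxnorm a.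
Proof.
move=> v1; apply: ub_le_sup; last first.
  exists (fun=> v); first by rewrite /= l2norm_ord1 sqrt_nsq_le1.
  by rewrite l2norm_ord1 opapp_ord1.
exists (Num.sqrt (\sum_k (\sum_j cabs (a k j)) ^+ 2)).
move=> _ [xi /= + <-]; rewrite !l2norm_ord1 opapp_ord1 sqrt_nsq_le1 => xi1.
rewrite ler_wsqrtr //; apply: ler_sum => k _; rewrite lerXn2r ?nnegrE //.
  by apply: sumr_ge0.
rewrite mxE; elim/big_ind2 : _ => [|z r w s zr ws|j _].
- by rewrite /cabs normr0.
- exact: le_trans (cabsD _ _) (lerD zr ws).
- rewrite cabsM ler_piMr //; rewrite -(@ler_pXn2r _ 2%N) ?nnegrE // expr1n.
  apply: le_trans xi1; rewrite /nsq (bigD1 j) //= lerDl.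
  by apply: sumr_ge0 => k' _; exact: sqr_ge0.
Qed.

Let sqrt_nsqD u v :
  Num.sqrt (nsq (u + v)) <= 2 * (Num.sqrt (nsq u) + Num.sqrt (nsq v)).
Proof.
have uv0 : 0 <= Num.sqrt (nsq u) + Num.sqrt (nsq v) by rewrite addr_ge0 ?sqrtr_ge0.
have -> : 2 * (Num.sqrt (nsq u) + Num.sqrt (nsq v)) =
          Num.sqrt ((2 * (Num.sqrt (nsq u) + Num.sqrt (nsq v))) ^+ 2).
  by rewrite sqrtr_sqr ger0_norm // mulr_ge0.
rewrite ler_wsqrtr // exprMn [(Num.sqrt _ + _) ^+ 2]sqrrD !sqr_sqrtr //.
have : nsq (u + v) <= 2 * (nsq u + nsq v).
  rewrite -big_split mulr_sumr; apply: ler_sum => k _; rewrite mxE /=.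
  apply: (@le_trans _ _ ((cabs (u k 0) + cabs (v k 0)) ^+ 2)).
    by rewrite lerXn2r ?nnegrE ?addr_ge0.
  have := sqr_ge0 (cabs (u k 0) - cabs (v k 0)); nra.
have := nsq_ge0 u; have := nsq_ge0 v.
have : 0 <= Num.sqrt (nsq u) * Num.sqrt (nsq v) by rewrite mulr_ge0 ?sqrtr_ge0.
by nra.
Qed.

Lemma cmxnorm0 : cmxnorm (0 : 'M[R[i]]_n) <= 0.
Proof.
apply: cmxnorm_le => v _; rewrite mul0mx /nsq big1 ?sqrtr0 // => k _.
by rewrite mxE /cabs normr0 expr0n.
Qed.

Lemma cmxnormZD (c : R[i]) a b :
  cmxnorm (c *: a + b) <= 2 * (cabs c * cmxnorm a + cmxnorm b).
Proof.
apply: cmxnorm_le => v v1; rewrite mulmxDl -scalemxAl.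
apply: le_trans (sqrt_nsqD _ _) _; rewrite ler_pM2l //; apply: lerD.
  have -> : nsq (c *: (a *m v)) = cabs c ^+ 2 * nsq (a *m v).
    by rewrite mulr_sumr; apply: eq_bigr => k _; rewrite mxE cabsM exprMn.
  rewrite sqrtrM ?sqr_ge0 // sqrtr_sqr ger0_norm //.
  by rewrite ler_wpM2l // cmxnorm_ge.
exact: cmxnorm_ge.
Qed.
End ComplexMatrixNorm.

Section Mu.
Variables (R : realType) (D : smosData R) (P : submodClosed (dual D)).

Definition WQ (n : nat) := {phi : {linear D -> matC R n} |
  [/\ completely_positive phi, complete_contraction phi
    & continuous (phi : weaktop (functionals P) -> 'M[R[i]^o]_n)]}.

Definition WQindex := {n : nat & WQ n}.

Definition WQfamily : lmodType R[i] :=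
  dfun (fun i : WQindex => 'M[R[i]]_(projT1 i) : lmodType R[i]).

Definition WQmap (i : WQindex) : {linear D -> matC R (projT1 i)} := sval (projT2 i).

Definition bounded_family : {pred WQfamily} := fun y =>
  `[< exists K : R, forall i, cmxnorm (y i) <= K >].

Lemma bounded_family_submod : submod_closed bounded_family.
Proof.
split=> [|c y z /asboolP[K yK] /asboolP[L zL]]; apply/asboolP.
  by exists 0 => i; exact: cmxnorm0.
exists (2 * (cabs c * K + L)) => i; apply: le_trans (cmxnormZD _ _ _) _.
rewrite ler_pM2l //; apply: lerD (zL i); apply: ler_wpM2l (yK i).
by rewrite /cabs normc_def sqrtr_ge0.
Qed.

HB.instance Definition _ :=
  GRing.isSubmodClosed.Build R[i] WQfamily bounded_family bounded_family_submod.

Definition WQcomponent (i : WQindex) (y : lsubspace bounded_family) :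
  matC R (projT1 i) := val y i.

(* N(D), the l_oo-direct sum over n of l_oo(WQ_n; M_n(C)). *)
Definition ND : smosData R :=
  @SmosData R (lsubspace bounded_family)
    (fun m y => sup [set mnorm (map_mx (WQcomponent i) y)
                    | i in [set: WQindex]])
    (fun y => tosub bounded_family (fun i => (val y i)^t* ))
    (fun m => [set y | forall i,
       mpos (map_mx (WQcomponent i) y)]).

Lemma mu_subproof (x : D) : ((fun i => WQmap i x) : WQfamily) \in bounded_family.
Proof.
apply/asboolP; exists (nrm x) => i; rewrite /WQmap.
case: (projT2 i) => phi /= [_ + _] => /(_ 1 (const_mx x)); apply: le_trans.
rewrite /cmxnorm le_eqVlt; apply/orP; left; apply/eqP; congr opnorm.
by apply/funext => k; apply/funext => l; rewrite !mxE.
Qed.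

Definition mu (x : D) : ND := exist _ ((fun i => WQmap i x) : WQfamily) (mu_subproof x).

Lemma mu_linear : linear mu.
Proof.
move=> a x y; apply/val_inj/functional_extensionality_dep => i /=.
by rewrite linearP.
Qed.

HB.instance Definition _ := GRing.isLinear.Build R[i] D ND *:%R mu mu_linear.
End Mu.

Section Dualization.
Variables (R : realType) (T : smosData R).

Let muT : {linear dual T -> ND (@bidual_image R T)} := @mu R (dual T) (@bidual_image R T).

(* T^d *)
Definition dualization : smosData R := subsmos (lrange muT).

(* mu_{T^*} as a map onto T^d *)
Definition dualization_map (f : dual T) : dualization :=
  exist _ (muT f) (mem_lrange muT f).

(* ||f||^d *)
Definition dnorm n (f : 'M[dual T]_n) : R := mnorm (map_mx dualization_map f).
End Dualization.

(* mu_{(T^d)^*} after the inverse of the dual map g |-> g \o mu_{T^*} from (T^d)^* to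
   T^** : the set below consists of the g whose image under the dual map is G. *)
Definition tau (R : realType) (T : smosData R) (G : dual (dual T)) :
    dualization (dualization T) :=
  dualization_map
    (xget 0 [set g : dual (dualization T) |
               forall f : dual T, val g (dualization_map f) = val G f]).

(* Main.v *)
(* Call S order approximable when every self-adjoint contraction h of M_n(S) is a
   norm limit of elements h' with -E <= h' <= E for some positive contraction E.  If
   S is unital take E = 1 and h' = h; if S is an algebra take E = s^2 and h' = s h s
   with s = 1 - (1 - h^2)^N.  Then a contraction is a combination of four positive
   ones, up to small errors, which bounds ||f|| by 4 ||f||^d; and for positive g the
   2 x 2 matrix trick turns the domination by E into ||g|| <= ||g||^d.

   The evaluations at positive contractions of M_n(S), n in N, represent S^* by
   block diagonal operators on a Hilbert sum.  When S is complete, errors halved at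
   each step add up, so that self-adjoint elements are exact differences of positive
   ones; this identifies the two weak-* topologies and makes the range weak-* closed.

   A complete contraction f : S -> M_n is a compression a^* g b of a completely
   positive contraction g, where a and b are almost contractive, hence the norm of
   M_oo(S^** ) can be computed on positive contractions of M_oo(S^* ).  On these the
   norms of S^* and S^d agree, which gives the isometry of tau.

   Finally a faithful representation of a C*-algebra is isometric, hence has a
   complete range.  Square roots 1 - (1 - x)^(1/2), obtained by iteration, replace
   spectral theory. *)

Require Import Defs.
From HB Require Import structures.
From mathcomp Require Import all_boot all_order all_algebra.
From mathcomp Require Import all_classical all_reals topology normedtype sequences.
From mathcomp Require Import complex lra ring.

Set Implicit Arguments.
Unset Strict Implicit.
Unset Printing Implicit Defensive.

Import Order.TTheory GRing.Theory Num.Theory Num.Def numFieldNormedType.Exports.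

Local Open Scope classical_set_scope.
Local Open Scope ring_scope.
Local Open Scope complex_scope.
Local Open Scope sesquilinear_scope.

(** * Complex numbers and pre-Hilbert spaces *)

(** Norms and cones of all spaces in the proof are read off from sesquilinear forms, so that the
    axioms of an operator space become inequalities between forms.

    The obstacle in (b) is that mu_{S^*} need not be isometric: S^d has a larger unit ball than S^*,
    and yet tau must preserve norms. The norm of (S^d)^d only tests weak-* continuous completely
    positive contractions, and each of these is evaluation at a matrix f over S^*. Testing it on
    positive contractions of S shows that f is positive with ||f|| <= 1 already in S^*, which gives
    one inequality. Wittstock's factorization gives the other. It comes from a functional on M_2m(S)
    + M_2m(C), found by applying Hahn-Banach to a gauge that encodes both the values of f in the
    off-diagonal corner and the traces of the diagonal scalar blocks.

    For weak-* closedness every evaluation at a point of S is extended to a weak-* continuous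
    functional on L(H), with a bound that holds for all operators and not only for those in the
    range; the exact decompositions serve to build these extensions from finitely many vectors. *)

Section ComplexAbs.
Variable R : realType.
Local Notation C := R[i].
Implicit Types z w : C.

Lemma normE z : `|z| = (cabs z)%:C. Proof. by rewrite /cabs normc_def. Qed.
Lemma cabs_ge0 z : 0 <= cabs z. Proof. by rewrite /cabs normc_def sqrtr_ge0. Qed.
Lemma cabsM z w : cabs (z * w) = cabs z * cabs w.
Proof. by rewrite /cabs normrM !normc_def /= mulr0 subr0. Qed.
Lemma cabsD z w : cabs (z + w) <= cabs z + cabs w.
Proof. by rewrite -raddfD; have := ler_normD z w; rewrite lecE => /andP[]. Qed.
Lemma cabsN z : cabs (- z) = cabs z. Proof. by rewrite /cabs normrN. Qed.
Lemma cabs0 : cabs (0 : C) = 0. Proof. by rewrite /cabs normr0. Qed.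
Lemma cabs1 : cabs (1 : C) = 1. Proof. by rewrite /cabs normr1. Qed.
Lemma cabsR (x : R) : cabs x%:C = `|x|.
Proof. by rewrite /cabs normc_def /= expr0n addr0 sqrtr_sqr. Qed.
Lemma cabs_eq0 z : cabs z = 0 -> z = 0.
Proof. by move=> z0; apply/eqP; rewrite -normr_eq0 normE z0. Qed.
Lemma cabs_conj z : cabs z^*%C = cabs z.
Proof. by case: z => a b; rewrite /cabs !normc_def /= sqrrN. Qed.
Lemma cabs_i : cabs ('i%C : C) = 1.
Proof. by rewrite /cabs normc_def /= expr0n add0r expr1n sqrtr1. Qed.
Lemma cabsB z w : cabs (z - w) <= cabs z + cabs w.
Proof. by rewrite -(cabsN w); exact: cabsD. Qed.
Lemma cabsBC z w : cabs (z - w) = cabs (w - z).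
Proof. by rewrite -cabsN opprB. Qed.
Lemma cabsV z : cabs z^-1 = (cabs z)^-1.
Proof.
have [->|z0] := eqVneq z 0; first by rewrite invr0 cabs0 invr0.
have h : cabs z * cabs z^-1 = 1 by rewrite -cabsM divff // cabs1.
have h0 : cabs z != 0 by apply: contra_neq z0 => /cabs_eq0.
by apply: (mulfI h0); rewrite h divff.
Qed.
Lemma Re_le_cabs z : complex.Re z <= cabs z.
Proof.
case: z => a b; rewrite /cabs normc_def /=; apply: le_trans (ler_norm _) _.
by rewrite -sqrtr_sqr ler_wsqrtr // lerDl sqr_ge0.
Qed.
Lemma Im_le_cabs z : complex.Im z <= cabs z.
Proof.
case: z => a b; rewrite /cabs normc_def /=; apply: le_trans (ler_norm _) _.
by rewrite -sqrtr_sqr ler_wsqrtr // lerDr sqr_ge0.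
Qed.
Lemma mulC_conj z : z * z^*%C = ((cabs z) ^+ 2)%:C.
Proof. by rewrite -sqr_normc normE -rmorphXn. Qed.
Lemma cabs_sum (I : Type) (r : seq I) (P : pred I) (F : I -> C) :
  cabs (\sum_(i <- r | P i) F i) <= \sum_(i <- r | P i) cabs (F i).
Proof.
elim/big_ind2 : _ => [|z x w y zx wy|//]; first by rewrite cabs0.
exact: le_trans (cabsD _ _) (lerD zx wy).
Qed.
Lemma cge0P z : (0 <= z) <-> (complex.Im z = 0 /\ 0 <= complex.Re z).
Proof. by rewrite lecE /=; split=> [/andP[/eqP -> ->]|[-> ->]]; rewrite ?eqxx. Qed.
Lemma cge0E z : 0 <= z -> z = (complex.Re z)%:C.
Proof. by case: z => a b /cge0P [/= -> _]. Qed.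
Lemma cRe_ge0 z : 0 <= z -> 0 <= complex.Re z. Proof. by case/cge0P. Qed.
Lemma cge0_conj z : 0 <= z -> z^*%C = z.
Proof. by case: z => a b /cge0P [/= -> _]; rewrite oppr0. Qed.
Lemma ReD z w : complex.Re (z + w) = complex.Re z + complex.Re w. Proof. by case: z w => ? ? []. Qed.
Lemma ImD z w : complex.Im (z + w) = complex.Im z + complex.Im w. Proof. by case: z w => ? ? []. Qed.
Lemma ReN z : complex.Re (- z) = - complex.Re z. Proof. by case: z. Qed.
Lemma ImN z : complex.Im (- z) = - complex.Im z. Proof. by case: z. Qed.
Lemma Re_conj z : complex.Re z^*%C = complex.Re z. Proof. by case: z. Qed.
Lemma Im_conj z : complex.Im z^*%C = - complex.Im z. Proof. by case: z. Qed.
Lemma ReZ (x : R) z : complex.Re (x%:C * z) = x * complex.Re z.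
Proof. by case: z => a b /=; rewrite mul0r subr0. Qed.
Lemma Re_i z : complex.Re ('i%C * z) = - complex.Im z.
Proof. by case: z => a b /=; rewrite mul0r mul1r sub0r. Qed.
Lemma Im_i z : complex.Im ('i%C * z) = complex.Re z.
Proof. by case: z => a b /=; rewrite mul0r mul1r add0r. Qed.
Lemma conjcD z w : (z + w)^*%C = z^*%C + w^*%C. Proof. exact: rmorphD. Qed.
Lemma conjcM z w : (z * w)^*%C = z^*%C * w^*%C. Proof. exact: rmorphM. Qed.
Lemma conjcN z : (- z)^*%C = - z^*%C. Proof. exact: rmorphN. Qed.
Lemma conjc_0 : (0 : C)^*%C = 0. Proof. exact: rmorph0. Qed.
Lemma conjc_1 : (1 : C)^*%C = 1. Proof. exact: rmorph1. Qed.
Lemma conjR (x : R) : (x%:C : C)^*%C = x%:C. Proof. by rewrite /= oppr0. Qed.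
Lemma conjc_sum (I : Type) (r : seq I) (P : pred I) (F : I -> C) :
  (\sum_(i <- r | P i) F i)^*%C = \sum_(i <- r | P i) (F i)^*%C.
Proof. exact: rmorph_sum. Qed.
Lemma Re_sum (I : Type) (r : seq I) (P : pred I) (F : I -> C) :
  complex.Re (\sum_(i <- r | P i) F i) = \sum_(i <- r | P i) complex.Re (F i).
Proof. by apply: (big_morph _ ReD). Qed.
Lemma cabs_Re_Im z : cabs z <= `|complex.Re z| + `|complex.Im z|.
Proof.
rewrite {1}(complexE z); apply: le_trans (cabsD _ _) _.
by rewrite cabsM cabs_i mul1r !cabsR.
Qed.

Lemma phase z : exists2 u : C, cabs u = 1 & u * z = (cabs z)%:C.
Proof.
have [->|z0] := eqVneq z 0; first by exists 1; rewrite ?cabs1 // mulr0 cabs0.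
have cz : cabs z != 0 by apply: contra_neq z0 => /cabs_eq0.
exists (z^*%C * ((cabs z)^-1)%:C).
  by rewrite cabsM cabs_conj cabsR ger0_norm ?invr_ge0 ?cabs_ge0 // mulfV.
by rewrite mulrAC [_ * z]mulrC mulC_conj -rmorphM expr2 mulfK.
Qed.

Lemma cge0_approx z :
  (forall e : R, 0 < e -> exists2 w, 0 <= w & cabs (z - w) <= e) -> 0 <= z.
Proof.
move=> h; apply/cge0P; split.
  apply/eqP; rewrite -normr_le0; apply/ler_addgt0Pr => e /h[w /cge0P[w1 _] zw].
  rewrite add0r; apply: le_trans zw; rewrite -[complex.Im z]subr0 -{1}w1 -ImN -ImD.
  by rewrite ler_norml lerNl -ImN Im_le_cabs -cabsN Im_le_cabs.
apply/ler_addgt0Pr => e /h[w /cge0P[_ w1] zw].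
have := le_trans (Re_le_cabs (w - z)) _ ; rewrite cabsBC => /(_ _ zw).
rewrite ReD ReN; lra.
Qed.

Lemma le_cabs_approx (a b : R) : (forall e, 0 < e -> a <= b + e) -> a <= b.
Proof. by move/ler_addgt0Pr. Qed.

End ComplexAbs.

(** The form may be degenerate and the space incomplete: C^n, finite powers and l2 sums are then
    instances on the same footing. Definiteness and completeness are separate hypotheses, stated
    where a Hilbert space is formed. *)
Record preHilbert (R : realType) := PreHilbert {
  ph_car :> lmodType R[i];
  pip : ph_car -> ph_car -> R[i];
  pip_lin : forall a x y z, pip (a *: x + y) z = a * pip x z + pip y z;
  pip_herm : forall x y, pip x y = (pip y x)^*%C;
  pip_ge0 : forall x, 0 <= pip x x }.
Arguments pip {R p}.

Section PreHilbertTheory.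
Variables (R : realType) (V : preHilbert R).
Local Notation C := R[i].
Implicit Types (x y z : V) (a b : C).

Definition vnorm x : R := Num.sqrt (complex.Re (pip x x)).

Lemma pip0l x : pip 0 x = 0 :> C.
Proof. by have := pip_lin (-1) 0 0 x; rewrite scaler0 addr0 mulN1r addNr. Qed.
Lemma pipDl x y z : pip (x + y) z = pip x z + pip y z.
Proof. by rewrite -[x]scale1r pip_lin mul1r scale1r. Qed.
Lemma pipZl a x y : pip (a *: x) y = a * pip x y.
Proof. by rewrite -[_ *: x]addr0 pip_lin pip0l addr0. Qed.
Lemma pipNl x y : pip (- x) y = - pip x y.
Proof. by rewrite -scaleN1r pipZl mulN1r. Qed.
Lemma pipDr x y z : pip z (x + y) = pip z x + pip z y.
Proof. by rewrite !(pip_herm z) pipDl conjcD. Qed.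
Lemma pipZr a x y : pip x (a *: y) = a^*%C * pip x y.
Proof. by rewrite !(pip_herm x) pipZl conjcM. Qed.
Lemma pip0r x : pip x 0 = 0 :> C.
Proof. by rewrite pip_herm pip0l conjc_0. Qed.
Lemma pipNr x y : pip x (- y) = - pip x y.
Proof. by rewrite !(pip_herm x) pipNl conjcN. Qed.
Lemma pip_suml (I : Type) (r : seq I) (P : pred I) (F : I -> V) x :
  pip (\sum_(i <- r | P i) F i) x = \sum_(i <- r | P i) pip (F i) x.
Proof. by apply: (big_morph (fun y => pip y x)) => [y z|]; rewrite ?pipDl ?pip0l. Qed.
Lemma pip_sumr (I : Type) (r : seq I) (P : pred I) (F : I -> V) x :
  pip x (\sum_(i <- r | P i) F i) = \sum_(i <- r | P i) pip x (F i).
Proof. by apply: (big_morph (fun y => pip x y)) => [y z|]; rewrite ?pipDr ?pip0r. Qed.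

Lemma pip_vnorm x : pip x x = (vnorm x ^+ 2)%:C.
Proof. by rewrite /vnorm sqr_sqrtr ?cRe_ge0 ?pip_ge0 // -cge0E // pip_ge0. Qed.
Lemma vnorm_ge0 x : 0 <= vnorm x. Proof. exact: sqrtr_ge0. Qed.
Lemma vnorm_sq x : vnorm x ^+ 2 = complex.Re (pip x x).
Proof. by rewrite /vnorm sqr_sqrtr // cRe_ge0 // pip_ge0. Qed.
Lemma vnorm0 : vnorm 0 = 0. Proof. by rewrite /vnorm pip0l sqrtr0. Qed.

Lemma vnorm_sqD x y :
  vnorm (x + y) ^+ 2 = vnorm x ^+ 2 + vnorm y ^+ 2 + 2 * complex.Re (pip x y).
Proof.
rewrite !vnorm_sq pipDl !pipDr !ReD [pip y x]pip_herm Re_conj; ring.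
Qed.

Lemma vnormZ a x : vnorm (a *: x) = cabs a * vnorm x.
Proof.
rewrite {1}/vnorm pipZl pipZr mulrA mulC_conj pip_vnorm -rmorphM -exprMn /=.
by rewrite sqrtr_sqr ger0_norm // mulr_ge0 ?cabs_ge0 ?vnorm_ge0.
Qed.
Lemma vnormN x : vnorm (- x) = vnorm x.
Proof. by rewrite -scaleN1r vnormZ cabsN cabs1 mul1r. Qed.

End PreHilbertTheory.

Section PolarBound.
Variables (R : realType) (V W : preHilbert R) (s : V -> W -> R[i]) (K : R).
Hypothesis K0 : 0 <= K.
Hypothesis sZl : forall a x y, s (a *: x) y = a * s x y.
Hypothesis sZr : forall (t : R) x y, s x (t%:C *: y) = t%:C * s x y.
Hypothesis sRe : forall x y,
  2 * complex.Re (s x y) <= K * (vnorm x ^+ 2 + vnorm y ^+ 2).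

(* Phases turn a bound on the real part into one on the modulus, and scaling
   the two vectors against each other turns AM-GM into a product bound. *)
Lemma polar_bound x y : cabs (s x y) <= K * (vnorm x * vnorm y).
Proof.
have [u u1 uxy] := phase (s x y).
have key t : 2 * t * cabs (s x y) <= K * (vnorm x ^+ 2 + t ^+ 2 * vnorm y ^+ 2).
  have := sRe (u *: x) (t%:C *: y).
  rewrite sZr sZl uxy -rmorphM /= !vnormZ u1 mul1r cabsR exprMn real_normK ?num_real //.
  by rewrite mulrA.
have x0 := vnorm_ge0 x; have y0 := vnorm_ge0 y; have c0 := cabs_ge0 (s x y).
apply: le_cabs_approx => e e0; rewrite -[e]/(e : R).
pose X := vnorm x; pose Y := vnorm y.
(* t = (X + d) / (Y + d) with d small *)
have [d d0 de] : exists2 d : R, 0 < d & K * (d * (X + Y + d)) <= e.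
  exists (Num.min 1 (e / ((K + 1) * (X + Y + 1)))).
    by rewrite lt_min ltr01 divr_gt0 // mulr_gt0 // ltr_wpDl // addr_ge0.
  set d := Num.min _ _.
  have d1 : d <= 1 by rewrite ge_min lexx.
  have d2 : d <= e / ((K + 1) * (X + Y + 1)) by rewrite ge_min lexx orbT.
  have h0 : 0 < (K + 1) * (X + Y + 1) by rewrite mulr_gt0 // ltr_wpDl // addr_ge0.
  have d0 : 0 < d by rewrite lt_min ltr01 divr_gt0.
  have : d * ((K + 1) * (X + Y + 1)) <= e by rewrite -ler_pdivlMr.
  apply: le_trans.
  have -> : K * (d * (X + Y + d)) = d * (K * (X + Y + d)) by ring.
  rewrite ler_wpM2l ?(ltW d0) //; apply: ler_pM => //; rewrite ?lerDl //.
  - by rewrite addr_ge0 ?(ltW d0) // addr_ge0.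
  - by rewrite lerD2l.
have Xd : 0 < X + d by rewrite ltr_wpDl.
have Yd : 0 < Y + d by rewrite ltr_wpDl.
have := key ((X + d) / (Y + d)); rewrite -/X -/Y => h.
have {h} : 2 * cabs (s x y) <=
    K * (X ^+ 2 * ((Y + d) / (X + d)) + Y ^+ 2 * ((X + d) / (Y + d))).
  rewrite -(ler_pM2l (divr_gt0 Xd Yd)).
  apply: le_trans (_ : _ <= _) (le_trans h _); rewrite le_eqVlt; apply/orP; left; apply/eqP.
    by ring.
  by field; rewrite !gt_eqF.
have h1 : X ^+ 2 * ((Y + d) / (X + d)) <= X * (Y + d).
  rewrite [leLHS]mulrA ler_pdivrMr //; have : 0 <= X * (Y + d) * d.
    by rewrite !mulr_ge0 // ltW.
  by rewrite expr2 mulrDr; lra.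
have h2 : Y ^+ 2 * ((X + d) / (Y + d)) <= Y * (X + d).
  rewrite [leLHS]mulrA ler_pdivrMr //; have : 0 <= Y * (X + d) * d.
    by rewrite !mulr_ge0 // ltW.
  by rewrite expr2 mulrDr; lra.
have : K * (X ^+ 2 * ((Y + d) / (X + d)) + Y ^+ 2 * ((X + d) / (Y + d))) <=
       K * (X * (Y + d) + Y * (X + d)) by rewrite ler_wpM2l // lerD.
have : K * (X * (Y + d) + Y * (X + d)) <= K * (2 * (X * Y)) + K * (d * (X + Y + d)).
  by rewrite -mulrDr ler_wpM2l //; nra.
rewrite -/X -/Y; lra.
Qed.
End PolarBound.

Section PreHilbertNorm.
Variables (R : realType) (V : preHilbert R).
Local Notation C := R[i].
Implicit Types (x y z : V) (a b : C).

(** The inequality |z - w|^2 >= 0 is the hypothesis of [polar_bound] with K = 1, which also covers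
    degenerate forms. *)
Lemma CauchySchwarz x y : cabs (pip x y) <= vnorm x * vnorm y.
Proof.
rewrite -[leRHS]mul1r; apply: (polar_bound (s := pip)) => [|a z w|t z w|z w].
- exact: ler01.
- exact: pipZl.
- by rewrite pipZr conjR.
- have := sqr_ge0 (vnorm (z - w)); rewrite vnorm_sqD vnormN pipNr ReN; lra.
Qed.

Lemma vnormD x y : vnorm (x + y) <= vnorm x + vnorm y.
Proof.
rewrite -(@ler_pXn2r _ 2) ?nnegrE ?addr_ge0 ?vnorm_ge0 //.
rewrite vnorm_sqD sqrrD; have := le_trans (Re_le_cabs _) (CauchySchwarz x y); lra.
Qed.
Lemma vnormBC x y : vnorm (x - y) = vnorm (y - x).
Proof. by rewrite -vnormN opprB. Qed.
Lemma vnorm_sum (I : Type) (r : seq I) (P : pred I) (F : I -> V) :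
  vnorm (\sum_(i <- r | P i) F i) <= \sum_(i <- r | P i) vnorm (F i).
Proof.
elim/big_ind2 : _ => [|z x w y zx wy|//]; first by rewrite vnorm0.
exact: le_trans (vnormD _ _) (lerD zx wy).
Qed.

End PreHilbertNorm.

(** * Positive semidefinite matrices *)

Section Factorization.
Variable R : realType.
Local Notation C := R[i].

Definition psd n (A : 'M[C]_n) : Prop :=
  A^t* = A /\ forall v : 'cV[C]_n, 0 <= (v^t* *m A *m v) 0 0.

Lemma adjmxM m n p (A : 'M[C]_(m, n)) (B : 'M[C]_(n, p)) :
  (A *m B)^t* = B^t* *m A^t*.
Proof. by rewrite trmx_mul map_mxM. Qed.

Lemma adjmxD m n (A B : 'M[C]_(m, n)) : (A + B)^t* = A^t* + B^t*.
Proof. by rewrite linearD map_mxD. Qed.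

(** By the spectral theorem A = P^* diag(d) P. The entries of d are values of the form of A, hence
    have square roots. *)
Lemma psd_factor n (A : 'M[C]_n) : psd A -> exists c : 'M[C]_n, A = c^t* *m c.
Proof.
move=> [Ah A0].
have : A \is normalmx by apply/normalmxP; rewrite Ah.
move/orthomx_spectralP; set P := spectralmx A; set d := spectral_diag A => AE.
have Pu : P \is unitarymx := spectral_unitarymx A.
have PiE : invmx P = P^t* := invmx_unitary Pu.
have PP : P *m P^t* = 1%:M by apply/unitarymxP.
have d0 i : 0 <= d 0 i.
  have := A0 (P^t* *m delta_mx i 0).
  rewrite adjmxM trmxCK AE PiE !mulmxA -[_ *m P *m P^t*]mulmxA PP mulmx1.
  rewrite -[_ *m P *m P^t*]mulmxA PP mulmx1 mul_mx_diag.
  rewrite mxE (bigD1 i) //= big1 ?addr0 => [|j ji]; last first.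
    by rewrite !mxE (negbTE ji) /= mulr0.
  by rewrite !mxE !eqxx /= conjC1 mul1r mulr1.
pose s := \row_i sqrtC (d 0 i).
have ds : diag_mx d = (diag_mx s)^t* *m diag_mx s.
  rewrite tr_diag_mx map_diag_mx mulmx_diag; congr diag_mx; apply/rowP => j.
  by rewrite !mxE /= geC0_conj ?sqrtC_ge0 // -expr2 sqrtCK.
by exists (diag_mx s *m P); rewrite adjmxM {1}AE PiE ds !mulmxA.
Qed.

(** The shift by e makes the factor invertible, because a vector in its kernel has e |v|^2 = 0. One
    can then divide by c, at a cost that vanishes with e. *)
Lemma psd_eps_factor n (A : 'M[C]_n) (e : R) : psd A -> 0 < e ->
  exists2 c : 'M[C]_n, c \in unitmx & A + e%:C%:M = c^t* *m c.
Proof.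
move=> [Ah A0] e0; set B := A + _.
have vBv (v : 'cV[C]_n) : (v^t* *m B *m v) 0 0 = (v^t* *m A *m v) 0 0 + e%:C * (v^t* *m v) 0 0.
  by rewrite mulmxDr mulmxDl mul_mx_scalar -scalemxAl !mxE.
have vv (v : 'cV[C]_n) : (v^t* *m v) 0 0 = \sum_i `|v i 0| ^+ 2.
  by rewrite mxE; apply: eq_bigr => i _; rewrite !mxE mulrC -normCK.
have Bp : psd B.
  split=> [|v].
    rewrite adjmxD Ah tr_scalar_mx; congr (_ + _).
    by rewrite map_scalar_mx; congr (_%:M); exact: conjR.
  rewrite vBv addr_ge0 // mulr_ge0 ?ler0c ?(ltW e0) // vv.
  by apply: sumr_ge0 => i _; rewrite exprn_ge0.
have [c cE] := psd_factor Bp; exists c => //.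
rewrite -unitmx_tr -row_free_unit -kermx_eq0; apply/eqP/row_matrixP => k; rewrite row0.
pose v : 'cV[C]_n := (row k (kermx c^T))^T.
have cv : c *m v = 0.
  by apply: trmx_inj; rewrite trmx_mul trmxK -row_mul mulmx_ker row0 trmx0.
have := vBv v; rewrite cE -!mulmxA cv !mulmx0 mxE => /esym/eqP.
rewrite paddr_eq0 ?mulmxA //; last first.
  by rewrite mulr_ge0 ?ler0c ?(ltW e0) // vv sumr_ge0 // => i _; rewrite exprn_ge0.
move=> /andP[_]; rewrite mulf_eq0 => /orP[/eqP/complexI e00|].
  by rewrite e00 ltxx in e0.
rewrite vv psumr_eq0 => [/allP h|i _]; last by rewrite exprn_ge0.
apply/rowP => j; have := h j (mem_index_enum _).
by rewrite /= expf_eq0 normr_eq0 !mxE => /andP[_ /eqP].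
Qed.
End Factorization.

(** * Quadratic forms and represented operator spaces *)

Section PowerSpace.
Variables (R : realType) (V : preHilbert R) (n : nat).
Local Notation C := R[i].

Let ppip (x y : 'I_n -> V) : C := \sum_i pip (x i) (y i).

Let ppip_lin a x y z : ppip (a *: x + y) z = a * ppip x z + ppip y z.
Proof. by rewrite /ppip mulr_sumr -big_split; apply: eq_bigr => i _; exact: pip_lin. Qed.
Let ppip_herm x y : ppip x y = (ppip y x)^*%C.
Proof. by rewrite /ppip conjc_sum; apply: eq_bigr => i _; exact: pip_herm. Qed.
Let ppip_ge0 x : 0 <= ppip x x.
Proof. by apply: sumr_ge0 => i _; exact: pip_ge0. Qed.

Definition powPH := PreHilbert ppip_lin ppip_herm ppip_ge0.

Lemma pow_vnorm_sq (x : powPH) : vnorm x ^+ 2 = \sum_i vnorm (x i) ^+ 2.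
Proof. by rewrite vnorm_sq /= Re_sum; apply: eq_bigr => i _; rewrite vnorm_sq. Qed.

Lemma comp_vnorm (x : powPH) i : vnorm (x i) <= vnorm x.
Proof.
rewrite -(@ler_pXn2r _ 2) ?nnegrE ?vnorm_ge0 // pow_vnorm_sq (bigD1 i) //= lerDl.
by apply: sumr_ge0 => j _; exact: sqr_ge0.
Qed.

Lemma pow_vnorm_le_sum (x : powPH) : vnorm x <= \sum_i vnorm (x i).
Proof.
have -> : x = \sum_i (fun k => (k == i)%:R *: x i) :> powPH.
  apply/funext => k; rewrite fct_sumE (bigD1 k) //= big1 ?addr0 ?eqxx ?scale1r // => i ik.
  by rewrite eq_sym (negbTE ik) scale0r.
apply: le_trans (vnorm_sum _ _ _) _; apply: ler_sum => i _.
rewrite -(@ler_pXn2r _ 2) ?nnegrE ?vnorm_ge0 // pow_vnorm_sq (bigD1 i) //= big1 => [|k ki].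
  rewrite eqxx scale1r addr0 fct_sumE (bigD1 i) //= eqxx scale1r big1 ?addr0 // => k ki.
  by rewrite eq_sym (negbTE ki) scale0r.
by rewrite (negbTE ki) scale0r vnorm0 expr0n.
Qed.

Definition delta_vec (i : 'I_n) (v : V) : powPH := fun k => if k == i then v else 0.

Lemma vnorm_delta i v : vnorm (delta_vec i v) = vnorm v.
Proof.
apply/eqP; rewrite -(@eqrXn2 _ 2) ?vnorm_ge0 // pow_vnorm_sq (bigD1 i) //= big1 => [|k ki].
  by rewrite /delta_vec eqxx addr0.
by rewrite /delta_vec (negbTE ki) vnorm0 expr0n.
Qed.
End PowerSpace.

Section Forms.
Variables (R : realType) (V : preHilbert R) (n : nat).
Local Notation C := R[i].
Implicit Types (B : 'I_n -> 'I_n -> V -> V) (xi eta : powPH V n).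

Definition mform B xi eta : C := \sum_i pip (opapp B xi i) (eta i).

Lemma mformE B xi eta : mform B xi eta = \sum_i \sum_j pip (B i j (xi j)) (eta i).
Proof. by apply: eq_bigr => i _; rewrite /opapp pip_suml. Qed.

Lemma mform_pip B xi eta : mform B xi eta = pip (opapp B xi : powPH V n) eta.
Proof. by []. Qed.

Lemma l2norm_vnorm xi : l2norm (@pip R V) xi = vnorm xi. Proof. by []. Qed.

Lemma opapp_le B K : 0 <= K ->
  (forall xi eta, cabs (mform B xi eta) <= K * (vnorm xi * vnorm eta)) ->
  forall xi, vnorm (opapp B xi : powPH V n) <= K * vnorm xi.
Proof.
move=> K0 h xi; have := h xi (opapp B xi); rewrite mform_pip pip_vnorm cabsR.
rewrite ger0_norm ?sqr_ge0 // => h2.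
have := vnorm_ge0 (opapp B xi : powPH V n); rewrite le_eqVlt => /predU1P[<-|t0].
  by rewrite mulr_ge0 ?vnorm_ge0.
by rewrite -(ler_pM2r t0) -mulrA -expr2.
Qed.

Lemma opnorm_le B K : 0 <= K ->
  (forall xi eta, cabs (mform B xi eta) <= K * (vnorm xi * vnorm eta)) ->
  opnorm (@pip R V) B <= K.
Proof.
move=> K0 h; apply: ge_sup.
  exists (l2norm (@pip R V) (opapp B (fun=> 0))); exists (fun=> 0) => //=.
  by rewrite l2norm_vnorm vnorm0.
move=> _ [xi /= xi1 <-]; rewrite l2norm_vnorm.
by apply: le_trans (opapp_le K0 h xi) _; rewrite ler_piMr.
Qed.

(** [opnorm] is a [sup], which is a default value on unbounded sets; the bounds on the entries,
    summed up to M, show that the set is bounded. *)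
Lemma opnorm_ge B : (forall i j, linear (B i j)) ->
  (forall i j, exists M : R, forall v, vnorm (B i j v) <= M * vnorm v) ->
  0 <= opnorm (@pip R V) B /\
  forall xi eta, cabs (mform B xi eta) <= opnorm (@pip R V) B * (vnorm xi * vnorm eta).
Proof.
move=> lB bB.
have [M Mb] : exists M : R, forall xi, vnorm (opapp B xi : powPH V n) <= M * vnorm xi.
  have /choice[Mf hM] : forall ij : 'I_n * 'I_n, exists M : R,
      forall v, vnorm (B ij.1 ij.2 v) <= M * vnorm v by move=> [i j]; exact: bB.
  exists (\sum_i \sum_j Num.max 0 (Mf (i, j))) => xi.
  apply: le_trans (pow_vnorm_le_sum _) _; rewrite mulr_suml; apply: ler_sum => i _.
  rewrite /opapp; apply: le_trans (vnorm_sum _ _ _) _; rewrite mulr_suml.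
  apply: ler_sum => j _; apply: le_trans (hM (i, j) _) _.
  apply: le_trans (_ : Num.max 0 (Mf (i, j)) * vnorm (xi j) <= _).
    by rewrite ler_wpM2r ?vnorm_ge0 // le_max lexx orbT.
  by rewrite ler_wpM2l ?comp_vnorm // le_max lexx.
have ub xi : vnorm xi <= 1 -> vnorm (opapp B xi : powPH V n) <= opnorm (@pip R V) B.
  move=> xi1; apply: ub_le_sup; last by exists xi.
  exists (Num.max 0 M) => _ [eta /= eta1 <-]; apply: le_trans (Mb eta) _.
  apply: (@le_trans _ _ (Num.max 0 M * vnorm (eta : powPH V n))).
    by rewrite ler_wpM2r ?vnorm_ge0 // le_max lexx orbT.
  by rewrite ler_piMr // le_max lexx.
have o0 : 0 <= opnorm (@pip R V) B.
  by apply: le_trans (ub 0 _); rewrite ?vnorm_ge0 // vnorm0.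
split=> // xi eta; rewrite mform_pip; apply: le_trans (CauchySchwarz _ _) _.
rewrite mulrA ler_wpM2r ?vnorm_ge0 //.
(* The form may be degenerate: a vector of norm 0 cannot be normalised, and the crude bound M shows
   that its image has norm 0 too. *)
have := vnorm_ge0 xi; rewrite le_eqVlt => /predU1P[x0|x0].
  by apply: le_trans (Mb xi) _; rewrite -x0 !mulr0.
have := ub ((vnorm xi)^-1%:C *: xi); rewrite vnormZ cabsR ger0_norm ?invr_ge0 ?(ltW x0) //.
rewrite mulVf ?gt_eqF // => /(_ (lexx _)).
have -> : opapp B ((vnorm xi)^-1%:C *: xi) = (vnorm xi)^-1%:C *: opapp B xi :> powPH V n.
  apply/funext => i; rewrite /opapp [RHS]scaler_sumr; apply: eq_bigr => j _.
  have := lB i j ((vnorm xi)^-1%:C) (xi j) 0.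
  have -> : B i j 0 = 0.
    by have := lB i j (-1) 0 0; rewrite scaler0 addr0 scaleN1r addNr.
  by rewrite !addr0 => <-.
by rewrite vnormZ cabsR ger0_norm ?invr_ge0 ?(ltW x0) // ler_pdivrMl // mulrC.
Qed.
End Forms.

(** * Scalar matrices acting on vectors *)

Section ScalarAction.
Variables (R : realType) (V : preHilbert R).
Local Notation C := R[i].

Definition mxact m n (b : 'M[C]_(m, n)) (xi : powPH V n) : powPH V m :=
  fun q => \sum_j b q j *: xi j.

(** The order of the arguments makes v^* G v the squared norm of the combination of the [xi j] with
    coefficients [v j]. *)
Definition gram n (xi : powPH V n) : 'M[C]_n := \matrix_(i, j) pip (xi j) (xi i).

Lemma gram_psd n (xi : powPH V n) : psd (gram xi).
Proof.
split=> [|v].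
  by apply/matrixP => i j; rewrite !mxE [RHS]pip_herm.
have -> : (v^t* *m gram xi *m v) 0 0 = pip (\sum_j v j 0 *: xi j) (\sum_j v j 0 *: xi j).
  rewrite mxE pip_suml; apply: eq_bigr => j _.
  rewrite pip_sumr mxE mulr_suml; apply: eq_bigr => i _.
  by rewrite !mxE pipZl pipZr; exact: mulrC.
exact: pip_ge0.
Qed.

Lemma cvdot_lin n a (x y z : 'cV[C]_n) : cvdot (a *: x + y) z = a * cvdot x z + cvdot y z.
Proof.
by rewrite /cvdot mulr_sumr -big_split; apply: eq_bigr => i _; rewrite !mxE mulrDl mulrA.
Qed.
Lemma cvdot_herm n (x y : 'cV[C]_n) : cvdot x y = (cvdot y x)^*%C.
Proof.
by rewrite /cvdot conjc_sum; apply: eq_bigr => i _; rewrite conjcM conjcK mulrC.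
Qed.
Lemma cvdot_ge0 n (x : 'cV[C]_n) : 0 <= cvdot x x.
Proof. by apply: sumr_ge0 => i _; rewrite mulC_conj ler0c sqr_ge0. Qed.
Definition cvPH n := PreHilbert (@cvdot_lin n) (@cvdot_herm n) (@cvdot_ge0 n).

Lemma cv_vnorm_sq n (v : cvPH n) : vnorm v ^+ 2 = \sum_i cabs (v i 0) ^+ 2.
Proof.
by rewrite vnorm_sq /= /cvdot Re_sum; apply: eq_bigr => i _; rewrite mulC_conj.
Qed.

Lemma cv_coord_le n (v : cvPH n) i : cabs (v i 0) <= vnorm v.
Proof.
rewrite -(@ler_pXn2r _ 2) ?nnegrE ?vnorm_ge0 ?cabs_ge0 // cv_vnorm_sq.
by rewrite (bigD1 i) //= lerDl; apply: sumr_ge0 => k _; exact: sqr_ge0.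
Qed.

Lemma cv_vnorm_le_sum n (v : cvPH n) : vnorm v <= \sum_i cabs (v i 0).
Proof.
have s0 : 0 <= \sum_i cabs (v i 0) by apply: sumr_ge0 => i _; exact: cabs_ge0.
rewrite -(@ler_pXn2r _ 2) ?nnegrE ?vnorm_ge0 // cv_vnorm_sq.
rewrite [leRHS]expr2 mulr_suml; apply: ler_sum => i _.
rewrite expr2 ler_wpM2l ?cabs_ge0 // (bigD1 i) //= lerDl.
by apply: sumr_ge0 => k _; exact: cabs_ge0.
Qed.

Lemma mulmx_bounded m n (a : 'M[C]_(m, n)) :
  exists M : R, forall v : cvPH n, vnorm (a *m v : cvPH m) <= M * vnorm v.
Proof.
exists (\sum_i \sum_j cabs (a i j)) => v.
apply: le_trans (cv_vnorm_le_sum _) _; rewrite mulr_suml; apply: ler_sum => i _.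
rewrite mxE; apply: le_trans (cabs_sum _ _ _) _; rewrite mulr_suml.
by apply: ler_sum => j _; rewrite cabsM ler_wpM2l ?cabs_ge0 // cv_coord_le.
Qed.

Lemma matC_norm k n (x : 'M[matC R k]_n) :
  0 <= mnorm x /\ forall xi eta,
    cabs (mform (V := cvPH k) (fun i j => mulmx (x i j)) xi eta) <=
    mnorm x * (vnorm xi * vnorm eta).
Proof.
apply: (@opnorm_ge R (cvPH k) n) => i j; last exact: mulmx_bounded.
by move=> c u v; rewrite mulmxDr scalemxAr.
Qed.

Lemma cmxnormE n (a : 'M[C]_n) : cmxnorm a = mnorm (const_mx a : 'M[matC R n]_1).
Proof. by congr opnorm; apply/funext => i; apply/funext => j; rewrite mxE. Qed.

Lemma cmxnorm_ge0 n (a : 'M[C]_n) : 0 <= cmxnorm a.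
Proof. by rewrite cmxnormE; have [] := matC_norm (const_mx a : 'M[matC R n]_1). Qed.

Lemma cmxnorm_bound n (a : 'M[C]_n) (u v : cvPH n) :
  cabs (cvdot (a *m u) v) <= cmxnorm a * (vnorm u * vnorm v).
Proof.
have [_ h] := matC_norm (const_mx a : 'M[matC R n]_1).
have := h (fun=> u) (fun=> v); rewrite -cmxnormE mformE !big_ord1 mxE.
suff e (w : cvPH n) : vnorm ((fun=> w) : powPH (cvPH n) 1) = vnorm w by rewrite !e.
by apply/eqP; rewrite -(@eqrXn2 _ 2) ?vnorm_ge0 // pow_vnorm_sq big_ord1.
Qed.

(** Reduction from V to scalars: a factor of the Gram matrix of [xi] yields vectors [u k] in C^n
    with the same sums of scalar products, and on C^n the bound is the definition of the matrix
    norm. *)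
Lemma mxact_bound m n r (b : 'I_r -> 'M[C]_(m, n)) (xi : powPH V n) :
  \sum_k vnorm (mxact (b k) xi) ^+ 2 <=
  cmxnorm (\sum_k (b k)^t* *m b k) * vnorm xi ^+ 2.
Proof.
set M := \sum_k (_ *m _); have [c cE] := psd_factor (gram_psd xi).
pose u k : cvPH n := (row k c)^T.
have gE i j : gram xi i j = \sum_k (u k i 0)^*%C * u k j 0.
  by rewrite cE mxE; apply: eq_bigr => k _; rewrite !mxE.
have uxi : \sum_k vnorm (u k) ^+ 2 = vnorm xi ^+ 2.
  rewrite pow_vnorm_sq; transitivity (\sum_i complex.Re (gram xi i i)); last first.
    by apply: eq_bigr => i _; rewrite mxE vnorm_sq.
  under [RHS]eq_bigr => i _ do rewrite gE Re_sum.
  rewrite exchange_big; apply: eq_bigr => k _; rewrite cv_vnorm_sq; apply: eq_bigr => i _.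
  by rewrite mulrC mulC_conj.
have -> : \sum_k vnorm (mxact (b k) xi) ^+ 2 =
    complex.Re (\sum_k cvdot (M *m u k) (u k)).
  have -> : \sum_k cvdot (M *m u k) (u k) = \sum_i \sum_j M i j * gram xi i j.
    under [RHS]eq_bigr => i _ do (under eq_bigr => j _ do rewrite gE mulr_sumr).
    under [RHS]eq_bigr => i _ do rewrite exchange_big.
    rewrite [RHS]exchange_big; apply: eq_bigr => k _; rewrite /cvdot; apply: eq_bigr => i _.
    rewrite mxE mulr_suml; apply: eq_bigr => j _.
    by rewrite -mulrA [u k j 0 * _]mulrC.
  have -> : \sum_i \sum_j M i j * gram xi i j =
      \sum_k pip (mxact (b k) xi) (mxact (b k) xi).
    under eq_bigr => i _ do under eq_bigr => j _ do rewrite summxE mulr_suml.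
    under eq_bigr => i _ do rewrite exchange_big.
    rewrite exchange_big; apply: eq_bigr => k _ /=.
    under [RHS]eq_bigr => q _ do rewrite pip_sumr.
    rewrite [RHS]exchange_big; apply: eq_bigr => i _ /=.
    under [RHS]eq_bigr => q _ do rewrite pip_suml.
    rewrite [RHS]exchange_big; apply: eq_bigr => j _ /=.
    rewrite mxE mulr_suml; apply: eq_bigr => q _.
    by rewrite !mxE pipZl pipZr mulrA [b k q j * _]mulrC.
  by rewrite Re_sum; apply: eq_bigr => k _; rewrite vnorm_sq.
apply: le_trans (Re_le_cabs _) _; apply: le_trans (cabs_sum _ _ _) _.
rewrite -uxi mulr_sumr; apply: ler_sum => k _; rewrite [in leRHS]expr2.
exact: cmxnorm_bound.
Qed.
End ScalarAction.

Lemma sum_CauchySchwarz (R : realType) r (a b : 'I_r -> R) :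
  \sum_k a k * b k <= Num.sqrt (\sum_k a k ^+ 2) * Num.sqrt (\sum_k b k ^+ 2).
Proof.
pose u (f : 'I_r -> R) : cvPH R r := \col_k (f k)%:C.
have nu f : vnorm (u f) = Num.sqrt (\sum_k f k ^+ 2).
  rewrite -[LHS]ger0_norm ?vnorm_ge0 // -sqrtr_sqr cv_vnorm_sq; congr Num.sqrt.
  by apply: eq_bigr => k _; rewrite mxE cabsR real_normK ?num_real.
rewrite -!nu; apply: le_trans (CauchySchwarz _ _); apply: le_trans (Re_le_cabs _).
rewrite le_eqVlt; apply/orP; left; apply/eqP; rewrite /= /cvdot Re_sum.
by apply: eq_bigr => k _; rewrite !mxE conjR -rmorphM.
Qed.

(** * Spaces normed by families of forms *)

Record op_rep (R : realType) (X : smosData R) (I : Type) (V : I -> preHilbert R)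
    (B : forall i, X -> V i -> V i) : Prop := OpRep {
  op_linx : forall i a x y v, B i (a *: x + y) v = a *: B i x v + B i y v;
  op_linv : forall i x, linear (B i x) }.
Arguments op_linx {R X I V B} _ i a x y v.
Arguments op_linv {R X I V B} _ i x a u v : rename.

(** The matrix norm is the supremum over a family of actions on pre-Hilbert spaces. For L(H) the
    family has one member; for a dual it is indexed by the contractions of all sizes, and for a
    dualization by the maps that define mu. *)
Record normed_by (R : realType) (X : smosData R) (I : Type) (V : I -> preHilbert R)
    (B : forall i, X -> V i -> V i) : Prop := NormedBy {
  nb_rep : op_rep B;
  nb_ge0 : forall n (x : 'M[X]_n), 0 <= mnorm x;
  nb_le : forall n (x : 'M[X]_n) (K : R), 0 <= K ->
    (mnorm x <= K <-> forall i xi eta,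
       cabs (mform (fun a b => B i (x a b)) xi eta) <= K * (vnorm xi * vnorm eta));
  nb_sep : forall x, (forall i v w, pip (B i x v) w = 0) -> x = 0 }.

Section OpRep.
Variables (R : realType) (X : smosData R) (I : Type) (V : I -> preHilbert R).
Variable (B : forall i, X -> V i -> V i).
Arguments B : clear implicits.
Hypothesis rp : op_rep B.
Local Notation C := R[i].

Definition nform i n (x : 'M[X]_n) := mform (fun a b => B i (x a b)).
Arguments nform : clear implicits.
Arguments nform i {n} x xi eta.

Lemma op_0 i v : B i 0 v = 0.
Proof. by have := op_linx rp i (-1) 0 0 v; rewrite scaler0 addr0 scaleN1r addNr => <-. Qed.
Lemma op_D i x y v : B i (x + y) v = B i x v + B i y v.
Proof. by rewrite -[x]scale1r (op_linx rp) !scale1r. Qed.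
Lemma op_Z i a x v : B i (a *: x) v = a *: B i x v.
Proof. by rewrite -[a *: x]addr0 (op_linx rp) op_0 addr0. Qed.
Lemma op_sum i (J : Type) (r : seq J) (P : pred J) (F : J -> X) v :
  B i (\sum_(j <- r | P j) F j) v = \sum_(j <- r | P j) B i (F j) v.
Proof. by apply: (big_morph (fun x => B i x v)) => [x y|]; rewrite ?op_D ?op_0. Qed.
Lemma op_v0 i x : B i x 0 = 0.
Proof. by have := op_linv rp i x (-1) 0 0; rewrite scaler0 addr0 scaleN1r addNr. Qed.
Lemma op_vD i x v w : B i x (v + w) = B i x v + B i x w.
Proof. by rewrite -[v]scale1r (op_linv rp i x) !scale1r. Qed.
Lemma op_vZ i x a v : B i x (a *: v) = a *: B i x v.
Proof. by rewrite -[a *: v]addr0 (op_linv rp i x) op_v0 addr0. Qed.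
Lemma op_vsum i x (J : Type) (r : seq J) (P : pred J) (F : J -> V i) :
  B i x (\sum_(j <- r | P j) F j) = \sum_(j <- r | P j) B i x (F j).
Proof. by apply: (big_morph (B i x)) => [v w|]; rewrite ?op_vD ?op_v0. Qed.

Lemma nformD i n (x y : 'M[X]_n) xi eta :
  nform i (x + y) xi eta = nform i x xi eta + nform i y xi eta.
Proof.
rewrite /nform !mformE -big_split; apply: eq_bigr => p _.
by rewrite -big_split; apply: eq_bigr => q _; rewrite mxE op_D pipDl.
Qed.
Lemma nformZ i n a (x : 'M[X]_n) xi eta :
  nform i (map_mx (fun v => a *: v) x) xi eta = a * nform i x xi eta.
Proof.
rewrite /nform !mformE mulr_sumr; apply: eq_bigr => p _.
by rewrite mulr_sumr; apply: eq_bigr => q _; rewrite mxE op_Z pipZl.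
Qed.
Lemma nform0 i n xi eta : nform i (0 : 'M[X]_n) xi eta = 0.
Proof. by rewrite /nform mformE big1 // => p _; rewrite big1 // => q _; rewrite mxE op_0 pip0l. Qed.
Lemma nform_sum i n (J : Type) (r : seq J) (P : pred J) (F : J -> 'M[X]_n) xi eta :
  nform i (\sum_(j <- r | P j) F j) xi eta = \sum_(j <- r | P j) nform i (F j) xi eta.
Proof. by apply: (big_morph (fun x => nform i x xi eta)) => [x y|]; rewrite ?nformD ?nform0. Qed.

Lemma nform_mxcompr i m n (a b : 'M[C]_(m, n)) (x : 'M[X]_m) xi eta :
  nform i (mxcompr a b x) xi eta = nform i x (mxact b xi) (mxact a eta).
Proof.
rewrite /nform !mformE.
transitivity (\sum_k \sum_l \sum_p \sum_q
   ((a p k)^*%C * b q l) * pip (B i (x p q) (xi l)) (eta k)).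
  apply: eq_bigr => k _; apply: eq_bigr => l _; rewrite mxE op_sum pip_suml.
  apply: eq_bigr => p _; rewrite op_sum pip_suml; apply: eq_bigr => q _.
  by rewrite op_Z pipZl.
transitivity (\sum_p \sum_q \sum_k \sum_l
   ((a p k)^*%C * b q l) * pip (B i (x p q) (xi l)) (eta k)); last first.
  apply: eq_bigr => p _; apply: eq_bigr => q _.
  rewrite pip_sumr; apply: eq_bigr => k _; rewrite op_vsum pip_suml; apply: eq_bigr => l _.
  by rewrite op_vZ pipZl pipZr mulrA [b q l * _]mulrC.
rewrite (eq_bigr _ (fun k _ => exchange_big _ _ _ _ _ _)) exchange_big /=.
apply: eq_bigr => p _.
rewrite (eq_bigr _ (fun k _ => eq_bigr _ (fun l _ => erefl _))).
rewrite [RHS]exchange_big; apply: eq_bigr => k _ /=.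
by rewrite exchange_big.
Qed.

End OpRep.
Arguments nform {R X I V} B i {n} x xi eta.

Section NormedBy.
Variables (R : realType) (X : smosData R) (I : Type) (V : I -> preHilbert R).
Variable (B : forall i, X -> V i -> V i).
Arguments B : clear implicits.
Hypothesis nb : normed_by B.
Local Notation C := R[i].
Local Notation nform := (nform B).

Lemma nform_le i n (x : 'M[X]_n) xi eta :
  cabs (nform i x xi eta) <= mnorm x * (vnorm xi * vnorm eta).
Proof. by apply: (nb_le nb x (nb_ge0 nb x)).1. Qed.

Lemma mnorm_le n (x : 'M[X]_n) (K : R) : 0 <= K ->
  (forall i xi eta, cabs (nform i x xi eta) <= K * (vnorm xi * vnorm eta)) ->
  mnorm x <= K.
Proof. by move=> K0 /(nb_le nb x K0). Qed.

(** In the last axiom, the k-th summand is at most max ||x_k|| times |b_k xi| |a_k eta|.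
    Cauchy-Schwarz for the sum over k separates the two factors, and [mxact_bound] estimates each of
    them. *)
Lemma normed_by_os : is_operator_space X.
Proof.
have hle := nform_le.
split=> [n x x0|n c x|n x y|m n r a b x].
- apply/matrixP => p q; rewrite mxE; apply: (nb_sep nb) => i v w.
  apply: cabs_eq0; apply/eqP; rewrite eq_le cabs_ge0 andbT.
  have := hle i n x (delta_vec q v) (delta_vec p w); rewrite x0 mul0r.
  rewrite /nform mformE (bigD1 p) //= [X in X + _](bigD1 q) //= big1 => [|k kq]; last first.
    by rewrite /delta_vec (negbTE kq) (op_v0 (nb_rep nb)) pip0l.
  rewrite big1 => [|k kp]; last by rewrite big1 // => l _; rewrite /delta_vec (negbTE kp) pip0r.
  by rewrite /delta_vec !eqxx !addr0.
- have le d (y : 'M[X]_n) : mnorm (map_mx (fun v => d *: v) y) <= cabs d * mnorm y.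
    apply: mnorm_le => [|i xi eta]; first by rewrite mulr_ge0 ?cabs_ge0 ?(nb_ge0 nb).
    by rewrite (nformZ (nb_rep nb)) cabsM -mulrA ler_wpM2l ?cabs_ge0.
  apply: le_anti; rewrite le /=; have [->|c0] := eqVneq c 0.
    by rewrite cabs0 mul0r (nb_ge0 nb).
  have cc : 0 < cabs c.
    by rewrite lt_def cabs_ge0 andbT; apply: contra_neq c0 => /cabs_eq0.
  rewrite -ler_pdivlMl //; apply: le_trans (_ : mnorm (map_mx (fun v => c^-1 *: v)
    (map_mx (fun v => c *: v) x)) <= _); last by rewrite -cabsV.
  have -> // : map_mx (fun v => c^-1 *: v) (map_mx (fun v => c *: v) x) = x.
  by apply/matrixP => p q; rewrite !mxE scalerA mulVf // scale1r.
- apply: mnorm_le => [|i xi eta]; first by rewrite addr_ge0 ?(nb_ge0 nb).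
  rewrite (nformD (nb_rep nb)) mulrDl; apply: le_trans (cabsD _ _) _; exact: lerD.
set mx := \big[Num.max/0]_k _.
have mx0 : 0 <= mx.
  by rewrite /mx; elim/big_ind : _ => // [u v u0 v0|k _]; rewrite ?le_max ?u0 // (nb_ge0 nb).
apply: mnorm_le => [|i xi eta]; first by rewrite !mulr_ge0 ?sqrtr_ge0.
rewrite (nform_sum (nb_rep nb)); apply: le_trans (cabs_sum _ _ _) _.
apply: (@le_trans _ _ (\sum_k mx * (vnorm (mxact (b k) xi) * vnorm (mxact (a k) eta)))).
  apply: ler_sum => k _; rewrite (nform_mxcompr (nb_rep nb)); apply: le_trans (hle _ _ _ _ _) _.
  by rewrite ler_wpM2r ?mulr_ge0 ?vnorm_ge0 // /mx (bigD1 k) //= le_max lexx.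
have E (p q t u v : R) : p * q * t * (u * v) = t * ((q * u) * (p * v)) by ring.
rewrite -mulr_sumr E ler_wpM2l //; apply: le_trans (sum_CauchySchwarz _ _) _.
have sq (U : preHilbert R) (c : R) (v : U) : 0 <= c ->
    Num.sqrt c * vnorm v = Num.sqrt (c * vnorm v ^+ 2).
  by move=> c0; rewrite sqrtrM // sqrtr_sqr ger0_norm // vnorm_ge0.
apply: ler_pM; [exact: sqrtr_ge0|exact: sqrtr_ge0| |].
  by rewrite (sq _ _ _ (cmxnorm_ge0 _)); apply: ler_wsqrtr; exact: mxact_bound.
by rewrite (sq _ _ _ (cmxnorm_ge0 _)); apply: ler_wsqrtr; exact: mxact_bound.
Qed.
End NormedBy.

(** * Matrix norms and duals *)

Section OperatorSpace.
Variables (R : realType) (X : smosData R).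
Hypothesis hX : is_operator_space X.
Local Notation C := R[i].

Lemma mnormZ n (c : C) (x : 'M[X]_n) :
  mnorm (map_mx (fun v => c *: v) x) = cabs c * mnorm x.
Proof. by case: hX. Qed.
Lemma mnormD n (x y : 'M[X]_n) : mnorm (x + y) <= mnorm x + mnorm y.
Proof. by case: hX. Qed.
Lemma mnorm_eq0 n (x : 'M[X]_n) : mnorm x = 0 -> x = 0.
Proof. by case: hX => h _ _ _; exact: h. Qed.
Lemma mnorm0 n : mnorm (0 : 'M[X]_n) = 0.
Proof.
rewrite -[RHS](mul0r (mnorm (0 : 'M[X]_n))) -(cabs0 R) -mnormZ; congr mnorm.
by apply/matrixP => i j; rewrite !mxE scaler0.
Qed.
Lemma mnormN n (x : 'M[X]_n) : mnorm (- x) = mnorm x.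
Proof.
rewrite -[RHS]mul1r -(cabs1 R) -cabsN -mnormZ; congr mnorm.
by apply/matrixP => i j; rewrite !mxE scaleN1r.
Qed.
Lemma mnorm_ge0 n (x : 'M[X]_n) : 0 <= mnorm x.
Proof. by have := mnormD x (- x); rewrite subrr mnorm0 mnormN; lra. Qed.
Lemma mnormB n (x y : 'M[X]_n) : mnorm (x - y) <= mnorm x + mnorm y.
Proof. by rewrite -(mnormN y) mnormD. Qed.

Lemma nrm_ge0 (x : X) : 0 <= nrm x. Proof. exact: mnorm_ge0. Qed.
Lemma nrm0 : nrm (0 : X) = 0.
Proof. by rewrite -[RHS](mnorm0 1); congr mnorm; apply/matrixP => i j; rewrite !mxE. Qed.
Lemma nrm_eq0 (x : X) : nrm x = 0 -> x = 0.
Proof. by move/mnorm_eq0/matrixP/(_ 0 0); rewrite !mxE. Qed.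
Lemma nrmZ c (x : X) : nrm (c *: x) = cabs c * nrm x.
Proof. by rewrite /nrm -mnormZ; congr mnorm; apply/matrixP => i j; rewrite !mxE. Qed.
Lemma nrmD (x y : X) : nrm (x + y) <= nrm x + nrm y.
Proof.
by rewrite /nrm; apply: le_trans (mnormD _ _); rewrite le_eqVlt; apply/orP; left;
  apply/eqP; congr mnorm; apply/matrixP => i j; rewrite !mxE.
Qed.
Lemma nrmN (x : X) : nrm (- x) = nrm x.
Proof. by rewrite -scaleN1r nrmZ cabsN cabs1 mul1r. Qed.
Lemma nrmB (x y : X) : nrm (x - y) <= nrm x + nrm y.
Proof. by rewrite -(nrmN y) nrmD. Qed.
Lemma nrmBC (x y : X) : nrm (x - y) = nrm (y - x).
Proof. by rewrite -nrmN opprB. Qed.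

Lemma cmxnorm11 (a : 'M[C]_1) : cmxnorm a <= cabs (a 0 0).
Proof.
apply: (@opnorm_le R (cvPH R 1) 1) => [|xi eta]; first exact: cabs_ge0.
have vE (w : powPH (cvPH R 1) 1) : vnorm w = cabs (w 0 0 0).
  apply/eqP; rewrite -(@eqrXn2 _ 2) ?vnorm_ge0 ?cabs_ge0 //.
  by rewrite pow_vnorm_sq big_ord1 cv_vnorm_sq big_ord1.
rewrite !vE mformE !big_ord1 /= /cvdot big_ord1 mxE big_ord1 !cabsM cabs_conj.
by rewrite mulrA.
Qed.

(** This is eta^* x xi, an element of X itself: forms of [f_ij(x)] become values of the entries of f
    at such elements. *)
Definition bicomb n (x : 'M[X]_n) (xi eta : 'cV[C]_n) : X :=
  \sum_i \sum_j ((eta i 0)^*%C * xi j 0) *: x i j.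

Lemma nrm_bicomb n (x : 'M[X]_n) (xi eta : cvPH R n) :
  nrm (bicomb x xi eta) <= mnorm x * (vnorm xi * vnorm eta).
Proof.
have [_ _ _ /(_ n 1 1 (fun=> eta) (fun=> xi) (fun=> x))] := hX.
rewrite !big_ord1.
have cE (u : cvPH R n) : Num.sqrt (cmxnorm (u^t* *m u)) <= vnorm u.
  rewrite -[leRHS]ger0_norm ?vnorm_ge0 // -sqrtr_sqr ler_wsqrtr //.
  apply: le_trans (cmxnorm11 _) _; rewrite cv_vnorm_sq mxE.
  apply: le_trans (cabs_sum _ _ _) _; apply: ler_sum => i _.
  by rewrite !mxE cabsM [cabs (_^*)]cabs_conj.
have -> : mxcompr eta xi x = const_mx (bicomb x xi eta).
  by apply/matrixP => i j; rewrite !mxE !ord1.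
rewrite -/(nrm _) => h; apply: le_trans h _.
rewrite big_ord_recl big_ord0 (max_idPl (mnorm_ge0 x)) mulrC ler_wpM2l ?mnorm_ge0 // mulrC.
by apply: ler_pM; rewrite ?sqrtr_ge0 // cE.
Qed.

Lemma nrm_entry n (x : 'M[X]_n) i j : nrm (x i j) <= mnorm x.
Proof.
have dn (k : 'I_n) : vnorm (delta_mx k 0 : cvPH R n) = 1.
  apply/eqP; rewrite -(@eqrXn2 _ 2) ?vnorm_ge0 // cv_vnorm_sq (bigD1 k) //= big1.
    by rewrite mxE !eqxx cabs1 expr1n addr0.
  by move=> l lk; rewrite mxE (negbTE lk) cabs0 expr0n.
have := nrm_bicomb x (delta_mx j 0) (delta_mx i 0); rewrite !dn !mulr1.
rewrite /bicomb (bigD1 i) //= (bigD1 j) //= big1 => [|l lj]; last first.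
  by rewrite !mxE (negbTE lj) /= mulr0 scale0r.
rewrite big1 => [|k ki]; last first.
  by rewrite big1 // => l _; rewrite !mxE (negbTE ki) andFb mulr0n conjc_0 mul0r scale0r.
by rewrite !mxE !eqxx mulr1n conjc_1 mulr1 scale1r !addr0.
Qed.
End OperatorSpace.

Section Shuffle.
Variable R : realType.
Local Notation C := R[i].

(* M_m(M_n(C)) = M_n(M_m(C)) by exchanging the two pairs of indices. *)
Definition shuffle m n (y : 'M[matC R n]_m) : 'M[matC R m]_n :=
  \matrix_(i, j) \matrix_(a, b) (y a b) i j.

Lemma shuffleK m n : cancel (@shuffle m n) (@shuffle n m).
Proof.
move=> y; apply/matrixP => a b; rewrite mxE; apply/matrixP => i j.
by rewrite !mxE.
Qed.

Definition swapv m n (xi : powPH (cvPH R n) m) : powPH (cvPH R m) n :=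
  fun j => \col_b xi b j 0.

Lemma swapvK m n : cancel (@swapv m n) (@swapv n m).
Proof. by move=> xi; apply/funext => j; apply/matrixP => i k; rewrite !mxE ord1. Qed.

Lemma vnorm_swapv m n (xi : powPH (cvPH R n) m) : vnorm (swapv xi) = vnorm xi.
Proof.
apply/eqP; rewrite -(@eqrXn2 _ 2) ?vnorm_ge0 // !pow_vnorm_sq.
under eq_bigr => j _ do rewrite cv_vnorm_sq.
under [eqbRHS]eq_bigr => j _ do rewrite cv_vnorm_sq.
rewrite exchange_big; apply/eqP; apply: eq_bigr => b _; apply: eq_bigr => j _.
by rewrite mxE.
Qed.

Definition matform k n (x : 'M[matC R k]_n) := mform (V := cvPH R k) (fun i j => mulmx (x i j)).

Lemma matformE k n (x : 'M[matC R k]_n) xi eta : matform x xi eta =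
  \sum_i \sum_j \sum_p \sum_q (x i j) p q * xi j q 0 * (eta i p 0)^*%C.
Proof.
rewrite /matform mformE; apply: eq_bigr => i _; apply: eq_bigr => j _.
by apply: eq_bigr => p _; rewrite mxE mulr_suml.
Qed.

Lemma matform_shuffle m n (y : 'M[matC R n]_m) xi eta :
  matform (shuffle y) (swapv xi) (swapv eta) = matform y xi eta.
Proof.
rewrite !matformE pair_big /= [RHS]pair_big /=.
transitivity (\sum_(ij : 'I_n * 'I_n) \sum_(ab : 'I_m * 'I_m)
  y ab.1 ab.2 ij.1 ij.2 * xi ab.2 ij.2 0 * (eta ab.1 ij.1 0)^*%C).
  apply: eq_bigr => ij _; rewrite pair_big /=; apply: eq_bigr => ab _.
  by rewrite !mxE.
rewrite exchange_big; apply: eq_bigr => ab _; rewrite pair_big /=.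
by apply: eq_bigr => ij _.
Qed.

Lemma matC_le k n (x : 'M[matC R k]_n) (K : R) : 0 <= K ->
  (mnorm x <= K <->
   forall xi eta, cabs (matform x xi eta) <= K * (vnorm xi * vnorm eta)).
Proof.
move=> K0; split=> [xK xi eta|h].
  have [_ h] := matC_norm x; apply: le_trans (h xi eta) _.
  by rewrite ler_wpM2r // mulr_ge0 ?vnorm_ge0.
exact: (@opnorm_le R (cvPH R k) n).
Qed.

Lemma mnorm_shuffle m n (y : 'M[matC R n]_m) : mnorm (shuffle y) = mnorm y.
Proof.
have le p q (z : 'M[matC R q]_p) : mnorm (shuffle z) <= mnorm z.
  have [z0 zb] := matC_norm z; apply/(matC_le _ z0) => xi eta.
  by have := zb (swapv xi) (swapv eta); rewrite !vnorm_swapv -/(matform z _ _) -matform_shuffle !swapvK.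
by apply: le_anti; rewrite le /= -{1}[y](@shuffleK m n) le.
Qed.

Lemma mpos_shuffle m n (y : 'M[matC R n]_m) : mpos (shuffle y) <-> mpos y.
Proof.
have le p q (z : 'M[matC R q]_p) : mpos z -> mpos (shuffle z).
  move=> zp xi; have := zp (swapv xi).
  by rewrite -[X in 0 <= X]/(matform z _ _) -matform_shuffle swapvK.
by split=> [/le|/le//]; rewrite shuffleK.
Qed.
End Shuffle.

(** * The dual operator space *)

Section DualSpace.
Variables (R : realType) (X : smosData R).
Hypothesis hX : is_operator_space X.
Local Notation C := R[i].
Local Notation D := (dual X).

Lemma dual_linear (f : D) : linear (val f).
Proof. by have /asboolP[] := valP f. Qed.
Lemma dualf0 (f : D) : val f 0 = 0.
Proof. by have := dual_linear f (-1) 0 0; rewrite scaler0 addr0 scaleN1r addNr. Qed.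
Lemma dualfD (f : D) x y : val f (x + y) = val f x + val f y.
Proof. by have := dual_linear f 1 x y; rewrite !scale1r. Qed.
Lemma dualfZ (f : D) a x : val f (a *: x) = a * val f x.
Proof. by have := dual_linear f a x 0; rewrite !addr0 dualf0 addr0. Qed.
Lemma dualf_sum (f : D) (J : Type) (r : seq J) (P : pred J) (F : J -> X) :
  val f (\sum_(j <- r | P j) F j) = \sum_(j <- r | P j) val f (F j).
Proof. by apply: (big_morph (val f)) => [x y|]; rewrite ?dualfD ?dualf0. Qed.
Lemma dualD (f g : D) x : val (f + g) x = val f x + val g x. Proof. by []. Qed.
Lemma dualZ a (f : D) x : val (a *: f) x = a * val f x.
Proof. by rewrite linearZ. Qed.
Lemma dual_bounded (f : D) : exists2 K : R, 0 <= K & forall x, cabs (val f x) <= K * nrm x.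
Proof.
have /asboolP[_ [K hK]] := valP f; exists (Num.max 0 K); first by rewrite le_max lexx.
move=> x; apply: le_trans (hK x) _; rewrite ler_wpM2r ?nrm_ge0 //.
by rewrite le_max lexx orbT.
Qed.
Lemma dual_ext (f g : D) : (forall x, val f x = val g x) -> f = g.
Proof. by move=> h; apply/val_inj/funext. Qed.

(** The roles of [theta] are exchanged: x is fixed and f varies, so that the dual norm is a supremum
    over maps on the dual, as [normed_by] requires. The two matrices differ by [shuffle], which
    preserves norms and positivity. *)
Definition evmx m (x : 'M[X]_m) (f : D) : matC R m := \matrix_(a, b) val f (x a b).

Lemma evmx_shuffle m n (x : 'M[X]_m) (f : 'M[D]_n) :
  map_mx (evmx x) f = shuffle (map_mx (theta f) x).
Proof. by apply/matrixP => i j; apply/matrixP => a b; rewrite !mxE. Qed.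

Lemma matform_evmx m n (x : 'M[X]_m) (f : 'M[D]_n) xi eta :
  matform (map_mx (evmx x) f) xi eta =
  \sum_i \sum_j val (f i j) (bicomb x (xi j) (eta i)).
Proof.
rewrite matformE; apply: eq_bigr => i _; apply: eq_bigr => j _.
rewrite dualf_sum; apply: eq_bigr => p _; rewrite dualf_sum; apply: eq_bigr => q _.
by rewrite !mxE dualfZ -mulrA mulrC [xi j q 0 * _]mulrC.
Qed.

Lemma dual_ge_ev n (f : 'M[D]_n) m (x : 'M[X]_m) :
  mnorm x <= 1 -> mnorm (map_mx (evmx x) f) <= mnorm f.
Proof.
move=> x1; rewrite evmx_shuffle mnorm_shuffle; apply: ub_le_sup; last by exists m, x.
(* The entries of f are bounded functionals; the sum of their bounds shows that the set whose [sup]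
   is the dual norm is bounded above. *)
have /choice[b hb] : forall ij : 'I_n * 'I_n, exists c : R,
    0 <= c /\ forall y, cabs (val (f ij.1 ij.2) y) <= c * nrm y.
  by move=> ij; have [c c0 cb] := dual_bounded (f ij.1 ij.2); exists c.
exists (\sum_i \sum_j b (i, j)) => _ [p [y [y1 ->]]].
have b0 i j : 0 <= b (i, j) by case: (hb (i, j)).
rewrite -mnorm_shuffle -evmx_shuffle; apply/matC_le.
  by apply: sumr_ge0 => i _; apply: sumr_ge0.
move=> xi eta; rewrite matform_evmx mulr_suml; apply: le_trans (cabs_sum _ _ _) _.
apply: ler_sum => i _; rewrite mulr_suml; apply: le_trans (cabs_sum _ _ _) _.
apply: ler_sum => j _; apply: le_trans ((hb (i, j)).2 _) _; rewrite ler_wpM2l //.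
apply: le_trans (nrm_bicomb hX _ _ _) _.
apply: le_trans (ler_wpM2r _ y1) _; first by rewrite mulr_ge0 ?vnorm_ge0.
by rewrite mul1r; apply: ler_pM; rewrite ?vnorm_ge0 // comp_vnorm.
Qed.

Lemma dual_mnorm_ge0 n (f : 'M[D]_n) : 0 <= mnorm f.
Proof.
have [h _] := matC_norm (map_mx (evmx (0 : 'M[X]_0)) f).
by apply: le_trans h (dual_ge_ev _ _); rewrite (mnorm0 hX) ler01.
Qed.

Lemma dual_sup n (f : 'M[D]_n) (K : R) : 0 <= K ->
  (mnorm f <= K <-> forall m (x : 'M[X]_m), mnorm x <= 1 -> mnorm (map_mx (evmx x) f) <= K).
Proof.
move=> K0; split=> [fK m x x1|h]; first exact: le_trans (dual_ge_ev f x1) fK.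
apply: ge_sup.
  exists (mnorm (map_mx (theta f) (0 : 'M[X]_0))), 0%N, 0; split=> //.
  by rewrite (mnorm0 hX) ler01.
by move=> _ [m [x [x1 ->]]]; rewrite -mnorm_shuffle -evmx_shuffle h.
Qed.

Definition dual_index := {m : nat & {x : 'M[X]_m | mnorm x <= 1}}.
Definition dual_mkindex m (x : 'M[X]_m) (x1 : mnorm x <= 1) : dual_index :=
  existT _ m (exist (fun y : 'M[X]_m => is_true (mnorm y <= 1)) x x1).
Definition dual_op (i : dual_index) (f : D) (v : cvPH R (projT1 i)) : cvPH R (projT1 i) :=
  evmx (sval (projT2 i)) f *m v.

Lemma evmxP m (x : 'M[X]_m) a (f g : D) : evmx x (a *: f + g) = a *: evmx x f + evmx x g.
Proof. by apply/matrixP => p q; rewrite !mxE dualD dualZ. Qed.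

Lemma dual_op_rep : op_rep dual_op.
Proof.
split=> [i a f g v|i f a u v]; first by rewrite /dual_op evmxP mulmxDl scalemxAl.
by rewrite /dual_op mulmxDr scalemxAr.
Qed.

Lemma dual_normed : normed_by dual_op.
Proof.
split=> [|n f|n f K K0|f h].
- exact: dual_op_rep.
- exact: dual_mnorm_ge0.
- split=> [/(dual_sup f K0) h [m [x x1]]|h]; last apply/dual_sup => // m x x1.
    have /= := (matC_le (map_mx (evmx x) f) K0).1 (h m x x1).
    move=> H xi eta; have := H xi eta; rewrite /matform.
    congr (cabs (mform _ _ _) <= _).
    by apply/funext => i; apply/funext => j; rewrite mxE.
  apply/matC_le => // xi eta; have := h (dual_mkindex x1) xi eta.
  rewrite /matform; congr (cabs (mform _ _ _) <= _).
  by apply/funext => i; apply/funext => j; rewrite mxE.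
- apply: dual_ext => x; have [K K0 fK] := dual_bounded f.
  (* Scaling by 1 / (||x|| + 1) turns x into a contraction without a separate case x = 0. *)
  pose t : R := (nrm x + 1)^-1.
  have t0 : 0 < nrm x + 1 by rewrite ltr_wpDl ?nrm_ge0.
  have y1 : mnorm (const_mx (t%:C *: x) : 'M[X]_1) <= 1.
    rewrite -/(nrm _) nrmZ // cabsR ger0_norm ?invr_ge0 ?(ltW t0) //.
    by rewrite mulrC ler_pdivrMr // mul1r lerDl.
  have := h (dual_mkindex y1) (const_mx 1) (const_mx 1).
  rewrite /= /cvdot /dual_op /= big_ord1 !mxE big_ord1 !mxE dualfZ conjc_1 !mulr1.
  move=> /eqP; rewrite mulf_eq0 => /orP[/eqP/complexI/eqP|/eqP//].
  by rewrite invr_eq0 gt_eqF.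
Qed.

Lemma dual_os : is_operator_space D. Proof. exact: normed_by_os dual_normed. Qed.

Lemma evmx_le m n (x : 'M[X]_m) (f : 'M[D]_n) :
  mnorm (map_mx (evmx x) f) <= mnorm f * mnorm x.
Proof.
have [f0 x0] : 0 <= mnorm f /\ 0 <= mnorm x by split; [exact: mnorm_ge0 dual_os _ _|exact: mnorm_ge0].
apply: le_cabs_approx => e e0.
pose d := e / (mnorm f + 1); have f1 : 0 < mnorm f + 1 by rewrite ltr_wpDl.
have d0 : 0 < d by rewrite divr_gt0.
have xd : 0 < mnorm x + d by rewrite ltr_wpDl.
pose t := (mnorm x + d)^-1; have t0 : 0 < t by rewrite invr_gt0.
have := (dual_sup f f0).1 (lexx _) m (map_mx (fun v => t%:C *: v) x).
rewrite (mnormZ hX) cabsR gtr0_norm // mulrC ler_pdivrMr // mul1r lerDl (ltW d0) => /(_ isT).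
set y := map_mx _ f; have -> : y = map_mx (fun v : matC R m => t%:C *: v) (map_mx (evmx x) f).
  by apply/matrixP => i j; apply/matrixP => p q; rewrite !mxE dualfZ.
have /matC_le matle : 0 <= mnorm f by [].
move=> /matle h; have K0 : 0 <= mnorm f * (mnorm x + d) by rewrite mulr_ge0 // ltW.
apply: le_trans (_ : mnorm f * (mnorm x + d) <= _); last first.
  rewrite mulrDr lerD2l /d mulrA ler_pdivrMr // mulrC ler_wpM2l ?(ltW e0) //.
  by rewrite lerDl ler01.
apply/(matC_le _ K0) => xi eta; have := h xi eta.
have -> : matform (map_mx (fun v : matC R m => t%:C *: v) (map_mx (evmx x) f)) xi eta =
    t%:C * matform (map_mx (evmx x) f) xi eta.
  rewrite !matformE mulr_sumr; apply: eq_bigr => i _; rewrite mulr_sumr.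
  apply: eq_bigr => j _; rewrite mulr_sumr; apply: eq_bigr => p _; rewrite mulr_sumr.
  by apply: eq_bigr => q _; rewrite !mxE !mulrA.
by rewrite cabsM cabsR gtr0_norm // ler_pdivrMl // mulrCA mulrA.
Qed.

Lemma dual_nrm_le (f : D) x : cabs (val f x) <= nrm f * nrm x.
Proof.
have := evmx_le (const_mx x : 'M[X]_1) (const_mx f : 'M[D]_1).
apply: le_trans; have [_ h] := matC_norm (map_mx (evmx (const_mx x : 'M[X]_1)) (const_mx f : 'M[D]_1)).
have := h (fun=> const_mx 1) (fun=> const_mx 1).
have -> : vnorm ((fun=> const_mx 1) : powPH (cvPH R 1) 1) = 1.
  apply/eqP; rewrite -(@eqrXn2 _ 2) ?vnorm_ge0 // pow_vnorm_sq big_ord1 cv_vnorm_sq big_ord1.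
  by rewrite mxE cabs1.
rewrite !mulr1; apply: le_trans; rewrite -/(matform _ _ _) matformE !big_ord1 !mxE.
by rewrite conjc_1 !mulr1.
Qed.

Lemma dual_nrm_ub (f : D) (K : R) : 0 <= K -> (forall x, cabs (val f x) <= K * nrm x) ->
  nrm f <= K.
Proof.
move=> K0 h; apply/dual_sup => // m x x1; apply/matC_le => // xi eta.
rewrite matform_evmx !big_ord1 mxE; apply: le_trans (h _) _; rewrite ler_wpM2l //.
apply: le_trans (nrm_bicomb hX _ _ _) _.
apply: le_trans (ler_wpM2r _ x1) _; first by rewrite mulr_ge0 ?vnorm_ge0.
by rewrite mul1r; apply: ler_pM; rewrite ?vnorm_ge0 // comp_vnorm.
Qed.
End DualSpace.

Section RepSmos.
Variables (R : realType) (X : smosData R).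
Local Notation C := R[i].

Definition star_axioms : Prop :=
  involutive (@mstar R X) /\
  (forall (c : C) (x y : X), mstar (c *: x + y) = c^*%C *: mstar x + mstar y).

Section StarTheory.
Hypothesis st : star_axioms.

Lemma mstarK : involutive (@mstar R X). Proof. by case: st. Qed.
Lemma mstarP (c : C) (x y : X) : mstar (c *: x + y) = c^*%C *: mstar x + mstar y.
Proof. by case: st. Qed.
Lemma mstar0 : mstar (0 : X) = 0.
Proof.
by have := mstarP (-1) 0 0; rewrite scaler0 addr0 conjcN conjc_1 scaleN1r addNr.
Qed.
Lemma mstarD (x y : X) : mstar (x + y) = mstar x + mstar y.
Proof. by have := mstarP 1 x y; rewrite conjc_1 !scale1r. Qed.
Lemma mstarZ c (x : X) : mstar (c *: x) = c^*%C *: mstar x.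
Proof. by have := mstarP c x 0; rewrite !addr0 mstar0 addr0. Qed.
Lemma mstarN (x : X) : mstar (- x) = - mstar x.
Proof. by rewrite -scaleN1r mstarZ conjcN conjc_1 scaleN1r. Qed.
Lemma mstar_sum (J : Type) (r : seq J) (P : pred J) (F : J -> X) :
  mstar (\sum_(j <- r | P j) F j) = \sum_(j <- r | P j) mstar (F j).
Proof. by apply: (big_morph mstar) => [x y|]; rewrite ?mstarD ?mstar0. Qed.

Lemma mxstarE n (x : 'M[X]_n) i j : mxstar x i j = mstar (x j i).
Proof. by rewrite !mxE. Qed.
Lemma mxstarK n (x : 'M[X]_n) : mxstar (mxstar x) = x.
Proof. by apply/matrixP => i j; rewrite !mxstarE mstarK. Qed.
Lemma mxstarD n (x y : 'M[X]_n) : mxstar (x + y) = mxstar x + mxstar y.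
Proof. by apply/matrixP => i j; rewrite mxstarE !mxE mstarD. Qed.
Lemma mxstarN n (x : 'M[X]_n) : mxstar (- x) = - mxstar x.
Proof. by apply/matrixP => i j; rewrite mxstarE !mxE mstarN. Qed.
Lemma mxstarZ n c (x : 'M[X]_n) :
  mxstar (map_mx (fun v => c *: v) x) = map_mx (fun v => c^*%C *: v) (mxstar x).
Proof. by apply/matrixP => i j; rewrite mxstarE !mxE mstarZ. Qed.
Lemma mxstar_compr m n (a : 'M[C]_(m, n)) (x : 'M[X]_m) :
  mxstar (mxcompr a a x) = mxcompr a a (mxstar x).
Proof.
apply/matrixP => i j; rewrite mxstarE !mxE mstar_sum exchange_big /=.
apply: eq_bigr => p _; rewrite mstar_sum; apply: eq_bigr => q _.
by rewrite mstarZ conjcM conjcK mxstarE [_^*%C * _]mulrC.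
Qed.
End StarTheory.

(** The forms E that define the cone may differ from those that define the norm: in a dual, norms
    are tested on contractions and positivity on positive matrices. Closedness of the cone only uses
    that each single form is continuous, with a bound K that may depend on the vector. *)
Lemma rep_smos (J : Type) (W : J -> preHilbert R) (E : forall j, X -> W j -> W j) :
  is_operator_space X -> star_axioms ->
  (forall n (x : 'M[X]_n), mnorm (mxstar x) = mnorm x) ->
  op_rep E ->
  (forall n (x : 'M[X]_n),
     mpos x <-> mxstar x = x /\ forall j xi, 0 <= nform E j x xi xi) ->
  (forall j n (xi : powPH (W j) n), exists K : R, forall x : 'M[X]_n,
     cabs (nform E j x xi xi) <= K * mnorm x) ->
  is_smos X.
Proof.
move=> os st iso rp posP bd; split=> //; first by move=> n x /posP[].
split=> [n x h|m n r a x xp].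
  apply/posP; split=> [|j xi].
    apply/subr0_eq/(mnorm_eq0 os)/eqP; rewrite eq_le (mnorm_ge0 os) andbT.
    apply: le_cabs_approx => e e0; rewrite add0r.
    have e2 : 0 < e / 2 by rewrite divr_gt0.
    have [y /posP[ys _] xy] := h _ e2.
    have -> : mxstar x - x = mxstar (x - y) - (x - y).
      by rewrite mxstarD // mxstarN // ys opprD opprK addrACA addNr addr0.
    by apply: le_trans (mnormB os _ _) _; rewrite iso; lra.
  apply: cge0_approx => e e0; have [K hK] := bd j n xi.
  have K1 : 0 < Num.max 0 K + 1 by rewrite ltr_wpDl // le_max lexx.
  have [y /posP[_ yp] xy] := h (e / (Num.max 0 K + 1)) (divr_gt0 e0 K1).
  exists (nform E j y xi xi); first exact: yp.
  have -> : nform E j x xi xi - nform E j y xi xi = nform E j (x - y) xi xi.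
    by apply/(canLR (addrK _)); rewrite -(nformD rp) subrK.
  apply: le_trans (hK _) _; move/ltW: xy; rewrite ler_pdivlMr // => xy.
  apply: le_trans xy; rewrite mulrC ler_wpM2l ?(mnorm_ge0 os) //.
  by rewrite ler_wpDr // le_max lexx orbT.
apply/posP; split=> [|j xi].
  apply/matrixP => p q; rewrite mxstarE !summxE mstar_sum //; apply: eq_bigr => k _.
  by rewrite -mxstarE mxstar_compr //; have /posP[-> _] := xp k.
rewrite (nform_sum rp); apply: sumr_ge0 => k _; rewrite (nform_mxcompr rp).
by have /posP[_] := xp k; apply.
Qed.
End RepSmos.

Section MatCStar.
Variable R : realType.
Local Notation C := R[i].

Lemma matC_star k : star_axioms (matC R k).
Proof.
split=> [x|c x y]; first exact: trmxCK.
by apply/matrixP => i j; rewrite !mxE rmorphD rmorphM.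
Qed.

Lemma matform_star k n (x : 'M[matC R k]_n) xi eta :
  matform (mxstar x) xi eta = (matform x eta xi)^*%C.
Proof.
rewrite !matformE conjc_sum exchange_big; apply: eq_bigr => i _.
rewrite conjc_sum; apply: eq_bigr => j _; rewrite exchange_big conjc_sum.
apply: eq_bigr => p _; rewrite conjc_sum; apply: eq_bigr => q _.
by rewrite !mxE !conjcM conjcK -!mulrA; congr (_ * _); exact: mulrC.
Qed.

Lemma matC_mnorm_star k n (x : 'M[matC R k]_n) : mnorm (mxstar x) = mnorm x.
Proof.
have le (y : 'M[matC R k]_n) : mnorm (mxstar y) <= mnorm y.
  have [y0 yb] := matC_norm y; apply/(matC_le _ y0) => xi eta.
  by rewrite matform_star cabs_conj [X in _ * X]mulrC; exact: yb.
by apply: le_anti; rewrite le /= -{1}[x](mxstarK (@matC_star k)) le.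
Qed.

Lemma matformN k n (x : 'M[matC R k]_n) xi eta : matform (- x) xi eta = - matform x xi eta.
Proof.
rewrite !matformE -sumrN; apply: eq_bigr => i _; rewrite -sumrN; apply: eq_bigr => j _.
rewrite -sumrN; apply: eq_bigr => p _; rewrite -sumrN; apply: eq_bigr => q _.
by rewrite !mxE !mulNr.
Qed.

Definition cvdelta k (q : 'I_k) : cvPH R k := delta_mx q 0.

Lemma matform_delta k n (y : 'M[matC R k]_n) i j p q :
  matform y (delta_vec j (cvdelta q)) (delta_vec i (cvdelta p)) = (y i j) p q.
Proof.
rewrite matformE (bigD1 i) //= (bigD1 j) //= (bigD1 p) //= (bigD1 q) //=.
have ds (l : 'I_n) (v : cvPH R k) : delta_vec l v l = v by rewrite /delta_vec eqxx.
have d0 (l l' : 'I_n) (v : cvPH R k) : l' != l -> delta_vec l v l' = 0.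
  by rewrite /delta_vec => /negbTE ->.
rewrite big1 => [|q' qq']; last by rewrite !ds !mxE (negbTE qq') mulr0 mul0r.
rewrite addr0 big1 => [|p' pp']; last first.
  rewrite big1 // => q' _; rewrite !ds [cvdelta p _ _]mxE (negbTE pp').
  by rewrite andFb mulr0n conjc_0 mulr0.
rewrite addr0 big1 => [|j' jj']; last first.
  rewrite big1 // => p' _; rewrite big1 // => q' _.
  by rewrite (d0 _ _ _ jj') [(0 : cvPH R k) q' 0]mxE mulr0 mul0r.
rewrite addr0 big1 => [|i' ii']; last first.
  rewrite big1 // => j' _; rewrite big1 // => p' _; rewrite big1 // => q' _.
  by rewrite (d0 _ _ _ ii') [(0 : cvPH R k) p' 0]mxE conjc_0 mulr0.
by rewrite !ds !mxE !eqxx mulr1n conjc_1 !mulr1 addr0.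
Qed.

Lemma matform_vP k n (x : 'M[matC R k]_n) a xi zeta eta :
  matform x (a *: xi + zeta) eta = a * matform x xi eta + matform x zeta eta.
Proof.
rewrite !matformE mulr_sumr -big_split; apply: eq_bigr => i _.
rewrite mulr_sumr -big_split; apply: eq_bigr => j _.
rewrite mulr_sumr -big_split; apply: eq_bigr => p _.
rewrite mulr_sumr -big_split; apply: eq_bigr => q _ /=.
by rewrite !mxE mulrDr !mulrDl; congr (_ + _); rewrite !mulrA [a * _]mulrC.
Qed.
End MatCStar.

Lemma polarization0 (R : realType) (V : preHilbert R) (s : V -> V -> R[i]) :
  (forall a x y z, s (a *: x + y) z = a * s x z + s y z) ->
  (forall a x y z, s z (a *: x + y) = a^*%C * s z x + s z y) ->
  (forall x, s x x = 0) -> forall x y, s x y = 0.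
Proof.
move=> sl sr s0 x y.
have h1 : s x y + s y x = 0.
  have := s0 (1 *: x + y); rewrite sl !sr !s0 conjc_1 !mul1r addr0 add0r.
  by move=> <-.
have h2 : 'i%C * s x y - 'i%C * s y x = 0.
  have := s0 ('i%C *: x + y); rewrite sl !sr !s0 mulr0 addr0 add0r.
  have -> : ('i%C : R[i])^*%C = - 'i%C by apply/eqP; rewrite eq_complex /= oppr0 !eqxx.
  by rewrite mulNr => <-.
have : 'i%C * (s x y - s y x) = 0 by rewrite mulrBr.
move/eqP; rewrite mulf_eq0 => /orP[/eqP[]/eqP|/eqP/subr0_eq e].
  by rewrite oner_eq0.
move: h1; rewrite e -mulr2n -mulr_natl => /eqP; rewrite mulf_eq0 pnatr_eq0 /=.
by move/eqP.
Qed.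

Section DualSmos.
Variables (R : realType) (X : smosData R).
Hypothesis hS : is_smos X.
Local Notation C := R[i].
Local Notation D := (dual X).

Lemma smos_os : is_operator_space X. Proof. by case: hS. Qed.
Lemma smos_star : star_axioms X. Proof. by case: hS. Qed.
Lemma smos_iso n (x : 'M[X]_n) : mnorm (mxstar x) = mnorm x. Proof. by case: hS. Qed.
Lemma smos_pos_sa n (x : 'M[X]_n) : mpos x -> mxstar x = x.
Proof. by case: hS => _ _ _ h _; exact: h. Qed.
Lemma smos_closed n (x : 'M[X]_n) :
  (forall e : R, 0 < e -> exists2 y, mpos y & mnorm (x - y) < e) -> mpos x.
Proof. by case: hS => _ _ _ _ [h _]; exact: h. Qed.
Lemma smos_sum m n r (a : 'I_r -> 'M[C]_(m, n)) (x : 'I_r -> 'M[X]_m) :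
  (forall k, mpos (x k)) -> mpos (\sum_k mxcompr (a k) (a k) (x k)).
Proof. by case: hS => _ _ _ _ [_ h]; exact: h. Qed.

Let os := smos_os.
Let st := smos_star.

Lemma nrm_star (x : X) : nrm (mstar x) = nrm x.
Proof.
rewrite /nrm -smos_iso; congr mnorm; apply/matrixP => i j.
by rewrite mxstarE !mxE mstarK.
Qed.

Lemma mxcompr1 n (x : 'M[X]_n) : mxcompr 1%:M 1%:M x = x.
Proof.
apply/matrixP => i j; rewrite mxE (bigD1 i) //= (bigD1 j) //= big1 => [|q qj]; last first.
  by rewrite !mxE (negbTE qj) mulr0n mulr0 scale0r.
rewrite big1 => [|p pi]; last first.
  by rewrite big1 // => q _; rewrite !mxE (negbTE pi) mulr0n conjc_0 mul0r scale0r.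
by rewrite !mxE !eqxx !mulr1n conjc_1 mulr1 scale1r !addr0.
Qed.

Lemma mposD n (x y : 'M[X]_n) : mpos x -> mpos y -> mpos (x + y).
Proof.
move=> xp yp.
have := @smos_sum n n 2 (fun=> 1%:M) (fun k => if k == 0 then x else y).
by rewrite big_ord_recl big_ord1 /= !mxcompr1; apply => k; case: ifP.
Qed.

Lemma mpos0 n : mpos (0 : 'M[X]_n).
Proof. by have := @smos_sum 0 n 0 (fun=> 0) (fun=> 0); rewrite big_ord0; apply=> -[]. Qed.

Lemma mposZ n (t : R) (x : 'M[X]_n) : 0 <= t -> mpos x -> mpos (map_mx (fun v => t%:C *: v) x).
Proof.
move=> t0 xp; have := @smos_sum n n 1 (fun=> (Num.sqrt t)%:C%:M) (fun=> x) (fun=> xp).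
rewrite big_ord1; congr mpos; apply/matrixP => i j.
have e (p q : 'I_n) : (((Num.sqrt t)%:C%:M p i)^*%C * (Num.sqrt t)%:C%:M q j : C) =
    t%:C * (((1%:M : 'M[C]_n) p i)^*%C * (1%:M : 'M[C]_n) q j).
  rewrite !mxE; case: (p == i); case: (q == j); rewrite ?mulr0n ?mulr1n ?conjc_0 ?conjc_1 ?mul0r ?mulr0 //.
  by rewrite conjR -rmorphM -expr2 sqr_sqrtr // !mulr1.
rewrite mxE [RHS]mxE -[in RHS](mxcompr1 x) mxE scaler_sumr; apply: eq_bigr => p _.
by rewrite scaler_sumr; apply: eq_bigr => q _; rewrite scalerA e.
Qed.

Lemma dual_starE (f : D) x : val (dual_star f) x = (val f (mstar x))^*%C.
Proof.
rewrite /dual_star /tosub val_insubd; case: ifP => // /negP[].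
have [K K0 hK] := dual_bounded os f.
apply/asboolP; split=> [a u v|]; first by rewrite mstarP // dualfD dualfZ conjcD conjcM conjcK.
by exists K => u; rewrite cabs_conj -(nrm_star u).
Qed.

Lemma dual_mstarE (f : D) x : val (mstar f) x = (val f (mstar x))^*%C.
Proof. exact: dual_starE. Qed.

Lemma evmx_star m (x : 'M[X]_m) (f : D) :
  evmx x (dual_star f) = mstar (evmx (mxstar x) f).
Proof. by apply/matrixP => a b; rewrite !mxE dual_starE. Qed.

Lemma map_evmx_star m n (x : 'M[X]_m) (f : 'M[D]_n) :
  map_mx (evmx x) (mxstar f) = mxstar (map_mx (evmx (mxstar x)) f).
Proof. by apply/matrixP => i j; rewrite mxE mxstarE evmx_star mxstarE mxE. Qed.

Lemma dual_star_axioms : star_axioms D.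
Proof.
split=> [f|c f g]; apply: dual_ext => x.
  by rewrite !dual_mstarE conjcK mstarK.
by rewrite dual_mstarE !dualD !dualZ conjcD conjcM !dual_mstarE.
Qed.

Lemma dual_iso n (f : 'M[D]_n) : mnorm (mxstar f) = mnorm f.
Proof.
have le (g : 'M[D]_n) : mnorm (mxstar g) <= mnorm g.
  have g0 := dual_mnorm_ge0 os g.
  apply/(dual_sup os _ g0) => m x x1; rewrite map_evmx_star matC_mnorm_star.
  by apply: dual_ge_ev => //; rewrite smos_iso.
have le2 := le (mxstar f); rewrite (mxstarK dual_star_axioms) in le2.
by apply/le_anti/andP; split; [exact: (le f)|exact: le2].
Qed.

(** That [theta f] preserves the involution is the equation [mxstar f = f] read entrywise; the rest
    is the passage from [theta] to [evmx] by [shuffle]. *)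
Lemma dual_posP n (f : 'M[D]_n) :
  mpos f <-> mxstar f = f /\ forall m (x : 'M[X]_m), mpos x -> mpos (map_mx (evmx x) f).
Proof.
split=> -[fs fp]; split=> //.
  by move=> m x xp; rewrite evmx_shuffle; apply/mpos_shuffle; apply: fp.2.
split=> [x|m x xp]; last by apply/mpos_shuffle; rewrite -evmx_shuffle; exact: fp.
apply/matrixP => i j; rewrite !mxE -{1}fs mxE [map_mx _ _ _ _]mxE dual_starE.
by rewrite mstarK.
Qed.

Definition pos_index := {m : nat & {x : 'M[X]_m | mpos x}}.
Definition pos_op (i : pos_index) (f : D) (v : cvPH R (projT1 i)) : cvPH R (projT1 i) :=
  evmx (sval (projT2 i)) f *m v.
Definition mk_pos m (x : 'M[X]_m) (xp : mpos x) : pos_index :=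
  existT _ m (exist (fun y : 'M[X]_m => mpos y) x xp).

Lemma pos_op_rep : op_rep pos_op.
Proof.
split=> [i a f g v|i f a u v]; first by rewrite /pos_op evmxP mulmxDl scalemxAl.
by rewrite /pos_op mulmxDr scalemxAr.
Qed.

Lemma nform_pos_op i n (f : 'M[D]_n) xi eta :
  nform pos_op i f xi eta = matform (map_mx (evmx (sval (projT2 i))) f) xi eta.
Proof.
rewrite /nform /matform; congr (mform _ _ _).
by apply/funext => a; apply/funext => b; rewrite mxE.
Qed.

Lemma dual_smos : is_smos D.
Proof.
apply: (rep_smos (E := pos_op)).
- exact: dual_os.
- exact: dual_star_axioms.
- exact: dual_iso.
- exact: pos_op_rep.
- move=> n f; split=> [/dual_posP[fs fp]|[fs fp]].
    split=> // -[m [x xp]] xi; rewrite nform_pos_op /=; exact: fp.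
  apply/dual_posP; split=> // m x xp xi.
  by have := fp (mk_pos xp) xi; rewrite nform_pos_op.
- move=> [m [x xp]] n xi; exists (mnorm x * (vnorm xi * vnorm xi)) => f.
  rewrite nform_pos_op /=; have [_ h] := matC_norm (map_mx (evmx x) f).
  apply: le_trans (h _ _) _; rewrite mulrAC ler_wpM2r ?mulr_ge0 ?vnorm_ge0 //.
  by rewrite mulrC evmx_le.
Qed.

Lemma matC_proper k n (y : 'M[matC R k]_n) : mpos y -> mpos (- y) -> y = 0.
Proof.
move=> yp yn; have d0 xi : matform y xi xi = 0.
  apply: le_anti; have := yn xi; rewrite -[X in 0 <= X]/(matform (- y) xi xi).
  rewrite matformN oppr_ge0 => ->; exact: (yp xi).
have sr a (u v w : powPH (cvPH R k) n) :
    matform y w (a *: u + v) = a^*%C * matform y w u + matform y w v.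
  rewrite -[LHS]conjcK -matform_star matform_vP conjcD conjcM !matform_star.
  by rewrite !conjcK.
have h := polarization0 (@matform_vP _ _ _ y) sr d0.
apply/matrixP => i j; apply/matrixP => p q; rewrite [(0 : 'M[matC R k]_n) i j]mxE [RHS]mxE.
by rewrite -(matform_delta y) h.
Qed.

(** At a positive x the scalar matrix of the values f_ij(x) is positive together with its negative,
    hence zero; the hypothesis then kills the entries of f. *)
Lemma dual_mos : (forall f : D, (forall x : X, mpos (const_mx x : 'M[X]_1) -> val f x = 0) -> f = 0) ->
  is_mos D.
Proof.
move=> sep; split=> [|n f fp fn]; first exact: dual_smos.
apply/matrixP => i j; rewrite mxE; apply: sep => x xp.
have [_ /(_ _ _ xp) h1] := (dual_posP f).1 fp.
have [_ /(_ _ _ xp) h2] := (dual_posP (- f)).1 fn.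
have : map_mx (evmx (const_mx x : 'M[X]_1)) f = 0.
  apply: matC_proper; [exact: h1|move: h2; congr mpos].
  by apply/matrixP => p q; apply/matrixP => a b; rewrite !mxE.
by move/matrixP/(_ i j)/matrixP/(_ 0 0); rewrite !mxE.
Qed.
End DualSmos.

(** * Weak-* closures *)

Section WeakTopology.
Variables (R : realType) (X : choiceType) (P : set (X -> R[i])).
Local Notation C := R[i].
Local Notation T := (weaktop P).
Implicit Types (t s : T) (A : set T).

Lemma cplx_nbhsP (z : C) (B : set C) :
  nbhs (z : C^o) B <-> exists2 e : R, 0 < e & forall w, cabs (w - z) < e -> B w.
Proof.
split=> [/nbhs_normP[e /= e0 h]|[e e0 h]].
  exists (complex.Re e); first by move: e0; rewrite ltcE => /andP[].
  move=> w wz; apply: h => /=; move: e0; rewrite ltcE /= => /andP[/eqP i0 _].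
  by rewrite [ltLHS]normE ltcE /= cabsBC wz i0 eqxx.
apply/(nbhs_normP (z : C^o) B); exists e%:C; first by rewrite /= ltcR.
by move=> w /=; rewrite [X in X < _]normE ltcR cabsBC => /h.
Qed.

Let f : X -> prod_topology (fun _ : set_type P => C^o) := fun x p => set_val p x.

Lemma weak_nbhs t (p : X -> C) (e : R) : P p -> 0 < e ->
  nbhs t [set s : T | cabs (p s - p t) < e].
Proof.
move=> Pp e0; pose i : set_type P := SigSub (mem_set Pp).
have ft : f @ nbhs t --> f t := @initial_continuous _ _ f t.
have /cvg_sup/(_ i) h := ft.
have [B [oB Bt] sB] : exists2 B : set C^o, open B /\ B (p t) &
    B `<=` [set w | cabs (w - p t) < e].
  have : nbhs (p t : C^o) [set w | cabs (w - p t) < e] by apply/cplx_nbhsP; exists e.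
  by rewrite nbhsE => -[B [oB Bt] sB]; exists B.
have : nbhs t (f @^-1` [set g | B (g i)]).
  apply: h; rewrite nbhsE; exists [set g | B (g i)] => //.
  by split=> //; exists B.
by apply: filterS => s; exact: sB.
Qed.

(** The sets that contain a basic neighbourhood form a filter F. The defining map of the initial
    topology converges along F, so every neighbourhood of t belongs to F. *)
Lemma weak_nbhs_base t A : nbhs t A -> exists n (q : 'I_n -> X -> C) (e : R),
  [/\ forall i, P (q i), 0 < e & forall s, (forall i, cabs (q i s - q i t) < e) -> A s].
Proof.
pose F : set_system X := [set B | exists n (q : 'I_n -> X -> C) (e : R),
  [/\ forall i, P (q i), 0 < e & forall s, (forall i, cabs (q i s - q i t) < e) -> B s]].
have FF : Filter F.
  split.
  - by exists 0%N, (fun=> fun=> 0), 1; split=> // -[].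
  - move=> B1 B2 [n1 [q1 [e1 [P1 e10 h1]]]] [n2 [q2 [e2 [P2 e20 h2]]]].
    pose q (i : 'I_(n1 + n2)) := match fintype.split i with inl j => q1 j | inr j => q2 j end.
    exists (n1 + n2)%N, q, (Num.min e1 e2).
    split=> [i||s h]; first by rewrite /q; case: (fintype.split i).
      by rewrite lt_min e10.
    split; [apply: h1 => i|apply: h2 => i].
      have := h (lshift n2 i); rewrite /q (unsplitK (inl i)).
      by rewrite lt_min => /andP[].
    have := h (rshift n1 i); rewrite /q (unsplitK (inr i)).
    by rewrite lt_min => /andP[].
  - move=> B1 B2 sB [n [q [e [Pq e0 h]]]]; exists n, q, e; split=> // s /h; exact: sB.
suff ft : f @ F --> f t.
  rewrite nbhsE => -[B [[D oD <-] Bt] sB].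
  have [n [q [e [Pq e0 h]]]] : F (f @^-1` D).
    by apply: ft; apply: open_nbhs_nbhs; split.
  by exists n, q, e; split=> // s /h; exact: sB.
apply/cvg_sup => i B; rewrite nbhsE => -[D [[E oE <-] Et] sD].
have : nbhs (f t i : C^o) E by apply: open_nbhs_nbhs.
move=> /cplx_nbhsP[e e0 h].
exists 1%N, (fun=> set_val i), e; split=> // [_|s /(_ 0) hs].
  exact: set_valP.
by apply: sD; exact: h.
Qed.

Lemma weak_continuous (U : topologicalType) (g : U -> X) :
  (forall p (u : U) (e : R), P p -> 0 < e -> nbhs u [set v | cabs (p (g v) - p (g u)) < e]) ->
  continuous (g : U -> T).
Proof.
move=> h u A /weak_nbhs_base[n [q [e [Pq e0 hA]]]].
have : nbhs u [set v | forall i, cabs (q i (g v) - q i (g u)) < e].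
  by apply: filter_forall => i; exact: h.
by apply: filterS => v; exact: hA.
Qed.

Definition weak_cont (g : X -> C) :=
  forall t (e : R), 0 < e -> nbhs t [set s : T | cabs (g s - g t) < e].

Lemma weak_cont_in p : P p -> weak_cont p.
Proof. by move=> Pp t e e0; exact: weak_nbhs. Qed.

Lemma weak_cont0 : weak_cont (fun=> 0).
Proof. by move=> t e e0; apply: filterE => s /=; rewrite subrr cabs0. Qed.

Lemma weak_contP2 a g h : weak_cont g -> weak_cont h -> weak_cont (fun x => a * g x + h x).
Proof.
move=> cg ch t e e0; have e2 : 0 < e / 2 by rewrite divr_gt0.
have a1 : 0 < cabs a + 1 by rewrite ltr_wpDl ?cabs_ge0.
apply: filterS (filterI (cg t _ (divr_gt0 e2 a1)) (ch t _ e2)) => s [/= gs hs].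
have -> : a * g s + h s - (a * g t + h t) = a * (g s - g t) + (h s - h t).
  by rewrite mulrBr opprD addrACA.
apply: le_lt_trans (cabsD _ _) _; rewrite cabsM.
have : cabs a * cabs (g s - g t) <= e / 2.
  apply: le_trans (_ : (cabs a + 1) * (e / 2 / (cabs a + 1)) <= _).
    by apply: ler_pM; rewrite ?cabs_ge0 ?lerDl // ltW.
  by rewrite mulrC mulfVK // gt_eqF.
lra.
Qed.

Lemma weak_cont_sum (J : Type) (r : seq J) (F : J -> X -> C) :
  (forall j, weak_cont (F j)) -> weak_cont (fun x => \sum_(j <- r) F j x).
Proof.
move=> h; elim: r => [|j r ih].
  by under eq_fun => x do rewrite big_nil; exact: weak_cont0.
under eq_fun => x do rewrite big_cons -[F j x]mul1r.
exact: weak_contP2.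
Qed.

Lemma weak_closure_approx A t g h : closure A t -> weak_cont g -> weak_cont h ->
  forall e : R, 0 < e -> exists s, [/\ A s, cabs (g s - g t) < e & cabs (h s - h t) < e].
Proof.
move=> clt cg ch e e0; have [s [As [gs hs]]] := clt _ (filterI (cg t e e0) (ch t e e0)).
by exists s.
Qed.

Lemma weak_closure_zero A t g : closure A t -> weak_cont g ->
  (forall s, A s -> g s = 0) -> g t = 0.
Proof.
move=> clt cg h; apply: cabs_eq0; apply/eqP; rewrite eq_le cabs_ge0 andbT.
apply: le_cabs_approx => e e0; rewrite add0r.
have [s [As gs _]] := weak_closure_approx clt cg cg e0.
by move: gs; rewrite (h _ As) sub0r cabsN => /ltW.
Qed.

Lemma closedP A : (forall t, closure A t -> A t) -> closed A.
Proof. by move=> h; apply/closure_id/seteqP; split=> //; exact: subset_closure. Qed.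
End WeakTopology.

(** * The bidual *)

Definition mkdual (R : realType) (X : smosData R) (g : X -> R[i]) (lg : linear g)
    (bg : exists K : R, forall x, cabs (g x) <= K * nrm x) : dual X :=
  exist (fun h => is_true (h \in @bounded_functional R X)) g (asboolT (conj lg bg)).

Lemma mkdualE (R : realType) (X : smosData R) (g : X -> R[i]) lg bg x :
  val (@mkdual R X g lg bg) x = g x.
Proof. by []. Qed.

Section SubOS.
Variables (R : realType) (X : smosData R) (W : submodClosed X).
Hypothesis hX : is_operator_space X.
Local Notation C := R[i].
Local Notation Y := (subsmos W).

Lemma sub_linear c (x y : Y) : val (c *: x + y) = c *: (val x : X) + val y.
Proof. by rewrite linearP. Qed.

Lemma sub_valD n (x y : 'M[Y]_n) :
  map_mx val (x + y) = map_mx val x + map_mx val y :> 'M[X]_n.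
Proof. by apply/matrixP => i j; rewrite !mxE. Qed.

Lemma sub_val_sum n (J : Type) (r : seq J) (P : pred J) (F : J -> 'M[Y]_n) :
  map_mx val (\sum_(j <- r | P j) F j) = \sum_(j <- r | P j) map_mx val (F j) :> 'M[X]_n.
Proof.
apply: (big_morph (fun x : 'M[Y]_n => map_mx val x : 'M[X]_n)) => [x y|].
  exact: sub_valD.
by apply/matrixP => i j; rewrite !mxE.
Qed.

Lemma sub_valZ n c (x : 'M[Y]_n) :
  map_mx val (map_mx (fun v => c *: v) x) = map_mx (fun v => c *: v) (map_mx val x) :> 'M[X]_n.
Proof. by apply/matrixP => i j; rewrite !mxE linearZ. Qed.

Lemma sub_val_compr m n (a b : 'M[C]_(m, n)) (x : 'M[Y]_m) :
  map_mx val (mxcompr a b x) = mxcompr a b (map_mx val x) :> 'M[X]_n.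
Proof.
apply/matrixP => i j; rewrite !mxE linear_sum; apply: eq_bigr => p _.
by rewrite linear_sum; apply: eq_bigr => q _; rewrite linearZ mxE.
Qed.

Lemma sub_val_inj n (x y : 'M[Y]_n) : map_mx val x = map_mx val y :> 'M[X]_n -> x = y.
Proof.
by move=> /matrixP e; apply/matrixP => i j; apply: val_inj; have := e i j; rewrite !mxE.
Qed.

Lemma sub_os : is_operator_space Y.
Proof.
have hmax r (F G : 'I_r -> R) : F =1 G -> \big[Num.max/0]_k F k = \big[Num.max/0]_k G k.
  by move=> e; apply: eq_bigr => k _.
split=> [n x /(mnorm_eq0 hX) x0|n c x|n x y|m n r a b x].
- by apply: sub_val_inj; rewrite x0; apply/matrixP => i j; rewrite !mxE.
- by rewrite /= -(mnormZ hX); congr mnorm; exact: sub_valZ.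
- by rewrite /=; apply: le_trans (mnormD hX _ _); rewrite -sub_valD.
- have [_ _ _ /(_ m n r a b (fun k => map_mx val (x k)))] := hX.
  apply: le_trans; rewrite /= sub_val_sum le_eqVlt; apply/orP; left; apply/eqP.
  by congr mnorm; apply: eq_bigr => k _; exact: sub_val_compr.
Qed.

Lemma sub_mnorm n (x : 'M[Y]_n) : mnorm x = mnorm (map_mx val x : 'M[X]_n).
Proof. by []. Qed.

Lemma sub_nrm (x : Y) : nrm x = nrm (val x).
Proof. by rewrite /nrm /=; congr mnorm; apply/matrixP => i j; rewrite !mxE. Qed.
End SubOS.

Section Bidual.
Variables (R : realType) (X : smosData R).
Hypothesis hX : is_operator_space X.
Local Notation C := R[i].
Local Notation D := (dual X).
Local Notation DD := (dual (dual X)).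
Local Notation P := (@bidual_image R X).

Let evf (x : X) : D -> C := fun f => val f x.

Let evf_bounded x : evf x \in @bounded_functional R D.
Proof.
apply/asboolP; split=> [a f g|]; first by rewrite /evf dualD dualZ.
by exists (nrm x) => f; rewrite mulrC; exact: dual_nrm_le.
Qed.

Definition ev (x : X) : DD := exist _ (evf x) (evf_bounded x).

Lemma evE x (f : D) : val (ev x) f = val f x. Proof. by []. Qed.

Lemma ev_mem x : ev x \in P.
Proof. by apply/asboolP; exists x. Qed.

Lemma bidual_image_ex (p : DD) : p \in P -> exists x, p = ev x.
Proof. by move=> /asboolP[x px]; exists x; apply: dual_ext => f; rewrite px. Qed.

Definition evP (x : X) : subsmos P := exist _ (ev x) (ev_mem x).

Lemma evP_ex (p : subsmos P) : exists x, p = evP x.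
Proof.
have /asboolP[x xE] := valP p; exists x; apply: val_inj; apply: dual_ext => f.
by rewrite xE.
Qed.

Lemma evP_mx_ex n (p : 'M[subsmos P]_n) : exists x : 'M[X]_n, p = map_mx evP x.
Proof.
have /choice[x xE] : forall ij : 'I_n * 'I_n, exists x, p ij.1 ij.2 = evP x.
  by move=> ij; exact: evP_ex.
exists (\matrix_(i, j) x (i, j)); apply/matrixP => i j; rewrite !mxE.
exact: (xE (i, j)).
Qed.

Lemma evmx_ev m n (x : 'M[X]_n) (f : 'M[D]_m) :
  map_mx (evmx f) (map_mx ev x) = shuffle (map_mx (evmx x) f).
Proof. by apply/matrixP => i j; apply/matrixP => a b; rewrite !mxE. Qed.

(* The matrix norm of X is the one it inherits from its bidual. *)
Definition normed_by_dual : Prop := forall n (x : 'M[X]_n) (K : R), 0 <= K ->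
  (forall m (f : 'M[D]_m), mnorm f <= 1 -> mnorm (map_mx (evmx x) f) <= K) -> mnorm x <= K.

Hypothesis nd : normed_by_dual.

Lemma ev_isometry n (x : 'M[X]_n) : mnorm (map_mx ev x) = mnorm x.
Proof.
have hD := dual_os hX; have x0 := mnorm_ge0 hX x.
apply/le_anti/andP; split.
  apply/(dual_sup hD _ x0) => m f f1; rewrite evmx_ev mnorm_shuffle.
  apply: le_trans (evmx_le hX _ _) _; rewrite -[leRHS]mul1r.
  exact: ler_wpM2r.
have e0 := mnorm_ge0 (dual_os hD) (map_mx ev x).
apply: nd => // m f f1; rewrite -mnorm_shuffle -evmx_ev.
exact: (dual_sup hD _ e0).1.
Qed.

Lemma evP_isometry n (x : 'M[X]_n) : mnorm (map_mx evP x) = mnorm x.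
Proof.
rewrite sub_mnorm -ev_isometry; have -> // : map_mx val (map_mx evP x) = map_mx ev x.
by apply/matrixP => i j; rewrite 2!mxE [RHS]mxE.
Qed.

Lemma ev_nrm x : nrm (ev x) = nrm x.
Proof. by rewrite /nrm -ev_isometry; congr mnorm; apply/matrixP => i j; rewrite !mxE. Qed.

Lemma evB x y : ev (x - y) = ev x - ev y.
Proof.
apply: dual_ext => f; have e : val (ev x - ev y) f = val (ev x) f - val (ev y) f by [].
by rewrite e !evE -scaleN1r dualfD dualfZ mulN1r.
Qed.

(** The embedding [ev] is isometric, so points x_k whose images approach G form a Cauchy sequence in
    X; its limit represents G. *)
Lemma bidual_image_closed : norm_complete X -> norm_closed [set p : DD | p \in P].
Proof.
move=> cX G hG; have hDD := dual_os (dual_os hX).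
have /choice[u hu] : forall k : nat, exists x, nrm (G - ev x) < (k.+1%:R)^-1.
  move=> k; have [] := hG (k.+1%:R)^-1; first by rewrite invr_gt0 ltr0n.
  by move=> p /bidual_image_ex[x ->] h; exists x.
have inv_small (e : R) : 0 < e -> exists N, forall p, (N <= p)%N -> (p.+1%:R)^-1 < e.
  move=> e0; exists (truncn e^-1) => p Np; rewrite invf_plt ?posrE ?ltr0n //.
  apply: lt_le_trans (truncnS_gt _) _; by rewrite ler_nat.
have [x hx] : exists x, forall e : R, 0 < e ->
    exists N, forall p, (N <= p)%N -> nrm (u p - x) < e.
  apply: cX => e e0; have e2 : 0 < e / 2 by rewrite divr_gt0.
  have [N hN] := inv_small _ e2; exists N => p q Np Nq.
  rewrite -ev_nrm evB -[ev (u p) - _](subrKA G); apply: le_lt_trans (nrmD hDD _ _) _.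
  rewrite (nrmBC hDD (ev (u p))).
  by rewrite (splitr e); apply: ltrD; [exact: lt_trans (hu p) (hN p Np)|exact: lt_trans (hu q) (hN q Nq)].
have -> : G = ev x; last exact: ev_mem.
apply/subr0_eq/(nrm_eq0 hDD)/eqP; rewrite eq_le (nrm_ge0 hDD) andbT.
apply: le_cabs_approx => e e0; rewrite add0r.
have e2 : 0 < e / 2 by rewrite divr_gt0.
have [N hN] := inv_small _ e2; have [M hM] := hx _ e2; pose p := maxn N M.
rewrite -(subrKA (ev (u p))); apply: le_trans (nrmD hDD _ _) _; rewrite -evB ev_nrm.
rewrite (splitr e); apply: lerD; apply: ltW; last exact: hM (leq_maxr _ _).
exact: lt_trans (hu p) (hN p (leq_maxl _ _)).
Qed.

Lemma tpdE (f : D) (p : subsmos P) : val (to_predual_dual P f) p = val (val p) f.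
Proof.
rewrite /to_predual_dual /tosub val_insubd; case: ifP => // /negP[].
apply/asboolP; split=> [a q r|]; first by rewrite sub_linear dualD dualZ.
exists (nrm f) => q; rewrite sub_nrm mulrC; exact: (dual_nrm_le (dual_os hX)).
Qed.

Lemma evmx_tpd m n (x : 'M[X]_m) (f : 'M[D]_n) :
  map_mx (evmx (map_mx evP x)) (map_mx (to_predual_dual P) f) = map_mx (evmx x) f.
Proof.
by apply/matrixP => i j; apply/matrixP => a b; rewrite !mxE tpdE.
Qed.

(** Every matrix over the predual is the image of a matrix over X of the same norm, so both dual
    norms are suprema over the same unit ball. *)
Lemma tpd_isometry : complete_isometry (to_predual_dual P).
Proof.
move=> n f; have hD := dual_os hX; have hP := sub_os P (dual_os hD).
apply/le_anti/andP; split.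
  have f0 := mnorm_ge0 hD f; apply/(dual_sup hP _ f0) => m p.
  have [x ->] := evP_mx_ex p; rewrite evP_isometry evmx_tpd => x1; exact: dual_ge_ev.
have f0 := mnorm_ge0 (dual_os hP) (map_mx (to_predual_dual P) f).
apply/(dual_sup hX _ f0) => m x x1; rewrite -evmx_tpd; apply: dual_ge_ev => //.
by rewrite evP_isometry.
Qed.

Lemma tpd_surj (F : dual (subsmos P)) : exists f, to_predual_dual P f = F.
Proof.
have hP := sub_os P (dual_os (dual_os hX)).
have [K K0 FK] := dual_bounded hP F.
have evPP a x y : evP (a *: x + y) = a *: evP x + evP y.
  apply: val_inj; rewrite linearP; apply: dual_ext => f.
  by rewrite dualD dualZ !evE dualfD dualfZ.
have lf : linear (fun x => val F (evP x)) by move=> a x y; rewrite evPP dualfD dualfZ.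
have bf : exists K : R, forall x, cabs (val F (evP x)) <= K * nrm x.
  by exists K => x; rewrite -ev_nrm -(sub_nrm (evP x)).
exists (mkdual lf bf); apply: dual_ext => p; rewrite tpdE.
by have [x ->] := evP_ex p.
Qed.
End Bidual.

Section DualMos.
Variables (R : realType) (X : smosData R).
Hypothesis hS : is_smos X.
Local Notation C := R[i].
Local Notation D := (dual X).
Local Notation P := (@bidual_image R X).

Lemma functionals_ev (x : X) : functionals P (fun f : D => val f x).
Proof. by exists (ev (smos_os hS) x) => //; exact: ev_mem. Qed.

(** Both conditions of [dual_posP] are closed conditions on finitely many values of the entries at a
    time. *)
Lemma dual_cone_closed n :
  closed ([set f | mpos f] : set (weaktop (@entry_functionals R D P n))).
Proof.
have ent i j (x : X) : weak_cont (@entry_functionals R D P n) (fun f => val (f i j) x).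
  apply: weak_cont_in; exists (fun f : D => val f x), i, j; split=> //.
  exact: functionals_ev.
apply: closedP => f clf; apply/(dual_posP hS); split.
  apply/matrixP => i j; rewrite mxstarE; apply: dual_ext => x.
  rewrite dual_mstarE //; apply/subr0_eq/cabs_eq0/eqP; rewrite eq_le cabs_ge0 andbT.
  apply: le_cabs_approx => e e0; rewrite add0r.
  have e2 : 0 < e / 2 by rewrite divr_gt0.
  have [g [/= gp h1 h2]] := weak_closure_approx clf (ent j i (mstar x)) (ent i j x) e2.
  have gs : mxstar g = g := ((dual_posP hS g).1 gp).1.
  have gE : (val (g j i) (mstar x))^*%C = val (g i j) x.
    by rewrite -dual_mstarE // -mxstarE gs.
  have -> : (val (f j i) (mstar x))^*%C - val (f i j) x =
      - (val (g j i) (mstar x) - val (f j i) (mstar x))^*%C + (val (g i j) x - val (f i j) x).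
    by rewrite -gE rmorphB /= opprB addrA subrK.
  apply: le_trans (cabsD _ _) _; rewrite cabsN cabs_conj; lra.
move=> m x xp xi; rewrite -[X in 0 <= X]/(matform _ xi xi) matform_evmx.
have cont : weak_cont (@entry_functionals R D P n)
    (fun g => \sum_i \sum_j val (g i j) (bicomb x (xi j) (xi i))).
  by apply: weak_cont_sum => i; apply: weak_cont_sum => j; exact: ent.
apply: cge0_approx => e e0; have [g [gp h _]] := weak_closure_approx clf cont cont e0.
exists (\sum_i \sum_j val (g i j) (bicomb x (xi j) (xi i))).
  by rewrite -matform_evmx; exact: ((dual_posP hS g).1 gp).2.
by rewrite cabsBC ltW.
Qed.

Lemma dual_is_dual_mos :
  (forall f : D, (forall x : X, mpos (const_mx x : 'M[X]_1) -> val f x = 0) -> f = 0) ->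
  normed_by_dual X -> norm_complete X -> is_dual_mos P.
Proof.
move=> sep nd cX; split; first exact: dual_mos.
split; [exact: dual_smos| |exact: (bidual_image_closed (smos_os hS) nd)| |exact: dual_cone_closed].
  move=> p /asboolP[x px]; apply/asboolP; exists (mstar x) => f.
  by rewrite (dual_mstarE (dual_smos hS)) px (dual_mstarE hS) conjcK.
by split; [exact: (tpd_isometry (smos_os hS) nd)|exact: (tpd_surj (smos_os hS) nd)].
Qed.
End DualMos.

(** * The Hahn-Banach theorem *)

Section HahnBanach.
Variables (R : realType) (V : lmodType R[i]).
Implicit Types (p q : V -> R) (x y : V) (t : R).

Definition sublinear p : Prop :=
  [/\ forall x y, p (x + y) <= p x + p y, p 0 = 0
    & forall t x, 0 < t -> p (t%:C *: x) <= t * p x].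

Lemma sublinearZ p t x : sublinear p -> 0 <= t -> p (t%:C *: x) = t * p x.
Proof.
move=> [_ p0 pZ]; rewrite le_eqVlt => /predU1P[<-|t0]; first by rewrite scale0r p0 mul0r.
apply: le_anti; rewrite pZ //=; have ti : 0 < t^-1 by rewrite invr_gt0.
have := pZ _ (t%:C *: x) ti; rewrite scalerA -rmorphM mulVf ?gt_eqF // scale1r.
by rewrite ler_pdivlMl.
Qed.

Lemma sublinear_lb p x : sublinear p -> - p (- x) <= p x.
Proof. by move=> [pD p0 _]; have := pD x (- x); rewrite subrr p0; lra. Qed.

Section MinimalIsLinear.
Variable q : V -> R.
Hypothesis sq : sublinear q.
Hypothesis qmin : forall p, sublinear p -> (forall x, p x <= q x) -> p = q.

(** The infimum over t >= 0 of q(x + t y) - t q(y) is again sublinear and below q. Minimality makes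
    it equal to q, and the value t = 1 gives q(x) + q(y) <= q(x + y). *)
Let E y x := [set q (x + t%:C *: y) - t * q y | t in [set t : R | 0 <= t]].
Let q' y x := inf (E y x).

Let E0 y x : E y x (q x).
Proof. by exists 0 => //=; rewrite scale0r addr0 mul0r subr0. Qed.

Let Elb y x : lbound (E y x) (- q (- x)).
Proof.
move=> _ [t /= t0 <-]; have [qD _ _] := sq.
by have := qD (x + t%:C *: y) (- x); rewrite addrAC subrr add0r (sublinearZ _ sq) //; lra.
Qed.

Let q'_le y x t : 0 <= t -> q' y x <= q (x + t%:C *: y) - t * q y.
Proof. by move=> t0; apply: ge_inf; [exists (- q (- x)); exact: Elb|exists t]. Qed.

Let q'_ge y x r : (forall t, 0 <= t -> r <= q (x + t%:C *: y) - t * q y) -> r <= q' y x.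
Proof.
by move=> h; apply: lb_le_inf => [|_ [t t0 <-]]; [exists (q x); exact: E0|exact: h].
Qed.

Let sq' y : sublinear (q' y).
Proof.
have [qD q0 qZ] := sq; split=> [x z||t x t0].
- rewrite -lerBlDr; apply: q'_ge => t t0; rewrite lerBlDl -lerBlDr.
  apply: q'_ge => u u0; rewrite lerBlDr.
  apply: le_trans (q'_le y _ (addr_ge0 t0 u0)) _.
  have := qD (x + t%:C *: y) (z + u%:C *: y).
  rewrite addrACA -scalerDl -rmorphD /=; lra.
- apply: le_anti; apply/andP; split.
    by have := q'_le y 0 (lexx 0); rewrite scale0r addr0 mul0r subr0 q0.
  by apply: q'_ge => t t0; rewrite add0r (sublinearZ _ sq) // subrr.
- rewrite -ler_pdivrMl //; apply: q'_ge => u u0; rewrite ler_pdivrMl // mulrBr mulrA.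
  have := q'_le y (t%:C *: x) (mulr_ge0 (ltW t0) u0); rewrite rmorphM -scalerA -scalerDr.
  by rewrite (sublinearZ _ sq) // ltW.
Qed.

Lemma minimal_sublinear_additive x y : q (x + y) = q x + q y.
Proof.
have [qD _ _] := sq; apply: le_anti; rewrite qD /=.
have qq' : q' y = q.
  apply: qmin; first exact: sq'.
  by move=> z; have := q'_le y z (lexx 0); rewrite scale0r addr0 mul0r subr0.
by have := q'_le y x ler01; rewrite qq' scale1r mul1r; lra.
Qed.
End MinimalIsLinear.

(* A minimal sublinear functional below p, given by Zorn's lemma, is linear. *)
Theorem hahn_banach p : sublinear p -> exists s : V -> R,
  [/\ forall x y, s (x + y) = s x + s y, forall t x, s (t%:C *: x) = t * s x
    & forall x, s x <= p x].
Proof.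
move=> sp; pose T := {q : V -> R | sublinear q /\ forall x, q x <= p x}.
pose le_T (q1 q2 : T) := `[< forall x, sval q2 x <= sval q1 x >].
have p0 : T by exists p.
have [q|q1 q2 q3|q1 q2|A tot|[q [sq qp]] qmax] := @Zorn T le_T.
- by apply/asboolP.
- move=> /asboolP h1 /asboolP h2; apply/asboolP => x; exact: le_trans (h2 x) (h1 x).
- move=> /asboolP h1 /asboolP h2; case: q1 q2 h1 h2 => [f1 f1P] [f2 f2P] h1 h2.
  have e : f1 = f2 by apply/funext => x; apply/le_anti; rewrite h1 h2.
  by case: _ / e f2P h1 h2 => f2P _ _; congr exist; exact: Prop_irrelevance.
- have [->|/set0P[q0 Aq0]] := eqVneq A set0; first by exists p0.
  pose E x := [set sval (q : T) x | q in A].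
  have subl (q : T) : A q -> sublinear (sval q) by move=> _; case: (svalP q).
  have chain (q r : T) : A q -> A r ->
      exists2 w, A w & forall x, sval w x <= sval q x /\ sval w x <= sval r x.
    move=> Aq Ar; case: (tot _ _ Aq Ar) => /asboolP h; [exists r|exists q] => // x.
  have lb x : lbound (E x) (- sval q0 (- x)).
    move=> _ [q Aq <-]; have [w Aw h] := chain _ _ Aq Aq0.
    apply: le_trans (h x).1; apply: le_trans (sublinear_lb x (subl _ Aw)).
    by rewrite lerN2; exact: (h (- x)).2.
  pose m x := inf (E x).
  have m_le (q : T) x : A q -> m x <= sval q x.
    by move=> Aq; apply: ge_inf; [exists (- sval q0 (- x)); exact: lb|exists q].
  have m_ge x r : (forall q : T, A q -> r <= sval q x) -> r <= m x.
    by move=> h; apply: lb_le_inf => [|_ [q Aq <-]]; [exists (sval q0 x), q0|exact: h].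
  have sm : sublinear m.
    split=> [x y||t x t0].
    - rewrite -lerBlDr; apply: (m_ge _ _) => q Aq; rewrite lerBlDl -lerBlDr.
      apply: (m_ge _ _) => r Ar; rewrite lerBlDr; have [w Aw h] := chain _ _ Aq Ar.
      apply: le_trans (m_le w _ Aw) _; have [wD _ _] := subl _ Aw.
      by apply: le_trans (wD _ _) _; rewrite addrC lerD ?(h x).1 ?(h y).2 // ?(h y).1 ?(h x).2.
    - apply: le_anti; apply/andP; split.
        by have := m_le q0 0 Aq0; have [_ -> _] := subl _ Aq0.
      by apply: (m_ge _ _) => q /subl[_ -> _].
    - rewrite -ler_pdivrMl //; apply: (m_ge _ _) => q Aq; rewrite ler_pdivrMl //.
      by apply: le_trans (m_le q _ Aq) _; rewrite (sublinearZ _ (subl _ Aq)) // ltW.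
  have mp : sublinear m /\ forall x, m x <= p x.
    by split=> // x; apply: le_trans (m_le q0 x Aq0) _; case: (svalP q0).
  by exists (exist _ m mp) => q Aq; apply/asboolP => x; exact: m_le.
have qmin r : sublinear r -> (forall x, r x <= q x) -> r = q.
  move=> sr rq; have rp : sublinear r /\ forall x, r x <= p x.
    by split=> // x; apply: le_trans (rq x) (qp x).
  have /(congr1 sval) := qmax (exist _ r rp) (asboolT rq).
  exact.
have qD := minimal_sublinear_additive sq qmin.
have [_ q0 _] := sq.
have qN x : q (- x) = - q x by apply/eqP; rewrite -addr_eq0 -qD addNr q0.
exists q; split=> // t x.
have [t0|/ltW t0] := leP 0 t; first exact: sublinearZ.
have t1 : 0 <= - t by rewrite oppr_ge0.
rewrite -[t]opprK rmorphN scaleNr qN (sublinearZ x sq t1).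
by rewrite -mulNr.
Qed.
End HahnBanach.

(** * Factorization of completely contractive maps *)

Section ScalarForms.
Variables (R : realType) (V : preHilbert R).
Local Notation C := R[i].

(** The form of M, acting on V^n by combinations of coordinates, at the pair (xi, xi). *)
Definition scform n (M : 'M[C]_n) (xi : powPH V n) : C := \sum_a \sum_b M a b * gram xi a b.

Lemma scform_sq m n (c : 'M[C]_(m, n)) (xi : powPH V n) :
  scform (c^t* *m c) xi = (vnorm (mxact c xi) ^+ 2)%:C.
Proof.
rewrite -pip_vnorm /scform /=.
under [RHS]eq_bigr => q _ do rewrite pip_sumr.
rewrite [RHS]exchange_big; apply: eq_bigr => a _ /=.
under [RHS]eq_bigr => q _ do rewrite pip_suml.
rewrite [RHS]exchange_big; apply: eq_bigr => b _ /=.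
rewrite !mxE mulr_suml; apply: eq_bigr => q _.
by rewrite !mxE pipZl pipZr mulrA [c q b * _]mulrC.
Qed.

Lemma scformP n t (M N : 'M[C]_n) (xi : powPH V n) :
  scform (t *: M + N) xi = t * scform M xi + scform N xi.
Proof.
rewrite /scform mulr_sumr -big_split; apply: eq_bigr => a _.
rewrite mulr_sumr -big_split; apply: eq_bigr => b _ /=.
by rewrite !mxE mulrDl mulrA.
Qed.

Lemma scform0 n (xi : powPH V n) : scform 0 xi = 0.
Proof. by rewrite /scform big1 // => a _; rewrite big1 // => b _; rewrite mxE mul0r. Qed.

Lemma scformD n (M N : 'M[C]_n) (xi : powPH V n) :
  scform (M + N) xi = scform M xi + scform N xi.
Proof. by rewrite -[M]scale1r scformP mul1r scale1r. Qed.

Lemma scformZ n t (M : 'M[C]_n) (xi : powPH V n) : scform (t *: M) xi = t * scform M xi.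
Proof. by rewrite -[t *: M]addr0 scformP scform0 addr0. Qed.

Lemma scform_scalar n (t : C) (xi : powPH V n) : scform t%:M xi = t * (vnorm xi ^+ 2)%:C.
Proof.
rewrite -pip_vnorm mulr_sumr; apply: eq_bigr => a _.
rewrite (bigD1 a) //= big1 => [|b ba]; last by rewrite !mxE eq_sym (negbTE ba) mulr0n mul0r.
by rewrite !mxE eqxx mulr1n addr0.
Qed.

Lemma scform_bound n (M : 'M[C]_n) (xi : powPH V n) :
  cabs (scform M xi) <= (\sum_a \sum_b cabs (M a b)) * vnorm xi ^+ 2.
Proof.
rewrite mulr_suml; apply: le_trans (cabs_sum _ _ _) _; apply: ler_sum => a _.
rewrite mulr_suml; apply: le_trans (cabs_sum _ _ _) _; apply: ler_sum => b _.
rewrite cabsM ler_wpM2l ?cabs_ge0 // mxE; apply: le_trans (CauchySchwarz _ _) _.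
by rewrite expr2; apply: ler_pM; rewrite ?vnorm_ge0 ?comp_vnorm.
Qed.

Lemma mxact_comp m n p (c : 'M[C]_(m, n)) (d : 'M[C]_(n, p)) (xi : powPH V p) :
  mxact c (mxact d xi) = mxact (c *m d) xi.
Proof.
apply/funext => q; rewrite /mxact.
under eq_bigr => j _ do rewrite scaler_sumr.
rewrite exchange_big; apply: eq_bigr => k _.
by rewrite mxE scaler_suml; apply: eq_bigr => j _; rewrite scalerA.
Qed.

Lemma mxact1 n (xi : powPH V n) : mxact 1%:M xi = xi.
Proof.
apply/funext => q; rewrite /mxact (bigD1 q) //= big1 => [|j jq].
  by rewrite mxE eqxx scale1r addr0.
by rewrite mxE eq_sym (negbTE jq) scale0r.
Qed.

End ScalarForms.

Lemma scform_const (R : realType) n (M : 'M[R[i]]_n) (v : 'cV[R[i]]_n) :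
  (v^t* *m M *m v) 0 0 = scform M ((fun a => const_mx (v a 0)) : powPH (cvPH R 1) n).
Proof.
rewrite mxE /scform exchange_big; apply: eq_bigr => b _ /=.
rewrite mxE mulr_suml; apply: eq_bigr => a _; move: (M a b) => q.
rewrite !mxE /= /cvdot big_ord1 !mxE mulrAC mulrC; congr (_ * _); exact: mulrC.
Qed.

Lemma gram_const (R : realType) n (w : 'cV[R[i]]_n) a b :
  gram ((fun a => const_mx (w a 0)) : powPH (cvPH R 1) n) a b = w b 0 * (w a 0)^*%C.
Proof. by rewrite mxE /= /cvdot big_ord1 !mxE. Qed.

Lemma mxcompr_comp (R : realType) (X : smosData R) m n p
    (a b : 'M[R[i]]_(n, p)) (c d : 'M[R[i]]_(m, n)) (x : 'M[X]_m) :
  mxcompr a b (mxcompr c d x) = mxcompr (c *m a) (d *m b) x.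
Proof.
apply/matrixP => i j; rewrite !mxE.
under eq_bigr => k _ do under eq_bigr => l _ do (rewrite mxE scaler_sumr;
  under eq_bigr => s _ do rewrite scaler_sumr).
transitivity (\sum_s \sum_t \sum_k \sum_l
  ((a k i)^*%C * b l j * ((c s k)^*%C * d t l)) *: x s t).
  rewrite pair_big /= (eq_bigr (fun kl : 'I_n * 'I_n => \sum_(st : 'I_m * 'I_m)
    ((a kl.1 i)^*%C * b kl.2 j * ((c st.1 kl.1)^*%C * d st.2 kl.2)) *: x st.1 st.2)); last first.
    by move=> kl _; rewrite pair_big /=; apply: eq_bigr => st _; rewrite scalerA.
  rewrite [RHS]pair_big /= exchange_big; apply: eq_bigr => st _ /=.
  by rewrite [RHS]pair_big /=.
apply: eq_bigr => s _; apply: eq_bigr => t _; rewrite !mxE conjc_sum mulr_suml.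
rewrite scaler_suml; apply: eq_bigr => k _; rewrite mulr_sumr scaler_suml.
apply: eq_bigr => l _; congr (_ *: _); rewrite conjcM; ring.
Qed.

Section DualForms.
Variables (R : realType) (X : smosData R).
Local Notation C := R[i].

Lemma matform_vZ k n (x : 'M[matC R k]_n) a xi eta :
  matform x (a *: xi) eta = a * matform x xi eta.
Proof.
rewrite !matformE mulr_sumr; apply: eq_bigr => i _.
rewrite mulr_sumr; apply: eq_bigr => j _; rewrite mulr_sumr; apply: eq_bigr => p _.
rewrite mulr_sumr; apply: eq_bigr => q _ /=.
by rewrite !mxE !mulrA; congr (_ * _ * _); exact: mulrC.
Qed.

Lemma matform_vZr k n (x : 'M[matC R k]_n) a xi eta :
  matform x xi (a *: eta) = a^*%C * matform x xi eta.
Proof. by rewrite -[LHS]conjcK -matform_star matform_vZ conjcM matform_star conjcK. Qed.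

Lemma nform_dual_op n m (x : 'M[X]_m) (x1 : mnorm x <= 1) (f : 'M[dual X]_n) xi eta :
  nform (@dual_op R X) (dual_mkindex x1) f xi eta = matform (map_mx (evmx x) f) xi eta.
Proof.
rewrite /nform /matform; congr (mform _ _ _).
by apply/funext => a; apply/funext => b; rewrite mxE.
Qed.
End DualForms.

Section Wittstock.
Variables (R : realType) (X : smosData R) (V : preHilbert R) (B : X -> V -> V).
Hypothesis hS : is_smos X.
Hypothesis nb : normed_by (fun _ : unit => B).
Hypothesis pp : forall n (x : 'M[X]_n), mpos x -> forall xi,
  0 <= nform (fun _ : unit => B) tt x xi xi.
Hypothesis adj : forall x v w, pip (B (mstar x) v) w = pip v (B x w).
Local Notation C := R[i].
Local Notation D := (dual X).
Local Notation nf := (nform (fun _ : unit => B) tt).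
Let os := smos_os hS.
Let rp := nb_rep nb.
Let B0 v : B 0 v = 0. Proof. exact: (@op_0 R X unit _ _ rp tt v). Qed.
Let BvZ x a v : B x (a *: v) = a *: B x v. Proof. exact: (@op_vZ R X unit _ _ rp tt x a v). Qed.

Variables (m : nat) (f : 'M[D]_m).
Hypothesis f1 : mnorm f <= 1.
Local Notation N := (m + m)%N.
(* Matrices over a module carry no module structure in the library, hence
   functions of two indices in the first component. *)
Local Notation Z := (('I_N -> 'I_N -> X) * 'M[C]_N)%type.

Let opmx (z : Z) : 'M[X]_N := \matrix_(i, j) z.1 i j.

(** An element z stands for the operator z.1 + z.2 on V^N, where the scalar matrix z.2 acts by
    combinations of coordinates; in this way a unit is adjoined to X. *)
Let cform (z : Z) (zeta : powPH V N) : C := nf (opmx z) zeta zeta + scform z.2 zeta.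

Let cformP a (z w : Z) zeta : cform (a *: z + w) zeta = a * cform z zeta + cform w zeta.
Proof.
rewrite /cform; have -> : opmx (a *: z + w) = map_mx (fun v => a *: v) (opmx z) + opmx w.
  by apply/matrixP => i j; rewrite !mxE.
by rewrite (nformD rp) (nformZ rp) scformP mulrDr addrACA.
Qed.

(** Paulsen's trick: the off-diagonal block is paired with f, while the diagonal blocks of size m
    carry the scalar matrices that control it. *)
Let corner (Y : 'M[X]_m) : 'M[X]_N := block_mx 0 Y 0 0.

Let pairing (Y : 'M[X]_m) : R := complex.Re (\sum_i \sum_j val (f i j) (Y i j)).

Let joinv (xi eta : powPH V m) : powPH V N := fun k =>
  match fintype.split k with inl i => xi i | inr i => eta i end.

Let joinvl xi eta i : joinv xi eta (lshift m i) = xi i.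
Proof. by rewrite /joinv (unsplitK (inl i)). Qed.
Let joinvr xi eta i : joinv xi eta (rshift m i) = eta i.
Proof. by rewrite /joinv (unsplitK (inr i)). Qed.

Let corner_form Y xi eta : nf (corner Y) (joinv xi eta) (joinv xi eta) = nf Y eta xi.
Proof.
rewrite /nform !mformE big_split_ord /= [X in _ + X]big1 ?addr0 => [|i _]; last first.
  rewrite big1 // => j _; case: (split_ordP j) => k ->.
    by rewrite block_mxEdl mxE B0 pip0l.
  by rewrite block_mxEdr mxE B0 pip0l.
apply: eq_bigr => i _; rewrite big_split_ord /= [X in X + _]big1 ?add0r => [|j _]; last first.
  by rewrite block_mxEul mxE B0 pip0l.
by apply: eq_bigr => j _; rewrite block_mxEur joinvl joinvr.
Qed.

Let diag_form (A1 A2 : 'M[C]_m) xi eta :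
  scform (block_mx A1 0 0 A2) (joinv xi eta) = scform A1 xi + scform A2 eta.
Proof.
rewrite /scform big_split_ord /=; congr (_ + _); apply: eq_bigr => i _.
  rewrite big_split_ord /= [X in _ + X]big1 ?addr0 => [|j _]; last first.
    by rewrite block_mxEur mxE mul0r.
  by apply: eq_bigr => j _; rewrite block_mxEul !mxE !joinvl.
rewrite big_split_ord /= [X in X + _]big1 ?add0r => [|j _]; last first.
  by rewrite block_mxEdl mxE mul0r.
by apply: eq_bigr => j _; rewrite block_mxEdr !mxE !joinvr.
Qed.

Let tr_sq (c : 'M[C]_m) : complex.Re (\tr (c^t* *m c)) =
  vnorm ((fun j => col j c) : powPH (cvPH R m) m) ^+ 2.
Proof.
rewrite pow_vnorm_sq /mxtrace Re_sum; apply: eq_bigr => j _; rewrite cv_vnorm_sq mxE Re_sum.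
by apply: eq_bigr => i _; rewrite !mxE mulrC [X in complex.Re X]mulC_conj.
Qed.

(** This is where ||f|| <= 1 enters. Dividing Y by factors of A1 + d and A2 + d gives Y' of norm at
    most 2, as the hypothesis lacks the factor 2 of [polar_bound]. The pairing is the form of f at
    Y' on the columns of the two factors, and the squared norms of these families of columns are the
    traces up to m d. *)
Let corner_bound Y (A1 A2 : 'M[C]_m) : psd A1 -> psd A2 ->
  (forall xi eta, complex.Re (nf Y eta xi) <= complex.Re (scform A1 xi + scform A2 eta)) ->
  pairing Y <= complex.Re (\tr A1) + complex.Re (\tr A2).
Proof.
move=> pA1 pA2 h; apply: le_cabs_approx => e e0.
(* The two traces grow by 2 m d in total; m + 1 keeps the denominator nonzero when m = 0. *)
pose d := e / (m.+1%:R * 2); have d0 : 0 < d by rewrite divr_gt0 // mulr_gt0 // ltr0n.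
have [c1 u1 E1] := psd_eps_factor pA1 d0; have [c2 u2 E2] := psd_eps_factor pA2 d0.
pose Y' := mxcompr (invmx c1) (invmx c2) Y.
have sc (A c : 'M[C]_m) xi : A + d%:C%:M = c^t* *m c -> c \in unitmx ->
    complex.Re (scform A (mxact (invmx c) xi)) <= vnorm (xi : powPH V m) ^+ 2.
  move=> E u; have := scform_sq c (mxact (invmx c) xi).
  rewrite mxact_comp mulmxV // mxact1 -E scformD scform_scalar => /(congr1 (@complex.Re R)).
  rewrite ReD ReZ /= => <-; rewrite lerDl mulr_ge0 ?sqr_ge0 //; exact: ltW.
have Y'2 : mnorm Y' <= 2.
  apply: (mnorm_le nb) => [//|[] xi eta].
  apply: (polar_bound (V := powPH V m) (W := powPH V m) (s := nf Y')).
  - exact: ler0n.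
  - move=> a x y; rewrite /nform !mformE mulr_sumr; apply: eq_bigr => i _.
    by rewrite mulr_sumr; apply: eq_bigr => j _; rewrite BvZ pipZl.
  - move=> t x y; rewrite /nform !mformE mulr_sumr; apply: eq_bigr => i _.
    by rewrite mulr_sumr; apply: eq_bigr => j _; rewrite pipZr conjR.
  - move=> x y; rewrite ler_pM2l // (nform_mxcompr rp); apply: le_trans (h _ _) _.
    by rewrite ReD addrC lerD // sc.
have YE : Y = mxcompr c1 c2 Y'.
  by rewrite mxcompr_comp !mulVmx // mxcompr1.
pose w (c : 'M[C]_m) : powPH (cvPH R m) m := fun j => col j c.
have -> : pairing Y = complex.Re (matform (map_mx (evmx Y') f) (w c2) (w c1)).
  rewrite matform_evmx /pairing; congr (complex.Re _).
  apply: eq_bigr => i _; apply: eq_bigr => j _; rewrite {1}YE mxE /bicomb; congr (val _ _).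
  by apply: eq_bigr => p _; apply: eq_bigr => q _; rewrite !mxE.
have [_ hf] := matC_norm (map_mx (evmx Y') f).
apply: le_trans (Re_le_cabs _) _; apply: le_trans (hf _ _) _.
have f2 : mnorm (map_mx (evmx Y') f) <= 2.
  apply: le_trans (evmx_le os _ _) _; rewrite -[leRHS]mul1r.
  by apply: ler_pM => //; [exact: (mnorm_ge0 (dual_os os))|exact: (mnorm_ge0 os)].
apply: le_trans (ler_wpM2r _ f2) _; first by rewrite mulr_ge0 ?vnorm_ge0.
have trE (A c : 'M[C]_m) : A + d%:C%:M = c^t* *m c ->
    vnorm (w c) ^+ 2 = complex.Re (\tr A) + m%:R * d.
  move=> E; rewrite -tr_sq -E mxtraceD mxtrace_scalar ReD; congr (_ + _).
  by rewrite -[d%:C *+ m]rmorphMn /= -mulr_natl.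
have md : m%:R * d * 2 <= e.
  rewrite /d mulrAC mulrA ler_pdivrMr ?mulr_gt0 ?ltr0n //.
  by rewrite mulrC ler_wpM2l ?(ltW e0) // ler_wpM2r // ler_nat.
have := sqr_ge0 (vnorm (w c1) - vnorm (w c2)).
rewrite sqrrB (trE _ _ E1) (trE _ _ E2); move: md; rewrite -[_ *+ 2]mulr_natl.
set u := vnorm _; set v := vnorm _; set a := complex.Re _; set b := complex.Re _.
set g := m%:R * d; move=> md; rewrite [u * v]mulrC; lra.
Qed.
Let pairingD Y Y' : pairing (Y + Y') = pairing Y + pairing Y'.
Proof.
rewrite /pairing -ReD -big_split; congr complex.Re; apply: eq_bigr => i _.
by rewrite -big_split; apply: eq_bigr => j _; rewrite mxE dualfD.
Qed.
Let pairingZ (t : R) Y : pairing (map_mx (fun v => t%:C *: v) Y) = t * pairing Y.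
Proof.
rewrite /pairing -ReZ mulr_sumr; congr complex.Re; apply: eq_bigr => i _.
by rewrite mulr_sumr; apply: eq_bigr => j _; rewrite mxE dualfZ.
Qed.

Let cornerD Y Y' : corner (Y + Y') = corner Y + corner Y'.
Proof. by rewrite /corner add_block_mx !addr0. Qed.
Let cornerZ a Y : corner (map_mx (fun v => a *: v) Y) = map_mx (fun v => a *: v) (corner Y).
Proof. by rewrite /corner map_block_mx; congr block_mx; apply/matrixP => i j; rewrite !mxE scaler0. Qed.

(** The gauge p(z) is the infimum of tr A1 + tr A2 - Re f(Y) over all dominations of z + corner(Y)
    by diag(A1, A2). A real functional below p is monotone, equals Re f on the corner, and is at
    most the trace on diagonal blocks: the three properties that the factorization uses. *)
Let feas (z : Z) (r : R) : Prop := exists Y A1 A2,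
  [/\ psd A1, psd A2, r = complex.Re (\tr A1) + complex.Re (\tr A2) - pairing Y
    & forall zeta, complex.Re (cform z zeta) + complex.Re (nf (corner Y) zeta zeta) <=
        complex.Re (scform (block_mx A1 0 0 A2) zeta)].

Let psdD (A A' : 'M[C]_m) : psd A -> psd A' -> psd (A + A').
Proof.
move=> [h1 p1] [h2 p2]; split=> [|v]; first by rewrite adjmxD h1 h2.
by rewrite mulmxDr mulmxDl mxE addr_ge0.
Qed.
Let psdZ (t : R) (A : 'M[C]_m) : 0 <= t -> psd A -> psd (t%:C *: A).
Proof.
move=> t0 [h p]; split=> [|v].
  by rewrite linearZ /= map_mxZ h; congr (_ *: _); exact: conjR.
by rewrite -scalemxAr -scalemxAl mxE mulr_ge0 // ler0c.
Qed.
Let psd1 : psd (1%:M : 'M[C]_m).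
Proof.
split=> [|v]; first by rewrite trmx1 map_mx1.
rewrite mulmx1 mxE; apply: sumr_ge0 => i _.
by rewrite !mxE mulrC [X in 0 <= X]mulC_conj ler0c sqr_ge0.
Qed.

Let feas_bound z (c : R) : 0 <= c ->
  (forall zeta, complex.Re (cform z zeta) <= c * vnorm zeta ^+ 2) ->
  feas z (2 * m%:R * c).
Proof.
move=> c0 h; exists 0, (c%:C *: 1%:M), (c%:C *: 1%:M).
have p0 : pairing 0 = 0 by rewrite /pairing big1 // => i _; rewrite big1 // => j _; rewrite mxE dualf0.
have k0 : corner 0 = 0 by rewrite /corner block_mx0.
split; [exact: psdZ|exact: psdZ| |move=> zeta].
  have -> : complex.Re (\tr (c%:C *: (1%:M : 'M[C]_m))) = m%:R * c.
    rewrite linearZ /= mxtrace1 ReZ mulrC; congr (_ * _).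
    by have -> : (m%:R : C) = (m%:R : R)%:C by rewrite rmorph_nat.
  by rewrite p0; ring.
rewrite k0 (nform0 rp) addr0; apply: le_trans (h zeta) _.
rewrite !scalemx1 -scalar_mx_block scform_scalar ReZ /=; exact: lexx.
Qed.

Let feasD z w r r' : feas z r -> feas w r' -> feas (z + w) (r + r').
Proof.
move=> [Y [A1 [A2 [p1 p2 -> h]]]] [Y' [A1' [A2' [p1' p2' -> h']]]].
exists (Y + Y'), (A1 + A1'), (A2 + A2'); split; [exact: psdD|exact: psdD| |move=> zeta].
  by rewrite !mxtraceD !ReD pairingD; ring.
have -> : block_mx (A1 + A1') 0 0 (A2 + A2') = block_mx A1 0 0 A2 + block_mx A1' 0 0 A2'.
  by rewrite add_block_mx !addr0.
have := cformP 1 z w zeta; rewrite scale1r mul1r => ->.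
move: (h zeta) (h' zeta); move: (cform z zeta) (cform w zeta) => u v.
by rewrite cornerD (nformD rp) scformD !ReD addrACA; exact: lerD.
Qed.

Let feasZ t z r : 0 < t -> feas z r -> feas (t%:C *: z) (t * r).
Proof.
move=> t0 [Y [A1 [A2 [p1 p2 -> h]]]]; have t0' := ltW t0.
exists (map_mx (fun v => t%:C *: v) Y), (t%:C *: A1), (t%:C *: A2).
split; [exact: psdZ|exact: psdZ| |move=> zeta].
  by rewrite !linearZ /= pairingZ !ReZ; ring.
have -> : block_mx (t%:C *: A1) 0 0 (t%:C *: A2) = t%:C *: block_mx A1 0 0 A2.
  by rewrite scale_block_mx !scaler0.
have := cformP t%:C z 0 zeta; rewrite addr0.
have -> : cform 0 zeta = 0.
  have -> : (0 : Z) = -1 *: (0 : Z) + 0 by rewrite scaler0 addr0.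
  by rewrite cformP mulN1r addNr.
rewrite addr0 => ->; rewrite cornerZ (nformZ rp) scformZ !ReZ -mulrDr.
by rewrite ler_pM2l.
Qed.

Let cform0 zeta : cform 0 zeta = 0.
Proof.
have -> : (0 : Z) = -1 *: (0 : Z) + 0 by rewrite scaler0 addr0.
by rewrite cformP mulN1r addNr.
Qed.

(** At z = 0 the domination, read on joined vectors, is the hypothesis of [corner_bound]. This
    consistency keeps the infimum p finite. *)
Let feas_ge0 r : feas 0 r -> 0 <= r.
Proof.
move=> [Y [A1 [A2 [p1 p2 -> h]]]]; rewrite subr_ge0; apply: corner_bound => // xi eta.
have := h (joinv xi eta); rewrite corner_form diag_form cform0.
by rewrite add0r.
Qed.

Let feas_ex z : exists r, feas z r.
Proof.
pose c := mnorm (opmx z) + \sum_a \sum_b cabs (z.2 a b).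
exists (2 * m%:R * c); apply: feas_bound => [|zeta].
  rewrite addr_ge0 ?(mnorm_ge0 os) //; apply: sumr_ge0 => a _.
  by apply: sumr_ge0 => b _; exact: cabs_ge0.
rewrite ReD mulrDl; apply: lerD; apply: le_trans (Re_le_cabs _) _.
  exact: (nform_le nb).
exact: scform_bound.
Qed.

Let feas0 : feas 0 0.
Proof.
have := @feas_bound 0 0 (lexx 0); rewrite mulr0; apply => zeta.
by rewrite cform0 mul0r.
Qed.

Let p (z : Z) : R := inf [set r | feas z r].

Let p_le z r : feas z r -> p z <= r.
Proof.
move=> fz; apply: ge_inf => //; have [r' fr'] := feas_ex (- z).
exists (- r') => u fu; have := feas_ge0; move=> /(_ (u + r')).
have := feasD fu fr'; rewrite subrr => h /(_ h); lra.
Qed.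

Let p_ge z r : (forall u, feas z u -> r <= u) -> r <= p z.
Proof. by move=> h; apply: lb_le_inf => [|u /h//]; have [u fu] := feas_ex z; exists u. Qed.

Let p_sublinear : sublinear p.
Proof.
split=> [z w||t z t0].
- rewrite -lerBlDr; apply: p_ge => u fu; rewrite lerBlDl -lerBlDr.
  apply: p_ge => v fv; rewrite lerBlDr addrC; apply: p_le; exact: feasD.
- by apply: le_anti; rewrite (p_le feas0) /=; apply: p_ge => u; exact: feas_ge0.
- rewrite -ler_pdivrMl //; apply: p_ge => u fu; rewrite ler_pdivrMl //.
  by apply: p_le; exact: feasZ.
Qed.

Section Functional.
Variable s : Z -> R.
Hypothesis sD : forall z w, s (z + w) = s z + s w.
Hypothesis sZ : forall t z, s (t%:C *: z) = t * s z.
Hypothesis sp : forall z, s z <= p z.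

Let s0 : s 0 = 0.
Proof. by have := sZ 0 0; rewrite scaler0 mul0r. Qed.
Let sN z : s (- z) = - s z.
Proof. by apply/eqP; rewrite -addr_eq0 -sD addNr s0. Qed.

(** The form of -z is at most 0, so that -z is feasible with value 0 and s(-z) <= 0. *)
Let s_ge0 z : (forall zeta, 0 <= complex.Re (cform z zeta)) -> 0 <= s z.
Proof.
move=> h; rewrite -[s z]opprK -sN oppr_ge0; apply: le_trans (sp _) _.
rewrite -(mulr0 (2 * m%:R)); apply: p_le; apply: feas_bound => // zeta.
have := cformP (-1) z 0 zeta; rewrite addr0 scaleN1r cform0 addr0 mulN1r => ->.
by rewrite ReN mul0r oppr_le0.
Qed.

Let s_bound z c : 0 <= c ->
  (forall zeta, complex.Re (cform z zeta) <= c * vnorm zeta ^+ 2) -> s z <= 2 * m%:R * c.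
Proof. by move=> c0 h; apply: le_trans (sp _) _; apply: p_le; exact: feas_bound. Qed.

Let funmx (Y : 'M[X]_N) : Z := (fun i j => Y i j, 0).

Let funmxK Y : opmx (funmx Y) = Y.
Proof. by apply/matrixP => i j; rewrite mxE. Qed.

(** Choosing Y itself in [feas] cancels the corner and gives s(- corner Y) <= - Re f(Y); the same
    for -Y gives equality. *)
Let s_corner Y : s (funmx (corner Y)) = pairing Y.
Proof.
have ge Y' : s (- funmx (corner Y')) <= - pairing Y'.
  apply: le_trans (sp _) _; apply: p_le; exists Y', 0, 0.
  have p0 : psd (0 : 'M[C]_m) by split=> [|v]; rewrite ?trmx0 ?map_mx0 // mulmx0 mul0mx mxE.
  split=> // [|zeta]; first by rewrite linear0 /= addr0 add0r.
  have := cformP (-1) (funmx (corner Y')) 0 zeta.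
  rewrite addr0 scaleN1r cform0 addr0 mulN1r => ->.
  by rewrite /cform funmxK !scform0 addr0 block_mx0 scform0 ReN addNr.
apply/le_anti/andP; split; last by have := ge Y; rewrite sN lerN2.
have := ge (map_mx (fun v => (-1)%:C *: v) Y); rewrite pairingZ mulN1r opprK.
congr (s _ <= _); rewrite /funmx; congr pair; last by rewrite oppr0.
apply/funext => i; apply/funext => j.
have e : ((-1)%:C : C) = -1 by rewrite rmorphN rmorph1.
by rewrite cornerZ e -[LHS]/(- (map_mx _ (corner Y) i j)) mxE scaleN1r opprK.
Qed.

Let sc (z : Z) : C := (s z)%:C - 'i%C * (s ('i%C *: z))%:C.

Let i_eq (z : Z) (x y : R) : (x%:C + 'i%C * y%:C) *: z = x%:C *: z + y%:C *: ('i%C *: z).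
Proof. by rewrite scalerDl scalerA [y%:C * _]mulrC. Qed.

Let scD z w : sc (z + w) = sc z + sc w.
Proof. by rewrite /sc scalerDr !sD !rmorphD /= mulrDr opprD addrACA. Qed.

Let scR (t : R) z : sc (t%:C *: z) = t%:C * sc z.
Proof.
rewrite /sc scalerA [_ * t%:C]mulrC -scalerA !sZ !rmorphM /= mulrBr.
by rewrite mulrCA.
Qed.

Let scI z : sc ('i%C *: z) = 'i%C * sc z.
Proof.
rewrite /sc scalerA -expr2 sqr_i scaleN1r sN rmorphN /= mulrN opprK mulrBr.
by rewrite mulrA -expr2 sqr_i mulN1r opprK addrC.
Qed.

Let scZ a z : sc (a *: z) = a * sc z.
Proof.
rewrite {1}(complexE a) i_eq scD !scR scI mulrA -mulrDl [(_)%:C * 'i%C]mulrC.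
by rewrite -complexE.
Qed.

Let sc_re z : complex.Re (sc z) = s z.
Proof. by rewrite /sc ReD ReN Re_i /= oppr0 subr0. Qed.
Let sc_im z : complex.Im (sc z) = - s ('i%C *: z).
Proof. by rewrite /sc ImD ImN Im_i /= add0r. Qed.

Let sc_ge0 z : (forall zeta, 0 <= cform z zeta) -> 0 <= sc z.
Proof.
have cZ a w zeta : cform (a *: w) zeta = a * cform w zeta.
  by have := cformP a w 0 zeta; rewrite cform0 !addr0.
move=> h; apply/cge0P; rewrite sc_re sc_im; split; last first.
  by apply: s_ge0 => zeta; exact: cRe_ge0.
have im0 zeta : complex.Im (cform z zeta) = 0 by have /cge0P[] := h zeta.
apply/eqP; rewrite oppr_eq0 eq_le; apply/andP; split; last first.
  by apply: s_ge0 => zeta; rewrite cZ Re_i im0 oppr0.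
rewrite -oppr_ge0 -sN -scaleN1r scalerA; apply: s_ge0 => zeta.
by rewrite cZ mulN1r mulNr ReN Re_i im0 !oppr0.
Qed.

Let unitz a b x : Z := (fun i j => if (i == a) && (j == b) then x else 0, 0).

Let unitzP a b t x y : unitz a b (t *: x + y) = t *: unitz a b x + unitz a b y.
Proof.
rewrite /unitz; congr pair; last by rewrite /= scaler0 addr0.
apply/funext => i; apply/funext => j; rewrite -[RHS]/(t *: (if _ then _ else _) + (if _ then _ else _)).
by case: ifP => _ //; rewrite scaler0 addr0.
Qed.

Let fst_sum (I : Type) (r : seq I) (F : I -> Z) i j :
  (\sum_(k <- r) F k).1 i j = \sum_(k <- r) (F k).1 i j.
Proof. by apply: (big_morph (fun z : Z => z.1 i j)). Qed.
Let snd_sum (I : Type) (r : seq I) (F : I -> Z) :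
  (\sum_(k <- r) F k).2 = \sum_(k <- r) (F k).2.
Proof. by apply: (big_morph (fun z : Z => z.2)). Qed.

Let sum_unitz (Y : 'M[X]_N) : \sum_a \sum_b unitz a b (Y a b) = funmx Y.
Proof.
apply: injective_projections; last first.
  by rewrite snd_sum big1 // => a _; rewrite snd_sum big1.
apply/funext => i; apply/funext => j.
transitivity (\sum_a \sum_b (if (i == a) && (j == b) then Y a b else 0)).
  by rewrite fst_sum; apply: eq_bigr => a _; rewrite fst_sum.
rewrite [LHS](bigD1 i) //= [X in _ + X]big1 => [|a ai]; last first.
  by rewrite big1 // => b _; rewrite eq_sym (negbTE ai).
rewrite (bigD1 j) //= big1 => [|b bj]; last by rewrite eqxx eq_sym (negbTE bj).
by rewrite !eqxx !addr0.
Qed.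

Let sc_sum (I : Type) (r : seq I) (F : I -> Z) :
  sc (\sum_(k <- r) F k) = \sum_(k <- r) sc (F k).
Proof.
apply: (big_morph sc) => [z w|]; first exact: scD.
by have := scZ 0 0; rewrite scaler0 mul0r.
Qed.

Let s_eq0 z : (forall zeta, complex.Re (cform z zeta) = 0) -> s z = 0.
Proof.
move=> h; apply/le_anti/andP; split; last by apply: s_ge0 => zeta; rewrite h.
rewrite -oppr_ge0 -sN; apply: s_ge0 => zeta.
have := cformP (-1) z 0 zeta; rewrite addr0 scaleN1r cform0 addr0 mulN1r => ->.
by rewrite ReN h oppr0.
Qed.

Let starz (z : Z) : Z := (fun i j => mstar (z.1 j i), z.2^t*).

Let cform_star z zeta : cform (starz z) zeta = (cform z zeta)^*%C.
Proof.
rewrite /cform conjcD; congr (_ + _).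
  rewrite /nform !mformE conjc_sum exchange_big; apply: eq_bigr => i _.
  rewrite conjc_sum; apply: eq_bigr => j _; rewrite !mxE /= adj.
  by rewrite pip_herm.
rewrite /scform conjc_sum exchange_big; apply: eq_bigr => a _; rewrite conjc_sum.
apply: eq_bigr => b _; rewrite conjcM !mxE /=; congr (_ * _); exact: pip_herm.
Qed.

(** By [s_eq0] the functional s only sees the real part of a form, and z and its adjoint have the
    same real part. *)
Let sc_star z : sc (starz z) = (sc z)^*%C.
Proof.
have cZ a w zeta : cform (a *: w) zeta = a * cform w zeta.
  by have := cformP a w 0 zeta; rewrite cform0 !addr0.
have cD w w' zeta : cform (w + w') zeta = cform w zeta + cform w' zeta.
  by have := cformP 1 w w' zeta; rewrite scale1r mul1r.
have e1 : s (starz z) = s z.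
  apply/eqP; rewrite -subr_eq0 -sN -sD -scaleN1r; apply/eqP/s_eq0 => zeta.
  by rewrite cD cZ cform_star mulN1r ReD ReN Re_conj subrr.
have e2 : s ('i%C *: starz z) = - s ('i%C *: z).
  apply/eqP; rewrite -addr_eq0 -sD -scalerDr; apply/eqP/s_eq0 => zeta.
  by rewrite cZ cD cform_star Re_i ImD Im_conj addNr oppr0.
by apply/eqP; rewrite eq_complex Re_conj Im_conj !sc_re !sc_im e1 e2 !eqxx.
Qed.

Let pip_B x v w : cabs (pip (B x v) w) <= nrm x * (vnorm v * vnorm w).
Proof.
have := @nform_le R X unit _ _ nb tt 1 (const_mx x) (fun=> v) (fun=> w).
rewrite /nform mformE !big_ord1 mxE; suff e u : vnorm ((fun=> u) : powPH V 1) = vnorm u.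
  by rewrite !e.
by apply/eqP; rewrite -(@eqrXn2 _ 2) ?vnorm_ge0 // pow_vnorm_sq big_ord1.
Qed.

Let cform_unitz a b x zeta : cform (unitz a b x) zeta = pip (B x (zeta b)) (zeta a).
Proof.
rewrite /cform scform0 addr0 /nform mformE (bigD1 a) //= [X in _ + X]big1 => [|i ia]; last first.
  by rewrite big1 // => j _; rewrite mxE /= (negbTE ia) B0 pip0l.
rewrite (bigD1 b) //= [X in _ + X + _]big1 => [|j jb]; last first.
  by rewrite mxE /= (negbTE jb) andbF B0 pip0l.
by rewrite mxE /= !eqxx !addr0.
Qed.

Let s_unitz a b x : s (unitz a b x) <= 2 * m%:R * nrm x.
Proof.
apply: s_bound => [|zeta]; first exact: nrm_ge0.
rewrite cform_unitz; apply: le_trans (Re_le_cabs _) _; apply: le_trans (pip_B _ _ _) _.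
rewrite ler_wpM2l ?nrm_ge0 // expr2.
by apply: ler_pM; rewrite ?vnorm_ge0 ?comp_vnorm.
Qed.

Let unitzZ a b t x : unitz a b (t *: x) = t *: unitz a b x.
Proof.
have := unitzP a b t x 0; rewrite addr0 => ->.
have -> : unitz a b 0 = 0; last by rewrite addr0.
by have := unitzP a b (-1) 0 0; rewrite scaler0 addr0 scaleN1r addNr.
Qed.

Let g_lin a b : linear (fun x => sc (unitz a b x)).
Proof. by move=> t x y; rewrite unitzP scD scZ. Qed.

Let g_bd a b : exists K : R, forall x, cabs (sc (unitz a b x)) <= K * nrm x.
Proof.
exists (2 * m%:R + 2 * m%:R) => x; rewrite mulrDl.
have ab y : `|s (unitz a b y)| <= 2 * m%:R * nrm y.
  rewrite ler_norml s_unitz andbT lerNl -sN -scaleN1r -unitzZ.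
  by apply: le_trans (s_unitz _ _ _) _; rewrite nrmZ // cabsN cabs1 mul1r.
apply: le_trans (cabs_Re_Im _) _; rewrite sc_re sc_im normrN; apply: lerD; first exact: ab.
by rewrite -unitzZ; apply: le_trans (ab _) _; rewrite nrmZ // cabs_i mul1r.
Qed.

Let g a b : D := mkdual (g_lin a b) (g_bd a b).
Let F' : 'M[D]_N := \matrix_(a, b) g a b.

(** The value of F' at x on two vectors is [sc] at this compression of x. Its form at zeta is the
    form of x at the combinations [ztv], so that positivity and contractivity of x pass to F'. *)
Let T k (x : 'M[X]_k) (xi eta : powPH (cvPH R k) N) : 'M[X]_N :=
  \matrix_(a, b) bicomb x (xi b) (eta a).

Let matform_F' k (x : 'M[X]_k) xi eta :
  matform (map_mx (evmx x) F') xi eta = sc (funmx (T x xi eta)).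
Proof.
rewrite matform_evmx -sum_unitz sc_sum; apply: eq_bigr => a _.
by rewrite sc_sum; apply: eq_bigr => b _; rewrite !mxE.
Qed.

Let ztv k (xi : powPH (cvPH R k) N) (zeta : powPH V N) : powPH V k :=
  fun q => \sum_b xi b q 0 *: zeta b.

Let T_form k (x : 'M[X]_k) xi eta zeta zeta' :
  nf (T x xi eta) zeta zeta' = nf x (ztv xi zeta) (ztv eta zeta').
Proof.
rewrite /nform !mformE.
transitivity (\sum_p \sum_q \sum_a \sum_b
  ((eta a p 0)^*%C * xi b q 0) * pip (B (x p q) (zeta b)) (zeta' a)); last first.
  apply: eq_bigr => p' _; apply: eq_bigr => q _; rewrite pip_sumr; apply: eq_bigr => a _.
  rewrite (@op_vsum R X unit _ _ rp tt) pip_suml; apply: eq_bigr => b _.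
  by rewrite BvZ pipZl pipZr mulrA [xi b q 0 * _]mulrC.
transitivity (\sum_a \sum_b \sum_p \sum_q
  ((eta a p 0)^*%C * xi b q 0) * pip (B (x p q) (zeta b)) (zeta' a)).
  apply: eq_bigr => a _; apply: eq_bigr => b _.
  rewrite mxE (@op_sum R X unit _ _ rp tt) pip_suml; apply: eq_bigr => p' _.
  rewrite (@op_sum R X unit _ _ rp tt) pip_suml; apply: eq_bigr => q _.
  by rewrite (@op_Z R X unit _ _ rp tt) pipZl.
rewrite pair_big /= [RHS]pair_big /=.
under eq_bigr => ab _ do rewrite pair_big /=.
rewrite exchange_big; apply: eq_bigr => pq _ /=.
by rewrite [RHS]pair_big.
Qed.

Let F'_pos : mpos F'.
Proof.
apply/(dual_posP hS); split.
  apply/matrixP => a b; rewrite mxstarE; apply: dual_ext => x.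
  rewrite (dual_mstarE hS) !mxE !mkdualE -sc_star; congr sc.
  rewrite /starz /unitz /= trmx0 map_mx0; congr pair.
  apply/funext => i; apply/funext => j; rewrite andbC.
  by case: ifP => _; rewrite ?(mstar0 (smos_star hS)) // (mstarK (smos_star hS)).
move=> k x xp xi; rewrite -[X in 0 <= X]/(matform _ xi xi) matform_F'.
apply: sc_ge0 => zeta; rewrite /cform scform0 addr0 funmxK T_form; exact: pp.
Qed.

(** The functional on the scalar part as a matrix: it plays the role of F'(1). *)
Let Qm : 'M[C]_N := \matrix_(a, b) sc (0, delta_mx a b).

Let sc_Qm M : sc (0, M) = \sum_a \sum_b M a b * Qm a b.
Proof.
have e : (0, M) = \sum_a \sum_b M a b *: ((0, delta_mx a b) : Z).
  apply: injective_projections => /=.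
    apply/funext => i; apply/funext => j; rewrite fst_sum big1 // => a _.
    by rewrite fst_sum big1 // => b _; rewrite -[LHS]/(M a b *: (0 : X)) scaler0.
  rewrite snd_sum {1}[M]matrix_sum_delta; apply: eq_bigr => a _.
  by rewrite snd_sum.
rewrite e sc_sum; apply: eq_bigr => a _; rewrite sc_sum; apply: eq_bigr => b _.
by rewrite scZ mxE.
Qed.

Let sc_Qm_form k (xi : powPH (cvPH R k) N) : sc (0, gram xi) = scform Qm xi.
Proof.
by rewrite sc_Qm; apply: eq_bigr => a _; apply: eq_bigr => b _; rewrite mulrC.
Qed.

Let gram_form k (xi : powPH (cvPH R k) N) zeta :
  cform (0, gram xi) zeta = (vnorm (ztv xi zeta) ^+ 2)%:C.
Proof.
have e0 : opmx (0, gram xi) = 0 by apply/matrixP => i j; rewrite !mxE.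
rewrite /cform e0 (nform0 rp) add0r -pip_vnorm /scform /=.
under [RHS]eq_bigr => q _ do rewrite pip_sumr.
rewrite [RHS]exchange_big; apply: eq_bigr => a _ /=.
under [RHS]eq_bigr => q _ do rewrite pip_suml.
rewrite [RHS]exchange_big; apply: eq_bigr => b _ /=.
rewrite !mxE /= /cvdot mulr_suml; apply: eq_bigr => q _.
by rewrite pipZl pipZr mulrA.
Qed.

Let Qm_psd : psd Qm.
Proof.
split=> [|v].
  apply/matrixP => a b; rewrite !mxE -[LHS]/((sc _)^*%C) -sc_star; congr sc.
  rewrite /starz /=; congr pair.
    by apply/funext => i; apply/funext => j; exact: (mstar0 (smos_star hS)).
  apply/matrixP => i j; rewrite !mxE andbC; case: (_ && _) => /=; first exact: conjc_1.
  exact: conjc_0.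
pose xi : powPH (cvPH R 1) N := fun a => const_mx (v a 0).
rewrite scform_const.
rewrite -sc_Qm_form; apply: sc_ge0 => zeta.
by rewrite gram_form ler0c sqr_ge0.
Qed.

Let s_diag A1 A2 : psd A1 -> psd A2 ->
  s (0, block_mx A1 0 0 A2) <= complex.Re (\tr A1) + complex.Re (\tr A2).
Proof.
move=> p1 p2; apply: le_trans (sp _) _; apply: p_le; exists 0, A1, A2.
have p0 : pairing 0 = 0 by rewrite /pairing big1 // => i _; rewrite big1 // => j _; rewrite mxE dualf0.
split=> // [|zeta]; first by rewrite p0 subr0.
have e0 : opmx (0, block_mx A1 0 0 A2) = 0 by apply/matrixP => i j; rewrite !mxE.
by rewrite /corner block_mx0 /cform e0 !(nform0 rp) addr0 add0r.
Qed.

Let compression_psd (u : 'M[C]_(N, m)) :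
  (forall v : 'cV[C]_m, s (0, gram ((fun a => const_mx ((u *m v) a 0)) : powPH (cvPH R 1) N)) <=
    complex.Re ((v^t* *m v) 0 0)) -> u^t* *m u = 1%:M ->
  psd (1%:M - u^t* *m Qm *m u).
Proof.
move=> h uu; have [Qh _] := Qm_psd; split=> [|v].
  rewrite adjmxD trmx1 map_mx1 linearN /= map_mxN !adjmxM trmxCK Qh.
  by rewrite mulmxA.
pose w := u *m v; pose xi : powPH (cvPH R 1) N := fun a => const_mx (w a 0).
have wE : (v^t* *m (u^t* *m Qm *m u) *m v) 0 0 = scform Qm xi.
  rewrite -scform_const; congr ((_ : 'M[C]_1) 0 0).
  by rewrite /w adjmxM !mulmxA.
rewrite mulmxBr mulmxBl mulmx1 mxE [X in _ + X]mxE wE -sc_Qm_form.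
have q0 : 0 <= sc (0, gram xi).
  by apply: sc_ge0 => zeta; rewrite gram_form ler0c sqr_ge0.
have v0 : 0 <= (v^t* *m v) 0 0.
  rewrite mxE; apply: sumr_ge0 => i _.
  by rewrite !mxE mulrC [X in 0 <= X]mulC_conj ler0c sqr_ge0.
rewrite subr_ge0 (cge0E q0) (cge0E v0) lecR sc_re; exact: h.
Qed.

Let scform_Qm_le (e : R) (c : 'M[C]_N) k (u : powPH (cvPH R k) N) : 0 < e -> c \in unitmx ->
  Qm + e%:C%:M = c^t* *m c -> s (0, gram (mxact (invmx c) u)) <= vnorm u ^+ 2.
Proof.
move=> e0 cu cE; rewrite -sc_re sc_Qm_form.
have := scform_sq c (mxact (invmx c) u).
rewrite mxact_comp mulmxV // mxact1 -cE scformD scform_scalar => /(congr1 (@complex.Re R)).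
rewrite ReD ReZ /= => <-; rewrite lerDl mulr_ge0 ?sqr_ge0 //; exact: ltW.
Qed.

(** A contraction x satisfies 2 Re <x u, w> <= |u|^2 + |w|^2. By monotonicity of s this becomes 2 Re
    F'(x)(u', w') <= Qm(u', u') + Qm(w', w'), and dividing by a factor of Qm + e turns the
    right-hand side into a bound by |u|^2 + |w|^2. *)
Let F_bound (e : R) (c : 'M[C]_N) : 0 < e -> c \in unitmx -> Qm + e%:C%:M = c^t* *m c ->
  mnorm (mxcompr (invmx c) (invmx c) F' : 'M[D]_N) <= 1.
Proof.
move=> e0 cu cE; set d := invmx c; set F := mxcompr d d F'.
apply/(dual_sup os _ ler01) => k x x1; apply/matC_le => // xi eta.
apply: (polar_bound (V := powPH (cvPH R k) N) (W := powPH (cvPH R k) N)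
  (s := matform (map_mx (evmx x) F))) => //; first exact: matform_vZ.
  by move=> t u w; rewrite matform_vZr conjR.
move=> u w; rewrite mul1r.
have -> : matform (map_mx (evmx x) F) u w =
    matform (map_mx (evmx x) F') (mxact d u) (mxact d w).
  by rewrite -!(@nform_dual_op R X _ _ _ x1) (nform_mxcompr (dual_op_rep X)).
rewrite matform_F' sc_re; set u' := mxact d u; set w' := mxact d w.
apply: le_trans (lerD (scform_Qm_le u e0 cu cE) (scform_Qm_le w e0 cu cE)).
rewrite -/d -/u' -/w' -subr_ge0 -sZ -sN -!sD; apply: s_ge0 => zeta.
have cD z z' : cform (z + z') zeta = cform z zeta + cform z' zeta.
  by have := cformP 1 z z' zeta; rewrite scale1r mul1r.
rewrite -scaleN1r scalerA cD cD !gram_form.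
have := cformP (-1 * 2%:C) (funmx (T x u' w')) 0 zeta; rewrite !addr0 cform0 addr0 => ->.
have -> : cform (funmx (T x u' w')) zeta = nf x (ztv u' zeta) (ztv w' zeta).
  by rewrite /cform scform0 addr0 funmxK T_form.
have h := @nform_le R X unit _ _ nb tt k x (ztv u' zeta) (ztv w' zeta).
have h1 : cabs (nf x (ztv u' zeta) (ztv w' zeta)) <= vnorm (ztv u' zeta) * vnorm (ztv w' zeta).
  by apply: le_trans h _; rewrite ler_piMl // mulr_ge0 ?vnorm_ge0.
have {h1} := le_trans (Re_le_cabs _) h1.
have := sqr_ge0 (vnorm (ztv u' zeta) - vnorm (ztv w' zeta)).
rewrite mulN1r mulNr !ReD ReN ReZ sqrrB /= -[_ *+ 2]mulr_natl.
set P := vnorm (ztv u' zeta); set P' := vnorm (ztv w' zeta); set r := complex.Re _; lra.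
Qed.

(** The two block columns select the upper right block of F'. There s is Re f, and the real part
    determines a complex-linear functional. *)
Let f_corner : f = mxcompr (col_mx 1%:M 0) (col_mx 0 1%:M) F'.
Proof.
apply/matrixP => i j; rewrite mxE.
have cE (p' : 'I_N) (k : 'I_m) :
    ((col_mx 1%:M 0 : 'M[C]_(N, m)) p' k)^*%C = (p' == lshift m k)%:R.
  case: (split_ordP p') => l ->.
    by rewrite col_mxEu mxE eq_lshift; case: (l == k); [exact: conjc_1|exact: conjc_0].
  by rewrite col_mxEd mxE eq_rlshift conjc_0.
have cE' (q : 'I_N) (k : 'I_m) :
    (col_mx 0 1%:M : 'M[C]_(N, m)) q k = (q == rshift m k)%:R.
  case: (split_ordP q) => l ->; first by rewrite col_mxEu mxE eq_lrshift.
  by rewrite col_mxEd mxE eq_rshift.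
rewrite (bigD1 (lshift m i)) //= [X in _ + X]big1 ?addr0 => [|p' pi]; last first.
  by rewrite big1 // => q _; rewrite cE (negbTE pi) mul0r scale0r.
rewrite (bigD1 (rshift m j)) //= [X in _ + X]big1 ?addr0 => [|q qj]; last first.
  by rewrite cE' (negbTE qj) mulr0 scale0r.
rewrite cE cE' !eqxx mulr1 scale1r mxE; apply: dual_ext => x; rewrite mkdualE.
pose Y y : 'M[X]_m := \matrix_(k, l) if (k == i) && (l == j) then y else 0.
have uE y : unitz (lshift m i) (rshift m j) y = funmx (corner (Y y)).
  congr pair; apply/funext => k; apply/funext => l.
  case: (split_ordP k) => k' ->; case: (split_ordP l) => l' ->.
  - by rewrite block_mxEul mxE eq_lrshift andbF.
  - by rewrite block_mxEur mxE eq_lshift eq_rshift.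
  - by rewrite block_mxEdl mxE eq_rlshift.
  - by rewrite block_mxEdr mxE eq_rlshift.
have pE y : pairing (Y y) = complex.Re (val (f i j) y).
  rewrite /pairing (bigD1 i) //= [X in _ + X]big1 => [|k ki]; last first.
    by rewrite big1 // => l _; rewrite mxE (negbTE ki) dualf0.
  rewrite (bigD1 j) //= [X in _ + X + _]big1 => [|l lj]; last first.
    by rewrite mxE (negbTE lj) andbF dualf0.
  by rewrite mxE !eqxx !addr0.
apply/eqP; rewrite eq_complex sc_re sc_im -unitzZ !uE !s_corner !pE dualfZ Re_i opprK.
by rewrite !eqxx.
Qed.

Let corner_psd (e : R) (c : 'M[C]_N) (u : 'M[C]_(N, m)) : Qm + e%:C%:M = c^t* *m c ->
  u^t* *m u = 1%:M -> psd (1%:M - u^t* *m Qm *m u) ->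
  psd ((1 + e)%:C%:M - (c *m u)^t* *m (c *m u)).
Proof.
move=> cE uu; congr psd.
rewrite adjmxM mulmxA -[_ *m _ *m c]mulmxA -cE mulmxDr mulmxDl mul_mx_scalar -scalemxAl uu.
have -> : (1 + e)%:C%:M = 1%:M + e%:C%:M :> 'M[C]_m by rewrite rmorphD rmorph1 raddfD.
by rewrite scalemx1 opprD addrACA subrr addr0.
Qed.

(** With c^* c = Qm + e, the matrices a and b are the two block columns of c. They are almost
    contractive because s is at most the trace on diagonal blocks, which bounds the diagonal blocks
    of Qm by 1. *)
Lemma factorization_of_functional (e : R) : 0 < e ->
  exists (F : 'M[D]_N) (a b : 'M[C]_(N, m)),
  [/\ mpos F, mnorm F <= 1, f = mxcompr a b F,
     psd ((1 + e)%:C%:M - a^t* *m a) & psd ((1 + e)%:C%:M - b^t* *m b)].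
Proof.
move=> e0; have [c cu cE] := psd_eps_factor Qm_psd e0; pose d := invmx c.
have trE (v : 'cV[C]_m) : \tr (gram ((fun i => const_mx (v i 0)) : powPH (cvPH R 1) m)) =
    (v^t* *m v) 0 0.
  by rewrite /mxtrace mxE; apply: eq_bigr => i _; rewrite !mxE /= /cvdot big_ord1 !mxE mulrC.
have p0 : psd (0 : 'M[C]_m) by split=> [|v]; rewrite ?trmx0 ?map_mx0 // mulmx0 mul0mx mxE.
exists (mxcompr d d F'), (c *m col_mx 1%:M 0), (c *m col_mx 0 1%:M); split.
- have := @smos_sum _ _ (dual_smos hS) N N 1 (fun=> d) (fun=> F') (fun=> F'_pos).
  by rewrite big_ord1.
- exact: F_bound e0 cu cE.
- by rewrite mxcompr_comp !mulmxA mulVmx // !mul1mx -f_corner.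
- have uu : (col_mx 1%:M 0 : 'M[C]_(N, m))^t* *m col_mx 1%:M 0 = 1%:M.
    by rewrite tr_col_mx map_row_mx trmx1 trmx0 map_mx1 map_mx0 mul_row_col mul1mx mul0mx addr0.
  refine (corner_psd cE uu (compression_psd _ uu)) => v.
  have -> : gram ((fun a => const_mx ((col_mx 1%:M 0 *m v) a 0)) : powPH (cvPH R 1) N) =
      block_mx (gram ((fun i => const_mx (v i 0)) : powPH (cvPH R 1) m)) 0 0 0.
    rewrite mul_col_mx mul1mx mul0mx; apply/matrixP => k l; rewrite gram_const.
    case: (split_ordP k) => k' ->; case: (split_ordP l) => l' ->;
      rewrite ?block_mxEul ?block_mxEur ?block_mxEdl ?block_mxEdr ?col_mxEu ?col_mxEd;
      by rewrite ?gram_const // ![(0 : 'M[C]_(_, _)) _ _]mxE ?conjc_0 ?mul0r ?mulr0.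
  apply: le_trans (s_diag (gram_psd _) p0) _.
  by rewrite linear0 /= addr0 trE.
- have uu : (col_mx 0 1%:M : 'M[C]_(N, m))^t* *m col_mx 0 1%:M = 1%:M.
    by rewrite tr_col_mx map_row_mx trmx1 trmx0 map_mx1 map_mx0 mul_row_col mul1mx mul0mx add0r.
  refine (corner_psd cE uu (compression_psd _ uu)) => v.
  have -> : gram ((fun a => const_mx ((col_mx 0 1%:M *m v) a 0)) : powPH (cvPH R 1) N) =
      block_mx 0 0 0 (gram ((fun i => const_mx (v i 0)) : powPH (cvPH R 1) m)).
    rewrite mul_col_mx mul1mx mul0mx; apply/matrixP => k l; rewrite gram_const.
    case: (split_ordP k) => k' ->; case: (split_ordP l) => l' ->;
      rewrite ?block_mxEul ?block_mxEur ?block_mxEdl ?block_mxEdr ?col_mxEu ?col_mxEd;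
      by rewrite ?gram_const // ![(0 : 'M[C]_(_, _)) _ _]mxE ?conjc_0 ?mul0r ?mulr0.
  apply: le_trans (s_diag p0 (gram_psd _)) _.
  by rewrite linear0 /= add0r trE.
Qed.
End Functional.

(* Wittstock's factorization: a completely contractive map into matrices is the
   compression of a completely positive contraction by almost contractive matrices. *)
Theorem wittstock_factorization (e : R) : 0 < e ->
  exists (F : 'M[D]_N) (a b : 'M[C]_(N, m)),
  [/\ mpos F, mnorm F <= 1, f = mxcompr a b F,
     psd ((1 + e)%:C%:M - a^t* *m a) & psd ((1 + e)%:C%:M - b^t* *m b)].
Proof.
move=> e0; have [s [sD sZ sp]] := hahn_banach p_sublinear.
exact: (factorization_of_functional sD sZ sp).
Qed.
End Wittstock.

(** * Hilbert spaces *)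

Definition ph_complete (R : realType) (V : preHilbert R) : Prop := forall u : nat -> V,
  (forall e : R, 0 < e ->
     exists N, forall p q, (N <= p)%N -> (N <= q)%N -> vnorm (u p - u q) < e) ->
  exists x, forall e : R, 0 < e -> exists N, forall p, (N <= p)%N -> vnorm (u p - x) < e.

Lemma natinv_lt (R : realType) (e : R) : 0 < e ->
  exists N, forall n, (N <= n)%N -> n.+1%:R^-1 < e.
Proof.
move=> e0; exists (truncn e^-1) => n Nn.
rewrite invf_plt ?posrE // ?ltr0n //; apply: lt_le_trans (truncnS_gt _) _.
by rewrite ler_nat ltnS.
Qed.

(* The representing vector is the limit of a minimising sequence of
   |x|^2 - 2 Re (phi x), which is Cauchy by the parallelogram identity. *)
Lemma Riesz (R : realType) (V : preHilbert R) (phi : V -> R[i]) (K : R) :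
  ph_complete V ->
  (forall a x y, phi (a *: x + y) = a * phi x + phi y) ->
  (forall x, cabs (phi x) <= K * vnorm x) ->
  exists y, forall x, phi x = pip x y.
Proof.
move=> cV lin bd; pose J x := vnorm x ^+ 2 - 2 * complex.Re (phi x).
have phiZ a x : phi (a *: x) = a * phi x.
  have p0 : phi 0 = 0 by have := lin (-1) 0 0; rewrite scaler0 addr0 mulN1r addNr.
  by have := lin a x 0; rewrite !addr0 p0 addr0.
have phiD x y : phi (x + y) = phi x + phi y by have := lin 1 x y; rewrite scale1r mul1r.
have JD x t h : J (x + t%:C *: h) =
    J x + t ^+ 2 * vnorm h ^+ 2 + 2 * t * (complex.Re (pip x h) - complex.Re (phi h)).
  rewrite /J vnorm_sqD vnormZ cabsR exprMn real_normK ?num_real // phiD phiZ ReD ReZ pipZr conjR ReZ; ring.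
have Jge x : - K ^+ 2 <= J x.
  have := le_trans (Re_le_cabs _) (bd x); rewrite /J.
  have := sqr_ge0 (vnorm x - K); rewrite sqrrB; lra.
have hi : has_inf [set J x | x in [set: V]].
  by split; [exists (J 0), 0|exists (- K ^+ 2) => _ [x _ <-]].
have dJ x : inf [set J x | x in [set: V]] <= J x by apply: ge_inf; [case: hi|exists x].
move: dJ; set d := inf _ => dJ.
have /choice[u hu] n : exists x, J x <= d + n.+1%:R^-1.
  have n0 : 0 < n.+1%:R^-1 :> R by rewrite invr_gt0 ltr0n.
  have [_ [x _ <-] h] := @inf_adherent _ _ _ n0 hi.
  by exists x; exact: ltW.
have par x y : vnorm (x - y) ^+ 2 <= 2 * (J x - d) + 2 * (J y - d).
  have := dJ (2^-1 *: (x + y)); rewrite /J.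
  have -> : 2^-1 = (2^-1 : R)%:C :> R[i] by rewrite fmorphV rmorphMn /=.
  rewrite vnormZ cabsR exprMn real_normK ?num_real // phiZ ReZ phiD ReD.
  rewrite !vnorm_sqD vnormN pipNr ReN.
  set a := vnorm x ^+ 2; set b := vnorm y ^+ 2; lra.
have [e e0|x ux] := cV u.
  have [N hN] := @natinv_lt R (e ^+ 2 / 4) (divr_gt0 (exprn_gt0 2 e0) (ltr0Sn _ 3)).
  exists N => p q Np Nq; rewrite -(@ltr_pXn2r _ 2) ?nnegrE ?vnorm_ge0 ?(ltW e0) //.
  have := par (u p) (u q); have := hu p; have := hu q; have := hN p Np; have := hN q Nq.
  set a := p.+1%:R^-1; set b := q.+1%:R^-1; lra.
have key h : complex.Re (phi h) = complex.Re (pip h x).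
  rewrite [pip h x]pip_herm Re_conj; set c := complex.Re (pip x h).
  have ineq t : 0 <= t ^+ 2 * vnorm h ^+ 2 + 2 * t * (c - complex.Re (phi h)).
    apply/ler_addgt0Pr => e e0.
    have [N1 hN1] := @natinv_lt R (e / 2) (divr_gt0 e0 (ltr0Sn _ 1)).
    have k0 : 0 < `|2 * t| * vnorm h + 1.
      by rewrite ltr_wpDl // mulr_ge0 // vnorm_ge0.
    have [N2 hN2] := ux (e / 2 / (`|2 * t| * vnorm h + 1)) (divr_gt0 (divr_gt0 e0 (ltr0Sn _ 1)) k0).
    have := hN1 _ (leq_maxl N1 N2); have := hN2 _ (leq_maxr N1 N2).
    set n := maxn N1 N2 => h2 h1; have := dJ (u n + t%:C *: h); rewrite JD.
    have := hu n.
    have h3 : 2 * t * (complex.Re (pip (u n) h) - c) <= e / 2.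
      have -> : complex.Re (pip (u n) h) - c = complex.Re (pip (u n - x) h).
        by rewrite pipDl pipNl ReD ReN.
      apply: le_trans (ler_norm _) _; rewrite normrM.
      have l1 : `|complex.Re (pip (u n - x) h)| <= vnorm (u n - x) * vnorm h.
        apply: le_trans _ (CauchySchwarz _ _); rewrite ler_norml Re_le_cabs andbT.
        by rewrite lerNl -ReN -(cabsN (pip _ _)) Re_le_cabs.
      apply: le_trans (ler_wpM2l (normr_ge0 _) l1) _.
      move/ltW: h2; rewrite ler_pdivlMr // => h2; apply: le_trans h2.
      rewrite mulrCA ler_wpM2l ?vnorm_ge0 //; lra.
    move: h1 h3; set A := J (u n); set B := t ^+ 2 * _; set z := n.+1%:R^-1; lra.
  have a0 : 0 <= vnorm h ^+ 2 by rewrite sqr_ge0.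
  (* The denominator |h|^2 + 1 cannot vanish. With a = |h|^2 and z = Re (phi h), this t gives the
     quadratic the value -(z - c)^2 (a + 2) / (a + 1)^2, which forces z = c. *)
  have := ineq ((complex.Re (phi h) - c) / (vnorm h ^+ 2 + 1)).
  move: a0; set a := vnorm h ^+ 2; set z := complex.Re (phi h) => a0.
  have b0 : 0 < a + 1 by lra.
  have -> : ((z - c) / (a + 1)) ^+ 2 * a + 2 * ((z - c) / (a + 1)) * (c - z) =
      - ((z - c) ^+ 2 * (a + 2)) / (a + 1) ^+ 2 by field; rewrite gt_eqF.
  rewrite ler_pdivlMr ?exprn_gt0 // mul0r oppr_ge0 pmulr_lle0 ?ltr_wpDl // => hz.
  by apply/subr0_eq/eqP; rewrite -sqrf_eq0 eq_le hz sqr_ge0.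
exists x => h; apply/eqP; rewrite eq_complex key eqxx /=.
by have := key ('i%C *: h); rewrite phiZ pipZl !Re_i => /oppr_inj ->.
Qed.

Section HilbertSpace.
Variables (R : realType) (H : hilbert R).
Local Notation C := R[i].

Lemma hip_lin (a : C) (x y z : H) : hip (a *: x + y) z = a * hip x z + hip y z.
Proof. by rewrite linearDl /= linearZl_LR. Qed.
Lemma hip_herm (x y : H) : hip x y = (hip y x)^*%C.
Proof. by rewrite hermC /= expr0 mul1r. Qed.
Lemma hip_ge0 (x : H) : 0 <= hip x x.
Proof. exact: dnorm_ge0. Qed.

Definition hilbPH : preHilbert R := PreHilbert hip_lin hip_herm hip_ge0.

Lemma hilb_normE (x : H) : `|x| = (vnorm (x : hilbPH))%:C.
Proof.
apply/eqP; rewrite -(@eqrXn2 _ 2) ?normr_ge0 ?ler0c ?vnorm_ge0 // hilbert_normE.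
by have := pip_vnorm (x : hilbPH); rewrite rmorphXn => /= ->.
Qed.

Lemma hilb_vnorm_eq0 (x : hilbPH) : vnorm x = 0 -> x = 0.
Proof. by move=> x0; apply/eqP; rewrite -(@normr_eq0 _ H) hilb_normE x0. Qed.

Lemma hilb_complete : ph_complete hilbPH.
Proof.
move=> u cu.
have : cauchy ((u : nat -> H) @ \oo).
  apply/cauchy_ballP => e e0.
  have er : 0 < complex.Re e by move: e0; rewrite ltcE /= => /andP[].
  have eE : e = (complex.Re e)%:C by rewrite -cge0E // ltW.
  have [N hN] := cu _ er.
  exists (u @` [set p | (N <= p)%N], u @` [set p | (N <= p)%N]).
    by split; exists N => // p /= Np; exists p.
  move=> [x y] [[p /= Np <-] [q /= Nq <-]] /=.
  by rewrite -ball_normE /ball_ /= eE hilb_normE ltcR; exact: hN.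
move/cauchy_cvg => /cvg_ex[x ux]; exists x => e e0.
have ec : 0 < e%:C :> C by rewrite ltcR.
have /cvgrPdist_lt /(_ _ ec) [N _ hN] := ux.
by exists N => p Np; have := hN p Np; rewrite hilb_normE ltcR vnormBC.
Qed.
End HilbertSpace.

(** The common abstraction of L(H), its self-adjoint subspaces and a represented C*-algebra: a
    single space from which norm, involution and cone are read off. *)
Record opsys_rep (R : realType) (X : smosData R) (V : preHilbert R) (B : X -> V -> V) : Prop :=
  OpsysRep {
    or_nb : normed_by (fun _ : unit => B);
    or_adj : forall x v w, pip (B (mstar x) v) w = pip v (B x w);
    or_pos : forall n (x : 'M[X]_n),
      mpos x <-> forall xi, 0 <= nform (fun _ : unit => B) tt x xi xi }.

Section OpsysRep.
Variables (R : realType) (X : smosData R) (V : preHilbert R) (B : X -> V -> V).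
Hypothesis rB : opsys_rep B.
Local Notation C := R[i].
Local Notation F := (nform (fun _ : unit => B) tt).

Let nb := or_nb rB.
Let rp := nb_rep nb.

Let BD x y v : B (x + y) v = B x v + B y v.
Proof. exact: (@op_D R X unit _ _ rp tt). Qed.
Let BZ a x v : B (a *: x) v = a *: B x v.
Proof. exact: (@op_Z R X unit _ _ rp tt). Qed.
Let BN x v : B (- x) v = - B x v.
Proof. by rewrite -scaleN1r BZ scaleN1r. Qed.
Let Bv0 x : B x 0 = 0.
Proof. exact: (@op_v0 R X unit _ _ rp tt). Qed.
Let FN n (x : 'M[X]_n) xi eta : F (- x) xi eta = - F x xi eta.
Proof.
rewrite /nform !mformE -sumrN; apply: eq_bigr => i _; rewrite -sumrN.
by apply: eq_bigr => j _; rewrite mxE BN pipNl.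
Qed.
Let FD n (x y : 'M[X]_n) xi eta : F (x + y) xi eta = F x xi eta + F y xi eta.
Proof. exact: (@nformD R X unit _ _ rp tt). Qed.
Let F0 n xi eta : F (0 : 'M[X]_n) xi eta = 0.
Proof. exact: (@nform0 R X unit _ _ rp tt). Qed.
Let Fle n (x : 'M[X]_n) xi eta : cabs (F x xi eta) <= mnorm x * (vnorm xi * vnorm eta).
Proof. exact: (@nform_le R X unit _ _ nb tt). Qed.

Lemma nform_delta n (x : 'M[X]_n) i j v w : F x (delta_vec j v) (delta_vec i w) = pip (B (x i j) v) w.
Proof.
rewrite /nform mformE (bigD1 i) //= [X in X + _](bigD1 j) //=.
rewrite [X in _ + X + _]big1 => [|k kj]; last first.
  by rewrite /delta_vec (negbTE kj) Bv0 pip0l.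
rewrite big1 => [|k ki]; last by rewrite big1 // => l _; rewrite /delta_vec (negbTE ki) pip0r.
by rewrite !addr0 /delta_vec !eqxx.
Qed.

Lemma nform_sep n (x y : 'M[X]_n) : (forall xi eta, F x xi eta = F y xi eta) -> x = y.
Proof.
move=> h; apply/matrixP => i j; apply/subr0_eq/(nb_sep nb) => -[] v w.
have := h (delta_vec j v) (delta_vec i w); rewrite !nform_delta => e.
by rewrite BD BN pipDl pipNl e subrr.
Qed.

Lemma nform_sesq n (x : 'M[X]_n) :
  (forall a xi zeta eta, F x (a *: xi + zeta) eta = a * F x xi eta + F x zeta eta) /\
  (forall a xi zeta eta, F x eta (a *: xi + zeta) = a^*%C * F x eta xi + F x eta zeta).
Proof.
split=> a xi zeta eta; rewrite /nform mform_pip; last first.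
  by rewrite pipDr pipZr -!mform_pip.
rewrite !mform_pip -pip_lin; congr pip; apply/funext => i.
change (\sum_j B (x i j) (a *: xi j + zeta j) =
  a *: \sum_j B (x i j) (xi j) + \sum_j B (x i j) (zeta j)).
rewrite scaler_sumr -big_split; apply: eq_bigr => j _ /=.
by rewrite (op_linv rp tt).
Qed.

Lemma rep_star_axioms : star_axioms X.
Proof.
split=> [x|c x y].
  apply/subr0_eq/(nb_sep nb) => -[] v w.
  rewrite BD BN pipDl pipNl (or_adj rB).
  by rewrite pip_herm (or_adj rB) -pip_herm subrr.
apply/subr0_eq/(nb_sep nb) => -[] v w.
rewrite BD BN pipDl pipNl (or_adj rB).
rewrite !BD !BZ pipDr pipZr pipDl pipZl.
by rewrite !(or_adj rB) subrr.
Qed.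

Lemma nform_star n (x : 'M[X]_n) xi eta : F (mxstar x) xi eta = (F x eta xi)^*%C.
Proof.
rewrite /nform !mformE conjc_sum exchange_big; apply: eq_bigr => i _.
rewrite conjc_sum; apply: eq_bigr => j _.
by rewrite !mxE (or_adj rB) pip_herm.
Qed.

Lemma rep_iso n (x : 'M[X]_n) : mnorm (mxstar x) = mnorm x.
Proof.
have le (y : 'M[X]_n) : mnorm (mxstar y) <= mnorm y.
  apply: (mnorm_le nb) => [|[] xi eta]; first exact: (nb_ge0 nb).
  by rewrite nform_star cabs_conj [X in _ * X]mulrC Fle.
by apply: le_anti; rewrite le -{1}[x](mxstarK rep_star_axioms) le.
Qed.

Lemma nform_diag0 n (x : 'M[X]_n) : (forall xi, F x xi xi = 0) -> x = 0.
Proof.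
move=> h; apply: nform_sep => xi eta; rewrite F0.
have [l r] := nform_sesq x.
exact: (@polarization0 R (powPH V n) (F x) l r h).
Qed.

(** If the diagonal form of x is real, that of x^* - x vanishes, and so does x^* - x by
    polarization. This supplies the self-adjointness that [rep_smos] asks for. *)
Lemma rep_posP n (x : 'M[X]_n) :
  mpos x <-> mxstar x = x /\ forall _ : unit, forall xi, 0 <= F x xi xi.
Proof.
split=> [/(or_pos rB) h|[_ h]]; last by apply/(or_pos rB) => xi; exact: h.
split=> //; apply/subr0_eq/nform_diag0 => xi.
by rewrite FD nform_star FN cge0_conj ?subrr.
Qed.

Lemma rep_is_mos : is_mos X.
Proof.
split.
  apply: (rep_smos (normed_by_os nb) rep_star_axioms rep_iso rp) => [n x|[] n xi].
    by rewrite rep_posP; split=> -[? h]; split=> // -[]; exact: h.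
  exists (vnorm xi * vnorm xi) => x; rewrite mulrC; exact: Fle.
move=> n x /(or_pos rB) p1 /(or_pos rB) p2; apply: nform_diag0 => xi.
by apply/le_anti/andP; split; [rewrite -oppr_ge0 -FN|].
Qed.
End OpsysRep.

Section LHRep.
Variables (R : realType) (H : hilbert R).
Local Notation C := R[i].
Local Notation V := (hilbPH H).

Lemma LH_valP a (S T : LH H) (v : H) : val (a *: S + T) v = a *: val S v + val T v.
Proof.
have -> // : val (a *: S + T) = a *: (val S : H -> H) + val T by rewrite linearP.
Qed.

Lemma LH_linear (T : LH H) : linear (val T : H -> H).
Proof. by have /asboolP[] := valP T. Qed.

Lemma LH_bounded (T : LH H) : exists2 K : R, 0 <= K &
  forall v : V, vnorm (val T v : V) <= K * vnorm v.
Proof.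
have /asboolP[_ [K hK]] := valP T; exists (Num.max 0 K); first by rewrite le_max lexx.
move=> v; have := hK v; rewrite (hilb_normE (val T v)) (hilb_normE v) -rmorphM lecR => h.
by apply: le_trans h _; rewrite ler_wpM2r ?vnorm_ge0 // le_max lexx orbT.
Qed.

Lemma mkLH (T : V -> V) : linear T -> (exists K : R, forall v, vnorm (T v) <= K * vnorm v) ->
  exists S : LH H, val S = T.
Proof.
move=> lT [K hK]; have bT : (T : H -> H) \in @bounded_op R H.
  by apply/asboolP; split=> //; exists K => x; rewrite !hilb_normE -rmorphM lecR.
by exists (exist (fun T => T \in @bounded_op R H) (T : H -> H) bT : LH H).
Qed.

Lemma adjoint_ex (T : LH H) : exists S : LH H, forall x y : H, hip (val T x) y = hip x (val S y).
Proof.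
have [K K0 hK] := LH_bounded T; have lT := LH_linear T.
have /choice[S hS] (y : V) : exists z : V, forall x : V, pip (val T x : V) y = pip x z.
  apply: (Riesz (@hilb_complete R H) (K := K * vnorm y)) => [a x z|x].
    by rewrite lT pip_lin.
  apply: le_trans (CauchySchwarz _ _) _.
  by rewrite mulrAC ler_wpM2r ?vnorm_ge0.
have uq (a b : V) : (forall x, pip x a = pip x b) -> a = b.
  move=> h; apply/subr0_eq/hilb_vnorm_eq0/eqP; rewrite -sqrf_eq0 vnorm_sq.
  by rewrite pipDr pipNr h subrr.
have [||S' S'E] := @mkLH S.
- by move=> a x y; apply: uq => z; rewrite -hS !(pipDr, pipZr) !hS.
- exists K => v; have := vnorm_ge0 (S v); rewrite le_eqVlt => /predU1P[<-|s0].
    by rewrite mulr_ge0 ?vnorm_ge0.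
  rewrite -(ler_pM2l s0) -expr2 vnorm_sq -hS.
  apply: le_trans (Re_le_cabs _) _; apply: le_trans (CauchySchwarz _ _) _.
  by rewrite mulrA [_ * K]mulrC ler_wpM2r ?vnorm_ge0.
- by exists S' => x y; rewrite S'E; exact: hS.
Qed.

Lemma adjointE (T : LH H) (x y : H) : hip (val T x) y = hip x (val (adjoint T) y).
Proof. exact: (xgetPex 0 (adjoint_ex T)). Qed.

Lemma LH_rep : opsys_rep (fun (T : LH H) (v : V) => val T v : V).
Proof.
have lb (n : nat) (x : 'M[LH H]_n) := @opnorm_ge R V n (fun i j => val (x i j))
  (fun i j => LH_linear (x i j)) (fun i j => let: ex_intro2 K _ h := LH_bounded (x i j) in ex_intro _ K h).
split.
- split=> [|n x|n x K K0|T h].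
  + split=> [_ a S T v|_ T]; [by rewrite LH_valP|exact: LH_linear].
  + exact: (lb n x).1.
  + split=> [h _ xi eta|h]; last by apply: (@opnorm_le R V n) => //; exact: (h tt).
    by apply: le_trans ((lb n x).2 xi eta) _; rewrite ler_wpM2r ?mulr_ge0 ?vnorm_ge0.
  + apply/val_inj/funext => v; apply: (@hilb_vnorm_eq0 R H); apply/eqP.
    by rewrite -sqrf_eq0 vnorm_sq (h tt).
- move=> T v w; rewrite pip_herm [RHS]pip_herm; congr (_^*%C); symmetry; exact: adjointE.
- by [].
Qed.
End LHRep.

(** * Concrete operator systems *)

Record concrete (R : realType) (S : smosData R) (H : hilbert R) (j : {linear S -> LH H}) : Prop :=
  Concrete {
    conc_inj : injective j;
    conc_norm : forall n (x : 'M[S]_n), mnorm x = mnorm (map_mx j x);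
    conc_star : forall x, j (mstar x) = mstar (j x);
    conc_pos : forall n (x : 'M[S]_n), mpos x <-> mpos (map_mx j x) }.

Section Concrete.
Variables (R : realType) (S : smosData R) (H : hilbert R) (j : {linear S -> LH H}).
Hypothesis cj : concrete j.
Local Notation V := (hilbPH H).

Definition conc_op (x : S) (v : V) : V := val (j x) v.

Lemma conc_rep : opsys_rep conc_op.
Proof.
have nbL := or_nb (LH_rep H).
have E n (x : 'M[S]_n) : (fun a b : 'I_n => conc_op (x a b)) =
    (fun a b => val (map_mx j x a b)).
  by apply/funext => a; apply/funext => b; rewrite mxE.
split.
- split=> [|n x|n x K K0|x h].
  + split=> [_ a x y v|_ x]; last exact: LH_linear.
    by rewrite /conc_op linearP LH_valP.
  + rewrite (conc_norm cj); exact: (nb_ge0 nbL).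
  + by rewrite (conc_norm cj) E; exact: (nb_le nbL).
  + apply: (conc_inj cj); rewrite linear0; apply: (nb_sep nbL) => -[]; exact: (h tt).
- by move=> x v w; rewrite /conc_op (conc_star cj); exact: (or_adj (LH_rep H)).
- by move=> n x; rewrite (conc_pos cj) /nform E; exact: (or_pos (LH_rep H)).
Qed.

End Concrete.

Section RangeMap.
Variables (R : realType) (S : smosData R) (H : hilbert R) (j : {linear S -> LH H}).

Definition range_map (x : S) : subsmos (lrange j) := exist _ (j x) (mem_lrange j x).

Lemma range_map_linear : linear range_map.
Proof. by move=> a x y; apply/val_inj; rewrite /= linearP. Qed.
HB.instance Definition _ := GRing.isLinear.Build R[i] S (subsmos (lrange j)) *:%R range_map range_map_linear.

Lemma range_map_val n (x : 'M[S]_n) : map_mx val (map_mx range_map x) = map_mx j x :> 'M[LH H]_n.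
Proof. by apply/matrixP => a b; rewrite !mxE. Qed.

Hypothesis j_inj : injective j.
Hypothesis j_star : forall x, j (mstar x) = mstar (j x).

Lemma lrange_selfadjoint : selfadjoint_subspace (lrange j).
Proof. by move=> T /asboolP[x <-]; rewrite -j_star; exact: mem_lrange. Qed.

Lemma range_map_star : star_preserving range_map.
Proof.
move=> x; apply: val_inj; rewrite /= /tosub val_insubd j_star.
by rewrite lrange_selfadjoint // mem_lrange.
Qed.

Lemma range_map_bij : bijective range_map.
Proof.
have /choice[g hg] (y : subsmos (lrange j)) : exists x, j x = val y by have /asboolP := valP y.
exists g => [x|y]; first by apply: j_inj; rewrite hg.
by apply: val_inj; rewrite /= hg.
Qed.

Lemma range_map_iso (K : R) :
  (forall n (x : 'M[S]_n), mpos x <-> mpos (map_mx j x)) ->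
  (forall n (x : 'M[S]_n), mnorm (map_mx j x) <= mnorm x) ->
  0 < K -> (forall n (x : 'M[S]_n), mnorm x <= K * mnorm (map_mx j x)) ->
  mos_isomorphism range_map.
Proof.
move=> jpos jn K0 nj; split; [exact: range_map_bij| |].
  split=> [|x y /(congr1 val)|n x _]; [exact: range_map_star|exact: j_inj|].
  by rewrite jpos -range_map_val.
split; first by exists 1 => n x; rewrite sub_mnorm range_map_val mul1r.
exists K^-1; first by rewrite invr_gt0.
by move=> n x; rewrite sub_mnorm range_map_val ler_pdivrMl.
Qed.
End RangeMap.

Lemma concrete_quasi (R : realType) (S : smosData R) (H : hilbert R) (j : {linear S -> LH H}) :
  concrete j -> quasi_operator_system S.
Proof.
move=> cj; split; first exact: (rep_is_mos (conc_rep cj)).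
exists H, (lrange j : submodClosed (LH H)); split.
  exact: (lrange_selfadjoint (conc_star cj)).
exists (range_map j : {linear S -> subsmos (lrange j)}).
apply: (range_map_iso (conc_inj cj) (conc_star cj) (conc_pos cj) _ ltr01) => n x.
  by rewrite (conc_norm cj).
by rewrite mul1r -(conc_norm cj).
Qed.

Definition sub_incl (R : realType) (X : smosData R) (W : submodClosed X) (x : subsmos W) : X := val x.

Lemma sub_incl_linear (R : realType) (X : smosData R) (W : submodClosed X) : linear (@sub_incl R X W).
Proof. by move=> a x y; rewrite /sub_incl sub_linear. Qed.
HB.instance Definition _ (R : realType) (X : smosData R) (W : submodClosed X) :=
  GRing.isLinear.Build R[i] (subsmos W) X *:%R (@sub_incl R X W) (@sub_incl_linear R X W).

Lemma subsmos_concrete (R : realType) (H : hilbert R) (W : submodClosed (LH H)) :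
  selfadjoint_subspace W -> concrete (@sub_incl R (LH H) W : {linear subsmos W -> LH H}).
Proof.
move=> sW; split=> // x.
change (val (tosub W (mstar (val x : LH H))) = mstar (val x : LH H)).
by rewrite /tosub val_insubd sW //; exact: valP.
Qed.

Lemma cstar_concrete (R : realType) (A : cstarAlgebra R) (H : hilbert R) (pi : faithful_rep A H) :
  @concrete R (cstar_smos pi) H pi.
Proof. by split=> //; [exact: rep_inj|exact: rep_star]. Qed.

(** * Recovering the matrix norm from the dual *)

Section Compression.
Variables (R : realType) (V : preHilbert R) (m : nat).
Local Notation C := R[i].

Definition vcomb (v : 'I_m -> V) (s : 'cV[C]_m) : V := \sum_k s k 0 *: v k.

Lemma vcomb_gram (v : powPH V m) (s : 'cV[C]_m) :
  pip (vcomb v s) (vcomb v s) = (s^t* *m gram v *m s) 0 0.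
Proof.
rewrite /vcomb pip_suml mxE; apply: eq_bigr => k _.
rewrite pip_sumr mxE mulr_suml; apply: eq_bigr => l _.
rewrite !mxE pipZl pipZr; ring.
Qed.

(* Replacing finitely many vectors by an almost orthonormal family with the same span. *)
Lemma orthonormalize (z : powPH V m) (e : R) : 0 < e ->
  exists (v : powPH V m) (c : 'M[C]_m),
    [/\ forall j, z j = vcomb v (col j c),
        forall s : cvPH R m, vnorm (vcomb v s) <= vnorm s
      & forall j, vnorm (col j c : cvPH R m) ^+ 2 = vnorm (z j) ^+ 2 + e].
Proof.
move=> e0; have [c cu cE] := psd_eps_factor (gram_psd z) e0.
pose v : powPH V m := fun k => vcomb z (col k (invmx c)).
have vE s : vcomb v s = vcomb z (invmx c *m s).
  rewrite /vcomb; under eq_bigr do rewrite scaler_sumr.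
  rewrite exchange_big; apply: eq_bigr => k _ /=; rewrite mxE scaler_suml.
  by apply: eq_bigr => l _; rewrite scalerA !mxE mulrC.
exists v, c; split=> [j|s|j].
- have cV : invmx c *m col j c = col j 1%:M by rewrite !colE mulmxA mulVmx.
  rewrite vE cV /vcomb (bigD1 j) //= big1 => [|k kj].
    by rewrite !mxE eqxx scale1r addr0.
  by rewrite !mxE (negbTE kj) scale0r.
- rewrite -(@ler_pXn2r _ 2) ?nnegrE ?vnorm_ge0 // !vnorm_sq vE vcomb_gram.
  set w := invmx c *m s.
  have -> : s = c *m w by rewrite mulmxA mulmxV // mul1mx.
  have -> : pip (c *m w : cvPH R m) (c *m w : cvPH R m) = (w^t* *m (gram z + e%:C%:M) *m w) 0 0.
    rewrite cE -!mulmxA mulmxA -adjmxM mxE; apply: eq_bigr => k _.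
    by rewrite !mxE mulrC.
  rewrite mulmxDr mulmxDl [in leRHS]mxE ReD lerDl.
  rewrite mul_mx_scalar -scalemxAl mxE ReZ; apply: mulr_ge0 (ltW e0) _.
  apply: cRe_ge0; rewrite mxE sumr_ge0 // => k _.
  by rewrite !mxE mulrC mulC_conj ler0c sqr_ge0.
- rewrite !vnorm_sq; have /matrixP/(_ j j) := cE; rewrite !mxE eqxx mulr1n.
  move/(congr1 (@complex.Re R)); rewrite ReD /= => ->.
  by congr complex.Re; apply: eq_bigr => k _; rewrite !mxE mulrC.
Qed.
End Compression.

Section RepDual.
Variables (R : realType) (X : smosData R) (V : preHilbert R) (B : X -> V -> V).
Hypothesis rB : opsys_rep B.
Local Notation C := R[i].
Local Notation F := (nform (fun _ : unit => B) tt).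

Let nb := or_nb rB.
Let rp := nb_rep nb.
Let os := normed_by_os nb.

Lemma vec_functional (v w : V) : exists f : dual X, forall x, val f x = pip (B x v) w.
Proof.
have lf : linear (fun x => pip (B x v) w : C^o).
  by move=> a x y; rewrite (@op_linx R X unit _ _ rp tt) pip_lin.
have bf : exists K : R, forall x, cabs (pip (B x v) w) <= K * nrm x.
  exists (vnorm v * vnorm w) => x; rewrite mulrC.
  have := @nform_le R X unit _ _ nb tt 1 (const_mx x) (delta_vec 0 v) (delta_vec 0 w).
  by rewrite (nform_delta rB) mxE !vnorm_delta.
by exists (mkdual lf bf) => x; rewrite mkdualE.
Qed.

Lemma matform_vec m (v : powPH V m) (f : 'M[dual X]_m) n (x : 'M[X]_n) s t :
  (forall k l y, val (f k l) y = pip (B y (v l)) (v k)) ->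
  matform (map_mx (evmx x) f) s t =
  F x (fun j => vcomb v (\col_l s l j 0)) (fun i => vcomb v (\col_k t k i 0)).
Proof.
move=> fE; rewrite matformE.
rewrite /nform mformE.
transitivity (\sum_(k < m) \sum_(l < m) \sum_(i < n) \sum_(j < n)
  pip (B (x i j) (v l)) (v k) * s l j 0 * (t k i 0)^*%C).
  apply: eq_bigr => k _; apply: eq_bigr => l _; apply: eq_bigr => i _; apply: eq_bigr => j _.
  by rewrite !mxE fE.
under eq_bigr => k _ do rewrite exchange_big.
rewrite exchange_big; apply: eq_bigr => i _ /=.
under eq_bigr => k _ do rewrite exchange_big.
rewrite exchange_big; apply: eq_bigr => j _ /=.
rewrite /vcomb pip_sumr; apply: eq_bigr => k _.
rewrite (@op_vsum R X unit _ _ rp tt) pip_suml; apply: eq_bigr => l _.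
rewrite !mxE (@op_vZ R X unit _ _ rp tt) pipZl pipZr; ring.
Qed.

(** The vector functionals of an almost orthonormal family form a contractive matrix f over the
    dual. If the family spans all [xi i] and [eta i], the form of x at (xi, eta) is the form of
    [f_kl(x)] at the coefficient vectors, whose norms are close to those of xi and eta. *)
Lemma rep_normed_by_dual : normed_by_dual X.
Proof.
move=> n x K K0 hK; apply: (mnorm_le nb K0) => -[] xi eta.
(* Both families of vectors are orthonormalised together, so that one matrix f of size 2n serves
   both arguments of the form. *)
pose z : powPH V (n + n) := fun k => match fintype.split k with inl i => xi i | inr i => eta i end.
have zl i : z (lshift n i) = xi i by rewrite /z (unsplitK (inl i)).
have zr i : z (rshift n i) = eta i by rewrite /z (unsplitK (inr i)).
suff key e : 0 < e ->
    cabs (F x xi eta) <= K * (Num.sqrt (vnorm xi ^+ 2 + n%:R * e) * Num.sqrt (vnorm eta ^+ 2 + n%:R * e)).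
  set a := vnorm xi in key *; set b := vnorm eta in key *.
  have a0 : 0 <= a by exact: vnorm_ge0.
  have b0 : 0 <= b by exact: vnorm_ge0.
  have d0 : 0 < K * (a + b + 1) + 1 by rewrite ltr_wpDl // mulr_ge0 // addr_ge0 ?addr_ge0.
  apply: le_cabs_approx => d dp; pose h := Num.min 1 (d / (K * (a + b + 1) + 1)).
  have h0 : 0 < h by rewrite lt_min ltr01 divr_gt0.
  have h1 : h <= 1 by rewrite ge_min lexx.
  have hd : h * (K * (a + b + 1) + 1) <= d by rewrite -ler_pdivlMr // ge_min lexx orbT.
  have n1 : 0 < n%:R + 1 :> R by rewrite ltr_wpDl.
  (* With e = h^2 / (n + 1) the added term n e is at most h^2, and the two square roots are at most
     a + h and b + h. *)
  apply: le_trans (key (h ^+ 2 / (n%:R + 1)) (divr_gt0 (exprn_gt0 _ h0) n1)) _.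
  have sq u : 0 <= u -> Num.sqrt (u ^+ 2 + n%:R * (h ^+ 2 / (n%:R + 1))) <= u + h.
    move=> u0; rewrite -[leRHS]ger0_norm ?addr_ge0 ?(ltW h0) // -sqrtr_sqr ler_wsqrtr //.
    have : n%:R * (h ^+ 2 / (n%:R + 1)) <= h ^+ 2.
      by rewrite mulrCA ler_piMr ?sqr_ge0 // ler_pdivrMr // mul1r lerDl.
    have := mulr_ge0 u0 (ltW h0); rewrite sqrrD; lra.
  apply: le_trans (ler_wpM2l K0 (ler_pM _ _ (sq a a0) (sq b b0))) _; rewrite ?sqrtr_ge0 //.
  have : K * (h * h) <= K * h by rewrite ler_wpM2l // ler_piMr ?(ltW h0).
  move: hd; nra.
move=> e0; have [v [c [zE v1 cE]]] := orthonormalize z e0.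
have /choice[f0 hf0] (kl : 'I_(n + n) * 'I_(n + n)) := vec_functional (v kl.2) (v kl.1).
pose f : 'M[dual X]_(n + n) := \matrix_(k, l) f0 (k, l).
have fE k l y : val (f k l) y = pip (B y (v l)) (v k) by rewrite mxE hf0.
have f1 : mnorm f <= 1.
  apply/(dual_sup os _ ler01) => p y y1; apply/(matC_le _ ler01) => s t.
  rewrite mul1r (matform_vec _ _ _ fE).
  apply: le_trans (@nform_le R X unit _ _ nb tt _ _ _ _) _.
  rewrite -[leRHS]mul1r; apply: ler_pM; rewrite ?mulr_ge0 ?vnorm_ge0 ?(nb_ge0 nb) //.
  have bd (u : powPH (cvPH R p) (n + n)) :
      vnorm ((fun j => vcomb v (\col_l u l j 0)) : powPH V p) <= vnorm u.
    rewrite -(@ler_pXn2r _ 2) ?nnegrE ?vnorm_ge0 // !pow_vnorm_sq.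
    under [leRHS]eq_bigr => l _ do rewrite cv_vnorm_sq.
    rewrite exchange_big; apply: ler_sum => j _ /=.
    apply: le_trans (_ : vnorm ((\col_l u l j 0) : cvPH R (n + n)) ^+ 2 <= _).
      by rewrite ler_pXn2r ?nnegrE ?vnorm_ge0.
    by rewrite cv_vnorm_sq; apply: ler_sum => l _; rewrite mxE.
  by apply: ler_pM; rewrite ?vnorm_ge0.
pose s : powPH (cvPH R n) (n + n) := fun l => \col_j c l (lshift n j).
pose t : powPH (cvPH R n) (n + n) := fun k => \col_i c k (rshift n i).
have -> : F x xi eta = matform (map_mx (evmx x) f) s t.
  rewrite (matform_vec _ _ _ fE); congr (nform _ _ _ _ _); apply/funext => i.
    by rewrite -zl zE; congr vcomb; apply/colP => k; rewrite !mxE.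
  by rewrite -zr zE; congr vcomb; apply/colP => k; rewrite !mxE.
have := (matC_le _ K0).1 (hK _ f f1) s t.
have sq (g : 'I_n -> 'I_(n + n)) (u : powPH V n) : (forall i, z (g i) = u i) ->
    vnorm ((fun l => \col_j c l (g j)) : powPH (cvPH R n) (n + n)) =
    Num.sqrt (vnorm u ^+ 2 + n%:R * e).
  move=> gu; rewrite -[LHS]ger0_norm ?vnorm_ge0 // -sqrtr_sqr; congr Num.sqrt.
  rewrite [LHS]pow_vnorm_sq; under eq_bigr => l _ do rewrite cv_vnorm_sq.
  rewrite exchange_big pow_vnorm_sq mulr_natl -[n in _ *+ n]card_ord -sumr_const -big_split.
  apply: eq_bigr => i _ /=; rewrite -gu -cE cv_vnorm_sq; apply: eq_bigr => l _.
  by rewrite !mxE.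
by rewrite (sq _ _ zl) (sq _ _ zr).
Qed.
End RepDual.

(** * Order approximation *)

(* The positive contractions E play the part of an approximate order unit. *)
Definition order_approx (R : realType) (X : smosData R) : Prop :=
  forall m (h : 'M[X]_m), mxstar h = h -> mnorm h <= 1 -> forall e : R, 0 < e ->
  exists E h' : 'M[X]_m,
    [/\ mpos E /\ mnorm E <= 1, mpos (E + h'), mpos (E - h') & mnorm (h - h') <= e].

Section DualForm.
Variables (R : realType) (X : smosData R).
Local Notation C := R[i].
Local Notation D := (dual X).

Definition evform m n (f : 'M[D]_n) (x : 'M[X]_m) xi eta := matform (map_mx (evmx x) f) xi eta.

Lemma evformP m n (f : 'M[D]_n) c (x y : 'M[X]_m) xi eta :
  evform f (map_mx (fun v => c *: v) x + y) xi eta = c * evform f x xi eta + evform f y xi eta.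
Proof.
have bP s t : bicomb (map_mx (fun v => c *: v) x + y) s t = c *: bicomb x s t + bicomb y s t.
  rewrite /bicomb scaler_sumr -big_split; apply: eq_bigr => i _ /=.
  rewrite scaler_sumr -big_split; apply: eq_bigr => j _ /=.
  by rewrite !mxE scalerDr !scalerA mulrC.
rewrite /evform !matform_evmx mulr_sumr -big_split; apply: eq_bigr => i _ /=.
rewrite mulr_sumr -big_split; apply: eq_bigr => j _ /=.
by rewrite bP dualfD dualfZ.
Qed.

Lemma evformD m n (f : 'M[D]_n) (x y : 'M[X]_m) xi eta :
  evform f (x + y) xi eta = evform f x xi eta + evform f y xi eta.
Proof.
have {1}-> : x = map_mx (fun v => 1 *: v) x by apply/matrixP => i j; rewrite mxE scale1r.
by rewrite evformP mul1r.
Qed.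

Lemma evform0 m n (f : 'M[D]_n) xi eta : evform f (0 : 'M[X]_m) xi eta = 0.
Proof. by apply: (addrI (evform f 0 xi eta)); rewrite -evformD !addr0. Qed.

Lemma evformZ m n (f : 'M[D]_n) c (x : 'M[X]_m) xi eta :
  evform f (map_mx (fun v => c *: v) x) xi eta = c * evform f x xi eta.
Proof. by have := evformP f c x 0 xi eta; rewrite !addr0 evform0 addr0. Qed.

Lemma evformB m n (f : 'M[D]_n) (x y : 'M[X]_m) xi eta :
  evform f (x - y) xi eta = evform f x xi eta - evform f y xi eta.
Proof. by apply/(canRL (addrK _)); rewrite -evformD subrK. Qed.

Hypothesis hX : is_operator_space X.

Lemma evform_le m n (f : 'M[D]_n) (x : 'M[X]_m) xi eta :
  cabs (evform f x xi eta) <= mnorm f * mnorm x * (vnorm xi * vnorm eta).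
Proof.
have f0 := dual_mnorm_ge0 hX f; have x0 := mnorm_ge0 hX x.
by apply: (matC_le _ (mulr_ge0 f0 x0)).1; exact: evmx_le.
Qed.

Lemma dual_evform n (f : 'M[D]_n) (K : R) : 0 <= K ->
  (forall m (x : 'M[X]_m), mnorm x <= 1 -> forall xi eta,
    cabs (evform f x xi eta) <= K * (vnorm xi * vnorm eta)) -> mnorm f <= K.
Proof. by move=> K0 h; apply/(dual_sup hX _ K0) => m x x1; apply/(matC_le _ K0); exact: h. Qed.
End DualForm.

Section OrderApprox.
Variables (R : realType) (X : smosData R).
Hypothesis hS : is_smos X.
Hypothesis ap : order_approx X.
Local Notation C := R[i].
Local Notation D := (dual X).
Let os := smos_os hS.
Let st := smos_star hS.

Let half_id (z a b : C) : z = z - b + (2^-1 : R)%:C * (a + b - (a - b)).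
Proof.
have -> : a + b - (a - b) = 2 * b by ring.
rewrite mulrA fmorphV rmorphMn /=.
by rewrite mulVf ?pnatr_eq0 // mul1r subrK.
Qed.

Let arith (z1 z2 z3 z4 K M e v d : R) : 0 <= e -> z4 <= (2 + e) * K * v ->
  z3 <= (2 + e) * K * v -> z2 <= M * e * v -> z1 <= z4 + z3 -> e * (K + M) * v + e = d ->
  z2 + 2^-1 * z1 <= 2 * K * v + d.
Proof. move=> e0 h1 h2 h3 h4 h5; lra. Qed.

Lemma sa_parts m (x : 'M[X]_m) : mnorm x <= 1 -> exists h k : 'M[X]_m,
  [/\ mxstar h = h, mxstar k = k, mnorm h <= 1, mnorm k <= 1
    & x = h + map_mx (fun v => 'i%C *: v) k].
Proof.
move=> x1; have xs1 : mnorm (mxstar x) <= 1 by rewrite (smos_iso hS).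
have h2 : (2^-1 : C) = (2^-1 : R)%:C by rewrite fmorphV rmorphMn.
have ci : ('i%C : C)^*%C = - 'i%C by apply/eqP; rewrite eq_complex /= oppr0 !eqxx.
exists (map_mx (fun v => 2^-1 *: v) (x + mxstar x)).
exists (map_mx (fun v => (2^-1 * - 'i%C) *: v) (x - mxstar x)); split.
- by rewrite (mxstarZ st) (mxstarD st) (mxstarK st) addrC h2 conjR.
- rewrite (mxstarZ st) (mxstarD st) (mxstarN st) (mxstarK st).
  apply/matrixP => i j; rewrite !mxE conjcM conjcN ci opprK h2 conjR -[in RHS]opprB scalerN.
  by rewrite mulrN scaleNr opprK.
- rewrite (mnormZ os) h2 cabsR ger0_norm ?invr_ge0 //.
  by have := mnormD os x (mxstar x); lra.
- rewrite (mnormZ os) cabsM cabsN cabs_i h2 cabsR ger0_norm ?invr_ge0 //.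
  by have := mnormB os x (mxstar x); lra.
- have ii : ('i%C : C) * (2^-1 * - 'i%C) = 2^-1.
    by rewrite mulrCA mulrN -expr2 sqr_i opprK mulr1.
  apply/matrixP => i j; rewrite !mxE scalerA ii -scalerDr addrACA subrr addr0.
  have hh : 2^-1 + 2^-1 = 1 :> C by rewrite -mulr2n -[_ *+ 2]mulr_natl mulfV // pnatr_eq0.
  by rewrite scalerDr -scalerDl hh scale1r.
Qed.

Lemma dual_bound_sa n (f : 'M[D]_n) (L : R) : 0 <= L ->
  (forall m (h : 'M[X]_m), mxstar h = h -> mnorm h <= 1 -> forall xi eta,
    cabs (evform f h xi eta) <= L * (vnorm xi * vnorm eta)) -> mnorm f <= 2 * L.
Proof.
move=> L0 hL; apply: (dual_evform os) => [|m x x1 xi eta]; first exact: mulr_ge0.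
have [h [k [hs ks h1 k1 ->]]] := sa_parts x1.
rewrite evformD evformZ; apply: le_trans (cabsD _ _) _; rewrite cabsM cabs_i mul1r.
by rewrite mulr_natl mulr2n mulrDl; exact: lerD (hL _ _ hs h1 xi eta) (hL _ _ ks k1 xi eta).
Qed.

(** The constant is 2 * 2: one factor for the real and imaginary parts, one because h' is half the
    difference of E + h' and E - h', two positive elements of norm at most 2 + e. *)
Lemma dual_bound4 n (f : 'M[D]_n) (K : R) : 0 <= K ->
  (forall m (x : 'M[X]_m), mpos x -> mnorm x <= 1 -> forall xi eta,
    cabs (evform f x xi eta) <= K * (vnorm xi * vnorm eta)) -> mnorm f <= 4 * K.
Proof.
move=> K0 hK; rewrite (_ : 4 * K = 2 * (2 * K)); last by ring.
apply: dual_bound_sa => [|m h hs h1 xi eta]; first exact: mulr_ge0.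
have f0 := dual_mnorm_ge0 os f.
have v0 : 0 <= vnorm xi * vnorm eta by rewrite mulr_ge0 ?vnorm_ge0.
set v := vnorm xi * vnorm eta in v0 *.
apply: le_cabs_approx => d dp; pose c := (K + mnorm f) * v + 1.
have c0 : 0 < c by rewrite ltr_wpDl // mulr_ge0 // addr_ge0.
have [E [h' [[Ep E1] p1 p2 hh']]] := ap hs h1 (divr_gt0 dp c0).
set e := d / c in hh'; have ec : e * c = d by rewrite divfK ?gt_eqF.
have e0 : 0 < e by exact: divr_gt0.
have h'1 : mnorm h' <= 1 + e.
  have -> : h' = h - (h - h') by rewrite opprB addrCA subrr addr0.
  by apply: le_trans (mnormB os _ _) _; apply: lerD.
have bd (p : 'M[X]_m) : mpos p -> mnorm p <= 2 + e -> cabs (evform f p xi eta) <= (2 + e) * K * v.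
  move=> pp pn; have t0 : 0 < 2 + e by rewrite ltr_wpDl.
  have := hK _ _ (mposZ hS (t := (2 + e)^-1) _ pp) _ xi eta; rewrite (mnormZ os) cabsR evformZ cabsM cabsR.
  rewrite ger0_norm ?invr_ge0 ?(ltW t0) // ler_pdivrMl // mulr1 ler_pdivrMl // -mulrA.
  by apply.
have s2 : mnorm E + mnorm h' <= 2 + e by rewrite (_ : 2 + e = 1 + (1 + e)) ?lerD // addrA.
have b1 := bd _ p1 (le_trans (mnormD os _ _) s2).
have b2 := bd _ p2 (le_trans (mnormB os _ _) s2).
have b3 := evform_le os f (h - h') xi eta.
have {}b3 : cabs (evform f (h - h') xi eta) <= mnorm f * e * v.
  by apply: le_trans b3 _; rewrite ler_wpM2r // ler_wpM2l.
have -> : evform f h xi eta = evform f (h - h') xi eta +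
    (2^-1 : R)%:C * (evform f (E + h') xi eta - evform f (E - h') xi eta).
  rewrite (evformB f h h') (evformB f E h') (evformD f E h'); exact: half_id.
apply: le_trans (cabsD _ _) _; rewrite cabsM cabsR ger0_norm ?invr_ge0 //.
have b4 := cabsB (evform f (E + h') xi eta) (evform f (E - h') xi eta).
have ec' : e * (K + mnorm f) * v + e = d by rewrite -ec /c; ring.
exact: arith (ltW e0) b1 b2 b3 b4 ec'.
Qed.

Lemma bicomb_compr m p (a b : 'M[C]_(m, p)) (x : 'M[X]_m) (s t : 'cV[C]_p) :
  bicomb (mxcompr a b x) s t = bicomb x (b *m s) (a *m t).
Proof.
rewrite /bicomb.
transitivity (\sum_i \sum_j \sum_k \sum_l
  (((t i 0)^*%C * s j 0) * ((a k i)^*%C * b l j)) *: x k l).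
  apply: eq_bigr => i _; apply: eq_bigr => j _; rewrite mxE scaler_sumr; apply: eq_bigr => k _.
  by rewrite scaler_sumr; apply: eq_bigr => l _; rewrite scalerA.
under eq_bigr => i _ do rewrite exchange_big.
rewrite exchange_big; apply: eq_bigr => k _ /=.
transitivity (\sum_i \sum_l \sum_j
  (((t i 0)^*%C * s j 0) * ((a k i)^*%C * b l j)) *: x k l).
  by apply: eq_bigr => i _; rewrite exchange_big.
rewrite exchange_big; apply: eq_bigr => l _ /=.
rewrite !mxE conjc_sum mulr_suml scaler_suml; apply: eq_bigr => i _.
rewrite mulr_sumr scaler_suml; apply: eq_bigr => j _.
by rewrite conjcM; congr (_ *: _); ring.
Qed.

Lemma evform_compr m p n (f : 'M[D]_n) (a b : 'M[C]_(m, p)) (x : 'M[X]_m) xi eta :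
  evform f (mxcompr a b x) xi eta = evform f x (fun j => b *m xi j) (fun i => a *m eta i).
Proof.
rewrite /evform !matform_evmx; apply: eq_bigr => i _; apply: eq_bigr => j _.
by rewrite bicomb_compr.
Qed.

Lemma mxstar_compr2 m p (a b : 'M[C]_(m, p)) (x : 'M[X]_m) :
  mxstar (mxcompr a b x) = mxcompr b a (mxstar x).
Proof.
apply/matrixP => i j; rewrite mxstarE !mxE (mstar_sum st) exchange_big /=.
apply: eq_bigr => p' _; rewrite (mstar_sum st); apply: eq_bigr => q _.
by rewrite (mstarZ st) conjcM conjcK mxstarE [_^*%C * _]mulrC.
Qed.

Lemma cmxnorm1 n : cmxnorm (1%:M : 'M[C]_n) <= 1.
Proof.
rewrite cmxnormE; apply/(matC_le _ ler01) => xi eta.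
have -> : matform (const_mx 1%:M : 'M[matC R n]_1) xi eta = pip (xi : powPH (cvPH R n) 1) eta.
  by rewrite /matform mformE [RHS]big_ord1 !big_ord1 mxE mul1mx.
by rewrite mul1r; exact: CauchySchwarz.
Qed.

Let up m : 'M[C]_(m, m + m) := row_mx 1%:M 0.
Let dn m : 'M[C]_(m, m + m) := row_mx 0 1%:M.

(** The block matrix with x and x^* off the diagonal is a sum of two compressions, and both sums of
    squares of the scalar coefficients are the identity: one instance of the operator space
    inequality. *)
Lemma offdiag_contraction m (x : 'M[X]_m) : mnorm x <= 1 ->
  mnorm (mxcompr (up m) (dn m) x + mxcompr (dn m) (up m) (mxstar x)) <= 1.
Proof.
move=> x1; have [_ _ _ hr] := os.
have := hr m (m + m)%N 2 (fun k => if k == 0 then up m else dn m)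
  (fun k => if k == 0 then dn m else up m) (fun k => if k == 0 then x else mxstar x).
rewrite !big_ord_recl !big_ord0 /= !addr0.
have e1 : (up m)^t* *m up m + (dn m)^t* *m dn m = 1%:M.
  rewrite /up /dn !tr_row_mx !map_col_mx !mul_col_row !add_block_mx !trmx0 !map_mx0.
  by rewrite !mulmx0 !mul0mx !addr0 !add0r trmx1 map_mx1 mulmx1 -scalar_mx_block.
have e2 := etrans (addrC _ _) e1; rewrite e1 e2 => h; apply: le_trans h _.
have s1 : Num.sqrt (cmxnorm (1%:M : 'M[C]_(m + m))) <= 1 by rewrite -[leRHS]sqrtr1 ler_wsqrtr // cmxnorm1.
apply: (@le_trans _ _ (1 * 1)); last by rewrite mulr1.
apply: ler_pM; rewrite ?mulr_ge0 ?sqrtr_ge0 //.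
- by rewrite !le_max lexx !orbT.
- by rewrite -[leRHS]mulr1; apply: ler_pM; rewrite ?sqrtr_ge0.
- by rewrite (smos_iso hS) !ge_max x1 ler01.
Qed.

Lemma evform_ge0 m n (f : 'M[D]_n) (x : 'M[X]_m) xi : mpos f -> mpos x -> 0 <= evform f x xi xi.
Proof. by move=> /(dual_posP hS)[_ h] /h; exact. Qed.

Section PositiveFunctional.
Variables (n : nat) (f : 'M[D]_n) (K : R).
Hypothesis K0 : 0 <= K.
Hypothesis fp : mpos f.
Hypothesis fK : forall m (x : 'M[X]_m), mpos x -> mnorm x <= 1 -> forall xi eta,
    cabs (evform f x xi eta) <= K * (vnorm xi * vnorm eta).

(** Positivity of f at E - h' bounds the form of h' by that of E, where the hypothesis gives K; the
    remainder h - h' costs at most d by the choice of c. Only the diagonal of the form is controlled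
    in this way. *)
Let diag m (h : 'M[X]_m) xi : mxstar h = h -> mnorm h <= 1 ->
  complex.Re (evform f h xi xi) <= K * vnorm xi ^+ 2.
Proof.
move=> hs h1; have f0 := dual_mnorm_ge0 os f.
set v := vnorm xi ^+ 2; have v0 : 0 <= v by rewrite sqr_ge0.
apply: le_cabs_approx => d dp; pose c := mnorm f * v + 1.
have c0 : 0 < c by rewrite ltr_wpDl // mulr_ge0.
have [E [h' [[Ep E1] _ p2 hh']]] := ap hs h1 (divr_gt0 dp c0).
set e := d / c in hh'; have ec : e * c = d by rewrite divfK ?gt_eqF.
have e0 : 0 < e by exact: divr_gt0.
have h2 : complex.Re (evform f h' xi xi) <= K * v.
  have /cRe_ge0 := evform_ge0 xi fp p2; rewrite evformB ReD ReN subr_ge0 => le; apply: le_trans le _.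
  by apply: le_trans (Re_le_cabs _) _; rewrite /v expr2; exact: fK.
have h3 : complex.Re (evform f (h - h') xi xi) <= d.
  apply: le_trans (Re_le_cabs _) _; apply: le_trans (evform_le os _ _ _ _) _.
  rewrite -expr2 -/v -ec; apply: le_trans (ler_wpM2r v0 (ler_wpM2l f0 hh')) _.
  by rewrite /c mulrDr mulr1 [mnorm f * e]mulrC -mulrA lerDl ltW.
by rewrite -(subrK h' h) evformD ReD addrC; exact: lerD.
Qed.

(** The off-diagonal value 2 Re f(x)(xi, eta) is a diagonal value of f at the self-adjoint block
    matrix with x and x^* off the diagonal. The stacked vector z has squared norm |xi|^2 + |eta|^2,
    so [polar_bound] returns K without loss. *)
Lemma dual_bound_pos : mnorm f <= K.
Proof.
have vP m p (g : 'M[matC R m]_p) a xi zeta eta :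
  matform g (a *: xi + zeta) eta = a * matform g xi eta + matform g zeta eta by exact: matform_vP.
apply: (dual_evform os K0) => m x x1; apply: (polar_bound K0) => [a xi eta|t xi eta|xi eta].
- exact: matform_vZ.
- by rewrite /evform matform_vZr conjR.
pose z : powPH (cvPH R (m + m)) n := fun j => col_mx (eta j) (xi j).
have zn : vnorm z ^+ 2 = vnorm xi ^+ 2 + vnorm eta ^+ 2.
  rewrite !pow_vnorm_sq -big_split; apply: eq_bigr => j _ /=.
  rewrite !cv_vnorm_sq big_split_ord addrC /=; congr (_ + _); apply: eq_bigr => i _.
    by rewrite /z col_mxEu.
  by rewrite /z col_mxEd.
rewrite -zn.
have hs : mxstar (mxcompr (up m) (dn m) x + mxcompr (dn m) (up m) (mxstar x)) =
    mxcompr (up m) (dn m) x + mxcompr (dn m) (up m) (mxstar x).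
  by rewrite (mxstarD st) !mxstar_compr2 (mxstarK st) addrC.
apply: le_trans (diag z hs (offdiag_contraction x1)).
rewrite evformD !evform_compr ReD.
have -> : (fun j => dn m *m z j) = xi.
  by apply/funext => j; rewrite /z /dn mul_row_col mul0mx mul1mx add0r.
have -> : (fun j => up m *m z j) = eta.
  by apply/funext => j; rewrite /z /up mul_row_col mul0mx mul1mx addr0.
have -> : evform f (mxstar x) eta xi = (evform f x xi eta)^*%C.
  have fs : mxstar f = f := ((dual_posP hS f).1 fp).1.
  by rewrite /evform -matform_star -[in RHS]fs (map_evmx_star hS) (mxstarK (matC_star R m)).
by rewrite Re_conj mulr_natl mulr2n.
Qed.
End PositiveFunctional.
End OrderApprox.

Lemma halves_lt (R : realType) (T e : R) : 0 < e -> exists N, forall n, (N <= n)%N -> T / 2 ^+ n < e.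
Proof.
move=> e0; have [T0|T0] := leP T 0.
  by exists 0%N => n _; apply: le_lt_trans e0; rewrite mulr_le0_ge0 // invr_ge0 exprn_ge0.
have [N hN] := natinv_lt (divr_gt0 e0 T0); exists N => n Nn.
rewrite mulrC -ltr_pdivlMr //; apply: le_lt_trans (hN n Nn).
by rewrite lef_pV2 ?posrE ?exprn_gt0 ?ltr0n // -natrX ler_nat ltn_expl.
Qed.

(** * Exact positive decompositions *)

Section Decomposition.
Variables (R : realType) (X : smosData R).
Hypothesis hS : is_smos X.
Hypothesis ap : order_approx X.
Hypothesis cX : norm_complete X.
Local Notation C := R[i].
Let os := smos_os hS.
Let st := smos_star hS.

Definition pos1 (x : X) : Prop := mpos (const_mx x : 'M[X]_1).

Let const_mxD (x y : X) : const_mx (x + y) = const_mx x + const_mx y :> 'M[X]_1.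
Proof. by apply/matrixP => i j; rewrite !mxE. Qed.
Let const_mxB (x y : X) : const_mx (x - y) = const_mx x - const_mx y :> 'M[X]_1.
Proof. by apply/matrixP => i j; rewrite !mxE. Qed.
Let const_sa (x : X) : mxstar (const_mx x : 'M[X]_1) = const_mx x <-> mstar x = x.
Proof.
split=> [/matrixP/(_ 0 0)|h]; first by rewrite !mxE.
by apply/matrixP => i j; rewrite !mxE.
Qed.

Lemma pos1D x y : pos1 x -> pos1 y -> pos1 (x + y).
Proof. by rewrite /pos1 const_mxD; exact: (mposD hS). Qed.
Lemma pos1_sa x : pos1 x -> mstar x = x.
Proof. by move=> /(smos_pos_sa hS)/const_sa. Qed.
Lemma pos1Z (t : R) x : 0 <= t -> pos1 x -> pos1 (t%:C *: x).
Proof. by move=> t0 /(mposZ hS t0); congr mpos; apply/matrixP => i j; rewrite !mxE. Qed.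

(** Order approximation at scale t with error t / 2, made total so that [choice] applies; the pair
    (0, 0) is a default value where the premises fail. *)
Let step_ex (th : R * X) : exists Eh : X * X, 0 < th.1 -> mstar th.2 = th.2 -> nrm th.2 <= th.1 ->
  [/\ nrm Eh.1 <= th.1, pos1 (Eh.1 + Eh.2), pos1 (Eh.1 - Eh.2), mstar Eh.2 = Eh.2
    & nrm (th.2 - Eh.2) <= th.1 / 2].
Proof.
case: th => t h /=.
have [[t0 [hs ht]]|no] := pselect (0 < t /\ (mstar h = h /\ nrm h <= t)); last first.
  by exists (0, 0) => a b c; case: no.
have a1 : mxstar (const_mx (t^-1%:C *: h) : 'M[X]_1) = const_mx (t^-1%:C *: h).
  by apply/const_sa; rewrite (mstarZ st) conjR hs.
have a2 : mnorm (const_mx (t^-1%:C *: h) : 'M[X]_1) <= 1.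
  rewrite -/(nrm _) (nrmZ os) cabsR ger0_norm ?invr_ge0 ?(ltW t0) //.
  by rewrite mulrC ler_pdivrMr // mul1r.
have h0 : 0 < 2^-1 :> R by rewrite invr_gt0.
have [E [k [[Ep E1] p1 p2 hk]]] := ap a1 a2 h0.
have eta1 (y : 'M[X]_1) : y = const_mx (y 0 0) by apply/matrixP => i j; rewrite mxE !ord1.
rewrite (eta1 E) in Ep E1 p1 p2; rewrite (eta1 k) in p1 p2 hk.
rewrite -const_mxD in p1; rewrite -const_mxB in p2; rewrite -const_mxB in hk.
set E0 := E 0 0 in Ep E1 p1 p2; set k0 := k 0 0 in p1 p2 hk.
have tt : t%:C * t^-1%:C = 1 :> C by rewrite -rmorphM mulfV ?gt_eqF.
exists (t%:C *: E0, t%:C *: k0) => _ _ _ /=; split.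
- by rewrite (nrmZ os) cabsR gtr0_norm // ler_piMr // ltW.
- by rewrite -scalerDr; apply: pos1Z => //; exact: ltW.
- by rewrite -scalerBr; apply: pos1Z => //; exact: ltW.
- rewrite (mstarZ st) conjR; congr (_ *: _).
  by have := pos1_sa p1; rewrite (mstarD st) (pos1_sa Ep) => /addrI.
- rewrite -[h]scale1r -tt -scalerA -scalerBr (nrmZ os) cabsR gtr0_norm //.
  by rewrite ler_pM2l.
Qed.

(* The errors left by successive order approximations are halved at each step,
   so the approximations and their order bounds sum up. *)
Lemma sa_dominated (h : X) : mstar h = h ->
  exists E, [/\ nrm E <= 2 * (nrm h + 1), pos1 (E + h) & pos1 (E - h)].
Proof.
move=> hs; have [G hG] := choice step_ex.
pose T := nrm h + 1; have T0 : 0 < T by rewrite ltr_wpDl // (nrm_ge0 os).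
pose t k := T / 2 ^+ k; have t0 k : 0 < t k by rewrite divr_gt0 // exprn_gt0.
have tS k : t k.+1 = t k / 2 by rewrite /t exprSr invfM mulrA.
pose u := fix u k := if k is k'.+1 then u k' - (G (t k', u k')).2 else h.
have uS k : u k.+1 = u k - (G (t k, u k)).2 by [].
have u1 k : mstar (u k) = u k /\ nrm (u k) <= t k.
  elim: k => [|k [us ut]]; first by rewrite /t expr0 divr1 lerDl ler01.
  have [_ _ _ ks kt] := hG (t k, u k) (t0 k) us ut.
  by rewrite uS tS (mstarD st) (mstarN st) us ks.
have u2 k : [/\ nrm (G (t k, u k)).1 <= t k, pos1 ((G (t k, u k)).1 + (u k - u k.+1))
    & pos1 ((G (t k, u k)).1 - (u k - u k.+1))].
  have [us ut] := u1 k; have [a b c _ _] := hG (t k, u k) (t0 k) us ut.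
  have d : u k - u k.+1 = (G (t k, u k)).2 by rewrite uS opprB addrC subrK.
  by rewrite d.
pose S := fix S k := if k is k'.+1 then S k' + (G (t k', u k')).1 else 0.
have SS k : S k.+1 = S k + (G (t k, u k)).1 by [].
have S1 n : pos1 (S n + (h - u n)) /\ pos1 (S n - (h - u n)).
  elim: n => [|n [p1 p2]].
    rewrite /= subrr subr0 addr0; suff p0 : pos1 0 by [].
    by have := mpos0 hS 1; congr mpos; apply/matrixP => i j; rewrite !mxE.
  have [_ q1 q2] := u2 n; have := pos1D p1 q1; have := pos1D p2 q2.
  have e1 (a b c d e : X) : a + (b - c) + (d + (c - e)) = a + d + (b - e).
    by rewrite addrACA; congr (_ + _); rewrite addrA subrK.
  have e2 (a b c d e : X) : a - (b - c) + (d - (c - e)) = a + d - (b - e).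
    by rewrite addrACA -opprD; congr (_ - _); rewrite addrA subrK.
  by rewrite e1 e2 -SS => b1 b2.
(* Each increment is at most t k = 2 t k - 2 t k.+1, so the bounds telescope. From N = 0 the total
   is at most 2 t 0 = 2 (||h|| + 1), the bound on E. *)
have S2 N n : nrm (S (N + n)%N - S N) <= 2 * t N - 2 * t (N + n)%N.
  elim: n => [|n IH]; first by rewrite addn0 !subrr (nrm0 os).
  rewrite addnS SS addrAC; apply: le_trans (nrmD os _ _) _.
  have [h1 _ _] := u2 (N + n)%N; have := tS (N + n)%N.
  move: IH h1; set a := nrm _; set b := nrm _; move: (t _) (t _) (t _) => x y z; lra.
have S3 N n : (N <= n)%N -> nrm (S n - S N) <= 2 * t N.
  move=> Nn; have := S2 N (n - N)%N; rewrite subnKC // => h1; apply: le_trans h1 _.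
  by rewrite lerBlDr lerDl mulr_ge0 // ltW.
have [|E hE] := cX (u := S).
  move=> e e0; have [N hN] := halves_lt T (divr_gt0 e0 (ltr0Sn R 3)); exists N => p q Np Nq.
  have := hN N (leqnn N); rewrite -/(t N) => tN.
  have -> : S p - S q = (S p - S N) - (S q - S N) by rewrite opprB addrA subrK.
  apply: le_lt_trans (nrmB os _ _) _; have := S3 _ _ Np; have := S3 _ _ Nq.
  move: tN; set a := nrm _; set b := nrm _; move: (t N) => x; lra.
(* The two order bounds are the cases s v = h - v and s v = v - h: as u n tends to 0, the positive
   elements s (u n) + S n tend to s 0 + E, and the cone is closed. *)
have lim (s : X -> X) : (forall n, pos1 (s (u n) + S n)) -> (forall x y, nrm (s x - s y) = nrm (x - y)) ->
    pos1 (s 0 + E).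
  move=> hs1 hs2; apply: (smos_closed hS) => e e0.
  have [N1 h1] := hE (e / 2) (divr_gt0 e0 (ltr0Sn R 1)).
  have [N2 h2] := halves_lt T (divr_gt0 e0 (ltr0Sn R 1)).
  set n := maxn N1 N2; exists (const_mx (s (u n) + S n)); first exact: hs1.
  rewrite -const_mxB -/(nrm _).
  have -> : s 0 + E - (s (u n) + S n) = (s 0 - s (u n)) - (S n - E).
    by rewrite opprD opprB addrACA.
  apply: le_lt_trans (nrmB os _ _) _; rewrite hs2 sub0r (nrmN os).
  have := (u1 n).2; have := h1 n (leq_maxl _ _); have := h2 n (leq_maxr _ _); rewrite -/(t n).
  set a := nrm _; set b := nrm _; move: (t n) => x; lra.
exists E; split.
- apply: le_cabs_approx => e e0; have [N hN] := hE e e0.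
  rewrite -(subrK (S N) E) addrC; apply: le_trans (nrmD os _ _) _.
  have := S3 0%N N (leq0n N); have := hN N (leqnn N); rewrite (nrmBC os) subr0 /t expr0 divr1.
  by move/ltW => h1 h2; exact: lerD.
- have := lim (fun v => h - v); rewrite subr0 addrC; apply=> [n|x y].
    by rewrite addrC; exact: (S1 n).1.
  by rewrite opprB addrC addrA subrK (nrmBC os).
- have := lim (fun v => v - h); rewrite sub0r addrC; apply=> [n|x y].
    by rewrite addrC -opprB; exact: (S1 n).2.
  by rewrite opprB addrA subrK.
Qed.

(** The parts are (E + h) / 2 and (E - h) / 2 for the real and the imaginary part h of x, with E
    dominating h. The norm bound on the parts is what later bounds the functionals built from
    them. *)
Lemma pos_decomposition (x : X) : exists p q r s : X,
  [/\ pos1 p, pos1 q, pos1 r, pos1 s & x = p - q + 'i%C *: (r - s)] /\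
  (forall y, y \in [:: p; q; r; s] -> nrm y <= 2 * (nrm x + 2)).
Proof.
have sa h : mstar h = h -> nrm h <= nrm x + 1 -> exists p q,
    [/\ pos1 p, pos1 q, h = p - q, nrm p <= 2 * (nrm x + 2) & nrm q <= 2 * (nrm x + 2)].
  move=> /sa_dominated[E [En p1 p2]] hx; have h0 : 0 <= 2^-1 :> R by rewrite invr_ge0.
  exists ((2^-1 : R)%:C *: (E + h)), ((2^-1 : R)%:C *: (E - h)).
  have bd (y : X) : nrm y <= nrm E + nrm h -> nrm ((2^-1 : R)%:C *: y) <= 2 * (nrm x + 2).
    rewrite (nrmZ os) cabsR ger0_norm // => yn; have := nrm_ge0 os x; lra.
  split; try exact: pos1Z; last 2 first.
  - by apply: bd; exact: (nrmD os).
  - by apply: bd; exact: (nrmB os).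
  have hh : (2^-1 : R)%:C + (2^-1 : R)%:C = 1 :> C by rewrite -rmorphD (_ : 2^-1 + 2^-1 = 1 :> R) //; field.
  by rewrite scalerDr scalerBr opprB addrC addrA subrK -scalerDl hh scale1r.
have x1 : 0 < nrm x + 1 by rewrite ltr_wpDl // (nrm_ge0 os).
have [|h [k [hs ks h1 k1 xE]]] := @sa_parts _ _ hS 1 (const_mx ((nrm x + 1)^-1%:C *: x)).
  rewrite -/(nrm _) (nrmZ os) cabsR ger0_norm ?invr_ge0 ?(ltW x1) //.
  by rewrite mulrC ler_pdivrMr // mul1r lerDl.
have {xE} xE : x = (nrm x + 1)%:C *: h 0 0 + 'i%C *: ((nrm x + 1)%:C *: k 0 0).
  move/matrixP/(_ 0 0): xE; rewrite !mxE => /(congr1 (fun v => (nrm x + 1)%:C *: v)).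
  by rewrite scalerA -rmorphM mulfV ?gt_eqF // scale1r scalerDr !scalerA [_ * 'i%C]mulrC.
have e (y : 'M[X]_1) : mxstar y = y -> mstar ((nrm x + 1)%:C *: y 0 0) = (nrm x + 1)%:C *: y 0 0.
  by move=> /matrixP/(_ 0 0); rewrite !mxE (mstarZ st) conjR => ->.
have n1 (y : 'M[X]_1) : mnorm y <= 1 -> nrm ((nrm x + 1)%:C *: y 0 0) <= nrm x + 1.
  move=> y1; rewrite (nrmZ os) cabsR gtr0_norm // ler_piMr ?(ltW x1) //.
  exact: le_trans (nrm_entry os y 0 0) y1.
have [p [q [p0 q0 pq pn qn]]] := sa _ (e _ hs) (n1 _ h1).
have [r [s [r0 s0 rs rn sn]]] := sa _ (e _ ks) (n1 _ k1).
exists p, q, r, s; split; first by split=> //; rewrite {1}xE pq rs.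
by move=> y; rewrite !inE => /or4P[] /eqP ->.
Qed.

Lemma dual_pos_sep (f : dual X) : (forall x : X, pos1 x -> val f x = 0) -> f = 0.
Proof.
move=> h; apply: dual_ext => x; have [p [q [r [s [[p0 q0 r0 s0 ->] _]]]]] := pos_decomposition x.
have fB (g : dual X) a b : val g (a - b) = val g a - val g b.
  by rewrite -scaleN1r dualfD dualfZ mulN1r.
rewrite dualfD dualfZ !fB !h // !subr0 mulr0 addr0.
by rewrite -[X in _ = val X _](scale0r f) dualZ mul0r.
Qed.
End Decomposition.

(** * Hilbert sums *)

Section MakeHilbert.
Variables (R : realType) (V : preHilbert R).
Hypothesis dV : forall x : V, vnorm x = 0 -> x = 0.
Hypothesis cV : ph_complete V.
Local Notation C := R[i].

(** The idle [let]s make the type depend on the two proofs, so that the structures declared below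
    can recover these proofs from the type alone. *)
Definition hcar : Type := let _ := dV in let _ := cV in V.
HB.instance Definition _ := GRing.Lmodule.on hcar.

Let hnorm (x : hcar) : C := (vnorm (x : V))%:C.
Let hnormD x y : hnorm (x + y) <= hnorm x + hnorm y.
Proof. by rewrite /hnorm -rmorphD lecR vnormD. Qed.
Let hnormZ (a : C) x : hnorm (a *: x) = `|a| * hnorm x.
Proof. by rewrite /hnorm vnormZ rmorphM normE. Qed.
Let hnorm0 x : hnorm x = 0 -> x = 0.
Proof. by move=> /(congr1 (@complex.Re R)) /= /dV. Qed.
HB.instance Definition _ := @Lmodule_isNormed.Build C hcar hnorm hnormD hnormZ hnorm0.

(** From sequences to filters: the centres of balls of radius 1 / (n + 1) that belong to F form a
    Cauchy sequence, and F converges to its limit. *)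
Let hcomplete (F : set_system hcar) : ProperFilter F -> cauchy F -> cvg F.
Proof.
move=> FF cF.
have ball_ex (e : R) : 0 < e -> exists x : hcar, F (ball x e%:C).
  by move=> e0; apply: (cauchyP F).1 => //; rewrite ltcR.
have /choice[u hu] (n : nat) : exists x : hcar, F (ball x (n.+1%:R^-1 : R)%:C).
  by apply: ball_ex; rewrite invr_gt0.
have near_u (p q : nat) : vnorm ((u p : V) - u q) < p.+1%:R^-1 + q.+1%:R^-1.
  have [y []] := filter_ex (filterI (hu p) (hu q)).
  rewrite -!ball_normE /ball_ /= !ltcR => h1 h2.
  rewrite -(subrK (y : V) (u p)) -addrA; apply: le_lt_trans (vnormD _ _) _.
  by apply: ltrD => //; rewrite vnormBC.
have [|x hx] := cV (u := u).
  move=> e e0; have [N hN] := natinv_lt (divr_gt0 e0 (ltr0Sn R 1)); exists N => p q Np Nq.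
  apply: lt_trans (near_u p q) _; have := hN p Np; have := hN q Nq.
  by set a := _^-1; set b := _^-1 => h1 h2; rewrite [e]splitr; exact: ltrD.
apply/cvg_ex; exists (x : hcar); apply/cvgrPdist_lt => e e0.
have er : 0 < complex.Re e by move: e0; rewrite ltcE /= => /andP[].
have eE : e = (complex.Re e)%:C by rewrite -cge0E // ltW.
have e2 := divr_gt0 er (ltr0Sn R 1).
have [N hN] := natinv_lt e2; have [M hM] := hx _ e2.
have := hu (maxn N M); apply: filterS => y.
rewrite -ball_normE /ball_ /= eE !ltcR => h1.
rewrite -(subrK (u (maxn N M) : V) x) -addrA; apply: le_lt_trans (vnormD _ _) _.
rewrite [ltRHS]splitr; apply: ltrD; first by rewrite vnormBC; apply: hM; exact: leq_maxr.
by apply: lt_trans h1 _; apply: hN; exact: leq_maxl.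
Qed.
HB.instance Definition _ := Uniform_isComplete.Build hcar hcomplete.

Let hdot (x y : hcar) : C := pip (x : V) y.
Let hdot_bilinear : bilinear_for *%R (conjC \; *%R) hdot.
Proof.
split=> [z a x y|z a x y]; first exact: pip_lin.
by rewrite /hdot pipDr pipZr.
Qed.
HB.instance Definition _ := bilinear_isBilinear.Build C hcar hcar C *%R (conjC \; *%R) hdot hdot_bilinear.
Let hdot_herm (x y : hcar) : hdot x y = (-1) ^+ false * conjC (hdot y x).
Proof. by rewrite expr0 mul1r; exact: pip_herm. Qed.
HB.instance Definition _ := @isHermitianSesquilinear.Build C hcar false conjC hdot hdot_herm.
Let hdot_gt0 (x : hcar) : x != 0 -> 0 < hdot x x.
Proof.
move=> x0; rewrite /hdot pip_vnorm ltcR exprn_gt0 // lt_def vnorm_ge0 andbT.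
by apply: contra_neq x0 => /dV.
Qed.
HB.instance Definition _ := @isDotProduct.Build C hcar hdot hdot_gt0.

Let hdot_norm (x : hcar) : `|x| ^+ 2 = hdot x x.
Proof. by rewrite /hdot pip_vnorm rmorphXn. Qed.

Definition mk_hilbert : hilbert R :=
  @Hilbert R hcar (hdot : {dot hcar for conjC}) hdot_norm.
End MakeHilbert.

Section FiniteSums.
Variables (R : realType) (I : choiceType).
Local Notation C := R[i].

(* Unordered summation: convergence along the net of finite subfamilies. *)
Definition hsum (F : I -> C) (z : C) : Prop := forall e : R, 0 < e ->
  exists s0 : seq I, forall s, uniq s -> {subset s0 <= s} -> cabs (z - \sum_(i <- s) F i) <= e.

Lemma hsum_le F z K : hsum F z -> (forall s, uniq s -> cabs (\sum_(i <- s) F i) <= K) -> cabs z <= K.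
Proof.
move=> h hK; apply: le_cabs_approx => e /h[s0 hs].
set S := \sum_(i <- undup s0) F i.
have h2 : cabs (z - S) <= e by apply: hs (undup_uniq _) _ => i; rewrite mem_undup.
rewrite -(subrK S z) addrC; apply: le_trans (cabsD _ _) _.
exact: lerD (hK _ (undup_uniq _)) h2.
Qed.

Lemma hsum_lin F G z w a : hsum F z -> hsum G w -> hsum (fun i => a * F i + G i) (a * z + w).
Proof.
move=> hF hG e e0; have a0 : 0 < cabs a + 1 by rewrite ltr_wpDl // cabs_ge0.
have [s0 h0] := hF _ (divr_gt0 (divr_gt0 e0 (ltr0Sn R 1)) a0).
have [s1 h1] := hG _ (divr_gt0 e0 (ltr0Sn R 1)).
exists (s0 ++ s1) => s us sub; rewrite big_split -mulr_sumr /=.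
have -> : a * z + w - (a * (\sum_(i <- s) F i) + \sum_(i <- s) G i) =
    a * (z - \sum_(i <- s) F i) + (w - \sum_(i <- s) G i) by ring.
apply: le_trans (cabsD _ _) _; rewrite [leRHS]splitr cabsM; apply: lerD.
  have sub0 : {subset s0 <= s} by move=> i si; apply: sub; rewrite mem_cat si.
  have := h0 s us sub0; rewrite ler_pdivlMr // => h2; apply: le_trans h2.
  by rewrite mulrC ler_wpM2l ?cabs_ge0 // lerDl.
by apply: h1 => // i si; apply: sub; rewrite mem_cat si orbT.
Qed.

Lemma hsum0 : hsum (fun=> 0) 0.
Proof. by move=> e e0; exists [::] => s _ _; rewrite big1 // subrr cabs0 ltW. Qed.

Lemma hsum_uniq F z w : hsum F z -> hsum F w -> z = w.
Proof.
move=> h1 h2; have := hsum_lin (-1) h1 h2; rewrite mulN1r addrC => h3.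
have e i : -1 * F i + F i = 0 by rewrite mulN1r addNr.
apply/esym/subr0_eq/cabs_eq0/eqP; rewrite eq_le cabs_ge0 andbT.
by apply: (hsum_le h3) => s _; rewrite big1 ?cabs0.
Qed.

Lemma hsum_sum n (F : 'I_n -> I -> C) z : (forall k, hsum (F k) (z k)) ->
  hsum (fun i => \sum_k F k i) (\sum_k z k).
Proof.
elim: n F z => [|n IH] F z h.
  rewrite big_ord0 (_ : (fun i => _) = fun=> 0); first exact: hsum0.
  by apply/funext => i; rewrite big_ord0.
rewrite big_ord_recl; have := hsum_lin 1 (h ord0) (IH _ _ (fun k => h (lift ord0 k))).
by rewrite mul1r; congr hsum; apply/funext => i; rewrite big_ord_recl mul1r.
Qed.

Lemma hsum_single F i0 : (forall i, i != i0 -> F i = 0) -> hsum F (F i0).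
Proof.
move=> h e e0; exists [:: i0] => s us sub.
rewrite (bigD1_seq i0) ?sub ?inE //= big1 ?addr0 ?subrr ?cabs0 ?ltW // => i; exact: h.
Qed.

Lemma sub_sum_le (a : I -> R) (s t : seq I) : (forall i, 0 <= a i) -> uniq s ->
  {subset s <= t} -> \sum_(i <- s) a i <= \sum_(i <- t) a i.
Proof.
move=> a0; elim: s t => [|i s IH] t; first by rewrite big_nil sumr_ge0.
move=> /andP[si us] sub; have it : i \in t by apply: sub; rewrite inE eqxx.
rewrite big_cons (perm_big _ (perm_to_rem it)) big_cons lerD2l; apply: IH => // k ks.
have := perm_mem (perm_to_rem it) k; rewrite sub ?inE ?ks ?orbT // => /esym/predU1P[ki|//].
by move: si; rewrite -ki ks.
Qed.

Lemma hsum_bounded (a : I -> R) (K : R) : (forall i, 0 <= a i) ->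
  (forall s, uniq s -> \sum_(i <- s) a i <= K) ->
  exists2 r : R, (forall s, uniq s -> \sum_(i <- s) a i <= r) & hsum (fun i => (a i)%:C) r%:C.
Proof.
move=> a0 hK; pose A := [set \sum_(i <- s) a i | s in [set s | uniq s]].
have hA : has_sup A.
  split; first by exists (\sum_(i <- [::]) a i), [::].
  by exists K => _ [s us <-]; exact: hK.
have ub s : uniq s -> \sum_(i <- s) a i <= sup A by move=> us; apply: ub_le_sup; [case: hA|exists s].
exists (sup A) => // e e0; have [_ [s0 us0 <-] h0] := sup_adherent e0 hA.
exists s0 => s us sub; rewrite -rmorph_sum -rmorphB cabsR ger0_norm ?subr_ge0 ?ub //.
have := sub_sum_le a0 us0 sub; move: h0; set x := \sum_(_ <- s0) _; set y := \sum_(_ <- s) _.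
by set z := sup A; lra.
Qed.
End FiniteSums.

(** * The l2 sum of a family of spaces *)

Section L2Sum.
Variables (R : realType) (I : choiceType) (V : I -> preHilbert R).
Local Notation C := R[i].

Definition l2mem : {pred dfun (fun i => V i : lmodType C)} := fun f =>
  `[< exists K : R, forall s, uniq s -> \sum_(i <- s) vnorm (f i) ^+ 2 <= K >].

Lemma l2mem_submod : submod_closed l2mem.
Proof.
split=> [|a f g /asboolP[K fK] /asboolP[L gL]]; apply/asboolP.
  exists 0 => s _; rewrite big1 // => i _.
  by rewrite (_ : (0 : dfun _) i = 0) // vnorm0 expr0n.
exists (2 * (cabs a ^+ 2 * K + L)) => s us.
apply: (@le_trans _ _ (2 * (cabs a ^+ 2 * \sum_(i <- s) vnorm (f i) ^+ 2 + \sum_(i <- s) vnorm (g i) ^+ 2))).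
  rewrite [_ ^+ 2 * \sum_(_ <- _) _]mulr_sumr -big_split mulr_sumr; apply: ler_sum => i _ /=.
  rewrite -exprMn -vnormZ; change ((a *: f + g) i) with (a *: f i + g i).
  have := sqr_ge0 (vnorm (a *: f i - g i)); rewrite !vnorm_sqD vnormN pipNr ReN.
  set x := vnorm _ ^+ 2; set y := vnorm _ ^+ 2; lra.
by rewrite ler_pM2l // lerD ?gL // ler_wpM2l ?sqr_ge0 ?fK.
Qed.
HB.instance Definition _ := GRing.isSubmodClosed.Build C (dfun (fun i => V i : lmodType C)) l2mem l2mem_submod.

Definition l2car : lmodType C := lsubspace l2mem.

Let ipF (f g : l2car) i : C := pip (val f i) (val g i).

Lemma l2_eval a (f g : l2car) i : val (a *: f + g) i = a *: val f i + val g i.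
Proof. have -> // : val (a *: f + g) = a *: (val f : dfun _) + val g by rewrite linearP. Qed.

(** Polarization: families of squared norms are summable by boundedness, 2 Re <f, g> is a
    combination of three of them, and the imaginary part is the real part for i g. *)
Let ip_ex (f g : l2car) : exists z, hsum (ipF f g) z.
Proof.
have nsq (h : l2car) : exists z, hsum (fun i => (vnorm (val h i) ^+ 2)%:C) z.
  have /asboolP[K hK] := valP h.
  by have [r _ hr] := hsum_bounded (fun i => sqr_ge0 (vnorm (val h i))) hK; exists r%:C.
have [zf hf] := nsq f; have [zg hg] := nsq g.
have re (h : l2car) : exists z, hsum (fun i => (2 * complex.Re (pip (val f i) (val h i)))%:C) z.
  have [z1 h1] := nsq f; have [z2 h2] := nsq h; have [z3 h3] := nsq (1 *: f + h).
  exists (-1 * z1 + (-1 * z2 + z3)).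
  have := hsum_lin (-1) h1 (hsum_lin (-1) h2 h3); congr hsum; apply/funext => i.
  rewrite l2_eval scale1r vnorm_sqD !mulN1r -!rmorphN -!rmorphD /=.
  by congr (_%:C); ring.
have [z1 h1] := re g; have [z2 h2] := re ('i%C *: g + 0).
exists (2^-1 * z1 + (2^-1 * 'i%C * z2 + 0)).
have := hsum_lin (2^-1) h1 (hsum_lin (2^-1 * 'i%C) h2 (@hsum0 R I)); congr hsum; apply/funext => i.
have ci : ('i%C : C)^*%C = - 'i%C by apply/eqP; rewrite eq_complex /= oppr0 !eqxx.
rewrite addr0 l2_eval (_ : val (0 : l2car) i = 0) // addr0 pipZr ci mulNr ReN Re_i opprK.
have h2' : (2^-1 : C) = (2^-1 : R)%:C by rewrite fmorphV rmorphMn.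
by rewrite [RHS]complexE -mulrA [2^-1 * ('i%C * _)]mulrCA h2' -!rmorphM !mulKf ?pnatr_eq0.
Qed.

Definition l2ip (f g : l2car) : C := xget 0 [set z | hsum (ipF f g) z].
Lemma l2ipP (f g : l2car) : hsum (fun i => pip (val f i) (val g i)) (l2ip f g).
Proof. exact: (xgetPex 0 (ip_ex f g)). Qed.

Lemma l2ip_lin a (f g h : l2car) : l2ip (a *: f + g) h = a * l2ip f h + l2ip g h.
Proof.
apply: hsum_uniq (l2ipP _ _) _; have := hsum_lin a (l2ipP f h) (l2ipP g h).
by congr hsum; apply/funext => i; rewrite l2_eval pip_lin.
Qed.
Lemma l2ip_herm (f g : l2car) : l2ip f g = (l2ip g f)^*%C.
Proof.
apply: hsum_uniq (l2ipP f g) _ => e e0; have [s0 h] := l2ipP g f e0.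
exists s0 => s us sub.
have -> : (l2ip g f)^*%C - \sum_(i <- s) pip (val f i) (val g i) =
    (l2ip g f - \sum_(i <- s) pip (val g i) (val f i))^*%C.
  rewrite conjcD conjcN conjc_sum; congr (_ - _); apply: eq_bigr => i _; exact: pip_herm.
by rewrite cabs_conj; exact: h.
Qed.
Lemma l2ip_sq (f : l2car) : exists2 r : R,
  (forall s, uniq s -> \sum_(i <- s) vnorm (val f i) ^+ 2 <= r) & l2ip f f = r%:C.
Proof.
have /asboolP[K hK] := valP f.
have [r ub hr] := hsum_bounded (fun i => sqr_ge0 (vnorm (val f i))) hK; exists r => //.
apply: hsum_uniq (l2ipP f f) _; move: hr; congr hsum.
by apply/funext => i; rewrite pip_vnorm.
Qed.
Lemma l2ip_ge0 (f : l2car) : 0 <= l2ip f f.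
Proof.
have [r h ->] := l2ip_sq f; rewrite ler0c.
by have := h [::] isT; rewrite big_nil.
Qed.

Definition l2PH : preHilbert R := PreHilbert l2ip_lin l2ip_herm l2ip_ge0.

Lemma l2_vnorm_ub (f : l2PH) s : uniq s -> \sum_(i <- s) vnorm (val f i) ^+ 2 <= vnorm f ^+ 2.
Proof. by have [r h e] := l2ip_sq f; rewrite vnorm_sq [pip f f]e; exact: h. Qed.

Lemma l2_vnorm_le (f : l2PH) K : (forall s, uniq s -> \sum_(i <- s) vnorm (val f i) ^+ 2 <= K) ->
  vnorm f ^+ 2 <= K.
Proof.
move=> h; rewrite vnorm_sq; apply: le_trans (Re_le_cabs _) _; apply: (hsum_le (l2ipP f f)) => s us.
under eq_bigr => i _ do rewrite pip_vnorm.
by rewrite -rmorph_sum cabsR ger0_norm ?h // sumr_ge0 // => i _; rewrite sqr_ge0.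
Qed.

Lemma l2_coord_le (f : l2PH) i : vnorm (val f i) <= vnorm f.
Proof.
rewrite -(@ler_pXn2r _ 2) ?nnegrE ?vnorm_ge0 //.
by have := @l2_vnorm_ub f [:: i] isT; rewrite big_seq1.
Qed.

Lemma mk_l2 (f : dfun (fun i => V i : lmodType C)) K :
  (forall s, uniq s -> \sum_(i <- s) vnorm (f i) ^+ 2 <= K) -> exists g : l2PH, val g = f.
Proof.
move=> h; have fm : f \in l2mem by apply/asboolP; exists K.
by exists (exist (fun g => g \in l2mem) f fm : l2car).
Qed.

Lemma l2_ext (f g : l2PH) : (forall i, val f i = val g i) -> f = g.
Proof. by move=> h; apply/val_inj/functional_extensionality_dep. Qed.

Lemma l2_0 i : val (0 : l2PH) i = 0. Proof. by []. Qed.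
Lemma l2_D (f g : l2PH) i : val (f + g) i = val f i + val g i.
Proof. by have := l2_eval 1 f g i; rewrite !scale1r. Qed.
Lemma l2_B (f g : l2PH) i : val (f - g) i = val f i - val g i.
Proof. by have := l2_eval (-1) g f i; rewrite !scaleN1r addrC => ->; rewrite addrC. Qed.

Lemma l2_definite : (forall i (x : V i), vnorm x = 0 -> x = 0) ->
  forall f : l2PH, vnorm f = 0 -> f = 0.
Proof.
move=> dV f f0; apply: l2_ext => i; rewrite l2_0; apply: dV; apply/eqP.
by rewrite eq_le vnorm_ge0 andbT -f0 l2_coord_le.
Qed.

(** The limit is taken in each coordinate. On a finite set of indices the Cauchy estimate survives
    the limit with a factor 2, uniformly in the set, which gives both membership and convergence. *)
Lemma l2_complete : (forall i, ph_complete (V i)) -> ph_complete l2PH.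
Proof.
move=> cV u cu.
have lim i : exists x : V i, forall e : R, 0 < e ->
    exists N, forall p, (N <= p)%N -> vnorm (val (u p) i - x) < e.
  apply: cV => e /cu[N hN]; exists N => p q Np Nq; rewrite -l2_B.
  exact: le_lt_trans (l2_coord_le _ _) (hN p q Np Nq).
pose f : dfun (fun i => V i : lmodType C) := fun i => sval (cid (lim i)).
have hf i : forall e : R, 0 < e -> exists N, forall p, (N <= p)%N -> vnorm (val (u p) i - f i) < e.
  exact: svalP (cid (lim i)).
have conv s d : 0 < d -> exists M, forall q, (M <= q)%N ->
    \sum_(i <- s) vnorm (val (u q) i - f i) ^+ 2 <= d.
  elim: s d => [|i s IH] d d0; first by exists 0%N => q _; rewrite big_nil ltW.
  have d2 := divr_gt0 d0 (ltr0Sn R 1).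
  have [M1 h1] := IH _ d2; have sd : 0 < Num.sqrt (d / 2) by rewrite sqrtr_gt0.
  have [M2 h2] := hf i _ sd; exists (maxn M1 M2) => q; rewrite geq_max => /andP[q1 q2].
  rewrite big_cons [leRHS]splitr; apply: lerD (h1 _ q1).
  rewrite -[d / 2]sqr_sqrtr ?(ltW d2) // ler_pXn2r ?nnegrE ?vnorm_ge0 ?sqrtr_ge0 //.
  exact: ltW (h2 _ q2).
have sq2 i (x y : V i) : vnorm (x + y) ^+ 2 <= 2 * vnorm x ^+ 2 + 2 * vnorm y ^+ 2.
  have := sqr_ge0 (vnorm (x - y)); rewrite !vnorm_sqD vnormN pipNr ReN.
  set a := vnorm _ ^+ 2; set b := vnorm _ ^+ 2; lra.
have bd e N : (forall p q, (N <= p)%N -> (N <= q)%N -> vnorm (u p - u q) < e) ->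
    forall p s, (N <= p)%N -> uniq s -> \sum_(i <- s) vnorm (val (u p) i - f i) ^+ 2 <= 2 * e ^+ 2.
  move=> hN p s Np us; apply: le_cabs_approx => d d0; have d2 := divr_gt0 d0 (ltr0Sn R 1).
  have [M hM] := conv s _ d2; set q := maxn N M.
  have h1 := hM q (leq_maxr _ _); have h2 := hN p q Np (leq_maxl _ _).
  have h3 := l2_vnorm_ub (u p - u q) us.
  apply: (@le_trans _ _ (2 * \sum_(i <- s) vnorm (val (u p - u q) i) ^+ 2 +
      2 * \sum_(i <- s) vnorm (val (u q) i - f i) ^+ 2)).
    rewrite !mulr_sumr -big_split; apply: ler_sum => i _ /=.
    by have := sq2 i (val (u p) i - val (u q) i) (val (u q) i - f i); rewrite addrA subrK.
  have h4 : vnorm (u p - u q) ^+ 2 <= e ^+ 2.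
    by rewrite ler_pXn2r ?nnegrE ?vnorm_ge0 ?(ltW h2) // (le_trans _ (ltW h2)) ?vnorm_ge0.
  apply: lerD; last by rewrite mulrC -ler_pdivlMr.
  by rewrite ler_pM2l //; exact: le_trans h3 h4.
have [N hN] := cu 1 ltr01.
have [|g gE] := @mk_l2 f (2 * vnorm (u N) ^+ 2 + 2 * (2 * 1 ^+ 2)).
  move=> s us; apply: (@le_trans _ _ (2 * \sum_(i <- s) vnorm (val (u N) i) ^+ 2 +
      2 * \sum_(i <- s) vnorm (val (u N) i - f i) ^+ 2)).
    rewrite !mulr_sumr -big_split; apply: ler_sum => i _ /=.
    have := sq2 i (val (u N) i) (- (val (u N) i - f i)); rewrite vnormN opprB addrCA subrr addr0.
    exact.
  by apply: lerD; apply: ler_wpM2l => //; [exact: l2_vnorm_ub|exact: (bd 1 N hN N s (leqnn N) us)].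
exists g => e e0; have [M hM] := cu _ (divr_gt0 e0 (ltr0Sn R 1)); exists M => p Mp.
rewrite -(@ltr_pXn2r _ 2) ?nnegrE ?vnorm_ge0 ?(ltW e0) //.
apply: (@le_lt_trans _ _ (2 * (e / 2) ^+ 2)).
  apply: l2_vnorm_le => s us; apply: le_trans (bd _ _ hM p s Mp us).
  by apply: ler_sum => i _; rewrite l2_B gE.
have := exprn_gt0 2 e0; rewrite exprMn; set a := e ^+ 2; rewrite exprVn; lra.
Qed.

Let single_dfun i (v : V i) : dfun (fun i => V i : lmodType C) :=
  @dfwith I (fun i => V i) (fun=> 0) i v.

Lemma single_ex i (v : V i) : exists g : l2PH, val g = single_dfun v.
Proof.
apply: (@mk_l2 _ (vnorm v ^+ 2)) => s us.
have [si|si] := boolP (i \in s); last first.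
  rewrite big_seq big1 ?sqr_ge0 // => k ks.
  rewrite /single_dfun dfwithout ?vnorm0 ?expr0n //.
  by apply: contraNneq si => ->.
rewrite (bigD1_seq i) //= /single_dfun dfwithin big1 ?addr0 // => k ki.
by rewrite dfwithout ?vnorm0 ?expr0n // eq_sym.
Qed.

Definition single i (v : V i) : l2PH := sval (cid (single_ex v)).

Lemma singleE i (v : V i) : val (single v) i = v.
Proof. by rewrite /single (svalP (cid (single_ex v))) /single_dfun dfwithin. Qed.
Lemma single_neq i k (v : V i) : k != i -> val (single v) k = 0.
Proof. by move=> ki; rewrite /single (svalP (cid (single_ex v))) /single_dfun dfwithout // eq_sym. Qed.

Lemma ip_single i (v : V i) (g : l2PH) : pip (single v) g = pip v (val g i).
Proof.
apply: hsum_uniq (l2ipP _ _) _; rewrite -[pip v _]/(pip v (val g i)).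
have := @hsum_single _ _ (fun k => pip (val (single v) k) (val g k)) i; rewrite singleE; apply.
by move=> k ki; rewrite single_neq // pip0l.
Qed.

Lemma vnorm_single i (v : V i) : vnorm (single v) = vnorm v.
Proof. by rewrite /vnorm ip_single singleE. Qed.

Lemma l2_trunc (f : l2PH) (e : R) : 0 < e -> exists2 s, uniq s &
  vnorm (f - \sum_(i <- s) single (val f i)) < e.
Proof.
move=> e0; have e2 : 0 < e ^+ 2 / 2 by rewrite divr_gt0 ?exprn_gt0.
have [s0 hs] := l2ipP f f e2; exists (undup s0); first exact: undup_uniq.
set s := undup s0; have us : uniq s := undup_uniq _.
have {}hs : vnorm f ^+ 2 - \sum_(i <- s) vnorm (val f i) ^+ 2 <= e ^+ 2 / 2.
  have := hs s us; rewrite -[l2ip f f]/(pip (f : l2PH) f) pip_vnorm.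
  under eq_bigr => i _ do rewrite pip_vnorm.
  rewrite -rmorph_sum -rmorphB cabsR => h; apply: le_trans (ler_norm _) (h _).
  by move=> i; rewrite mem_undup.
have val_sum k : val (\sum_(i <- s) single (val f i)) k = if k \in s then val f k else 0.
  have -> : val (\sum_(i <- s) single (val f i)) k = \sum_(i <- s) val (single (val f i)) k.
    by apply: (big_morph (fun g : l2PH => val g k)) => // g h; rewrite l2_D.
  have [ks|ks] := boolP (k \in s).
    by rewrite (bigD1_seq k) //= singleE big1 ?addr0 // => i ik; rewrite single_neq // eq_sym.
  by rewrite big_seq big1 // => i iS; rewrite single_neq //; apply: contraNneq ks => ->.
rewrite -(@ltr_pXn2r _ 2) ?nnegrE ?vnorm_ge0 ?(ltW e0) //.
apply: (@le_lt_trans _ _ (e ^+ 2 / 2)); last by rewrite ltr_pdivrMr // ltr_pMr ?exprn_gt0 // ltr1n.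
apply: l2_vnorm_le => t ut; apply: le_trans hs; rewrite lerBrDr.
have ust : uniq (s ++ [seq i <- t | i \notin s]).
  rewrite cat_uniq us filter_uniq // andbT /=; apply/hasPn => i.
  by rewrite mem_filter => /andP[].
apply: le_trans (l2_vnorm_ub f ust); rewrite big_cat addrC lerD2l big_filter.
rewrite [leRHS]big_mkcond; apply: ler_sum => i _.
rewrite l2_B val_sum; case: (i \in s); first by rewrite subrr vnorm0 expr0n.
by rewrite subr0.
Qed.
End L2Sum.

(** * The block representation of the dual *)

Lemma rep_mnorm_le (R : realType) (X : smosData R) (V : preHilbert R) (B : X -> V -> V)
    (rB : opsys_rep B) n (x : 'M[X]_n) (K : R) : 0 <= K ->
  (forall xi eta, 2 * complex.Re (nform (fun _ : unit => B) tt x xi eta) <=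
     K * (vnorm xi ^+ 2 + vnorm eta ^+ 2)) -> mnorm x <= K.
Proof.
move=> K0 h; have [sl sr] := nform_sesq rB x.
apply: (mnorm_le (or_nb rB) K0) => -[].
set F := nform (fun _ : unit => B) tt x in sl sr h *.
have l0 y : F 0 y = 0.
  by have := sl (-1) 0 0 y; rewrite scaler0 addr0 mulN1r addNr.
have r0 y : F y 0 = 0.
  by have := sr (-1) 0 0 y; rewrite scaler0 addr0 conjcN conjc_1 mulN1r addNr.
apply: (polar_bound K0 (s := F)) => [a u v|t u v|//].
- by have := sl a u 0 v; rewrite addr0 l0 addr0.
- by have := sr (t%:C) v 0 u; rewrite addr0 r0 addr0 conjR.
Qed.

Lemma real_complete (R : realType) (u : nat -> R) :
  (forall e : R, 0 < e -> exists N, forall p q, (N <= p)%N -> (N <= q)%N -> `|u p - u q| < e) ->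
  exists x, forall e : R, 0 < e -> exists N, forall p, (N <= p)%N -> `|u p - x| < e.
Proof.
move=> cu.
have : cauchy ((u : nat -> R^o) @ \oo).
  apply/cauchy_ballP => e /cu[N hN].
  exists (u @` [set p | (N <= p)%N], u @` [set p | (N <= p)%N]).
    by split; exists N => // p /= Np; exists p.
  by move=> [x y] [[p /= Np <-] [q /= Nq <-]] /=; rewrite -ball_normE; exact: hN.
move/cauchy_cvg => /cvg_ex[x ux]; exists x => e e0.
have /cvgrPdist_lt /(_ _ e0) [N _ hN] := ux.
by exists N => p Np; have := hN p Np; rewrite distrC.
Qed.

Lemma cv_definite (R : realType) n (v : cvPH R n) : vnorm v = 0 -> v = 0.
Proof.
move=> v0; apply/colP => i; rewrite [RHS]mxE; apply/cabs_eq0/eqP.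
by rewrite eq_le cabs_ge0 andbT -v0 cv_coord_le.
Qed.

Lemma cv_complete (R : realType) n : ph_complete (cvPH R n).
Proof.
move=> u cu.
have lim (i : 'I_n) : exists z : R[i], forall e : R, 0 < e ->
    exists N, forall p, (N <= p)%N -> cabs (u p i 0 - z) < e.
  have cau (g : R[i] -> R) : (forall z w, g (z - w) = g z - g w) -> (forall z, `|g z| <= cabs z) ->
      exists x, forall e : R, 0 < e -> exists N, forall p, (N <= p)%N -> `|g (u p i 0) - x| < e.
    move=> gB gle; apply: real_complete => e /cu[N hN]; exists N => p q Np Nq.
    rewrite -gB; apply: le_lt_trans (gle _) _; apply: le_lt_trans (hN p q Np Nq).
    by apply: le_trans (cv_coord_le _ i); rewrite !mxE.
  have [||a ha] := cau (@complex.Re R).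
  - by move=> z w; rewrite ReD ReN.
  - by move=> z; rewrite ler_norml Re_le_cabs andbT lerNl -ReN -(cabsN z) Re_le_cabs.
  have [||b hb] := cau (@complex.Im R).
  - by move=> z w; rewrite ImD ImN.
  - by move=> z; rewrite ler_norml Im_le_cabs andbT lerNl -ImN -(cabsN z) Im_le_cabs.
  exists (a +i* b)%C => e e0; have e2 := divr_gt0 e0 (ltr0Sn R 1).
  have [N hN] := ha _ e2; have [M hM] := hb _ e2; exists (maxn N M) => p.
  rewrite geq_max => /andP[Np Mp]; apply: le_lt_trans (cabs_Re_Im _) _.
  by rewrite ReD ImD ReN ImN /= [ltRHS]splitr; apply: ltrD; [exact: hN|exact: hM].
have [z hz] := choice lim; exists (\col_i z i) => e e0.
have n1 : 0 < n%:R + 1 :> R by rewrite ltr_wpDl.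
have /choice[N hN] (i : 'I_n) := hz i _ (divr_gt0 e0 n1).
exists (\max_i N i) => p Np; apply: le_lt_trans (cv_vnorm_le_sum _) _.
apply: (@le_lt_trans _ _ (\sum_(i < n) e / (n%:R + 1))).
  apply: ler_sum => i _; rewrite !mxE; apply/ltW/hN; apply: leq_trans Np; exact: leq_bigmax.
rewrite sumr_const card_ord -(mulr_natl (e / (n%:R + 1))) mulrCA gtr_pMr //.
by rewrite ltr_pdivrMr // mul1r ltrDl ltr01.
Qed.

Section BlockRep.
Variables (R : realType) (X : smosData R).
Hypothesis hS : is_smos X.
Local Notation C := R[i].
Local Notation D := (dual X).
Let os := smos_os hS.
Let st := smos_star hS.

(** The summands of the Hilbert sum are indexed by all positive contractions of all sizes.
    Reflecting the condition into a boolean makes this a choice type, as the finite families in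
    [hsum] require. *)
Definition posball : choiceType :=
  {m : nat & {x : 'M[X]_m | `[< mpos x /\ mnorm x <= 1 >]}}.
Definition pbmx (i : posball) : 'M[X]_(tag i) := val (tagged i).
Lemma pbmxP i : mpos (pbmx i) /\ mnorm (pbmx i) <= 1.
Proof. by have /asboolP := valP (tagged i). Qed.
(** Size and matrix are replaced by an index in one step, which avoids casts between matrices of
    size m and of size [tag i]. *)
Lemma pb_ind (Q : forall m, 'M[X]_m -> Prop) : (forall i, Q (tag i) (pbmx i)) ->
  forall m (x : 'M[X]_m), mpos x -> mnorm x <= 1 -> Q m x.
Proof.
move=> h m x xp x1; have hx : `[< mpos x /\ mnorm x <= 1 >] by apply/asboolP.
exact: (h (existT _ m (exist (fun y : 'M[X]_m => `[< mpos y /\ mnorm y <= 1 >]) x hx))).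
Qed.

Definition pbV (i : posball) : preHilbert R := cvPH R (tag i).

Lemma evmx_mul_le m (x : 'M[X]_m) (f : D) (v : cvPH R m) : mnorm x <= 1 ->
  vnorm (evmx x f *m v : cvPH R m) <= nrm f * vnorm v.
Proof.
move=> x1; set w : cvPH R m := evmx x f *m v.
have f0 : 0 <= nrm f by exact: (nrm_ge0 (dual_os os)).
have := vnorm_ge0 w; rewrite le_eqVlt => /predU1P[<-|w0]; first by rewrite mulr_ge0 ?vnorm_ge0.
rewrite -(ler_pM2r w0) -expr2.
have e : pip w w = evform (const_mx f : 'M[D]_1) x (delta_vec 0 v) (delta_vec 0 w).
  rewrite /evform /matform mformE !big_ord1 !mxE /delta_vec !eqxx.
  by congr (cvdot (_ *m _) _); rewrite !mxE.
have := evform_le os (const_mx f : 'M[D]_1) x (delta_vec 0 v) (delta_vec 0 w).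
rewrite -e pip_vnorm cabsR ger0_norm ?sqr_ge0 // !vnorm_delta => h; apply: le_trans h _.
rewrite -[leLHS]mulrA -[leRHS]mulrA; apply: (ler_wpM2l f0).
by rewrite ler_piMl // mulr_ge0 ?vnorm_ge0.
Qed.

Definition blockH : hilbert R :=
  mk_hilbert (l2_definite (V := pbV) (fun i => @cv_definite R (tag i)))
             (l2_complete (V := pbV) (fun i => @cv_complete R (tag i))).

Let blk_ex (f : D) (xi : l2PH pbV) : exists g : l2PH pbV,
  forall i, val g i = evmx (pbmx i) f *m val xi i.
Proof.
have f0 : 0 <= nrm f by exact: (nrm_ge0 (dual_os os)).
have [|g gE] := @mk_l2 R posball pbV (fun i => evmx (pbmx i) f *m val xi i) (nrm f ^+ 2 * vnorm xi ^+ 2).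
  move=> s us; apply: le_trans (ler_wpM2l (sqr_ge0 (nrm f)) (l2_vnorm_ub xi us)).
  rewrite mulr_sumr; apply: ler_sum => i _; rewrite -exprMn ler_pXn2r ?nnegrE ?mulr_ge0 ?vnorm_ge0 //.
  by apply: evmx_mul_le; case: (pbmxP i).
by exists g => i; rewrite gE.
Qed.

Let blk f xi := sval (cid (blk_ex f xi)).
Let blkE f xi i : val (blk f xi) i = evmx (pbmx i) f *m val xi i.
Proof. exact: (svalP (cid (blk_ex f xi))). Qed.

Let blockop_ex (f : D) : exists T : LH blockH, forall xi : l2PH pbV, val T xi = blk f xi.
Proof.
have [||T TE] := @mkLH R blockH (blk f).
- move=> a x y; apply: l2_ext => i; change (val (blk f (a *: (x : l2PH pbV) + y)) i =
    val (a *: blk f x + blk f y) i).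
  by rewrite l2_eval !blkE l2_eval mulmxDr scalemxAr.
- exists (nrm f) => v; have f0 : 0 <= nrm f by exact: (nrm_ge0 (dual_os os)).
  change (vnorm (blk f v) <= nrm f * vnorm (v : l2PH pbV)).
  rewrite -(@ler_pXn2r _ 2) ?nnegrE ?mulr_ge0 ?vnorm_ge0 //; apply: l2_vnorm_le => s us.
  rewrite exprMn; apply: le_trans (ler_wpM2l (sqr_ge0 (nrm f)) (l2_vnorm_ub (v : l2PH pbV) us)).
  rewrite mulr_sumr; apply: ler_sum => i _.
  rewrite blkE -exprMn ler_pXn2r ?nnegrE ?mulr_ge0 ?vnorm_ge0 //.
  by apply: evmx_mul_le; case: (pbmxP i).
- by exists T => xi; rewrite TE.
Qed.

Definition blockop (f : D) : LH blockH := sval (cid (blockop_ex f)).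
Lemma blockopE (f : D) (xi : l2PH pbV) i :
  val (val (blockop f) xi : l2PH pbV) i = evmx (pbmx i) f *m val xi i.
Proof. by rewrite (svalP (cid (blockop_ex f))) blkE. Qed.

Lemma LH_ext (H : hilbert R) (S T : LH H) : (forall x, val S x = val T x) -> S = T.
Proof. by move=> h; apply/val_inj/funext. Qed.

Lemma blockop_linear : linear blockop.
Proof.
move=> a f g; apply: LH_ext => xi; apply: (@l2_ext R posball pbV) => i.
rewrite LH_valP; change (val (val (blockop (a *: f + g)) xi : l2PH pbV) i =
  val (a *: (val (blockop f) xi : l2PH pbV) + (val (blockop g) xi : l2PH pbV)) i).
by rewrite l2_eval !blockopE evmxP mulmxDl scalemxAl.
Qed.
HB.instance Definition _ := GRing.isLinear.Build C D (LH blockH) *:%R blockop blockop_linear.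

Let BH (T : LH blockH) (v : hilbPH blockH) : hilbPH blockH := val T v.
Let F n (f : 'M[D]_n) := nform (fun _ : unit => BH) tt (map_mx blockop f).

Lemma blockop_hsum n (f : 'M[D]_n) (xi eta : 'I_n -> l2PH pbV) :
  hsum (fun i => evform f (pbmx i) (fun j => val (xi j) i) (fun j => val (eta j) i)) (F f xi eta).
Proof.
rewrite /F /nform mformE.
have := @hsum_sum R posball n _ _ (fun a => @hsum_sum R posball n _ _ (fun b =>
  l2ipP (val (blockop (f a b)) (xi b) : l2PH pbV) (eta a))).
congr (hsum _ _).
  apply/funext => i; rewrite /evform /matform mformE; apply: eq_bigr => a _; apply: eq_bigr => b _.
  by rewrite blockopE mxE.
by apply: eq_bigr => a _; apply: eq_bigr => b _; rewrite mxE.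
Qed.

(** Vectors supported on one summand recover evaluation at its positive contraction; lower norm
    bounds and positivity of f are read off from [blockop] through this identity. *)
Lemma blockop_single n (f : 'M[D]_n) i (xi eta : powPH (pbV i) n) :
  F f (fun j => single (xi j)) (fun j => single (eta j)) = evform f (pbmx i) xi eta.
Proof.
apply: hsum_uniq (blockop_hsum _ _ _) _.
have := @hsum_single R posball (fun k => evform f (pbmx k)
  (fun j => val (single (xi j)) k) (fun j => val (single (eta j)) k)) i.
have -> : (fun j => val (single (xi j)) i) = xi by apply/funext => j; rewrite singleE.
have -> : (fun j => val (single (eta j)) i) = eta by apply/funext => j; rewrite singleE.
apply=> k ki; rewrite /evform matform_evmx big1 // => a _; rewrite big1 // => b _.
rewrite single_neq // /bicomb big1 ?dualf0 // => p _; rewrite big1 // => q _.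
by rewrite [(0 : pbV k) q 0]mxE mulr0 scale0r.
Qed.

Let rL := LH_rep blockH.

Lemma blockop_le n (f : 'M[D]_n) : mnorm (map_mx blockop f) <= mnorm f.
Proof.
have f0 := dual_mnorm_ge0 os f.
apply: (rep_mnorm_le rL f0) => xi eta.
apply: (@le_trans _ _ (2 * (mnorm f * (vnorm xi ^+ 2 + vnorm eta ^+ 2) / 2))); last first.
  by rewrite mulrC divfK ?pnatr_eq0.
rewrite ler_pM2l //; apply: le_trans (Re_le_cabs _) _.
apply: (hsum_le (blockop_hsum f xi eta)) => s us.
apply: le_trans (cabs_sum _ _ _) _.
apply: (@le_trans _ _ (\sum_(i <- s) mnorm f * ((\sum_j vnorm (val (xi j : l2PH pbV) i) ^+ 2 +
    \sum_j vnorm (val (eta j : l2PH pbV) i) ^+ 2) / 2))).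
  apply: ler_sum => i _; have [_ x1] := pbmxP i.
  set u : powPH (pbV i) n := fun j => val (xi j : l2PH pbV) i.
  set v : powPH (pbV i) n := fun j => val (eta j : l2PH pbV) i.
  rewrite -(pow_vnorm_sq u) -(pow_vnorm_sq v).
  apply: le_trans (evform_le os f (pbmx i) u v) _.
  rewrite -[leLHS]mulrA ler_wpM2l //.
  apply: (@le_trans _ _ (vnorm u * vnorm v)); first by rewrite ler_piMl // mulr_ge0 ?vnorm_ge0.
  have := sqr_ge0 (vnorm u - vnorm v); rewrite sqrrB; lra.
rewrite -mulr_sumr -mulrA ler_wpM2l // -mulr_suml ler_pM2r ?invr_gt0 // big_split /=.
apply: lerD; rewrite exchange_big pow_vnorm_sq; apply: ler_sum => j _ /=.
  exact: (l2_vnorm_ub (xi j : l2PH pbV) us).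
exact: (l2_vnorm_ub (eta j : l2PH pbV) us).
Qed.

Let single_vnorm n i (xi : powPH (pbV i) n) :
  vnorm ((fun j => single (xi j)) : powPH (hilbPH blockH) n) = vnorm xi.
Proof.
apply/eqP; rewrite -(@eqrXn2 _ 2) ?vnorm_ge0 // !pow_vnorm_sq; apply/eqP.
by apply: eq_bigr => j _; congr (_ ^+ 2); exact: vnorm_single.
Qed.

Lemma blockop_ge n (f : 'M[D]_n) m (x : 'M[X]_m) xi eta : mpos x -> mnorm x <= 1 ->
  cabs (evform f x xi eta) <= mnorm (map_mx blockop f) * (vnorm xi * vnorm eta).
Proof.
move=> xp x1; move: m x xp x1 xi eta.
apply: (@pb_ind (fun m x => forall xi eta : powPH (cvPH R m) n, cabs (evform f x xi eta) <=
    mnorm (map_mx blockop f) * (vnorm xi * vnorm eta))) => i xi eta.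
rewrite -blockop_single -(single_vnorm xi) -(single_vnorm eta).
exact: (@nform_le R (LH blockH) unit _ _ (or_nb rL) tt).
Qed.

Hypothesis ap : order_approx X.

Lemma blockop_bound n (f : 'M[D]_n) : mnorm f <= 4 * mnorm (map_mx blockop f).
Proof.
apply: (dual_bound4 hS ap) => [|m x xp x1 xi eta]; first exact: (nb_ge0 (or_nb rL)).
exact: blockop_ge.
Qed.

Lemma blockop_inj : injective blockop.
Proof.
move=> f g e; apply/subr0_eq/(nrm_eq0 (dual_os os))/eqP.
rewrite eq_le (nrm_ge0 (dual_os os)) andbT; apply: le_trans (blockop_bound _) _.
have -> : map_mx blockop (const_mx (f - g) : 'M[D]_1) = 0.
  have e0 : blockop (f - g) = 0 by rewrite linearB /= e subrr.
  by apply/matrixP => a b; rewrite [LHS]mxE [RHS]mxE [const_mx _ _ _]mxE.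
by rewrite (mnorm0 (normed_by_os (or_nb rL))) mulr0.
Qed.

Let cvdot_adj n (a : 'M[C]_n) (v w : 'cV[C]_n) : cvdot (a^t* *m v) w = cvdot v (a *m w).
Proof.
rewrite /cvdot; under eq_bigr => k _ do rewrite mxE mulr_suml.
rewrite exchange_big; apply: eq_bigr => k _ /=; rewrite mxE conjc_sum mulr_sumr.
by apply: eq_bigr => l _; rewrite !mxE conjcM; ring.
Qed.

Lemma blockop_star (f : D) : blockop (mstar f) = mstar (blockop f).
Proof.
apply/subr0_eq/(nb_sep (or_nb rL)) => -[] v w.
rewrite -scaleN1r addrC LH_valP scaleN1r pipDl pipNl; apply/(canLR (addKr _)).
rewrite addr0; apply: etrans _ (esym (or_adj rL (blockop f) v w)).
rewrite -[RHS]/(l2ip (v : l2PH pbV) (val (blockop f) w)).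
rewrite -[LHS]/(l2ip (val (blockop (mstar f)) v : l2PH pbV) w).
apply: hsum_uniq (l2ipP _ _) _; have := l2ipP (v : l2PH pbV) (val (blockop f) w).
congr hsum; apply/funext => i; rewrite !blockopE (evmx_star hS).
have [xp _] := pbmxP i; rewrite (smos_pos_sa hS xp); exact/esym/cvdot_adj.
Qed.

(** Operator positivity is tested by forms alone and includes self-adjointness. Together with
    [blockop_pos] this makes f positive as soon as its forms at positive contractions are. *)
Lemma blockop_pos_test n (f : 'M[D]_n) :
  (forall m (x : 'M[X]_m) xi, mpos x -> mnorm x <= 1 -> 0 <= evform f x xi xi) ->
  mpos (map_mx blockop f).
Proof.
move=> fp; apply/(or_pos rL) => xi; apply: cge0_approx => e e0.
have [s0 hs] := blockop_hsum f xi xi e0.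
exists (\sum_(i <- undup s0) evform f (pbmx i) (fun j => val (xi j : l2PH pbV) i) (fun j => val (xi j : l2PH pbV) i)).
  by apply: sumr_ge0 => i _; apply: fp; case: (pbmxP i).
by apply: hs (undup_uniq _) _ => i; rewrite mem_undup.
Qed.

(** The summands only give contractions, so a positive x is rescaled first. Self-adjointness is
    pulled back through the injectivity of [blockop], hence through order approximation. *)
Lemma blockop_pos n (f : 'M[D]_n) : mpos f <-> mpos (map_mx blockop f).
Proof.
split=> [fp|h].
  by apply: blockop_pos_test => m x xi xp _; exact: (evform_ge0 hS).
have hb m (x : 'M[X]_m) : mpos x -> mnorm x <= 1 -> forall xi, 0 <= evform f x xi xi.
  move: m x; apply: (@pb_ind (fun m x => forall xi : powPH (cvPH R m) n, 0 <= evform f x xi xi)).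
  by move=> i z; rewrite -blockop_single; exact: ((or_pos rL _).1 h).
have hx m (x : 'M[X]_m) xi : mpos x -> 0 <= evform f x xi xi.
  move=> xp; have t0 : 0 < mnorm x + 1 by rewrite ltr_wpDl // (mnorm_ge0 os).
  have t1 : 0 <= (mnorm x + 1)^-1 by rewrite invr_ge0 ltW.
  have x1 : mnorm (map_mx (fun v => (mnorm x + 1)^-1%:C *: v) x) <= 1.
    by rewrite (mnormZ os) cabsR ger0_norm // mulrC ler_pdivrMr // mul1r lerDl.
  have := hb _ _ (mposZ hS t1 xp) x1 xi; rewrite evformZ pmulr_rge0 //.
  by rewrite ltcR invr_gt0.
apply/(dual_posP hS); split=> [|m x xp xi]; last exact: hx.
have e : map_mx blockop (mxstar f) = map_mx blockop f.
  have <- : mxstar (map_mx blockop f) = map_mx blockop f := ((rep_posP rL _).1 h).1.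
  by apply/matrixP => a b; rewrite !(mxE, mxstarE) blockop_star.
apply/matrixP => a b; apply: blockop_inj.
by have /matrixP/(_ a b) := e; rewrite !mxE.
Qed.
End BlockRep.

Lemma sum_AMGM (R : realType) (a b c : nat -> R) N n (K e : R) : 0 <= K ->
  (forall k, c k <= K * a k * b k) -> \sum_(N <= k < n) a k ^+ 2 <= e ->
  \sum_(N <= k < n) b k ^+ 2 <= e -> \sum_(N <= k < n) c k <= K * e.
Proof.
move=> K0 hc ha hb; apply: (@le_trans _ _ (\sum_(N <= k < n) K * (2^-1 * (a k ^+ 2 + b k ^+ 2)))).
  apply: ler_sum => k _; apply: le_trans (hc k) _; rewrite -mulrA; apply: ler_wpM2l => //.
  by have := sqr_ge0 (a k - b k); rewrite sqrrB; lra.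
by rewrite -mulr_sumr -mulr_sumr big_split /=; apply: ler_wpM2l => //; lra.
Qed.

Lemma cvg_cabs (R : realType) (u : nat -> R[i]^o) (l : R[i]^o) : u @ \oo --> l ->
  forall d : R, 0 < d -> exists M, forall n, (M <= n)%N -> cabs (l - u n : R[i]) < d.
Proof.
move=> ul d d0; have dc : 0 < d%:C :> R[i] by rewrite ltcR.
have /cvgrPdist_lt /(_ _ dc) [M _ hM] := ul.
by exists M => n Mn; have := hM n Mn; rewrite normE ltcR.
Qed.

(** * Normal functionals restricted to the block representation *)

Section BlockRepWeak.
Variables (R : realType) (X : smosData R).
Hypothesis hS : is_smos X.
Hypothesis nd : normed_by_dual X.
Hypothesis cX : norm_complete X.
Local Notation C := R[i].
Local Notation D := (dual X).
Local Notation H := (blockH X).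
Local Notation L := (l2PH (@pbV R X)).
Local Notation phi := (blockop hS).
Local Notation P := (@bidual_image R X).
Let os := smos_os hS.
Let st := smos_star hS.

Let fB (f : D) x y : val f (x - y) = val f x - val f y.
Proof. by rewrite -scaleN1r dualfD dualfZ mulN1r. Qed.

(** Evaluations that approximate G come from a Cauchy sequence of points, since [ev] is isometric; X
    being complete, the limit point represents G. *)
Lemma functionals_closed (G : D -> C) :
  (forall e : R, 0 < e -> exists x : X, forall f : D, cabs (G f - val f x) <= e * nrm f) ->
  functionals P G.
Proof.
move=> hG; have n0 n : 0 < n.+1%:R^-1 :> R by rewrite invr_gt0.
have /choice[u hu] n := hG _ (n0 n).
have [|x hx] := cX (u := u).
  move=> e e0; have [N hN] := natinv_lt (divr_gt0 e0 (ltr0Sn R 1)); exists N => p q Np Nq.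
  have h1 := hN p Np; have h2 := hN q Nq; move: (hu p) (hu q) h1 h2.
  set a := _^-1; set b := _^-1 => up uq h1 h2.
  have ab0 : 0 <= a + b by rewrite addr_ge0 // invr_ge0.
  rewrite -(ev_nrm os nd); apply: (@le_lt_trans _ _ (a + b)); last by lra.
  apply: (dual_nrm_ub (dual_os os)) => // f; rewrite evE fB.
  have -> : val f (u p) - val f (u q) = (G f - val f (u q)) - (G f - val f (u p)) by ring.
  by apply: le_trans (cabsB _ _) _; rewrite mulrDl addrC; apply: lerD.
have -> : G = fun f => val f x.
  apply/funext => f; apply/subr0_eq/cabs_eq0/eqP; rewrite eq_le cabs_ge0 andbT.
  have f1 : 0 < nrm f + 1 by rewrite ltr_wpDl // (nrm_ge0 (dual_os os)).
  apply: le_cabs_approx => e e0; rewrite add0r.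
  have e2 := divr_gt0 (divr_gt0 e0 (ltr0Sn R 1)) f1.
  have [N hN] := natinv_lt e2; have [M hM] := hx _ e2.
  have := hN _ (leq_maxl N M); have := hM _ (leq_maxr N M); set n := maxn N M => h2 h1.
  have -> : G f - val f x = (G f - val f (u n)) + val f (u n - x).
    by rewrite fB; ring.
  apply: le_trans (cabsD _ _) _; rewrite [leRHS]splitr; apply: lerD.
    apply: le_trans (hu n f) _; move: h1; set a := _^-1 => h1.
    apply: (@le_trans _ _ (a * (nrm f + 1))).
      by rewrite ler_wpM2l ?invr_ge0 // lerDl.
    by rewrite -ler_pdivlMr // ltW.
  apply: le_trans (dual_nrm_le os f _) _; rewrite mulrC.
  apply: (@le_trans _ _ (nrm (u n - x) * (nrm f + 1))).
    by rewrite ler_wpM2l ?(nrm_ge0 os) // lerDl.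
  by rewrite -ler_pdivlMr // ltW.
exact: functionals_ev.
Qed.

Lemma functionals_ex (G : D -> C) : functionals P G -> exists x : X, forall f, G f = val f x.
Proof. by move=> [p /asboolP[x px] ->]; exists x. Qed.

Lemma block_single (f : D) (i : posball X) (u : pbV i) (eta : L) :
  hip (val (phi f) (single u : H)) (eta : H) = val f (bicomb (pbmx i) u (val eta i)).
Proof.
change (l2ip (val (phi f) (single u : H) : L) eta = val f (bicomb (pbmx i) u (val eta i))).
apply: hsum_uniq (l2ipP _ _) _.
have := @hsum_single R (posball X) (fun k => pip (val (val (phi f) (single u : H) : L) k) (val eta k)) i.
have -> : pip (val (val (phi f) (single u : H) : L) i) (val eta i) = val f (bicomb (pbmx i) u (val eta i)).
  rewrite blockopE singleE dualf_sum; apply: eq_bigr => p _; rewrite dualf_sum mxE mulr_suml.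
  by apply: eq_bigr => q _; rewrite dualfZ !mxE; ring.
by apply=> k ki; rewrite blockopE single_neq // mulmx0 pip0l.
Qed.

Let phi_bd (f : D) (v : L) : vnorm (val (phi f) (v : H) : L) <= nrm f * vnorm v.
Proof.
have rL := LH_rep H.
have h := @opapp_le R (hilbPH H) 1 (fun _ _ => val (phi f)) (nrm f) (nrm_ge0 (dual_os os) f) _ (delta_vec 0 (v : hilbPH H)).
have e1 : vnorm (delta_vec (0 : 'I_1) (v : hilbPH H)) = vnorm v by rewrite vnorm_delta.
have e2 : vnorm (opapp (fun _ _ : 'I_1 => val (phi f)) (delta_vec 0 (v : hilbPH H)) : powPH (hilbPH H) 1) =
   vnorm (val (phi f) (v : H) : L).
  apply/eqP; rewrite -(@eqrXn2 _ 2) ?vnorm_ge0 // pow_vnorm_sq big_ord1 /opapp big_ord1.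
  by rewrite /delta_vec eqxx.
rewrite -e1 -e2; apply: h => xi eta.
have := @nform_le R (LH H) unit _ _ (or_nb rL) tt 1 (const_mx (phi f)) xi eta.
rewrite /nform !mformE !big_ord1 mxE => h; apply: le_trans h _.
apply: ler_wpM2r; first by rewrite mulr_ge0 ?vnorm_ge0.
have -> : (const_mx (phi f) : 'M[LH H]_1) = map_mx phi (const_mx f).
  by apply/matrixP => a b; rewrite !mxE.
exact: blockop_le.
Qed.

(** If xi lives on finitely many summands, the functional is evaluation at a finite sum of elements
    [bicomb]. Truncation of xi and [functionals_closed] give the general case. *)
Let rank_one (xi eta : L) : exists x : X, forall f : D,
  hip (val (phi f) (xi : H)) (eta : H) = val f x.
Proof.
apply/functionals_ex/functionals_closed => e e0.
have n1 : 0 < vnorm eta + 1 by rewrite ltr_wpDl // vnorm_ge0.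
have [s us hs] := l2_trunc xi (divr_gt0 e0 n1).
exists (\sum_(i <- s) bicomb (pbmx i) (val xi i) (val eta i)) => f.
rewrite dualf_sum.
have -> : \sum_(i <- s) val f (bicomb (pbmx i) (val xi i) (val eta i)) =
    hip (val (phi f) ((\sum_(i <- s) single (val xi i) : L) : H)) (eta : H).
  have lT := LH_linear (phi f).
  have T0 : val (phi f) (0 : H) = 0.
    by have := lT (-1) 0 0; rewrite scaler0 addr0 scaleN1r addNr.
  have TD : {morph val (phi f) : x y / x + y}.
    by move=> x y; have := lT 1 x y; rewrite !scale1r.
  rewrite -[RHS]/(pip (val (phi f) ((\sum_(i <- s) single (val xi i) : L) : H) : hilbPH H) (eta : H)).
  rewrite (big_morph (val (phi f)) TD T0) pip_suml; apply: eq_bigr => i _.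
  by rewrite -block_single.
set z : L := \sum_(i <- s) _ in hs *.
have -> : hip (val (phi f) (xi : H)) (eta : H) - hip (val (phi f) (z : H)) (eta : H) =
    pip (val (phi f) ((xi - z : L) : H) : L) eta.
  have -> : val (phi f) ((xi - z : L) : H) = (val (phi f) (xi : H) - val (phi f) (z : H) : L).
    have := LH_linear (phi f) (-1) (z : H) (xi : H); rewrite !scaleN1r addrC => e1.
    by rewrite -[X in val (phi f) X](addrC (- z : L)) [LHS]e1 addrC.
  by rewrite pipDl pipNl.
apply: le_trans (CauchySchwarz _ _) _.
apply: le_trans (ler_wpM2r (vnorm_ge0 eta) (phi_bd f (xi - z))) _.
have f0 := nrm_ge0 (dual_os os) f; have z0 := vnorm_ge0 (xi - z); have v0 := vnorm_ge0 eta.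
move: hs; rewrite ltr_pdivlMr // => /ltW hs.
rewrite [e * _]mulrC -mulrA; apply: (ler_wpM2l f0); apply: le_trans hs.
by apply: (ler_wpM2l z0); rewrite lerDl.
Qed.

Lemma series_tail (xi : nat -> L) :
  cvgn (series (fun k => `|xi k : H| ^+ 2 : C^o)) -> forall e : R, 0 < e ->
  exists N, forall n, (N <= n)%N -> \sum_(N <= k < n) vnorm (xi k) ^+ 2 <= e.
Proof.
move=> /cvg_ex[l hl] e e0; have e2 := divr_gt0 e0 (ltr0Sn R 1).
have [N hN] := cvg_cabs hl e2; exists N => n Nn.
have h1 := hN n Nn; have h2 := hN N (leqnn N).
have e1 : (\sum_(N <= k < n) vnorm (xi k) ^+ 2)%:C =
    series (fun k => `|xi k : H| ^+ 2 : C^o) n - series (fun k => `|xi k : H| ^+ 2 : C^o) N.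
  rewrite sub_series_geq // rmorph_sum; apply: eq_bigr => k _.
  by rewrite (hilb_normE (xi k : H)) -rmorphXn.
have : cabs (\sum_(N <= k < n) vnorm (xi k) ^+ 2)%:C <= e.
  rewrite e1; set a := series _ n in h1 *; set b := series _ N in h2 *.
  have -> : a - b = (l - b) - (l - a) by rewrite opprB [RHS]addrC addrA subrK.
  by apply: le_trans (cabsB _ _) _; rewrite [leRHS]splitr; apply: lerD; apply: ltW.
rewrite cabsR; exact: le_trans (ler_norm _).
Qed.

(** The partial sums are evaluations by [rank_one]. The tails are at most e ||f|| by Cauchy-Schwarz
    and square summability, so the limit is again an evaluation. *)
Lemma normal_on_range (w : LH H -> C) : normal_functionals w ->
  exists x : X, forall f : D, w (phi f) = val f x.
Proof.
move=> [xi [eta [cxi ceta hw]]]; apply/functionals_ex/functionals_closed => e e0.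
have [N1 h1] := series_tail cxi e0; have [N2 h2] := series_tail ceta e0.
have /choice[y hy] k := rank_one (xi k) (eta k).
set N := maxn N1 N2; exists (\sum_(0 <= k < N) y k) => f; rewrite dualf_sum.
have f0 := nrm_ge0 (dual_os os) f.
under eq_bigr => k _ do rewrite -hy.
apply: le_cabs_approx => d d0; have [M hM] := cvg_cabs (hw (phi f)) d0.
set n := maxn M N; have hn := hM n (leq_maxl _ _).
have Nn : (N <= n)%N := leq_maxr _ _.
set T := series _ n in hn.
have TE : T - \sum_(0 <= k < N) hip (val (phi f) (xi k)) (eta k) =
    \sum_(N <= k < n) hip (val (phi f) (xi k)) (eta k).
  by have := sub_series_geq (fun k => hip (val (phi f) (xi k)) (eta k) : C^o) Nn.
set S := \sum_(0 <= k < N) _ in TE *.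
have -> : w (phi f) - S = (w (phi f) - T) + (T - S) by rewrite addrA subrK.
apply: le_trans (cabsD _ _) _; rewrite addrC; apply: lerD; last exact: ltW.
rewrite TE; apply: le_trans (cabs_sum _ _ _) _.
have tail (u : nat -> L) M' : (forall m, (M' <= m)%N -> \sum_(M' <= k < m) vnorm (u k) ^+ 2 <= e) ->
    (M' <= N)%N -> \sum_(N <= k < n) vnorm (u k) ^+ 2 <= e.
  move=> hu MN; apply: le_trans (hu n (leq_trans MN Nn)).
  by rewrite (big_cat_nat MN Nn) /= lerDr sumr_ge0 // => k _; exact: sqr_ge0.
have t1 := tail _ _ h1 (leq_maxl _ _); have t2 := tail _ _ h2 (leq_maxr _ _).
rewrite [e * _]mulrC.
apply: (sum_AMGM (a := fun k => vnorm (xi k : L)) (b := fun k => vnorm (eta k : L)) f0 _ t1 t2) => k.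
apply: le_trans (CauchySchwarz (val (phi f) (xi k) : L) (eta k : L)) _.
exact: (ler_wpM2r (vnorm_ge0 (eta k : L)) (phi_bd f (xi k))).
Qed.
End BlockRepWeak.

Lemma l2_sep (R : realType) (I : choiceType) (V : I -> preHilbert R) :
  (forall i (x : V i), vnorm x = 0 -> x = 0) -> forall a b : l2PH V,
  (forall i (u : V i), pip (single u) a = pip (single u) b) -> a = b.
Proof.
move=> dV a b h; apply: l2_ext => i; apply/subr0_eq/dV/eqP; rewrite -sqrf_eq0 vnorm_sq.
by have := h i (val a i - val b i); rewrite !ip_single pipDr pipNr => ->; rewrite subrr.
Qed.

Lemma finite_normal (R : realType) (H : hilbert R) n (xi eta : nat -> H) :
  normal_functionals (fun T : LH H => \sum_(0 <= k < n) hip (val T (xi k)) (eta k)).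
Proof.
pose cut (u : nat -> H) k : H := if (k < n)%N then u k else 0.
have stat (T : zmodType) (u : nat -> T) : (forall k, (n <= k)%N -> u k = 0) ->
    forall m, (n <= m)%N -> series u m = series u n.
  move=> u0 m nm; rewrite /series /= (big_cat_nat (leq0n n) nm) /= [X in _ + X]big_nat_cond.
  by rewrite [X in _ + X]big1 ?addr0 // => k /andP[/andP[nk _] _]; exact: u0.
have sq (u : nat -> H) : cvgn (series (fun k => `|cut u k| ^+ 2 : R[i]^o)).
  apply/cvg_ex; exists (series (fun k => `|cut u k| ^+ 2 : R[i]^o) n).
  apply: cvg_near_cst; exists n => // m /= nm; apply: stat => // k nk.
  by rewrite /cut ltnNge nk /= normr0 expr0n.
exists (cut xi), (cut eta); split; [exact: sq|exact: sq|] => T.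
apply: cvg_near_cst; exists n => // m /= nm; rewrite (stat R[i] _ _ m nm).
  rewrite /series /= big_nat [RHS]big_nat; apply: eq_bigr => k kn.
  by rewrite /cut (andP kn).2.
move=> k nk; rewrite /cut ltnNge nk /=.
exact: (pip0r (val T (0 : H) : hilbPH H)).
Qed.

(** * Weak-* closedness of the range *)

Section BlockRepClosed.
Variables (R : realType) (X : smosData R).
Hypothesis hS : is_smos X.
Hypothesis nd : normed_by_dual X.
Hypothesis cX : norm_complete X.
Hypothesis ap : order_approx X.
Local Notation C := R[i].
Local Notation D := (dual X).
Local Notation H := (blockH X).
Local Notation L := (l2PH (@pbV R X)).
Local Notation phi := (blockop hS).
Local Notation P := (@bidual_image R X).
Let os := smos_os hS.
Let st := smos_star hS.

(** With t = ||y|| + 1, the 1 x 1 matrix y / t is itself an index of the Hilbert sum, and the vector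
    of length t^(1/2) in its summand represents evaluation at y. *)
Lemma pos_vec (y : X) : pos1 y -> exists z : L,
  (forall f : D, hip (val (phi f) (z : H)) (z : H) = val f y) /\ vnorm z ^+ 2 <= nrm y + 1.
Proof.
move=> yp; have t0 : 0 < nrm y + 1 by rewrite ltr_wpDl // (nrm_ge0 os).
set t := nrm y + 1 in t0 *.
have key : forall m (x : 'M[X]_m), mpos x -> mnorm x <= 1 -> forall u : cvPH R m, exists z : L,
    (forall f : D, hip (val (phi f) (z : H)) (z : H) = val f (bicomb x u u)) /\ vnorm z = vnorm u.
  apply: pb_ind => i u; exists (@single R (posball X) (@pbV R X) i u).
  split=> [f|]; last exact: vnorm_single.
  by rewrite block_single singleE.
have ti : 0 <= t^-1 by rewrite invr_ge0 ltW.
have yp' : mpos (const_mx (t^-1%:C *: y) : 'M[X]_1) by exact: (pos1Z hS).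
have y1 : mnorm (const_mx (t^-1%:C *: y) : 'M[X]_1) <= 1.
  rewrite -/(nrm _) (nrmZ os) cabsR ger0_norm // mulrC ler_pdivrMr // mul1r.
  by rewrite /t lerDl.
have [z [hz zn]] := key _ _ yp' y1 (const_mx (Num.sqrt t)%:C); exists z; split=> [f|].
  rewrite hz /bicomb !big_ord1 !mxE conjR scalerA -!rmorphM -expr2 sqr_sqrtr ?(ltW t0) //.
  by rewrite mulfV ?gt_eqF // scale1r.
rewrite zn cv_vnorm_sq big_ord1 mxE cabsR ger0_norm ?sqrtr_ge0 // sqr_sqrtr //; exact: ltW.
Qed.

Let ar1 (K c : R) : K * (2 * (c + 3)) + (K * (2 * (c + 3)) + (K * (2 * (c + 3)) + K * (2 * (c + 3)))) =
  K * (8 * (c + 3)).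
Proof. by ring. Qed.
Let ar2 (c d e : R) : c <= d + 1 -> d <= 2 * (e + 2) -> c <= 2 * (e + 3).
Proof. by move=> h1 h2; lra. Qed.

(** Evaluation at x extends from the range to all of L(H): x is a combination of four positive
    elements, each represented by a vector. The squared norms of these vectors are at most 2 (||x||
    + 3), whence the bound, which must hold for operators T not known to lie in the range. *)
Lemma ev_normal (x : X) : exists w : LH H -> C, [/\ normal_functionals w,
  forall f : D, w (phi f) = val f x
  & forall (T : LH H) (K : R), 0 <= K -> (forall v : hilbPH H, vnorm (val T v : hilbPH H) <= K * vnorm v) ->
      cabs (w T) <= K * (8 * (nrm x + 3))].
Proof.
have [p [q [r [s [[p0 q0 r0 s0 xE] bd]]]]] := pos_decomposition hS ap cX x.
have fx (f : D) : val f x = val f p + (-1 * val f q + ('i%C * val f r + - 'i%C * val f s)).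
  have fB a b : val f (a - b) = val f a - val f b by rewrite -scaleN1r dualfD dualfZ mulN1r.
  rewrite xE dualfD dualfZ !fB; move: (val f p) (val f q) (val f r) (val f s) => a b c d; ring.
have [zp [hp np]] := pos_vec p0; have [zq [hq nq]] := pos_vec q0.
have [zr [hr nr]] := pos_vec r0; have [zs [hs ns]] := pos_vec s0.
pose eta (k : nat) : hilbPH H := nth 0 [:: (zp : hilbPH H); zq; zr; zs] k.
pose xi (k : nat) : hilbPH H := nth 0 [:: (zp : hilbPH H); -1 *: (zq : hilbPH H);
  'i%C *: (zr : hilbPH H); (- 'i%C) *: (zs : hilbPH H)] k.
pose q4 (T : LH H) (v : L) : C := hip (val T (v : H)) (v : H).
have lT (T : LH H) a (v : L) : hip (val T (a *: (v : hilbPH H) : H)) (v : H) = a * q4 T v.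
  have lin := LH_linear T; have T0 : val T (0 : H) = 0.
    by have := lin (-1) 0 0; rewrite scaler0 addr0 scaleN1r addNr.
  have -> : val T (a *: (v : hilbPH H) : H) = a *: (val T (v : H) : hilbPH H).
    by have := lin a (v : H) 0; rewrite T0 !addr0.
  exact: (pipZl a (val T (v : H) : hilbPH H) (v : hilbPH H)).
have sum4 (G : nat -> C) : \sum_(0 <= k < 4) G k = G 0%N + (G 1%N + (G 2%N + G 3%N)).
  by rewrite unlock /= addr0.
pose w T := q4 T zp + (-1 * q4 T zq + ('i%C * q4 T zr + - 'i%C * q4 T zs)).
have wE : w = fun T : LH H => \sum_(0 <= k < 4) hip (val T (xi k)) (eta k).
  by apply/funext => T; rewrite sum4 /w -!lT.
exists w; split.
- rewrite wE; exact: finite_normal.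
- by move=> f; rewrite fx -(hp f) -(hq f) -(hr f) -(hs f).
- move=> T K K0 hT.
  have tm (a : C) (v : L) (y : X) : cabs a = 1 -> vnorm v ^+ 2 <= nrm y + 1 -> y \in [:: p; q; r; s] ->
      cabs (a * q4 T v) <= K * (2 * (nrm x + 3)).
    move=> a1 vy /bd yb; rewrite cabsM a1 mul1r.
    apply: le_trans (CauchySchwarz (val T (v : H) : hilbPH H) (v : hilbPH H)) _.
    apply: le_trans (ler_wpM2r (vnorm_ge0 (v : hilbPH H)) (hT _)) _.
    rewrite -mulrA; apply: (ler_wpM2l K0).
    move: vy yb; rewrite expr2 -[vnorm (v : hilbPH H)]/(vnorm v).
    by move=> h1 h2; exact: ar2 h1 h2.
  have i1 : cabs ('i%C : C) = 1 by exact: cabs_i.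
  have i2 : cabs (- 'i%C : C) = 1 by rewrite cabsN cabs_i.
  have i3 : cabs (-1 : C) = 1 by rewrite cabsN cabs1.
  have m1 : p \in [:: p; q; r; s] by rewrite !inE eqxx.
  have m2 : q \in [:: p; q; r; s] by rewrite !inE eqxx !orbT.
  have m3 : r \in [:: p; q; r; s] by rewrite !inE eqxx !orbT.
  have m4 : s \in [:: p; q; r; s] by rewrite !inE eqxx !orbT.
  have b1 := tm 1 zp p (cabs1 R) np m1; have b2 := tm (-1) zq q i3 nq m2.
  have b3 := tm ('i%C) zr r i1 nr m3; have b4 := tm (- 'i%C) zs s i2 ns m4.
  rewrite mul1r in b1; rewrite /w.
  apply: le_trans (le_trans (cabsD _ _) (lerD b1 (le_trans (cabsD _ _)
    (lerD b2 (le_trans (cabsD _ _) (lerD b3 b4)))))) _.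
  by rewrite ar1.
Qed.

(* By taking adjoints, an operator is determined by its values on the summands. *)
Lemma block_ext (S T : LH H) :
  (forall (i : posball X) (u : pbV i) (zeta : L),
    hip (val S (single u : H)) (zeta : H) = hip (val T (single u : H)) (zeta : H)) -> S = T.
Proof.
move=> h; have rL := LH_rep H; have stL := rep_star_axioms rL.
suff e : mstar S = mstar T by rewrite -(mstarK stL S) e (mstarK stL).
apply: LH_ext => eta.
have key (i : posball X) (u : pbV i) :
    hip (single u : H) (val (adjoint S) eta) = hip (single u : H) (val (adjoint T) eta).
  have e1 := adjointE S (single u : H) eta; have e2 := adjointE T (single u : H) eta.
  have e3 := h i u eta.
  exact: etrans (esym e1) (etrans e3 e2).
exact: (@l2_sep R (posball X) (@pbV R X) (fun i => @cv_definite R (tag i)) _ _ key).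
Qed.

Let neg_add (u v : C) : -1 * u + v = 0 -> v = u.
Proof. by rewrite mulN1r addrC => /subr0_eq. Qed.

(** For T in the closure put f(x) = w_x(T), with w_x the extended evaluation at x. Linearity in x is
    a relation between weak-* continuous functionals that holds on the range, hence at T; the bound
    comes from [ev_normal]. The matrix coefficients of T and of [blockop f] agree for the same
    reason. *)
Lemma block_range_closed : weakstar_closed (lrange phi).
Proof.
apply: closedP => T clT.
have /choice[w hw] := ev_normal.
have cw x : weak_cont (@normal_functionals R H) (w x).
  by apply: weak_cont_in; case: (hw x).
have wphi x f : w x (phi f) = val f x by case: (hw x).
have [K K0 hK] := LH_bounded T.
have zero (g : LH H -> C) : weak_cont (@normal_functionals R H) g -> (forall f, g (phi f) = 0) -> g T = 0.
  move=> cg g0; apply: (weak_closure_zero clT cg) => U UW.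
  have /asboolP[f <-] : U \in lrange phi by exact: UW.
  exact: g0.
have lf : linear (fun x => w x T : C^o).
  move=> a x y.
  have h := weak_contP2 (-1) (weak_contP2 a (cw x) (cw y)) (cw (a *: x + y)).
  have e : -1 * (a * w x T + w y T) + w (a *: x + y) T = 0.
    by apply: (zero _ h) => f; rewrite !wphi dualfD dualfZ; ring.
  exact: neg_add e.
have bf : exists M : R, forall x, cabs (w x T) <= M * nrm x.
  (* The bound of [ev_normal] is affine in ||x||. Normalising x makes it linear, with constant 32 =
     8 (1 + 3). *)
  exists (K * 32) => x; have := nrm_ge0 os x; rewrite le_eqVlt => /predU1P[x0|x0].
    have -> : x = 0 by apply: (nrm_eq0 os); rewrite -x0.
    have -> : w 0 T = 0.
      by have := lf (-1) 0 0; rewrite scaler0 addr0 scaleN1r addNr.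
    by rewrite cabs0 (nrm0 os) mulr0.
  have [_ _ /(_ T K K0 hK)] := hw ((nrm x)^-1%:C *: x).
  have -> : w ((nrm x)^-1%:C *: x) T = (nrm x)^-1%:C * w x T.
    have := lf ((nrm x)^-1%:C) x 0; have -> : w 0 T = 0.
      by have := lf (-1) 0 0; rewrite scaler0 addr0 scaleN1r addNr.
    by rewrite !addr0.
  rewrite cabsM (nrmZ os) cabsR ger0_norm ?invr_ge0 ?(ltW x0) // mulVf ?gt_eqF //.
  by rewrite ler_pdivrMl // mulrC (_ : 8 * (1 + 3) = 32) //; ring.
pose f : D := mkdual lf bf; have fE x : val f x = w x T by rewrite mkdualE.
apply/asboolP; exists f.
apply: block_ext => i u zeta; rewrite block_single fE.
have nf : normal_functionals (fun U : LH H => hip (val U (single u : H)) (zeta : H)).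
  have := @finite_normal R H 1 (fun=> single u : H) (fun=> zeta : H).
  by congr normal_functionals; apply/funext => U; rewrite big_nat1.
have h := weak_contP2 (-1) (cw (bicomb (pbmx i) u (val zeta i))) (weak_cont_in nf).
apply/esym/neg_add; apply: (zero _ h) => g.
by rewrite wphi block_single mulN1r addNr.
Qed.

(** The homeomorphism results from matching functionals: normal functionals restrict to evaluations
    by [normal_on_range], and every evaluation extends to a normal functional by [ev_normal]. *)
Lemma dual_quasi : is_dual_quasi_operator_system P.
Proof.
split.
  by apply: dual_is_dual_mos => // f h; exact: (dual_pos_sep hS ap cX).
exists H, (lrange phi : submodClosed (LH H)); split.
- exact: (lrange_selfadjoint (blockop_star hS)).
- exact: block_range_closed.
exists (range_map phi : {linear D -> subsmos (lrange phi)}); split.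
  have k4 : 0 < 4 :> R by [].
  apply: (range_map_iso (blockop_inj ap) (blockop_star hS) (blockop_pos hS ap) (blockop_le hS) k4).
  exact: blockop_bound.
have [psi h1 h2] := range_map_bij (blockop_inj (hS := hS) ap); exists psi; split=> //.
  apply: weak_continuous => p f e [w wn pE] e0.
  have [x hx] := normal_on_range hS nd cX wn.
  have pf : functionals P (fun g : D => p (range_map phi g)).
    have -> : (fun g : D => p (range_map phi g)) = fun g => val g x.
      by apply/funext => g; rewrite pE -hx.
    exact: functionals_ev.
  exact (weak_nbhs f pf e0).
apply: weak_continuous => p y e /functionals_ex[x hx] e0.
have [w [wn wp _]] := ev_normal x.
have wn' : @normal_functionals_on R H (lrange phi) (fun z => p (psi z)).
  exists w => //; apply/funext => z; rewrite hx -wp; congr w.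
  exact: (congr1 val (h2 z)).
exact (weak_nbhs y wn' e0).
Qed.
End BlockRepClosed.

(** * The dual norm on positive elements *)

Section WeakMaps.
Variables (R : realType) (D : smosData R) (P : submodClosed (dual D)).
Local Notation C := R[i].

Lemma mx_continuous n (phi : D -> 'M[C]_n) :
  (forall i j, weak_cont (functionals P) (fun f => phi f i j)) <->
  continuous (phi : weaktop (functionals P) -> 'M[C^o]_n).
Proof.
split=> [h f A [Q QA sub]|h i j f e e0].
  pose t : weaktop (functionals P) := f.
  pose F (ij : 'I_n * 'I_n) : set (weaktop (functionals P)) := [set g | Q ij.1 ij.2 (phi g ij.1 ij.2)].
  have : nbhs t [set g | forall ij, F ij g].
    apply: (@filter_forall (weaktop (functionals P)) _ F (nbhs t) (nbhs_filter t)) => -[i j].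
    have /cplx_nbhsP[e e0 he] := QA i j.
    by apply: filterS (h i j t e e0) => g; exact: he.
  by apply: filterS => g hg; apply: sub => i j; exact: (hg (i, j)).
have /(h f) : nbhs (phi f : 'M[C^o]_n) [set M : 'M[C^o]_n | cabs (M i j - phi f i j : C) < e].
  exists (fun k l => if (k == i) && (l == j) then [set z : C^o | cabs (z - phi f i j : C) < e] else setT).
    move=> k l; case: ifP => [/andP[/eqP -> /eqP ->]|_]; last exact: filterT.
    by apply/cplx_nbhsP; exists e.
  by move=> M /(_ i j); rewrite !eqxx.
by [].
Qed.

Lemma WQmap_le (i : WQindex P) n (f : 'M[D]_n) : mnorm (map_mx (WQmap i) f) <= mnorm f.
Proof. by case: i => k [phi [a b c]]; exact: b. Qed.

Lemma mu_component n (f : 'M[D]_n) (i : WQindex P) :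
  map_mx (@WQcomponent R D P i) (map_mx (mu P) f) = map_mx (WQmap i) f.
Proof. by apply/matrixP => a b; rewrite !mxE. Qed.

Lemma mu_norm_ge (i : WQindex P) n (f : 'M[D]_n) :
  mnorm (map_mx (WQmap i) f) <= mnorm (map_mx (mu P) f : 'M[ND P]_n).
Proof.
rewrite -mu_component; apply: ub_le_sup; last by exists i.
by exists (mnorm f) => _ [k _ <-]; rewrite mu_component; exact: WQmap_le.
Qed.

Lemma mu_norm_le n (f : 'M[D]_n) (K : R) : 0 <= K ->
  (forall i : WQindex P, mnorm (map_mx (WQmap i) f) <= K) ->
  mnorm (map_mx (mu P) f : 'M[ND P]_n) <= K.
Proof.
move=> K0 h.
change (sup [set mnorm (map_mx (@WQcomponent R D P i) (map_mx (mu P) f)) | i in [set: WQindex P]] <= K).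
(* [sup] of the empty set is 0, which settles the case of an empty index set; K >= 0 is used
   there. *)
have [[k0 _]|no] := pselect (exists i : WQindex P, True).
  apply: ge_sup => [|_ [k _ <-]]; last by rewrite mu_component; exact: h.
  by exists (mnorm (map_mx (@WQcomponent R D P k0) (map_mx (mu P) f))), k0.
rewrite (_ : [set _ | _ in _] = set0) ?sup0 //.
by rewrite -subset0; move=> r [k _ _]; case: no; exists k.
Qed.
End WeakMaps.

Section Evaluations.
Variables (R : realType) (T : smosData R).
Hypothesis hT : is_smos T.
Local Notation C := R[i].
Local Notation D := (dual T).
Local Notation P := (@bidual_image R T).
Let os := smos_os hT.

Lemma evmx_linear k (y : 'M[T]_k) : linear (evmx y : D -> matC R k).
Proof. by move=> a f g; exact: evmxP. Qed.

(** Evaluations at positive contractions are thereby available as components of mu, both for norms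
    and for positivity. *)
Lemma WQ_ev k (y : 'M[T]_k) : mpos y -> mnorm y <= 1 ->
  exists i : WQindex P, forall n (f : 'M[D]_n), mnorm (map_mx (WQmap i) f) = mnorm (map_mx (evmx y) f)
    /\ (mpos (map_mx (WQmap i) f) -> mpos (map_mx (evmx y) f)).
Proof.
move=> yp y1; have ys := smos_pos_sa hT yp.
pose L := GRing.isLinear.Build C D (matC R k) *:%R (evmx y) (evmx_linear y).
pose phi : {linear D -> matC R k} := HB.pack (evmx y : D -> matC R k) L.
have cp : completely_positive phi.
  split=> [f|n f fp]; last by have := ((dual_posP hT f).1 fp).2 _ _ yp.
  by have := evmx_star hT y f; rewrite ys.
have cc : complete_contraction phi.
  move=> n f; apply: le_trans (evmx_le os y f) _.
  by rewrite ler_piMr // (dual_mnorm_ge0 os).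
have ct : continuous (phi : weaktop (functionals P) -> 'M[C^o]_k).
  apply/mx_continuous => i j; have -> : (fun f => phi f i j) = fun f : D => val f (y i j).
    by apply/funext => f; rewrite [LHS]mxE.
  by apply: weak_cont_in; exact: functionals_ev.
have hW : [/\ completely_positive phi, complete_contraction phi
  & continuous (phi : weaktop (functionals P) -> 'M[C^o]_k)] by split.
exists (existT (fun n => WQ P n) k (exist _ phi hW)) => n f; split; [exact: erefl|exact: id].
Qed.

Lemma dnormE n (f : 'M[D]_n) : dnorm f = mnorm (map_mx (mu P) f : 'M[ND P]_n).
Proof. by rewrite /dnorm sub_mnorm; congr mnorm; apply/matrixP => a b; rewrite !mxE. Qed.

Lemma dnorm_ev n (f : 'M[D]_n) k (y : 'M[T]_k) : mpos y -> mnorm y <= 1 ->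
  mnorm (map_mx (evmx y) f) <= dnorm f.
Proof.
move=> yp y1; have [i h] := WQ_ev yp y1; rewrite dnormE -(h n f).1.
exact: (mu_norm_ge i f).
Qed.

Lemma dnorm_ge0 n (f : 'M[D]_n) : 0 <= dnorm f.
Proof.
have := dnorm_ev f (mpos0 hT 0); rewrite (mnorm0 os) => /(_ ler01); apply: le_trans.
by have [h _] := matC_norm (map_mx (evmx (0 : 'M[T]_0)) f).
Qed.

Lemma dnorm_le n (f : 'M[D]_n) : dnorm f <= mnorm f.
Proof.
rewrite dnormE; apply: mu_norm_le => [|i].
  exact: (dual_mnorm_ge0 os).
exact: WQmap_le.
Qed.

Lemma dnorm_evform n (f : 'M[D]_n) m (x : 'M[T]_m) xi eta : mpos x -> mnorm x <= 1 ->
  cabs (evform f x xi eta) <= dnorm f * (vnorm xi * vnorm eta).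
Proof. by move=> xp x1; apply: (matC_le _ (dnorm_ge0 f)).1; exact: dnorm_ev. Qed.

Hypothesis ap : order_approx T.

Lemma dnorm_ge n (f : 'M[D]_n) : mnorm f <= 4 * dnorm f.
Proof.
apply: (dual_bound4 hT ap (dnorm_ge0 f)) => m x xp x1 xi eta; exact: dnorm_evform.
Qed.

Lemma dnorm_pos n (g : 'M[D]_n) : mpos g -> mnorm g = dnorm g.
Proof.
move=> gp; apply/le_anti/andP; split; last exact: dnorm_le.
apply: (dual_bound_pos hT ap (dnorm_ge0 g) gp) => m x xp x1 xi eta; exact: dnorm_evform.
Qed.
End Evaluations.

(** * The bidual of the dualization *)

Lemma tosub_in (R : realType) (X : lmodType R[i]) (W : submodClosed X) (x : X) :
  x \in W -> val (tosub W x) = x.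
Proof. by move=> xW; rewrite /tosub val_insubd xW. Qed.

Section DualizationSpace.
Variables (R : realType) (T : smosData R).
Hypothesis hT : is_smos T.
Hypothesis ap : order_approx T.
Local Notation C := R[i].
Local Notation D := (dual T).
Local Notation P := (@bidual_image R T).
Local Notation Sd := (dualization T).
Local Notation delta := (@dualization_map R T).
Let os := smos_os hT.

Lemma dzm_P a (f g : D) : delta (a *: f + g) = a *: delta f + delta g.
Proof. by apply: val_inj; rewrite [RHS]sub_linear /= linearP. Qed.

Lemma dzm_0 : delta 0 = 0.
Proof. by have := dzm_P (-1) 0 0; rewrite scaler0 addr0 scaleN1r addNr. Qed.

Lemma dzm_B (f g : D) : delta (f - g) = delta f - delta g.
Proof. by have := dzm_P (-1) g f; rewrite !scaleN1r addrC => ->; rewrite addrC. Qed.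

Lemma dzm_surj n (Y : 'M[Sd]_n) : exists f : 'M[D]_n, Y = map_mx delta f.
Proof.
have /choice[g hg] (y : Sd) : exists f, delta f = y.
  by have /asboolP[f fy] := valP y; exists f; apply: val_inj.
by exists (map_mx g Y); apply/matrixP => i j; rewrite !mxE hg.
Qed.

Lemma dzm_norm n (f : 'M[D]_n) : mnorm (map_mx delta f) = dnorm f. Proof. by []. Qed.

Lemma dzm_inj : injective delta.
Proof.
move=> f g e; apply/subr0_eq/(nrm_eq0 (dual_os os))/eqP.
rewrite eq_le (nrm_ge0 (dual_os os)) andbT; apply: le_trans (dnorm_ge hT ap _) _.
have d0 : delta (f - g) = delta 0 by rewrite dzm_B e subrr dzm_0.
rewrite -dzm_norm (_ : map_mx delta _ = map_mx delta (0 : 'M[D]_1)).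
  by rewrite dzm_norm -(mulr0 4) ler_pM2l // -(mnorm0 (dual_os os) 1); exact: dnorm_le.
by apply/matrixP => i j; rewrite mxE [RHS]mxE mxE [(0 : 'M[D]_1) i j]mxE.
Qed.

Let WQstar (i : WQindex P) (f : D) : WQmap i (mstar f) = (WQmap i f : 'M[C]_(projT1 i))^t*.
Proof. by case: (svalP (projT2 i)) => -[a _] _ _; exact: a. Qed.

Lemma mu_star (f : D) : mstar (mu P f) = mu P (mstar f).
Proof.
apply: val_inj.
have e : (fun i => (WQmap i f : 'M[C]_(projT1 i))^t*) = val (mu P (mstar f)) :> WQfamily P.
  by apply: functional_extensionality_dep => i; rewrite -WQstar.
have m : (fun i => (WQmap i f : 'M[C]_(projT1 i))^t*) \in @bounded_family R D P.
  by rewrite e; exact: (valP (mu P (mstar f))).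
exact: (etrans (tosub_in m) e).
Qed.

Lemma dzm_star (f : D) : mstar (delta f) = delta (mstar f).
Proof.
apply: val_inj; change (val (tosub (lrange (mu P)) (mstar (mu P f))) = mu P (mstar f)).
by rewrite mu_star; apply: tosub_in; exact: mem_lrange.
Qed.

Definition wq_op (i : WQindex P) (y : Sd) (v : cvPH R (projT1 i)) : cvPH R (projT1 i) :=
  (WQcomponent i (val y) : 'M[C]_(projT1 i)) *m v.

Let wq_delta i n (f : 'M[D]_n) xi eta :
  nform wq_op i (map_mx delta f) xi eta = matform (map_mx (WQmap i) f) xi eta.
Proof.
rewrite /nform /matform; congr (mform _ _ _).
by apply/funext => a; apply/funext => b; apply/funext => v; rewrite /wq_op !mxE.
Qed.

Lemma dz_op_rep : op_rep wq_op.
Proof.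
split=> [i a x y v|i x a u v]; last by rewrite /wq_op mulmxDr scalemxAr.
have [fx] := dzm_surj (const_mx x : 'M_1); have [fy] := dzm_surj (const_mx y : 'M_1).
move=> /matrixP/(_ 0 0); rewrite !mxE => -> /matrixP/(_ 0 0); rewrite !mxE => ->.
rewrite -dzm_P /wq_op scalemxAl -mulmxDl; congr (_ *m v).
by change (WQmap i (a *: fx 0 0 + fy 0 0) = a *: WQmap i (fx 0 0) + WQmap i (fy 0 0)); rewrite linearP.
Qed.

Lemma dz_normed_by : normed_by wq_op.
Proof.
split=> [|n x|n x K K0|x h].
- exact: dz_op_rep.
- by have [f ->] := dzm_surj x; exact: dnorm_ge0.
- have [f ->] := dzm_surj x; rewrite dzm_norm dnormE; split=> [h i xi eta|h].
    rewrite -[mform _ _ _]/(nform wq_op i (map_mx delta f) xi eta) wq_delta.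
    by apply: (matC_le _ K0).1; apply: le_trans (mu_norm_ge i f) h.
  apply: mu_norm_le => // i; apply/(matC_le _ K0) => xi eta; rewrite -wq_delta; exact: h.
- have [f] := dzm_surj (const_mx x : 'M_1); move=> /matrixP/(_ 0 0); rewrite !mxE => xf.
  suff -> : x = delta 0 by exact: dzm_0.
    rewrite xf; congr delta; apply/(nrm_eq0 (dual_os os))/eqP.
    rewrite eq_le (nrm_ge0 (dual_os os)) andbT; apply: le_trans (dnorm_ge hT ap _) _.
    rewrite -(mulr0 4) ler_pM2l // dnormE; apply: mu_norm_le => // i.
    apply/(matC_le _ (lexx 0)) => xi eta; rewrite -wq_delta mul0r /nform mformE !big_ord1.
    rewrite mxE [const_mx _ _ _]mxE -xf.
    by rewrite (_ : pip _ _ = 0) ?cabs0 //; exact: (h i).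
Qed.

Lemma dz_pos n (f : 'M[D]_n) : mpos (map_mx delta f) <-> forall i : WQindex P, mpos (map_mx (WQmap i) f).
Proof.
have E i : map_mx (@WQcomponent R D P i) (map_mx val (map_mx delta f)) = map_mx (WQmap i) f.
  by apply/matrixP => a b; rewrite !mxE.
split=> h; first by move=> i; rewrite -E; exact: (h i).
suff h' i : mpos (map_mx (@WQcomponent R D P i) (map_mx val (map_mx delta f))) by exact: h'.
by rewrite E.
Qed.

(** The components of mu are completely positive, which is one direction. Evaluations at positive
    contractions occur among them, and these suffice to test positivity of f. *)
Lemma dz_posE n (f : 'M[D]_n) : mpos (map_mx delta f) <-> mpos f.
Proof.
split=> [/dz_pos h|fp]; last first.
  by apply/dz_pos => i; case: (svalP (projT2 i)) => -[_ a] _ _; exact: a.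
apply/(blockop_pos hT ap)/(blockop_pos_test hT) => m x xi xp x1.
have [i hi] := WQ_ev hT xp x1.
exact: ((hi n f).2 (h i) xi).
Qed.

Lemma dz_smos : is_smos Sd.
Proof.
have nb := dz_normed_by; have osd := normed_by_os nb.
have lift_star n (f : 'M[D]_n) : mxstar (map_mx delta f) = map_mx delta (mxstar f).
  by apply/matrixP => a b; rewrite !mxE dzm_star.
have WQs (i : WQindex P) n (f : 'M[D]_n) : map_mx (WQmap i) (mxstar f) = mxstar (map_mx (WQmap i) f).
  by apply/matrixP => a b; rewrite !mxE WQstar.
apply: (rep_smos osd _ _ dz_op_rep).
- split=> [y|c y z].
    have [f] := dzm_surj (const_mx y : 'M_1); move=> /matrixP/(_ 0 0); rewrite !mxE => ->.
    by rewrite !dzm_star (mstarK (dual_star_axioms hT)).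
  have [f] := dzm_surj (const_mx y : 'M_1); move=> /matrixP/(_ 0 0); rewrite !mxE => ->.
  have [g] := dzm_surj (const_mx z : 'M_1); move=> /matrixP/(_ 0 0); rewrite !mxE => ->.
  by rewrite -dzm_P !dzm_star -dzm_P (mstarP (dual_star_axioms hT)).
- have le n (f : 'M[D]_n) : dnorm (mxstar f) <= dnorm f.
    rewrite [dnorm (mxstar f)]dnormE.
    apply: mu_norm_le => [|i]; first exact: dnorm_ge0.
    by rewrite WQs matC_mnorm_star dnormE; exact: mu_norm_ge.
  move=> n y; have [f ->] := dzm_surj y; rewrite lift_star !dzm_norm.
  have h1 := le n f; have h2 := le n (mxstar f).
  rewrite (mxstarK (dual_star_axioms hT)) in h2.
  by apply/le_anti/andP; split; [exact: h1|exact: h2].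
- move=> n y; have [f ->] := dzm_surj y; rewrite dz_posE lift_star; split=> [fp|[_ h]].
    split=> [|i xi]; first by rewrite ((dual_posP hT f).1 fp).1.
    by rewrite wq_delta; exact: (((dz_pos f).1 ((dz_posE f).2 fp) i) xi).
  apply/dz_posE/dz_pos => i xi; have := h i xi; rewrite wq_delta; exact.
- move=> i n xi; exists (vnorm xi * vnorm xi) => y; rewrite mulrC; exact: (nform_le nb).
Qed.
End DualizationSpace.

(** * Weak-* continuous functionals are evaluations *)

Lemma kernel_span (R : realType) (X : lmodType R[i]) n (q : 'I_n -> X -> R[i]) (g : X -> R[i]) :
  (forall i, linear (q i : X -> R[i]^o)) -> linear (g : X -> R[i]^o) ->
  (forall s, (forall i, q i s = 0) -> g s = 0) ->
  exists c : 'I_n -> R[i], forall s, g s = \sum_i c i * q i s.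
Proof.
elim: n q g => [|n IH] q g lq lg h.
  by exists (fun=> 0) => s; rewrite big_ord0; apply: h => -[].
(* If the first functional vanishes on the common kernel of the others, it gets the coefficient 0;
   otherwise a point s0 of that kernel determines its coefficient t. *)
have [[s0 [q0 qn]]|no] := pselect (exists s0, (forall i, q (lift ord0 i) s0 = 0) /\ q ord0 s0 != 0); last first.
  have [|c hc] := IH (fun i => q (lift ord0 i)) g (fun i => lq _) lg.
    move=> s hs; apply: h => i; case: (unliftP ord0 i) => [k ->|->]; first exact: hs.
    by apply/eqP; apply: contrapT => /negP qs; apply: no; exists s.
  exists (fun i => if unlift ord0 i is Some k then c k else 0) => s.
  rewrite big_ord_recl unlift_none mul0r add0r hc; apply: eq_bigr => k _.
  by rewrite liftK.
pose t := g s0 / q ord0 s0.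
have [||c hc] := IH (fun i => q (lift ord0 i)) (fun s => g s - t * q ord0 s) (fun i => lq _).
- move=> a x y; rewrite lg lq.
  change (a * g x + g y - t * (a * q ord0 x + q ord0 y) =
    a * (g x - t * q ord0 x) + (g y - t * q ord0 y)); ring.
- move=> s hs; have hz i : q i (s - (q ord0 s / q ord0 s0) *: s0) = 0.
    rewrite addrC -scaleNr lq; change (- (q ord0 s / q ord0 s0) * q i s0 + q i s = 0).
    case: (unliftP ord0 i) => [k ->|->]; first by rewrite q0 hs mulr0 addr0.
    by rewrite mulNr divfK // addNr.
  have := h _ hz; rewrite addrC -scaleNr lg => e; rewrite -e.
  by change (g s - t * q ord0 s = - (q ord0 s / q ord0 s0) * g s0 + g s); rewrite /t; ring.
exists (fun i => if unlift ord0 i is Some k then c k else t) => s.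
rewrite big_ord_recl unlift_none addrC; apply/(canRL (subrK _)); rewrite hc.
by apply: eq_bigr => k _; rewrite liftK.
Qed.

Section WeakFunctionals.
Variables (R : realType) (T : smosData R).
Local Notation C := R[i].
Local Notation D := (dual T).
Local Notation P := (@bidual_image R T).

(** Continuity at 0 gives finitely many evaluations whose common kernel is mapped by g into the open
    unit disc, hence to 0 by scaling. So g is a combination of these evaluations. *)
Lemma weak_cont_ev (g : D -> C) : linear (g : D -> C^o) -> weak_cont (functionals P) g ->
  exists x : T, forall f, g f = val f x.
Proof.
move=> lg cg; have g0 : g 0 = 0.
  by have := lg (-1) 0 0; rewrite scaler0 addr0 scaleN1r addNr.
have gZ a f : g (a *: f) = a * g f by have := lg a f 0; rewrite g0 !addr0.
have [n [q [e [Pq e0 hq]]]] := weak_nbhs_base (cg 0 1 ltr01).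
have /choice[x hx] i := functionals_ex (Pq i).
have qZ i a f : q i (a *: f) = a * q i f by rewrite !hx dualZ.
have [|||c hc] := @kernel_span R D n q g.
- by move=> i a f h; rewrite !hx dualD dualZ.
- exact: lg.
- move=> s qs; apply: cabs_eq0; apply/eqP; rewrite eq_le cabs_ge0 andbT; apply/negPn/negP; rewrite -ltNge => gs.
  have /= := hq ((cabs (g s))^-1%:C *: s); rewrite g0 subr0 gZ cabsM cabsR ger0_norm ?invr_ge0 ?ltW //.
  rewrite mulVf ?gt_eqF // ltxx => abs; apply: notF; apply: abs => i.
  have q0 : q i 0 = 0 by have := qZ i 0 0; rewrite scaler0 mul0r.
  by rewrite qZ qs mulr0 q0 subrr cabs0.
exists (\sum_i c i *: x i) => f; rewrite hc dualf_sum; apply: eq_bigr => i _.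
by rewrite dualfZ hx.
Qed.

Lemma WQ_point (i : WQindex P) : exists y : 'M[T]_(projT1 i), forall f, WQmap i f = evmx y f.
Proof.
case: (svalP (projT2 i)) => _ _ /mx_continuous ct.
have /choice[y hy] (kl : 'I_(projT1 i) * 'I_(projT1 i)) : exists y : T, forall f : D,
    (WQmap i f : 'M[C]__) kl.1 kl.2 = val f y.
  apply: weak_cont_ev => [a f h|]; last exact: ct.
  by rewrite linearP !mxE.
exists (\matrix_(k, l) y (k, l)) => f; apply/matrixP => k l.
by rewrite [RHS]mxE mxE -hy.
Qed.
End WeakFunctionals.

Lemma mulmx_psd_le (R : realType) m n (b : 'M[R[i]]_(m, n)) (t : R) (v : cvPH R n) :
  psd (t%:C%:M - b^t* *m b) -> vnorm (b *m v : cvPH R m) ^+ 2 <= t * vnorm v ^+ 2.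
Proof.
move=> [_ /(_ v)/cRe_ge0]; rewrite mulmxBr mulmxBl !mxE ReD ReN subr_ge0.
have e k (w : 'cV[R[i]]_k) : complex.Re ((w^t* *m w) 0 0) = vnorm (w : cvPH R k) ^+ 2.
  rewrite mxE Re_sum cv_vnorm_sq; apply: eq_bigr => i _.
  by rewrite !mxE mulrC mulC_conj.
have e1 : \sum_j (v^t* *m (b^t* *m b)) 0 j * v j 0 = ((b *m v)^t* *m (b *m v)) 0 0.
  have -> : (b *m v)^t* *m (b *m v) = v^t* *m (b^t* *m b) *m v by rewrite adjmxM !mulmxA.
  by rewrite [RHS]mxE.
have e2 : \sum_j (v^t* *m t%:C%:M) 0 j * v j 0 = t%:C * (v^t* *m v) 0 0.
  by rewrite mxE mulr_sumr; apply: eq_bigr => j _; rewrite mul_mx_scalar mxE mulrA.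
by rewrite e1 e2 ReZ !e.
Qed.

(** * The isometry tau *)

Section Tau.
Variables (R : realType) (S : smosData R) (V : preHilbert R) (B : S -> V -> V).
Hypothesis rB : opsys_rep B.
Hypothesis ap : order_approx S.
Local Notation C := R[i].
Local Notation D := (dual S).
Local Notation Sd := (dualization S).
Local Notation delta := (@dualization_map R S).
Let hS : is_smos S := (rep_is_mos rB).1.
Let os := smos_os hS.
Let hD := dual_smos hS.
Let hSd := dz_smos hS ap.

Let pre_ex (G : dual D) : exists g : dual Sd, forall f : D, val g (delta f) = val G f.
Proof.
have /choice[k hk] (y : Sd) : exists f, delta f = y.
  by have /asboolP[f fy] := valP y; exists f; apply: val_inj.
have kd f : k (delta f) = f by apply: (dzm_inj hS ap); rewrite hk.
have lg : linear (fun y => val G (k y) : C^o).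
  by move=> a x y; rewrite -(hk x) -(hk y) -dzm_P !kd dualfD dualfZ.
have bg : exists M : R, forall y, cabs (val G (k y)) <= M * nrm y.
  (* By [dnorm_ge], the map onto T^d is bounded below by 1/4. *)
  exists (nrm G * 4) => y; apply: le_trans (dual_nrm_le (smos_os hD) G (k y)) _.
  rewrite -mulrA ler_wpM2l ?(nrm_ge0 (dual_os (smos_os hD))) //.
  apply: le_trans (dnorm_ge hS ap (const_mx (k y) : 'M[D]_1)) _.
  rewrite -dzm_norm (_ : map_mx delta _ = const_mx y) //.
  by apply/matrixP => p q; rewrite !mxE hk.
by exists (mkdual lg bg) => f; rewrite mkdualE kd.
Qed.

Definition predual_lift (G : dual D) : dual Sd :=
  xget 0 [set g : dual Sd | forall f : D, val g (delta f) = val G f].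

Lemma predual_liftE (G : dual D) (f : D) : val (predual_lift G) (delta f) = val G f.
Proof. exact: (xgetPex 0 (pre_ex G) f). Qed.

Let J n (G : 'M[dual D]_n) : 'M[dual Sd]_n := map_mx predual_lift G.

Let evmx_J n (G : 'M[dual D]_n) m (f : 'M[D]_m) :
  map_mx (evmx (map_mx delta f)) (J G) = map_mx (evmx f) G.
Proof.
apply/matrixP => i j; rewrite [LHS]mxE [J G i j]mxE [RHS]mxE.
by apply/matrixP => a b; rewrite [LHS]mxE [map_mx delta f a b]mxE predual_liftE mxE.
Qed.

(** Evaluation at x, transported to the dual of S^d. For a positive contraction x this is a positive
    contraction, on which the maps that define the norm of (S^d)^d can be tested. *)
Let test m (x : 'M[S]_m) : 'M[dual Sd]_m := map_mx (fun y => predual_lift (ev os y)) x.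

Let evmx_test m (x : 'M[S]_m) n (f : 'M[D]_n) :
  map_mx (evmx (map_mx delta f)) (test x) = map_mx (theta f) x.
Proof.
apply/matrixP => i j; rewrite [LHS]mxE [test x i j]mxE [RHS]mxE.
apply/matrixP => a b; rewrite [LHS]mxE [map_mx delta f a b]mxE predual_liftE evE.
by rewrite [RHS]mxE.
Qed.

Let test_pos m (x : 'M[S]_m) : mpos x -> mpos (test x).
Proof.
move=> xp; apply/(dual_posP hSd); split.
  apply/matrixP => a b; rewrite mxstarE [test x b a]mxE [RHS]mxE; apply: dual_ext => y.
  have [f yf] := dzm_surj (const_mx y : 'M_1); move: yf => /matrixP/(_ 0 0); rewrite !mxE => ->.
  rewrite (dual_mstarE hSd) (dzm_star (f 0 0)) !predual_liftE !evE (dual_mstarE hS) conjcK.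
  by rewrite -mxstarE (smos_pos_sa hS xp).
move=> n y; have [f ->] := dzm_surj y; move=> /(dz_posE hS ap)[_ [_ h]].
by rewrite evmx_test; exact: h.
Qed.

Let test_norm m (x : 'M[S]_m) : mpos x -> mnorm x <= 1 -> mnorm (test x) <= 1.
Proof.
move=> xp x1; apply/(dual_sup (smos_os hSd) _ ler01) => n y.
have [f ->] := dzm_surj y; rewrite dzm_norm evmx_test => f1; apply: le_trans f1.
by rewrite -mnorm_shuffle -evmx_shuffle; exact: dnorm_ev.
Qed.

(** Applied to the elements [test x], the map shows that f is positive on positive contractions of S
    and bounded by 1 there. For positive f this bounds the norm in S^*, not merely the smaller norm
    in S^d, by [dual_bound_pos]. *)
Let WQ_contraction (i : WQindex (@bidual_image R Sd)) (f : 'M[D]_(projT1 i)) :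
  (forall g, WQmap i g = evmx (map_mx delta f) g) -> mpos f /\ mnorm f <= 1.
Proof.
move=> hf; case: (svalP (projT2 i)) => -[_ cp] cc _.
have wt m (x : 'M[S]_m) : map_mx (WQmap i) (test x) = map_mx (theta f) x.
  by rewrite -evmx_test; apply/matrixP => a b; rewrite [LHS]mxE hf [RHS]mxE.
have fp : mpos f.
  apply/(blockop_pos hS ap)/(blockop_pos_test hS) => m x xi xp _.
  have := cp _ _ (test_pos xp); rewrite -/(WQmap i) wt => h.
  have : mpos (map_mx (evmx x) f) by rewrite evmx_shuffle; apply/mpos_shuffle.
  by apply.
split=> //; apply: (dual_bound_pos hS ap ler01 fp) => m x xp x1.
have h : mnorm (map_mx (evmx x) f) <= 1.
  rewrite evmx_shuffle mnorm_shuffle -wt; apply: le_trans (cc _ _) (test_norm xp x1).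
exact: (matC_le _ ler01).1 h.
Qed.

(** For the upper bound, every map in the definition of the norm is evaluation at a contraction of
    M_k(S^* ). For the lower bound, a contraction f is a compression of a positive contraction F,
    and at F the norm of (S^d)^d applies. *)
Lemma predual_lift_norm n (G : 'M[dual D]_n) : dnorm (J G) = mnorm G.
Proof.
have G0 := dual_mnorm_ge0 (smos_os hD) G.
apply/le_anti/andP; split.
  rewrite dnormE; apply: (mu_norm_le G0) => i; have [y hy] := WQ_point i.
  have [f yf] := dzm_surj y; rewrite yf in hy; have [_ f1] := WQ_contraction hy.
  have -> : map_mx (WQmap i) (J G) = map_mx (evmx f) G.
    by rewrite -evmx_J; apply/matrixP => a b; rewrite [LHS]mxE hy [RHS]mxE.
  exact: (dual_ge_ev (smos_os hD)  G f1).
have K0 := dnorm_ge0 hSd (J G); set K := dnorm (J G) in K0 *.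
apply: (dual_evform (smos_os hD) K0) => m f f1 xi eta.
(* The compressions by a and b contribute a factor 1 + e; its cost e K |xi| |eta| is at most e c =
   d. *)
apply: le_cabs_approx => d d0; pose c := K * (vnorm xi * vnorm eta) + 1.
have c0 : 0 < c by rewrite ltr_wpDl // !mulr_ge0 ?vnorm_ge0.
have [F [a [b [Fp F1 -> pa pb]]]] := wittstock_factorization hS (or_nb rB)
  (fun n x => (or_pos rB x).1) (or_adj rB) f1 (divr_gt0 d0 c0).
set e := d / c in pa pb; have e0 : 0 < e by exact: divr_gt0.
rewrite evform_compr.
have bd k (M : 'M[C]_(m + m, m)) (u : powPH (cvPH R m) k) : psd ((1 + e)%:C%:M - M^t* *m M) ->
    vnorm ((fun j => M *m u j) : powPH (cvPH R (m + m)) k) <= Num.sqrt (1 + e) * vnorm u.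
  move=> pM; rewrite -(@ler_pXn2r _ 2) ?nnegrE ?mulr_ge0 ?sqrtr_ge0 ?vnorm_ge0 //.
  have s1 : 0 <= 1 + e by rewrite addr_ge0 // ltW.
  rewrite exprMn (sqr_sqrtr s1) !pow_vnorm_sq mulr_sumr.
  by apply: ler_sum => j _; exact: mulmx_psd_le.
have -> : evform G F (fun j => b *m xi j) (fun i => a *m eta i) =
    evform (J G) (map_mx delta F) (fun j => b *m xi j) (fun i => a *m eta i).
  by rewrite /evform evmx_J.
have Fd : mnorm (map_mx delta F) <= 1 by apply: le_trans (dnorm_le hS F) F1.
have Fp' : mpos (map_mx delta F) by apply/(dz_posE hS ap).
apply: le_trans (dnorm_evform hSd (J G) _ _ Fp' Fd) _.
apply: (@le_trans _ _ (K * ((Num.sqrt (1 + e) * vnorm xi) * (Num.sqrt (1 + e) * vnorm eta)))).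
  apply: (ler_wpM2l K0).
  exact: (ler_pM (vnorm_ge0 _) (vnorm_ge0 _) (bd n b xi pb) (bd n a eta pa)).
have s2 : Num.sqrt (1 + e) * Num.sqrt (1 + e) = 1 + e.
  by rewrite -expr2 sqr_sqrtr // addr_ge0 // ltW.
rewrite mulrACA s2; have ec : e * c = d by rewrite divfK ?gt_eqF.
move: ec; rewrite /c; move: (vnorm xi * vnorm eta) => v ec; lra.
Qed.

Lemma tau_isometry : complete_isometry (@tau R S).
Proof.
move=> n G; rewrite -predual_lift_norm -dzm_norm; congr mnorm.
by apply/matrixP => i j; rewrite !mxE.
Qed.

Lemma predual_liftP a (G G' : dual D) :
  predual_lift (a *: G + G') = a *: predual_lift G + predual_lift G'.
Proof.
apply: dual_ext => y; have [f] := dzm_surj (const_mx y : 'M_1).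
move=> /matrixP/(_ 0 0); rewrite !mxE => ->.
by rewrite dualD dualZ !predual_liftE dualD dualZ.
Qed.

Lemma tau_bijective : bijective (@tau R S).
Proof.
have inj : injective (@tau R S).
  move=> G G' e; apply/subr0_eq/(nrm_eq0 (dual_os (smos_os hD))).
  rewrite /nrm -tau_isometry.
  have -> : map_mx (@tau R S) (const_mx (G - G') : 'M_1) = map_mx (@dualization_map R Sd) (0 : 'M_1).
    apply/matrixP => i j; rewrite [LHS]mxE [const_mx _ _ _]mxE [RHS]mxE [(0 : 'M__) i j]mxE.
    rewrite /tau -/(predual_lift _) addrC -scaleN1r predual_liftP dzm_P.
    by rewrite -/(tau _) -/(tau _) e scaleN1r addNr dzm_0.
  by rewrite dzm_norm; apply/le_anti/andP; split;
    [rewrite -(mnorm0 (dual_os (smos_os hSd)) 1); exact: dnorm_le|exact: dnorm_ge0].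
have sur (y : dualization Sd) : exists G, tau G = y.
  have /asboolP[g gy] := valP y.
  have lG : linear (fun f : D => val g (delta f) : C^o).
    by move=> a f f'; rewrite dzm_P dualfD dualfZ.
  have bG : exists M : R, forall f, cabs (val g (delta f)) <= M * nrm f.
    exists (nrm g) => f; apply: le_trans (dual_nrm_le (smos_os hSd) g (delta f)) _.
    rewrite ler_wpM2l ?(nrm_ge0 (dual_os (smos_os hSd))) //.
    apply: le_trans (dnorm_le hS (const_mx f : 'M[D]_1)).
    rewrite -dzm_norm (_ : map_mx delta _ = const_mx (delta f)) //.
    by apply/matrixP => p q; rewrite !mxE.
  exists (mkdual lG bG); apply: val_inj; rewrite -gy; congr (val (dualization_map _)).
  apply: dual_ext => z; have [f] := dzm_surj (const_mx z : 'M_1).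
  by move=> /matrixP/(_ 0 0); rewrite !mxE => ->; rewrite predual_liftE mkdualE.
have [t ht] := choice sur; exists t => [G|y]; last exact: ht.
by apply: inj; rewrite ht.
Qed.
End Tau.

(** * Order approximation in operator systems and algebras *)

Section OperatorPowers.
Variables (R : realType) (W : preHilbert R) (h : W -> W).
Hypothesis hD : forall x y, h (x + y) = h x + h y.
Hypothesis h_sa : forall x y, pip (h x) y = pip x (h y).
Hypothesis h1 : forall x, vnorm (h x) <= vnorm x.

(** The operator (1 - h^2)^n. *)
Definition defect (n : nat) : W -> W := iter n (fun x => x - h (h x)).
Local Notation c := defect.

Let h0 : h 0 = 0. Proof. by apply: (addrI (h 0)); rewrite -hD !addr0. Qed.
Let hN x : h (- x) = - h x.
Proof. by apply: (addrI (h x)); rewrite -hD !subrr h0. Qed.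

Let step_le x : vnorm (x - h (h x)) ^+ 2 <= vnorm x ^+ 2 - vnorm (h x) ^+ 2.
Proof.
rewrite vnorm_sqD vnormN pipNr ReN -h_sa pip_vnorm /=.
have : vnorm (h (h x)) ^+ 2 <= vnorm (h x) ^+ 2 by rewrite ler_pXn2r ?nnegrE ?vnorm_ge0.
move: (vnorm (h (h x)) ^+ 2) (vnorm (h x) ^+ 2) (vnorm x ^+ 2) => a b d; lra.
Qed.

Lemma defectC n x : h (c n x) = c n (h x).
Proof. by elim: n => [//|n IH] /=; rewrite hD hN IH. Qed.

Lemma defect_sa n x y : pip (c n x) y = pip x (c n y).
Proof.
elim: n x y => [//|n IH] x y; rewrite /= pipDl pipNl pipDr pipNr !h_sa !IH.
by rewrite !defectC.
Qed.

(** Passing from n to n + 1 lowers the squared norm by at least |h c_n x|^2, and these losses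
    decrease with n, so n times the latest one is at most |x|^2. This stands in for the estimate of
    t (1 - t^2)^n by functional calculus. *)
Lemma defect_decay n x : vnorm (c n x) ^+ 2 + n%:R * vnorm (h (c n x)) ^+ 2 <= vnorm x ^+ 2.
Proof.
elim: n => [|n IH]; first by rewrite mul0r addr0.
have s1 := step_le (c n x).
have s2 : vnorm (h (c n.+1 x)) ^+ 2 <= vnorm (h (c n x)) ^+ 2.
  rewrite /= hD hN; have := step_le (h (c n x)); have := sqr_ge0 (vnorm (h (h (c n x)))).
  move: (vnorm (h (h (c n x))) ^+ 2) => a a0 s; apply: le_trans s _; lra.
move: s1 s2 IH; rewrite -[c n x - _]/(c n.+1 x) -natr1.
move: (vnorm (c n.+1 x) ^+ 2) (vnorm (h (c n.+1 x)) ^+ 2) (vnorm (c n x) ^+ 2) (vnorm (h (c n x)) ^+ 2).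
move=> a b d e s1 s2 IH; apply: le_trans IH; have n0 : 0 <= n%:R :> R by [].
have := ler_wpM2l n0 s2; rewrite mulrDl mul1r; lra.
Qed.

Lemma defect_le n x : vnorm (c n x) <= vnorm x.
Proof.
rewrite -(@ler_pXn2r _ 2) ?nnegrE ?vnorm_ge0 //; apply: le_trans (defect_decay n x).
by rewrite lerDl mulr_ge0 // sqr_ge0.
Qed.

Lemma defect_small n x : vnorm (h (c n x)) ^+ 2 <= n.+1%:R^-1 * vnorm x ^+ 2.
Proof.
have n0 : 0 < n.+1%:R :> R by rewrite ltr0n.
rewrite ler_pdivlMl //; apply: le_trans (defect_decay n x).
rewrite -natr1 mulrDl mul1r addrC lerD2r ler_pXn2r ?nnegrE ?vnorm_ge0 //.
Qed.

(** The even exponent writes (1 - h^2)^(2n) as the square of a self-adjoint contraction, so that its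
    form is nonnegative and dominates its square. *)
Lemma codefect_le n x : vnorm (x - c (n + n) x) <= vnorm x.
Proof.
rewrite -(@ler_pXn2r _ 2) ?nnegrE ?vnorm_ge0 // vnorm_sqD vnormN pipNr ReN.
have -> : c (n + n) x = c n (c n x) by rewrite /c iterD.
rewrite -defect_sa pip_vnorm /=.
have : vnorm (c n (c n x)) ^+ 2 <= vnorm (c n x) ^+ 2.
  by rewrite ler_pXn2r ?nnegrE ?vnorm_ge0 ?defect_le.
have := sqr_ge0 (vnorm (c n x)).
move: (vnorm (c n (c n x)) ^+ 2) (vnorm (c n x) ^+ 2) (vnorm x ^+ 2) => a b d; lra.
Qed.
End OperatorPowers.

Section RepOperators.
Variables (R : realType) (X : smosData R) (V : preHilbert R) (B : X -> V -> V).
Hypothesis rB : opsys_rep B.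
Local Notation C := R[i].
Local Notation F := (nform (fun _ : unit => B) tt).
Let nb := or_nb rB.
Let rp := nb_rep nb.

Definition mxop n (x : 'M[X]_n) : powPH V n -> powPH V n := opapp (fun a b => B (x a b)).

Lemma nform_mxop n (x : 'M[X]_n) xi eta : F x xi eta = pip (mxop x xi) eta.
Proof. by []. Qed.

Lemma mxopD n (x : 'M[X]_n) xi eta : mxop x (xi + eta) = mxop x xi + mxop x eta.
Proof.
apply/funext => i; change (\sum_j B (x i j) (xi j + eta j) =
  \sum_j B (x i j) (xi j) + \sum_j B (x i j) (eta j)).
by rewrite -big_split; apply: eq_bigr => j _; rewrite (@op_vD R X unit _ _ rp tt).
Qed.

Lemma mxop_addl n (x y : 'M[X]_n) xi : mxop (x + y) xi = mxop x xi + mxop y xi.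
Proof.
apply/funext => i; change (\sum_j B ((x + y) i j) (xi j) =
  \sum_j B (x i j) (xi j) + \sum_j B (y i j) (xi j)).
by rewrite -big_split; apply: eq_bigr => j _; rewrite mxE (@op_D R X unit _ _ rp tt).
Qed.

Lemma mxop_oppl n (x : 'M[X]_n) xi : mxop (- x) xi = - mxop x xi.
Proof.
apply: (addrI (mxop x xi)); rewrite -mxop_addl !subrr; apply/funext => i.
by rewrite /mxop /opapp big1 // => j _; rewrite mxE (@op_0 R X unit _ _ rp tt).
Qed.

Lemma mxop_sa n (x : 'M[X]_n) xi eta : mxstar x = x -> pip (mxop x xi) eta = pip xi (mxop x eta).
Proof.
move=> xs; rewrite -nform_mxop -{1}xs (nform_star rB) nform_mxop.
by rewrite [RHS]pip_herm.
Qed.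

Lemma mxop_le n (x : 'M[X]_n) (K : R) xi : mnorm x <= K -> vnorm (mxop x xi) <= K * vnorm xi.
Proof.
move=> xK; have K0 : 0 <= K := le_trans (nb_ge0 nb x) xK.
by apply: opapp_le => // ? ?; have := (nb_le nb x K0).1 xK tt; apply.
Qed.

Lemma mnorm_mxop n (x : 'M[X]_n) (K : R) : 0 <= K ->
  (forall xi, vnorm (mxop x xi) <= K * vnorm xi) -> mnorm x <= K.
Proof.
move=> K0 h; apply: (mnorm_le nb K0) => -[] xi eta; rewrite nform_mxop.
apply: le_trans (CauchySchwarz _ _) _; rewrite mulrA ler_wpM2r ?vnorm_ge0 //.
Qed.

Lemma mxop_quad n (x : 'M[X]_n) xi : mxstar x = x -> mnorm x <= 1 ->
  0 <= (vnorm xi ^+ 2)%:C + F x xi xi /\ 0 <= (vnorm xi ^+ 2)%:C - F x xi xi.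
Proof.
move=> xs x1; set z := F x xi xi.
have zr : complex.Im z = 0.
  have : z = z^*%C by rewrite /z -{1}xs (nform_star rB).
  by move/(congr1 (@complex.Im R)); rewrite Im_conj => e; lra.
have zle : cabs z <= vnorm xi ^+ 2.
  rewrite expr2 -[leRHS]mul1r; apply: le_trans (@nform_le R X unit _ _ nb tt _ _ _ _) _.
  by apply: ler_wpM2r x1; rewrite mulr_ge0 ?vnorm_ge0.
have z1 := Re_le_cabs z; have z2 := Re_le_cabs (- z); rewrite cabsN ReN in z2.
split; apply/cge0P; rewrite ?ImD ?ImN ?ReD ?ReN zr /= ?oppr0 ?addr0; split=> //.
  by move: zle z1 z2; move: (vnorm xi ^+ 2) (complex.Re z) (cabs z) => a b d; lra.
by move: zle z1 z2; move: (vnorm xi ^+ 2) (complex.Re z) (cabs z) => a b d; lra.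
Qed.

Lemma unital_order_approx (e : X) : (forall v, B e v = v) -> order_approx X.
Proof.
move=> Be m h hs h1 eps e0; pose E : 'M[X]_m := \matrix_(i, j) if i == j then e else 0.
have FE xi eta : F E xi eta = pip xi eta.
  rewrite nform_mxop; congr pip; apply/funext => i; rewrite /mxop /opapp (bigD1 i) //= big1.
    by rewrite mxE eqxx Be addr0.
  by move=> j ji; rewrite mxE eq_sym (negbTE ji) (@op_0 R X unit _ _ rp tt).
have FN xi : F (- h) xi xi = - F h xi xi by rewrite !nform_mxop mxop_oppl pipNl.
exists E, h; split.
- split; first by apply/(or_pos rB) => xi; rewrite FE; exact: pip_ge0.
  by apply: (mnorm_le nb ler01) => -[] xi eta; rewrite FE mul1r; exact: CauchySchwarz.
- apply/(or_pos rB) => xi; rewrite (nformD rp) FE pip_vnorm; exact: (mxop_quad xi hs h1).1.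
- apply/(or_pos rB) => xi; rewrite (nformD rp) FE pip_vnorm FN; exact: (mxop_quad xi hs h1).2.
- by rewrite subrr (mnorm0 (normed_by_os nb)) ltW.
Qed.

Section Multiplicative.
Variable mul : X -> X -> X.
Hypothesis BM : forall x y v, B (mul x y) v = B x (B y v).

Definition mxmul n (x y : 'M[X]_n) : 'M[X]_n := \matrix_(i, k) \sum_j mul (x i j) (y j k).

Lemma mxop_mul n (x y : 'M[X]_n) xi : mxop (mxmul x y) xi = mxop x (mxop y xi).
Proof.
apply/funext => i; change (\sum_k B (mxmul x y i k) (xi k) =
  \sum_j B (x i j) (\sum_k B (y j k) (xi k))).
under [RHS]eq_bigr => j _ do rewrite (@op_vsum R X unit _ _ rp tt).
rewrite exchange_big; apply: eq_bigr => k _ /=; rewrite mxE (@op_sum R X unit _ _ rp tt).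
by apply: eq_bigr => j _; rewrite BM.
Qed.

(* The order bounds are E = (1 - (1 - h^2)^N)^2, a polynomial in h without
   constant term, and h' = (1 - (1 - h^2)^N) h (1 - (1 - h^2)^N). *)
Lemma mul_order_approx : order_approx X.
Proof.
move=> m h hs h1 eps e0.
pose T := mxop h; have TD := mxopD h; have Tsa xi eta := mxop_sa xi eta hs.
have T1 xi : vnorm (T xi) <= vnorm xi by have := mxop_le xi h1; rewrite mul1r.
(* The element 1 - (1 - h^2)^n written inside the algebra, which may lack a unit: for q = h^2, one
   has 1 - (1 - q)(1 - p) = p + q - q p. *)
pose p := fix p n := if n is k.+1 then p k + (mxmul h h - mxmul (mxmul h h) (p k)) else 0.
have TB x y : T (x - y) = T x - T y.
  apply: (addIr (T y)); rewrite subrK; apply: etrans (esym (TD _ _)) _.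
  by rewrite subrK.
have pE n xi : mxop (p n) xi = xi - defect T n xi.
  elim: n => [|n IH].
    rewrite subrr; apply/funext => i; rewrite /mxop /opapp big1 // => j _.
    by rewrite mxE (@op_0 R X unit _ _ rp tt).
  rewrite /= !mxop_addl mxop_oppl !mxop_mul IH -!/(T _) !TB.
  have s (b c : powPH V m) : b - (b - c) = c by rewrite opprB addrCA subrr addr0.
  by rewrite s opprB -addrA; congr (_ + _); exact: addrC.
(* The bound eps^2 / 4 on squares makes h (1 - h^2)^(2N) at most eps / 2 in norm; such a term occurs
   twice in h - h'. *)
have [N hN] := @natinv_lt R (eps ^+ 2 / 4) (divr_gt0 (exprn_gt0 2 e0) (ltr0Sn _ 3)).
pose e := p (N + N)%N; set M := (N + N)%N in e *.
have eE xi : mxop e xi = xi - defect T M xi := pE M xi.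
have esa xi eta : pip (mxop e xi) eta = pip xi (mxop e eta).
  by rewrite !eE pipDl pipNl pipDr pipNr (defect_sa TD Tsa).
have e1 xi : vnorm (mxop e xi) <= vnorm xi by rewrite eE (codefect_le TD Tsa T1).
exists (mxmul e e), (mxmul e (mxmul h e)).
have F1 xi : F (mxmul e e) xi xi = (vnorm (mxop e xi) ^+ 2)%:C.
  by rewrite nform_mxop mxop_mul esa pip_vnorm.
have F2 xi : F (mxmul e (mxmul h e)) xi xi = F h (mxop e xi) (mxop e xi).
  by rewrite nform_mxop !mxop_mul esa.
have F2N xi : F (- mxmul e (mxmul h e)) xi xi = - F h (mxop e xi) (mxop e xi).
  by rewrite nform_mxop mxop_oppl pipNl -F2.
split.
- split; first by apply/(or_pos rB) => xi; rewrite F1 ler0c sqr_ge0.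
  apply: mnorm_mxop => // xi; rewrite mxop_mul mul1r; exact: le_trans (e1 _) (e1 _).
- by apply/(or_pos rB) => xi; rewrite (nformD rp) F1 F2; exact: (mxop_quad _ hs h1).1.
- by apply/(or_pos rB) => xi; rewrite (nformD rp) F1 F2N; exact: (mxop_quad _ hs h1).2.
have small xi : vnorm (T (defect T M xi)) <= eps / 2 * vnorm xi.
  rewrite -(@ler_pXn2r _ 2) ?nnegrE ?mulr_ge0 ?vnorm_ge0 ?invr_ge0 ?(ltW e0) //.
  apply: le_trans (defect_small TD Tsa T1 M xi) _; rewrite exprMn ler_wpM2r ?sqr_ge0 //.
  apply: le_trans (ltW (hN M (leq_addr _ _))) _; rewrite exprMn exprVn.
  by rewrite ler_wpM2l ?sqr_ge0 // lef_pV2 ?posrE // expr2; lra.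
apply: mnorm_mxop => [|xi]; first exact: ltW.
rewrite mxop_addl mxop_oppl !mxop_mul -!/(T _).
(* With c = 1 - e, which commutes with h, this is h - e h e = h c + h c e. *)
have -> : T xi - mxop e (T (mxop e xi)) = T (defect T M xi) + T (defect T M (mxop e xi)).
  rewrite (eE (T (mxop e xi))) -(defectC TD) opprB addrCA; rewrite addrC; congr (_ + _).
  by rewrite -TB eE opprB addrCA subrr addr0.
apply: le_trans (vnormD _ _) _; apply: le_trans (lerD (small _) (small _)) _.
rewrite -mulrDr; have := ler_wpM2l (ltW e0) (e1 xi); move: (vnorm _) (vnorm _) => a b; lra.
Qed.
End Multiplicative.
End RepOperators.

(** * Faithful representations are isometric *)

Lemma normed_complete (R : realType) (E : completeNormedModType R[i]) (u : nat -> E) :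
  (forall e : R, 0 < e ->
     exists N, forall p q, (N <= p)%N -> (N <= q)%N -> complex.Re `|u p - u q| < e) ->
  exists x, forall e : R, 0 < e -> exists N, forall p, (N <= p)%N -> complex.Re `|u p - x| < e.
Proof.
move=> cu.
have nE (x : E) : `|x| = (complex.Re `|x|)%:C by rewrite -cge0E.
have : cauchy (u @ \oo).
  apply/cauchy_ballP => e e0.
  have er : 0 < complex.Re e by move: e0; rewrite ltcE /= => /andP[].
  have eE : e = (complex.Re e)%:C by rewrite -cge0E // ltW.
  have [N hN] := cu _ er.
  exists (u @` [set p | (N <= p)%N], u @` [set p | (N <= p)%N]).
    by split; exists N => // p /= Np; exists p.
  move=> [x y] [[p /= Np <-] [q /= Nq <-]] /=.
  by rewrite -ball_normE /ball_ /= eE nE ltcR; exact: hN.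
move/cauchy_cvg => /cvg_ex[x ux]; exists x => e e0.
have ec : 0 < e%:C :> R[i] by rewrite ltcR.
have /cvgrPdist_lt /(_ _ ec) [N _ hN] := ux.
exists N => p Np; have h : `|x - u p| < e%:C := hN p Np.
by rewrite nE ltcR distrC in h.
Qed.

Lemma monotone_cauchy (R : realType) (t : nat -> R) (K : R) :
  (forall p q, (p <= q)%N -> t p <= t q) -> (forall n, t n <= K) ->
  forall e : R, 0 < e -> exists N, forall p q, (N <= p)%N -> (N <= q)%N -> `|t p - t q| < e.
Proof.
move=> tm tK e e0; pose s := [set t n | n in [set: nat]].
have hs : has_sup s by split; [exists (t 0%N), 0%N|exists K => _ [n _ <-]].
have ub n : t n <= sup s by apply: ub_le_sup; [case: hs|exists n].
have [_ [N _ <-] hN] := sup_adherent e0 hs; exists N => p q Np Nq.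
rewrite ltr_norml; have := tm _ _ Np; have := tm _ _ Nq; have := ub p; have := ub q.
by move: hN; set z := sup s => h1 h2 h3 h4 h5; apply/andP; split; lra.
Qed.

(** * Square roots in C*-algebras *)

Section CstarAlgebra.
Variables (R : realType) (A : cstarAlgebra R).
Local Notation C := R[i].
Local Notation N x := (complex.Re `|x|).
Implicit Types (x y z b : A).

Lemma csD x y z : cmul (x + y) z = cmul x z + cmul y z. Proof. exact: linearDl. Qed.
Lemma csDr x y z : cmul z (x + y) = cmul z x + cmul z y. Proof. exact: linearDr. Qed.
Lemma csZ (a : C) x y : cmul (a *: x) y = a *: cmul x y. Proof. exact: linearZl_LR. Qed.
Lemma csZr (a : C) x y : cmul y (a *: x) = a *: cmul y x. Proof. exact: linearZr_LR. Qed.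
Lemma csN x y : cmul (- x) y = - cmul x y. Proof. by rewrite -scaleN1r csZ scaleN1r. Qed.
Lemma csNr x y : cmul y (- x) = - cmul y x. Proof. by rewrite -scaleN1r csZr scaleN1r. Qed.
Lemma cstD x y : cstar (x + y) = cstar x + cstar y.
Proof. by have := cstarP 1 x y; rewrite conjc_1 !scale1r. Qed.
Lemma cst0 : cstar (0 : A) = 0.
Proof. by apply: (addrI (cstar 0)); rewrite -cstD !addr0. Qed.
Lemma cstZ (a : C) x : cstar (a *: x) = a^*%C *: cstar x.
Proof. by have := cstarP a x 0; rewrite cst0 !addr0. Qed.
Lemma cstN x : cstar (- x) = - cstar x.
Proof. by rewrite -scaleN1r cstZ conjcN conjc_1 scaleN1r. Qed.

Let nE x : `|x| = (N x)%:C. Proof. by rewrite -cge0E. Qed.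
Lemma cn_ge0 x : 0 <= N x. Proof. exact: cRe_ge0. Qed.
Lemma cnD x y : N (x + y) <= N x + N y.
Proof. by rewrite -lecR rmorphD /= -!nE; exact: ler_normD. Qed.
Lemma cnZ (a : C) x : N (a *: x) = cabs a * N x.
Proof. by rewrite normrZ normE ReZ. Qed.
Lemma cnN x : N (- x) = N x. Proof. by rewrite normrN. Qed.
Lemma cnB x y : N (x - y) <= N x + N y. Proof. by rewrite -(cnN y) cnD. Qed.
Lemma cnBC x y : N (x - y) = N (y - x). Proof. by rewrite -cnN opprB. Qed.
Lemma cnM x y : N (cmul x y) <= N x * N y.
Proof. by rewrite -lecR rmorphM /= -!nE; exact: cnormM. Qed.
Lemma cn_id x : N (cmul (cstar x) x) = N x ^+ 2.
Proof. by rewrite cstar_identity {1}nE -rmorphXn. Qed.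
Lemma cn_eq0 x : N x <= 0 -> x = 0.
Proof.
move=> x0; apply/eqP; rewrite -normr_eq0 nE; apply/eqP; congr (_%:C).
by apply/le_anti; rewrite x0 cn_ge0.
Qed.
Lemma cn_star x : N (cstar x) = N x.
Proof.
have le y : N y <= N (cstar y).
  have := cn_ge0 y; rewrite le_eqVlt => /predU1P[<-|y0]; first exact: cn_ge0.
  by rewrite -(ler_pM2r y0) -expr2 -cn_id; exact: cnM.
by apply/le_anti; rewrite le andbT -{2}(cstarK x) le.
Qed.
Lemma cn_small x K : 0 <= K -> (forall e : R, 0 < e -> N x <= K * e) -> x = 0.
Proof.
move=> K0 h; apply: cn_eq0; apply: le_cabs_approx => e e0; rewrite add0r.
have K1 : 0 < K + 1 by rewrite ltr_wpDl.
apply: le_trans (h _ (divr_gt0 e0 K1)) _; rewrite mulrA ler_pdivrMr // mulrC ler_wpM2l ?(ltW e0) //.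
by rewrite lerDl.
Qed.

(* 1 - y is the square root of 1 - x, obtained from y = (x + y^2) / 2. *)
Lemma cstar_sqrt x : cstar x = x -> N x <= 1 -> exists y,
  [/\ cstar y = y, N y <= 1, y + y = x + cmul y y
    & forall b, cmul b x = cmul x b -> cmul b y = cmul y b].
Proof.
move=> xs x1; have h2 : (2^-1 : C) = (2^-1 : R)%:C by rewrite fmorphV rmorphMn.
pose u := fix u k := if k is k'.+1 then (2^-1 : C) *: (x + cmul (u k') (u k')) else 0.
(* The same iteration for the scalar 1. It increases and is bounded by 1, and it majorises the norms
   of the u k and of their increments, so u is Cauchy even when ||x|| = 1. *)
pose t := fix t k : R := if k is k'.+1 then (1 + t k' ^+ 2) / 2 else 0.
have uS k : u k.+1 = (2^-1 : C) *: (x + cmul (u k) (u k)) by [].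
have tS k : t k.+1 = (1 + t k ^+ 2) / 2 by [].
have nh z : N ((2^-1 : C) *: z) = 2^-1 * N z by rewrite cnZ h2 cabsR ger0_norm ?invr_ge0.
have t01 k : 0 <= t k <= 1.
  elim: k => [|k /andP[a b]]; first by rewrite lexx ler01.
  have c : t k ^+ 2 <= 1 by rewrite expr_le1.
  have d := sqr_ge0 (t k); rewrite tS; apply/andP; split; lra.
have tm k : t k <= t k.+1 by have := sqr_ge0 (1 - t k); rewrite tS sqrrB; lra.
have tM p q : (p <= q)%N -> t p <= t q.
  move=> pq; rewrite -(subnKC pq); elim: (q - p)%N => [|n IH]; first by rewrite addn0.
  by rewrite addnS; exact: le_trans IH (tm _).
have un k : N (u k) <= t k.
  elim: k => [|k IH]; first by rewrite /= normr0.
  rewrite uS nh tS mulrC ler_pM2r ?invr_gt0 //; apply: le_trans (cnD _ _) _; apply: lerD x1 _.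
  by apply: le_trans (cnM _ _) _; rewrite expr2; apply: ler_pM; rewrite ?cn_ge0.
have sqB a b : cmul a a - cmul b b = cmul (a - b) a + cmul b (a - b).
  by rewrite csD csDr csN csNr addrA subrK.
have h01 : 0 <= 2^-1 :> R by rewrite invr_ge0.
have ud k : N (u k.+1 - u k) <= t k.+1 - t k.
  elim: k => [|k IH].
    by rewrite subr0 /= subr0; have := un 1%N; rewrite /=.
  rewrite (uS k.+1) [in X in _ - X](uS k) -scalerBr nh opprD addrACA subrr add0r sqB.
  have /andP[tk0 _] := t01 k; have /andP[tk1 _] := t01 k.+1.
  apply: (@le_trans _ _ (2^-1 * ((t k.+1 - t k) * t k.+1 + t k * (t k.+1 - t k)))).
    apply: (ler_wpM2l h01); apply: le_trans (cnD _ _) _; apply: lerD.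
      by apply: le_trans (cnM _ _) _; apply: ler_pM; rewrite ?cn_ge0 ?un.
    by apply: le_trans (cnM _ _) _; apply: ler_pM; rewrite ?cn_ge0 ?un.
  rewrite (tS k.+1) {5}(tS k) ; have := tS k; move: (t k.+1) (t k) => a b ab.
  by rewrite !expr2; lra.
have uq p q : (p <= q)%N -> N (u q - u p) <= t q - t p.
  move=> pq; rewrite -(subnKC pq); elim: (q - p)%N => [|n IH]; first by rewrite addn0 !subrr normr0.
  rewrite addnS -(subrK (u (p + n)%N) (u _.+1)) -addrA; apply: le_trans (cnD _ _) _.
  by apply: le_trans (lerD (ud _) IH) _; rewrite addrA subrK.
have [|y hy] := normed_complete (u := u).
  move=> e e0; have [M hM] := monotone_cauchy tM (fun n => (andP (t01 n)).2) e0; exists M => p q Mp Mq.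
  have := hM p q Mp Mq; apply: le_lt_trans; have [pq|qp] := leqP p q.
    rewrite cnBC [X in _ <= X]distrC ger0_norm ?subr_ge0 ?tM //; exact: uq.
  have qp' := ltnW qp; rewrite ger0_norm ?subr_ge0 ?tM //; exact: uq.
have near (e : R) : 0 < e -> exists n, N (u n - y) <= e /\ N (u n.+1 - y) <= e.
  by move=> e0; have [n hn] := hy e e0; exists n; split; apply/ltW/hn.
have us k : cstar (u k) = u k.
  elim: k => [|k IH]; first exact: cst0.
  by rewrite uS cstZ h2 conjR cstD cstarM IH xs.
have y1 : N y <= 1.
  apply: le_cabs_approx => e e0; have [n [hn _]] := near e e0.
  have -> : y = u n - (u n - y) by rewrite opprB addrCA subrr addr0.
  apply: le_trans (cnB _ _) (lerD _ hn); apply: le_trans (un n) _; by case/andP: (t01 n).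
exists y; split=> // [||b bx].
- apply/subr0_eq/(@cn_small _ 2) => // e e0; have [n [hn _]] := near e e0.
  have -> : cstar y - y = (u n - y) - cstar (u n - y).
    by rewrite cstD cstN us opprB [RHS]addrC addrA addrNK.
  by apply: le_trans (cnB _ _) _; rewrite cn_star mulr_natl mulr2n lerD.
- apply/subr0_eq/(@cn_small _ 4) => // e e0; have [n [hn hn']] := near e e0.
  have e1 : u n.+1 + u n.+1 = x + cmul (u n) (u n).
    have hh : (2^-1 : C) + 2^-1 = 1 by rewrite -mulr2n -[_ *+ 2]mulr_natl mulfV // pnatr_eq0.
    by rewrite uS -scalerDl hh scale1r.
  have -> : y + y - (x + cmul y y) =
      (cmul (u n - y) (u n) + cmul y (u n - y)) - ((u n.+1 - y) + (u n.+1 - y)).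
    have e2 : (u n.+1 - y) + (u n.+1 - y) = (x + cmul (u n) (u n)) - (y + y).
      by rewrite addrACA -opprD e1.
    by rewrite -sqB e2 opprB [RHS]addrC !opprD !addrA addrNK.
  have n1 : N (u n) <= 1 by apply: le_trans (un n) _; case/andP: (t01 n).
  apply: le_trans (cnB _ _) _.
  apply: (@le_trans _ _ ((e * 1 + 1 * e) + (e + e))); last by lra.
  apply: lerD; apply: le_trans (cnD _ _) _; apply: lerD => //.
    by apply: le_trans (cnM _ _) _; apply: ler_pM; rewrite ?cn_ge0.
  by apply: le_trans (cnM _ _) _; apply: ler_pM; rewrite ?cn_ge0.
- have bu k : cmul b (u k) = cmul (u k) b.
    elim: k => [|k IH]; first by rewrite /= -(scale0r (0 : A)) csZ csZr !scale0r.
    by rewrite uS csZ csZr csD csDr bx cmulA IH -cmulA IH cmulA.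
  apply/subr0_eq/(@cn_small _ (2 * N b)) => [|e e0]; first by rewrite mulr_ge0 ?cn_ge0.
  have [n [hn _]] := near e e0.
  have -> : cmul b y - cmul y b = cmul (u n - y) b - cmul b (u n - y).
    by rewrite csD csDr csN csNr bu opprD opprK addrACA subrr add0r addrC.
  apply: le_trans (cnB _ _) _; rewrite -mulrA mulr_natl mulr2n; apply: lerD.
    by apply: le_trans (cnM _ _) _; rewrite mulrC ler_wpM2l ?cn_ge0.
  by apply: le_trans (cnM _ _) _; rewrite ler_wpM2l ?cn_ge0.
Qed.

(* 1 + w is an isometry. *)
Lemma cstar_unitary w b : w + cstar w + cmul (cstar w) w = 0 -> N (b + cmul w b) = N b.
Proof.
move=> hw; apply/eqP; rewrite -(@eqrXn2 _ 2) ?cn_ge0 // -!cn_id; apply/eqP; congr (N _).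
transitivity (cmul (cstar b) b + cmul (cstar b) (cmul (w + cstar w + cmul (cstar w) w) b)).
  by rewrite cstD cstarM !csD !csDr -!cmulA !addrA.
by rewrite hw -(scale0r (0 : A)) csZ csZr !scale0r addr0.
Qed.
End CstarAlgebra.

(** * Comparison of the algebra norm with the operator norm *)

Section SupNorm.
Variables (R : realType) (A : cstarAlgebra R) (H : hilbert R) (pi : faithful_rep A H).
Local Notation C := R[i].
Local Notation N x := (complex.Re `|x|).
Local Notation V := (hilbPH H).
Local Notation S := (cstar_smos pi).
Local Notation B := (@conc_op R S H pi).
Implicit Types (x y h : A) (v w : V).

Let rB : opsys_rep B := conc_rep (cstar_concrete pi).
Let nb := or_nb rB.
Let rp := nb_rep nb.

Lemma rep_mul x y v : B (cmul x y) v = B x (B y v).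
Proof. by rewrite /conc_op (repM pi). Qed.

Let BD x y v : B (x + y) v = B x v + B y v.
Proof. exact: (@op_D R S unit _ _ rp tt). Qed.
Let Badj x v w : pip (B (cstar x) v) w = pip v (B x w).
Proof. exact: (or_adj rB). Qed.
Let B0 v : B 0 v = 0. Proof. exact: (@op_0 R S unit _ _ rp tt). Qed.
Let BN x v : B (- x) v = - B x v.
Proof. by apply: (addrI (B x v)); rewrite -BD !subrr B0. Qed.

Let mxopE (x : S) (xi : powPH V 1) : mxop B (const_mx x : 'M[S]_1) xi = (fun=> B x (xi 0)).
Proof. by apply/funext => i; rewrite /mxop /opapp big_ord1 mxE. Qed.

Let vnorm1 (xi : powPH V 1) : vnorm xi = vnorm (xi 0).
Proof. by rewrite /vnorm [in LHS]/pip /= big_ord1. Qed.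

Lemma rep_le (x : S) v : vnorm (B x v) <= nrm x * vnorm v.
Proof.
have := @mxop_le _ _ _ _ rB 1 (const_mx x) (nrm x) (fun=> v) (lexx _).
by rewrite mxopE !vnorm1.
Qed.

Lemma rep_ge (x : S) (K : R) : 0 <= K -> (forall v, vnorm (B x v) <= K * vnorm v) -> nrm x <= K.
Proof.
by move=> K0 h; apply: (mnorm_mxop rB K0) => xi; rewrite mxopE !vnorm1.
Qed.

Let pip_small v w : vnorm v ^+ 2 <= 0 -> pip v w = 0.
Proof.
move=> v0; have z : vnorm v = 0.
  by apply/eqP; rewrite -sqrf_eq0; apply/eqP/le_anti; rewrite v0 sqr_ge0.
have := CauchySchwarz v w; rewrite z mul0r => c; apply/eqP.
by rewrite -normr_eq0 normE; apply/eqP; congr (_%:C); apply/le_anti; rewrite c cabs_ge0.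
Qed.

Let BZ (r : R) x v : B (r%:C *: x) v = r%:C *: B x v.
Proof. exact: (@op_Z R S unit _ _ rp tt). Qed.

(** With y = 1 - (1 - x^* x)^(1/2), the relation 2 y = x^* x + y^2 gives |v|^2 - |x v|^2 = |v - y
    v|^2 >= 0. *)
Let contract1 x v : N x <= 1 -> vnorm (B x v) <= vnorm v.
Proof.
move=> x1; have as_ : cstar (cmul (cstar x) x) = cmul (cstar x) x by rewrite cstarM cstarK.
have a1 : N (cmul (cstar x) x) <= 1 by rewrite cn_id expr_le1 ?cn_ge0.
have [y [ys _ yy _]] := cstar_sqrt as_ a1.
have e1 : (vnorm (B x v) ^+ 2)%:C = pip (B (cmul (cstar x) x) v) v by rewrite rep_mul Badj pip_vnorm.
have e2 : (vnorm (B y v) ^+ 2)%:C = pip (B (cmul y y) v) v by rewrite rep_mul -{2}ys Badj pip_vnorm.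
have e3 : pip (B y v) v + pip (B y v) v = (vnorm (B x v) ^+ 2)%:C + (vnorm (B y v) ^+ 2)%:C.
  by rewrite e1 e2 -!pipDl -!BD yy.
rewrite -(@ler_pXn2r _ 2) ?nnegrE ?vnorm_ge0 //.
have e4 : complex.Re (pip (B y v) v) + complex.Re (pip (B y v) v) =
    vnorm (B x v) ^+ 2 + vnorm (B y v) ^+ 2 by rewrite -ReD e3 ReD.
have := sqr_ge0 (vnorm (v - B y v)); rewrite vnorm_sqD vnormN pipNr ReN [pip v _]pip_herm Re_conj.
move: e4.
move: (complex.Re (pip (B y v) v)) (vnorm (B x v) ^+ 2) (vnorm (B y v) ^+ 2) (vnorm v ^+ 2) => a b c d.
lra.
Qed.

Lemma rep_contractive x : nrm (x : S) <= N x.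
Proof.
apply: rep_ge => [|v]; first exact: cn_ge0.
have := cn_ge0 x; rewrite le_eqVlt => /predU1P[x0|x0].
  have -> : x = 0 by apply: cn_eq0; rewrite -x0.
  by rewrite B0 vnorm0 mulr_ge0 ?cn_ge0 ?vnorm_ge0.
have e : x = (N x)%:C *: ((N x)^-1%:C *: x).
  by rewrite scalerA -rmorphM mulfV ?gt_eqF // scale1r.
rewrite {1}e BZ vnormZ cabsR ger0_norm ?(ltW x0) // ler_pM2l //; apply: contract1.
by rewrite cnZ cabsR ger0_norm ?invr_ge0 ?(ltW x0) // mulVf ?gt_eqF.
Qed.

(* With q = h^2 the element w = - q + i z, where z^2 = 2 q - q^2, is such that
   1 + w is unitary, so that z is a contraction; then 1 - (1 - z^2)^(1/2) agrees
   with q in the representation because ||B q|| <= 1. *)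
Let sa_le h : cstar h = h -> N h <= 6 / 5 -> nrm (h : S) <= 1 -> N h <= 1.
Proof.
move=> hs h65 h1; set q := cmul h h.
have qs : cstar q = q by rewrite cstarM hs.
have Nq : N q = N h ^+ 2 by rewrite -cn_id hs.
(* Since (6/5)^2 / 2 < 1, the element q / 2 is a contraction and 1 - p is the square root of 1 - q /
   2. Then g = h (1 - p) satisfies g^2 = q - q^2 / 2, half of the square wanted for z. *)
have [||p [ps _ pp pc]] := @cstar_sqrt R A ((2^-1 : R)%:C *: q).
- by rewrite cstZ conjR qs.
- rewrite cnZ cabsR ger0_norm ?invr_ge0 // Nq.
  have : N h ^+ 2 <= (6 / 5) ^+ 2 by rewrite ler_pXn2r ?nnegrE ?cn_ge0 //; lra.
  rewrite !expr2; lra.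
have hp : cmul h p = cmul p h by apply: pc; rewrite csZ csZr /q cmulA.
have qp : cmul q p = cmul p q by rewrite /q -cmulA hp cmulA hp -cmulA.
pose g := h - cmul h p.
have gs : cstar g = g by rewrite /g cstD cstN cstarM hs ps hp.
have hg : cmul h g = cmul g h by rewrite /g csD csDr csN csNr cmulA -/q -cmulA -hp cmulA.
have gg : cmul g g = q - (2^-1 : R)%:C *: cmul q q.
  have e1 : cmul (cmul h p) h = cmul q p by rewrite -cmulA -hp cmulA.
  have e2 : cmul (cmul h p) (cmul h p) = cmul q (cmul p p).
    by rewrite cmulA e1 -cmulA.
  rewrite /g csD csN !csDr !csNr e1 e2 opprD opprK cmulA -/q -addrA; congr (_ + _).
  have := congr1 (cmul q) pp; rewrite !csDr csZr => e3.
  by rewrite addrA -opprD e3 opprD addrNK.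
pose z := (Num.sqrt 2 : R)%:C *: g.
have zs : cstar z = z by rewrite cstZ conjR gs.
have zz : cmul z z = q + q - cmul q q.
  rewrite csZ csZr scalerA -rmorphM -expr2 sqr_sqrtr // gg scalerBr scalerA -rmorphM /= mulfV ?pnatr_eq0 //.
  by rewrite scale1r (_ : (2 : R)%:C = 1 + 1 :> C) ?scalerDl ?scale1r // -rmorphD.
have hz : cmul h z = cmul z h by rewrite csZ csZr hg.
have qz : cmul q z = cmul z q by rewrite /q -cmulA hz cmulA hz -cmulA.
clearbody z; pose iC : C := 'i%C.
have ii : iC * iC = -1 by rewrite -expr2 sqr_i.
have ic : iC^*%C = - iC by apply/eqP; rewrite eq_complex /= oppr0 !eqxx.
have iso (c : C) : c * c = -1 -> c^*%C = - c -> forall b, N (b + cmul (- q + c *: z) b) = N b.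
  move=> cc cj b; apply: cstar_unitary; rewrite cstD cstN cstZ cj zs qs scaleNr.
  have e1 : cmul (- q - c *: z) (- q + c *: z) = cmul q q + cmul z z.
    rewrite csD !csDr !csN !csNr !opprK !csZ !csZr scalerA cc qz scaleN1r opprK.
    by rewrite -!addrA; congr (_ + _); rewrite addrA addNr add0r.
  by rewrite e1 [cmul q q + _]addrC zz subrK [X in X + _]addrACA subrr addr0 -opprD addNr.
(* Half the difference of the isometries 1 - q + i z and 1 - q - i z is i z. *)
have zc b : N (cmul z b) <= N b.
  have e : (iC + iC) *: cmul z b = (b + cmul (- q + iC *: z) b) - (b + cmul (- q + (- iC) *: z) b).
    rewrite opprD addrACA subrr add0r !csD opprD addrACA subrr add0r !csZ scaleNr opprK.
    by rewrite -scalerDl.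
  have := cnB (b + cmul (- q + iC *: z) b) (b + cmul (- q + (- iC) *: z) b).
  rewrite -e (iso _ ii ic) (iso (- iC)) ?mulrNN ?conjcN ?ic //.
  have n2 : cabs (iC + iC) = 2.
    by rewrite /cabs normc_def /= addr0 expr0n /= add0r sqrtr_sqr ger0_norm // addr_ge0.
  by rewrite cnZ n2; move: (N (cmul z b)) (N b) => s t; lra.
have Nzz : N (cmul z z) = N z ^+ 2 by rewrite -cn_id zs.
have z1 : N z <= 1.
  have := zc z; rewrite Nzz expr2 => e; rewrite leNgt; apply/negP => z1.
  have z0 : 0 < N z := lt_trans ltr01 z1.
  by move: e; rewrite leNgt ltr_pMl ?z1.
have [||y [ys y1 yy yc]] := @cstar_sqrt R A (cmul z z).
- by rewrite cstarM zs.
- by rewrite Nzz expr_le1 ?cn_ge0.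
have qy : cmul q y = cmul y q by apply: yc; rewrite cmulA qz -cmulA qz cmulA.
(* Both (1 - q)^2 and (1 - y)^2 equal 1 - z^2, and q commutes with y; hence (2 - q - y)(q - y) =
   0. *)
pose D := q - y; have Ds : cstar D = D by rewrite cstD cstN qs ys.
have DD : cmul (q + y) D = D + D.
  have e : cmul q q = q + q - (y + y) + cmul y y.
    by rewrite yy zz opprD opprB; rewrite -addrA addrNK addrC subrK.
  by rewrite csD !csDr !csNr qy addrA subrK e addrK opprD addrACA.
have Bq v : vnorm (B q v) <= vnorm v.
  have b w : vnorm (B h w) <= vnorm w.
    by apply: le_trans (rep_le h w) _; rewrite ler_piMl ?vnorm_ge0.
  by rewrite rep_mul; exact: le_trans (b _) (b _).
(* On eta in the range of B D, the contractions B q and B y add up to 2. By the parallelogram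
   identity they agree at eta, so that D^2 and hence the self-adjoint D act as zero. *)
have D0 v w : pip (B D v) w = 0.
  apply: pip_small; set eta := B D v.
  have e1 : B q eta + B y eta = eta + eta by rewrite -BD -rep_mul DD BD.
  have e2 : B D eta = B q eta - B y eta by rewrite BD BN.
  have e3 : pip (B D eta) v = 0.
    apply: pip_small; rewrite e2 vnorm_sqD vnormN pipNr ReN.
    have e4 : vnorm (B q eta + B y eta) ^+ 2 = vnorm (eta + eta) ^+ 2 by rewrite e1.
    rewrite !vnorm_sqD -vnorm_sq in e4.
    have Q2 : vnorm (B q eta) ^+ 2 <= vnorm eta ^+ 2 by rewrite ler_pXn2r ?nnegrE ?vnorm_ge0.
    have Y2 : vnorm (B y eta) ^+ 2 <= vnorm eta ^+ 2.
      by rewrite ler_pXn2r ?nnegrE ?vnorm_ge0 // contract1.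
    move: e4 Q2 Y2.
    move: (vnorm (B y eta) ^+ 2) (vnorm (B q eta) ^+ 2) (vnorm eta ^+ 2) (complex.Re (pip (B q eta) (B y eta))).
    by move=> a b c d; lra.
  by rewrite vnorm_sq {2}/eta -Badj Ds e3.
have : D = 0 by apply: (nb_sep nb) => -[]; exact: D0.
move/subr0_eq => qE; have : N q <= 1 by rewrite qE.
by rewrite Nq expr_le1 ?cn_ge0.
Qed.

Let rep_scale x (K : R) : 0 < K -> nrm (x : S) <= K -> nrm (K^-1%:C *: x : S) <= 1.
Proof.
move=> K0 xK; have Ki : 0 <= K^-1 by rewrite invr_ge0 ltW.
apply: (rep_ge ler01) => v; rewrite BZ vnormZ cabsR (ger0_norm Ki) mul1r ler_pdivrMl //.
by apply: le_trans (rep_le x v) _; rewrite ler_wpM2r ?vnorm_ge0.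
Qed.

Let nrm_ge0 (x : S) : 0 <= nrm x. Proof. exact: (nb_ge0 nb). Qed.

(** Division by K brings h within the bounds of [sa_le], which gives ||h|| <= K. If K is 5/6 ||h||,
    this forces h = 0. *)
Let sa_norm h : cstar h = h -> N h <= nrm (h : S).
Proof.
move=> hs; pose K := Num.max (nrm (h : S)) (5 / 6 * N h).
have hK : nrm (h : S) <= K by rewrite le_max lexx.
have hK' : 5 / 6 * N h <= K by rewrite le_max lexx orbT.
have := le_trans (nrm_ge0 h) hK; rewrite le_eqVlt => /predU1P[K0|K0].
  by apply: (@le_trans _ _ 0) (nrm_ge0 h); move: hK'; rewrite -K0; move: (N h) => a; lra.
have Ki : 0 <= K^-1 by rewrite invr_ge0 ltW.
have NK : N (K^-1%:C *: h) = K^-1 * N h by rewrite cnZ cabsR (ger0_norm Ki).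
have : N (K^-1%:C *: h) <= 1.
  apply: sa_le; [by rewrite cstZ conjR hs| |exact: rep_scale].
  by rewrite NK ler_pdivrMl //; move: hK'; move: (N h) => a; lra.
rewrite NK ler_pdivrMl // mulr1 /K le_max => /orP[//|a].
by apply: le_trans (nrm_ge0 h); move: a; move: (N h) => a; lra.
Qed.

(** The C*-identity reduces the claim to the self-adjoint x^* x, where [sa_norm] applies; in the
    representation its norm is at most the square of the norm of x. *)
Lemma rep_isometric x : nrm (x : S) = N x.
Proof.
apply/le_anti; rewrite rep_contractive /= -(@ler_pXn2r _ 2) ?nnegrE ?cn_ge0 ?nrm_ge0 // -cn_id.
have xs : cstar (cmul (cstar x) x) = cmul (cstar x) x by rewrite cstarM cstarK.
apply: le_trans (sa_norm xs) _; apply: rep_ge => [|v]; first exact: sqr_ge0.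
rewrite rep_mul; apply: le_trans (rep_le _ _) _.
have := nrm_star (rep_is_mos rB).1 (x : S) => /= ->; rewrite expr2 -mulrA.
by apply: (ler_wpM2l (nrm_ge0 x)); exact: rep_le.
Qed.

Lemma cstar_complete : norm_complete S.
Proof.
move=> u cu; have [|x hx] := @normed_complete R A u.
  by move=> e /cu[M hM]; exists M => p q Mp Mq; rewrite -rep_isometric; exact: hM.
by exists x => e /hx[M hM]; exists M => p Mp; rewrite rep_isometric; exact: hM.
Qed.
End SupNorm.

Lemma dualizable_bounds (R : realType) (S : smosData R) (H : hilbert R) (j : {linear S -> LH H}) :
  concrete j -> order_approx S -> norm_complete S ->
  (dualizable S /\
   (forall (n : nat) (f : 'M[dual S]_n), dnorm f <= mnorm f /\ mnorm f <= 4 * dnorm f) /\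
   (forall (n : nat) (g : 'M[dual S]_n), mpos g -> mnorm g = dnorm g)) /\
  (bijective (@tau R S) /\ complete_isometry (@tau R S)).
Proof.
move=> cj ap cS; have rB := conc_rep cj; have hS := (rep_is_mos rB).1.
split; last by split; [exact: tau_bijective rB ap|exact: tau_isometry rB ap].
split; first by split; [exact: concrete_quasi cj|exact: dual_quasi hS (rep_normed_by_dual rB) cS ap].
split=> [n f|n g]; last exact: dnorm_pos hS ap _ _.
by split; [exact: dnorm_le hS _ f|exact: dnorm_ge hS ap _ f].
Qed.

Theorem theorem3p17 (R : realType) (S : smosData R)
    (hS : cstar_or_unital_complete_opsys S) :
  (dualizable S /\
   (forall (n : nat) (f : 'M[dual S]_n),
      dnorm f <= mnorm f /\ mnorm f <= 4 * dnorm f) /\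
   (forall (n : nat) (g : 'M[dual S]_n), mpos g -> mnorm g = dnorm g)) /\
  (bijective (@tau R S) /\ complete_isometry (@tau R S)).
Proof.
case: S / hS => [A H pi|H W sW [T WT TE] cW].
  have ap := mul_order_approx (conc_rep (cstar_concrete pi)) (rep_mul pi).
  exact (dualizable_bounds (cstar_concrete pi) ap (cstar_complete (pi := pi))).
have rW := conc_rep (subsmos_concrete sW).
have ap : order_approx (subsmos W).
  apply: (unital_order_approx rW (e := exist _ T WT)) => v.
  by rewrite -[RHS]/(id v) -[X in _ = X v]TE.
exact (dualizable_bounds (subsmos_concrete sW) ap cW).
Qed.
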